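(* Let $A$ be a $\sigma$-unital $\mathrm{C}^*$-algebra with $T(A)$ non-empty and compact, and with weak CPoU. Let $\alpha:G \curvearrowright A$ be an action by an amenable countable discrete group and assume it has local equivariant property Gamma with respect to bounded traces. For each $m \in \mathbb N$, let \[h_m(x_1, \ldots, x_{r_m}, z_1, \ldots, z_{s_m})\] be a $G$-$*$-polynomial in $r_m + s_m$ non-commuting variables. Let $(a_i)_{i \in \mathbb N}$ be a sequence in $A^{\omega,\mathrm b}$. Suppose that for every $\varepsilon >0$, $\ell \in \mathbb N$ and $\tau \in \overline{T_\omega(A)}^{w^*}$, there exist contractions $(y_i^\tau)_{i \in \mathbb N}$ in $A^{\omega,\mathrm b}$ such that \[\| h_m(a_1, \ldots, a_{r_m}, y_1^\tau, \ldots, y_{s_m}^\tau) \|_{2,\tau} < \varepsilon \quad \text{for } m =1, \ldots, \ell.\] Then there exist contractions $(y_i)_{i \in \mathbb N}$ in $A^{\omega,\mathrm b}$ such that \[h_m(a_1, \ldots, a_{r_m}, y_1, \ldots, y_{s_m})=0 \quad \text{for all } m \in \mathbb N.\]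
   Context: $\omega$ is a fixed free ultrafilter on $\mathbb N$. $T(A)$ is the set of tracial states on $A$ with the weak-$*$-topology; $\|a\|_{2,\tau}=\tau(a^*a)^{1/2}$ and $\|a\|_{2,X}=\sup_{\tau\in X}\|a\|_{2,\tau}$. Uniform bounded tracial ultrapower (for $T(A)\ne\emptyset$): $A_\omega=\ell^\infty(A)/\{(a_n)_n:\lim_{n\to\omega}\|a_n\|=0\}$, $J_A^{\mathrm b}=\{[(a_n)_n]\in A_\omega:\lim_{n\to\omega}\|a_n\|_{2,T(A)}=0\}$, $A^{\omega,\mathrm b}=A_\omega/J_A^{\mathrm b}$; it is unital when $A$ is $\sigma$-unital and $T(A)$ is compact. Elements of $A$ are viewed in $A^{\omega,\mathrm b}$ via constant sequences. An action $\alpha:G\curvearrowright A$ induces an action $\alpha^\omega:G\curvearrowright A^{\omega,\mathrm b}$ componentwise. $T_\omega(A)$ is the set of limit traces $[(a_n)_n]\mapsto\lim_{n\to\omega}\tau_n(a_n)$ on $A^{\omega,\mathrm b}$, for sequences $(\tau_n)_n$ in $T(A)$; $\overline{T_\omega(A)}^{w^*}$ is its weak-$*$-closure in the set of tracial states on $A^{\omega,\mathrm b}$. Local equivariant property Gamma w.r.t. bounded traces (for $A$ $\sigma$-unital, $T(A)$ non-empty and compact): for all $n\in\mathbb N$ and all $\|\cdot\|_{2,T_\omega(A)}$-separable subsets $S\subset A^{\omega,\mathrm b}$ there exist pairwise orthogonal projections $p_1,\dots,p_n\in(A^{\omega,\mathrm b})^{\alpha^\omega}\cap S'$ such that $\tau(ap_i)=\frac1n\tau(a)$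 for all $i=1,\dots,n$, $a\in S$, $\tau\in T_\omega(A)$. Weak CPoU: for every $\|\cdot\|_{2,T_\omega(A)}$-separable subset $S\subset A^{\omega,\mathrm b}$, every $k\in\mathbb N$, all $a_1,\dots,a_k\in A_+$ and every $\delta>\sup_{\tau\in T(A)}\min_{i=1,\dots,k}\tau(a_i)$, there exist positive contractions $e_1,\dots,e_k\in A^{\omega,\mathrm b}\cap S'$ such that $\tau(\sum_{i=1}^k e_i)=1$ and $\tau(a_ie_i)\le\delta\tau(e_i)$ for all $i=1,\dots,k$ and $\tau\in T_\omega(A)$. A non-commutative $G$-$*$-polynomial in variables $X$ is a non-commutative $*$-polynomial in the variables $\{g\cdot x\mid g\in G,\ x\in X\}$. For an action $\beta:G\curvearrowright B$ on a $\mathrm{C}^*$-algebra and a tuple in $B$, it is evaluated by interpreting $g\cdot x_i$ as $\beta_g(b_i)$ when $b_i$ is substituted for $x_i$. Here evaluations are with respect to $\alpha^\omega$ on $A^{\omega,\mathrm b}$. *)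

(* Defs.v *)
From HB Require Import structures.
From mathcomp Require Import all_boot all_order all_algebra.
From mathcomp Require Import all_classical all_reals.
From mathcomp Require Import topology normedtype sequences.
From mathcomp Require Import complex.

Set Implicit Arguments.
Unset Strict Implicit.
Unset Printing Implicit Defensive.

Import Order.TTheory GRing.Theory Num.Theory numFieldNormedType.Exports.

Local Open Scope classical_set_scope.
Local Open Scope ring_scope.

(* The library puts the topology of the modulus on (R[i])^o only. *)
HB.instance Definition _ (R : realType) := NormedModule.copy R[i] (R[i])^o.

Reserved Notation "x ** y" (at level 40, left associativity).

(* Algebras are not assumed unital; the norm of the library takes its values in
   R[i], and rnorm below is its real-valued version. *)
HB.mixin Record NormedModule_isNormedStarAlg (R : realType) A
    & NormedModule R[i] A := {
  smul : A -> A -> A;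
  star : A -> A;
  smulA : associative smul;
  smulDl : left_distributive smul +%R;
  smulDr : right_distributive smul +%R;
  smulZl : forall (c : R[i]) x y, smul (c *: x) y = c *: smul x y;
  smulZr : forall (c : R[i]) x y, smul x (c *: y) = c *: smul x y;
  starK : involutive star;
  starD : {morph star : x y / x + y};
  starZ : forall (c : R[i]) x, star (c *: x) = conjc c *: star x;
  starM : forall x y, star (smul x y) = smul (star y) (star x);
  norm_smul : forall x y, `|smul x y| <= `|x| * `|y|;
  norm_star : forall x, `|star x| = `|x|
}.

#[short(type="normedStarAlgType")]
HB.structure Definition NormedStarAlg (R : realType) :=
  {A of NormedModule R[i] A & NormedModule_isNormedStarAlg R A}.

Notation "x ** y" := (smul x y) : ring_scope.

HB.mixin Record NormedStarAlg_isCStarAlg (R : realType) A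
    & NormedStarAlg R A := {
  cstar_norm : forall x : A, `|star x ** x| = `|x| ^+ 2
}.

#[short(type="cstarAlgType")]
HB.structure Definition CStarAlg (R : realType) :=
  {A of NormedStarAlg R A & CompleteNormedModule R[i] A
      & NormedStarAlg_isCStarAlg R A}.

Section RealNorm.
Variables (R : realType).
Implicit Types (B : normedModType R[i]).

Definition rnorm B (x : B) : R := complex.Re `|x|.

Lemma rnormE B (x : B) : (rnorm x)%:C%C = `|x|.
Proof.
rewrite /rnorm; have := normr_ge0 x.
by case: (`|x|) => a b; rewrite lecE /= => /andP[/eqP-> _].
Qed.

Lemma rnorm_ge0 B (x : B) : 0 <= rnorm x.
Proof. by have := normr_ge0 x; rewrite -rnormE lecE /= => /andP[]. Qed.

Lemma rnorm_leC B (x : B) (M : R) : (`|x| <= M%:C%C) = (rnorm x <= M).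
Proof. by rewrite -rnormE lecR. Qed.

Lemma rnormD B (x y : B) : rnorm (x + y) <= rnorm x + rnorm y.
Proof. by rewrite -rnorm_leC rmorphD /= !rnormE ler_normD. Qed.

Lemma rnormN B (x : B) : rnorm (- x) = rnorm x.
Proof. by rewrite /rnorm normrN. Qed.

Lemma rnormZ B (c : R[i]) (x : B) : rnorm (c *: x) = rnorm (c : R[i]) * rnorm x.
Proof.
have : (rnorm (c *: x))%:C%C = (rnorm (c : R[i]) * rnorm x)%:C%C.
  by rewrite rmorphM /= !rnormE normrZ.
by case.
Qed.

Lemma rnorm0 B : rnorm (0 : B) = 0.
Proof. by rewrite /rnorm normr0. Qed.

Lemma rnorm0_eq0 B (x : B) : rnorm x = 0 -> x = 0.
Proof. by move=> h; apply/normr0_eq0; rewrite -rnormE h. Qed.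

End RealNorm.

Lemma rnorm_smul (R : realType) (B : normedStarAlgType R) (x y : B) :
  rnorm (x ** y) <= rnorm x * rnorm y.
Proof. by rewrite -rnorm_leC rmorphM /= !rnormE norm_smul. Qed.

Lemma rnorm_star (R : realType) (B : normedStarAlgType R) (x : B) :
  rnorm (star x) = rnorm x.
Proof. by rewrite /rnorm norm_star. Qed.

Record star_ideal (R : realType) (B : normedStarAlgType R) := StarIdeal {
  ideal_set :> B -> Prop;
  ideal0 : ideal_set 0;
  idealD : forall x y, ideal_set x -> ideal_set y -> ideal_set (x + y);
  idealZ : forall (c : R[i]) x, ideal_set x -> ideal_set (c *: x);
  idealMl : forall x y, ideal_set y -> ideal_set (x ** y);
  idealMr : forall x y, ideal_set x -> ideal_set (x ** y);
  idealS : forall x, ideal_set x -> ideal_set (star x);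
  ideal_closed : closed (ideal_set : set B)
}.

Section Quotient.
Variables (R : realType) (B : normedStarAlgType R) (I : star_ideal B).

Definition ideal_pred : {pred B} := fun x => `[< I x >].

Lemma ideal_pred_zmod : zmod_closed ideal_pred.
Proof.
split; first by apply/asboolP; exact: ideal0.
move=> x y /asboolP Ix /asboolP Iy; apply/asboolP.
by apply: idealD => //; rewrite -scaleN1r; exact: idealZ.
Qed.

HB.instance Definition _ := GRing.isZmodClosed.Build B ideal_pred ideal_pred_zmod.

Definition star_quot : Type := Quotient.quot ideal_pred.

HB.instance Definition _ := GRing.Zmodule.on star_quot.

Definition qcls (x : B) : star_quot := \pi_(Quotient.quot ideal_pred)%qT x.
Definition qrep (q : star_quot) : B := repr (q : Quotient.quot ideal_pred).

Lemma qrepK : cancel qrep qcls.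
Proof. by move=> q; exact: reprK. Qed.

Lemma qcls_eq x y : qcls x = qcls y <-> I (x - y).
Proof.
split=> [h|h].
  suff: x - y \in ideal_pred by move/asboolP.
  by rewrite Quotient.idealrBE; apply/eqP.
by apply/eqP; rewrite -[_ == _]Quotient.idealrBE; apply/asboolP.
Qed.

Lemma qclsD x y : qcls (x + y) = qcls x + qcls y.
Proof. exact: (raddfD \pi_(Quotient.quot ideal_pred)%qT). Qed.

Lemma qclsN x : qcls (- x) = - qcls x.
Proof. exact: (raddfN \pi_(Quotient.quot ideal_pred)%qT). Qed.

Lemma qcls0 : qcls 0 = 0.
Proof. exact: (raddf0 \pi_(Quotient.quot ideal_pred)%qT). Qed.

Lemma qrep_cls x : I (qrep (qcls x) - x).
Proof. by apply/qcls_eq; rewrite qrepK. Qed.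

Lemma idealN x : I x -> I (- x).
Proof. by move=> Ix; rewrite -scaleN1r; exact: idealZ. Qed.

Definition qscale (c : R[i]) (q : star_quot) : star_quot := qcls (c *: qrep q).
Definition qmul (p q : star_quot) : star_quot := qcls (qrep p ** qrep q).
Definition qstar (q : star_quot) : star_quot := qcls (star (qrep q)).
Definition qn (q : star_quot) : R := inf [set rnorm x | x in [set x | qcls x = q]].
Definition qnorm (q : star_quot) : R[i] := (qn q)%:C%C.

Lemma qscaleE c x : qscale c (qcls x) = qcls (c *: x).
Proof. by apply/qcls_eq; rewrite -scalerBr; apply/idealZ/qrep_cls. Qed.

Lemma smulN (x y : B) : x ** (- y) = - (x ** y).
Proof. by rewrite -scaleN1r smulZr scaleN1r. Qed.

Lemma sNmul (x y : B) : (- x) ** y = - (x ** y).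
Proof. by rewrite -scaleN1r smulZl scaleN1r. Qed.

Lemma starN (x : B) : star (- x) = - star x.
Proof.
rewrite -scaleN1r starZ -[RHS]scaleN1r; congr (_ *: _).
by rewrite rmorphN rmorph1.
Qed.

Lemma qmulE x y : qmul (qcls x) (qcls y) = qcls (x ** y).
Proof.
apply/qcls_eq.
have -> : qrep (qcls x) ** qrep (qcls y) - x ** y =
    (qrep (qcls x) - x) ** qrep (qcls y) + x ** (qrep (qcls y) - y).
  by rewrite smulDl smulDr smulN sNmul addrA subrK.
by apply: idealD; [apply: idealMr|apply: idealMl]; exact: qrep_cls.
Qed.

Lemma qstarE x : qstar (qcls x) = qcls (star x).
Proof. by apply/qcls_eq; rewrite -starN -starD; apply/idealS/qrep_cls. Qed.

Lemma qclsP (q : star_quot) : exists x, q = qcls x.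
Proof. by exists (qrep q); rewrite qrepK. Qed.

Ltac qelim q := let x := fresh "x" in have [x ->] := qclsP q.

Lemma qscaleA a b v : qscale a (qscale b v) = qscale (a * b) v.
Proof. by qelim v; rewrite !qscaleE scalerA. Qed.
Lemma qscale1 : left_id 1 qscale.
Proof. by move=> v; qelim v; rewrite qscaleE scale1r. Qed.
Lemma qscaleDr : right_distributive qscale +%R.
Proof. by move=> c u v; qelim u; qelim v; rewrite -qclsD !qscaleE scalerDr qclsD. Qed.
Lemma qscaleDl v : {morph qscale^~ v : a b / a + b}.
Proof. by move=> a b; qelim v; rewrite !qscaleE scalerDl qclsD. Qed.

HB.instance Definition _ := GRing.Zmodule_isLmodule.Build R[i] star_quot
  qscaleA qscale1 qscaleDr qscaleDl.

Lemma qclsZ c x : qcls (c *: x) = c *: qcls x.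
Proof. by rewrite -qscaleE. Qed.

Lemma qn_le x : qn (qcls x) <= rnorm x.
Proof.
apply: ge_inf; last by exists x.
by exists 0 => _ [z _ <-]; exact: rnorm_ge0.
Qed.

Lemma qn_ge0 q : 0 <= qn q.
Proof.
apply: lb_le_inf; first by exists (rnorm (qrep q)), (qrep q) => //=; rewrite qrepK.
by move=> _ [z _ <-]; exact: rnorm_ge0.
Qed.

Lemma qn_lt q (e : R) : 0 < e -> exists2 x, qcls x = q & rnorm x < qn q + e.
Proof.
move=> e0.
have [|_ [x xq <-] ?] := @inf_adherent _ [set rnorm x | x in [set x | qcls x = q]] e e0.
  split; first by exists (rnorm (qrep q)), (qrep q) => //=; rewrite qrepK.
  by exists 0 => _ [z _ <-]; exact: rnorm_ge0.
by exists x.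
Qed.

Lemma qnD p q : qn (p + q) <= qn p + qn q.
Proof.
apply/ler_addgt0Pr => e e0.
have e2 : 0 < e / 2 by rewrite divr_gt0.
have [x xp hx] := qn_lt p e2; have [y yq hy] := qn_lt q e2.
rewrite -{1}xp -{1}yq -qclsD (le_trans (qn_le _))// (le_trans (rnormD _ _))//.
by rewrite (splitr e) addrACA lerD// ltW.
Qed.

Lemma qnZ_le c q : qn (c *: q) <= rnorm (c : R[i]) * qn q.
Proof.
apply/ler_addgt0Pr => e e0.
pose d := e / (rnorm (c : R[i]) + 1).
have c1 : 0 < rnorm (c : R[i]) + 1 by rewrite ltr_wpDl ?rnorm_ge0.
have d0 : 0 < d by rewrite divr_gt0.
have [x <- hx] := qn_lt q d0.
rewrite -qclsZ (le_trans (qn_le _))// rnormZ.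
rewrite (le_trans (ler_wpM2l (rnorm_ge0 _) (ltW hx)))// mulrDr lerD2l.
by rewrite /d mulrA ler_pdivrMr// mulrC ler_wpM2l ?ltW// ltrDl.
Qed.

Lemma rnormR (c : R[i]) : (rnorm c)%:C%C = `|c|.
Proof. exact: rnormE. Qed.

Lemma qnZ c q : qn (c *: q) = rnorm (c : R[i]) * qn q.
Proof.
apply/le_anti; rewrite qnZ_le /=.
have [->|c0] := eqVneq c 0.
  by rewrite rnorm0 mul0r qn_ge0.
have := qnZ_le c^-1 (c *: q); rewrite scalerA mulVf// scale1r => h.
have cp : 0 < rnorm c.
  by rewrite lt_neqAle rnorm_ge0 andbT eq_sym; apply: contra_neq c0 => /rnorm0_eq0.
have cV : rnorm c^-1 = (rnorm c)^-1.
  have : (rnorm c^-1)%:C%C = ((rnorm c)^-1)%:C%C by rewrite fmorphV /= !rnormR normfV.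
  by case.
by move: h; rewrite cV ler_pdivlMl.
Qed.

Lemma qn0_eq0 q : qn q = 0 -> q = 0.
Proof.
move=> h; rewrite -(qrepK q) -qcls0; apply/qcls_eq; rewrite subr0.
apply: ideal_closed => V /nbhs_ballP[e /= e0 Ve].
have e0' : 0 < complex.Re e by move: e0; rewrite ltcE /= => /andP[].
have [x xq hx] := qn_lt q e0'.
exists (qrep q - x); split.
  by apply/qcls_eq; rewrite qrepK.
apply: Ve; rewrite -ball_normE /ball_ /= opprB addrC subrK -rnormE.
by move: e0 hx; rewrite h add0r !ltcE /= => /andP[/eqP-> _] ->; rewrite eqxx.
Qed.

Lemma qnormD p q : qnorm (p + q) <= qnorm p + qnorm q.
Proof. by rewrite -rmorphD lecR; exact: qnD. Qed.
Lemma qnormZ (c : R[i]) q : qnorm (c *: q) = `|c| * qnorm q.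
Proof. by rewrite -rnormR -rmorphM; congr (_%:C%C); exact: qnZ. Qed.
Lemma qnorm0_eq0 q : qnorm q = 0 -> q = 0.
Proof. by case; exact: qn0_eq0. Qed.

HB.instance Definition _ := Lmodule_isNormed.Build R[i] star_quot
  qnormD qnormZ qnorm0_eq0.

Lemma qmulA : associative qmul.
Proof. by move=> p q r; qelim p; qelim q; qelim r; rewrite !qmulE smulA. Qed.
Lemma qmulDl : left_distributive qmul +%R.
Proof.
by move=> p q r; qelim p; qelim q; qelim r; rewrite -qclsD !qmulE smulDl qclsD.
Qed.
Lemma qmulDr : right_distributive qmul +%R.
Proof.
by move=> p q r; qelim p; qelim q; qelim r; rewrite -qclsD !qmulE smulDr qclsD.
Qed.
Lemma qmulZl (c : R[i]) p q : qmul (c *: p) q = c *: qmul p q.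
Proof. by qelim p; qelim q; rewrite -qclsZ !qmulE smulZl qclsZ. Qed.
Lemma qmulZr (c : R[i]) p q : qmul p (c *: q) = c *: qmul p q.
Proof. by qelim p; qelim q; rewrite -qclsZ !qmulE smulZr qclsZ. Qed.
Lemma qstarK : involutive qstar.
Proof. by move=> p; qelim p; rewrite !qstarE starK. Qed.
Lemma qstarD : {morph qstar : p q / p + q}.
Proof. by move=> p q; qelim p; qelim q; rewrite -qclsD !qstarE starD qclsD. Qed.
Lemma qstarZ (c : R[i]) p : qstar (c *: p) = conjc c *: qstar p.
Proof. by qelim p; rewrite -qclsZ !qstarE starZ qclsZ. Qed.
Lemma qstarM p q : qstar (qmul p q) = qmul (qstar q) (qstar p).
Proof. by qelim p; qelim q; rewrite !(qmulE, qstarE) starM. Qed.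

Lemma qnorm_mul (p q : star_quot) : `|qmul p q| <= `|p| * `|q|.
Proof.
rewrite -[`|p|]/(qnorm p) -[`|q|]/(qnorm q) -rmorphM lecR.
rewrite -/(qn _) -/(qn p) -/(qn q).
apply/ler_addgt0Pr => e e0.
pose d := Num.min 1 (e / (qn p + qn q + 1)).
have s0 : 0 < qn p + qn q + 1 by rewrite ltr_wpDl// addr_ge0 ?qn_ge0.
have d0 : 0 < d by rewrite lt_min ltr01 divr_gt0.
have [x xp hx] := qn_lt p d0; have [y yq hy] := qn_lt q d0.
rewrite -{1}xp -{1}yq qmulE (le_trans (qn_le _))// (le_trans (rnorm_smul _ _))//.
rewrite (le_trans (ler_pM (rnorm_ge0 _) (rnorm_ge0 _) (ltW hx) (ltW hy)))//.
rewrite mulrDl !mulrDr -addrA lerD2l addrA.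
have d1 : d <= 1 by rewrite ge_min lexx.
apply: (@le_trans _ _ (d * (qn p + qn q + 1))); last first.
  by rewrite -ler_pdivlMr// ge_min lexx orbT.
rewrite !mulrDr mulr1 [qn p * d]mulrC lerD//.
by rewrite -[leRHS]mulr1 ler_wpM2l// ltW.
Qed.

Lemma qn_star_le p : qn (qstar p) <= qn p.
Proof.
apply/ler_addgt0Pr => e e0; have [x <- hx] := qn_lt p e0.
by rewrite qstarE (le_trans (qn_le _))// rnorm_star ltW.
Qed.

Lemma qnorm_star (p : star_quot) : `|qstar p| = `|p|.
Proof.
congr (_%:C%C); apply/le_anti; rewrite qn_star_le /=.
by rewrite -{1}(qstarK p) qn_star_le.
Qed.

HB.instance Definition _ := NormedModule_isNormedStarAlg.Build R star_quot
  qmulA qmulDl qmulDr qmulZl qmulZr qstarK qstarD qstarZ qstarM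
  qnorm_mul qnorm_star.

Lemma rnorm_qcls (x : B) : rnorm (qcls x) <= rnorm x.
Proof. exact: qn_le. Qed.

Lemma rnorm_quot_lt (q : star_quot) (e : R) :
  0 < e -> exists2 x, qcls x = q & rnorm x < rnorm q + e.
Proof. exact: qn_lt. Qed.

Lemma qclsM (x y : B) : qcls (x ** y) = qcls x ** qcls y.
Proof. by rewrite -qmulE. Qed.

Lemma qclsS (x : B) : qcls (star x) = star (qcls x).
Proof. by rewrite -qstarE. Qed.

End Quotient.

Section BoundedSequences.
Variables (R : realType) (B : normedStarAlgType R).

Definition bounded_seq (a : nat -> B) : Prop :=
  exists M : R, forall n, rnorm (a n) <= M.

Definition linf_pred : {pred nat -> B} := fun a => `[< bounded_seq a >].

Record linf := Linf { linf_val :> nat -> B; linfP : linf_val \in linf_pred }.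

HB.instance Definition _ := [isSub for linf_val].
HB.instance Definition _ := [Choice of linf by <:].

Lemma linf_submod : submod_closed linf_pred.
Proof.
split; first by apply/asboolP; exists 0 => n; rewrite rnorm0.
move=> c a b /asboolP[M aM] /asboolP[N bN]; apply/asboolP.
exists (rnorm (c : R[i]) * M + N) => n.
rewrite (le_trans (rnormD _ _))// rnormZ lerD//.
by rewrite ler_wpM2l// rnorm_ge0.
Qed.

HB.instance Definition _ := GRing.isSubmodClosed.Build R[i] (nat -> B) linf_pred linf_submod.
HB.instance Definition _ := [SubChoice_isSubLmodule of linf by <:].

Lemma linf_bounded (a : linf) : bounded_seq a.
Proof. exact/asboolP/linfP. Qed.

Lemma linf_ext (a b : linf) : (forall n, a n = b n) -> a = b.
Proof. by move=> h; apply/val_inj/funext. Qed.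

Definition mk_linf (a : nat -> B) (h : bounded_seq a) : linf := Linf (asboolT h).

Lemma bounded_mul (a b : linf) : bounded_seq (fun n => a n ** b n).
Proof.
have [M aM] := linf_bounded a; have [N bN] := linf_bounded b.
exists (M * N) => n; rewrite (le_trans (rnorm_smul _ _))//.
by rewrite ler_pM// rnorm_ge0.
Qed.

Lemma bounded_star (a : linf) : bounded_seq (fun n => star (a n)).
Proof. by have [M aM] := linf_bounded a; exists M => n; rewrite rnorm_star. Qed.

Definition linf_mul (a b : linf) := mk_linf (bounded_mul a b).
Definition linf_star (a : linf) := mk_linf (bounded_star a).

Definition linf_sup (a : linf) : R := sup [set rnorm (a n) | n in setT].

Lemma linf_sup_ge (a : linf) n : rnorm (a n) <= linf_sup a.
Proof.
have [M aM] := linf_bounded a.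
by apply: ub_le_sup; [exists M => _ [m _ <-]; exact: aM|exists n].
Qed.

Lemma linf_sup_le (a : linf) (M : R) : (forall n, rnorm (a n) <= M) -> linf_sup a <= M.
Proof.
move=> aM; apply: ge_sup; first by exists (rnorm (a 0%N)), 0%N.
by move=> _ [n _ <-].
Qed.

Lemma linf_sup_ge0 (a : linf) : 0 <= linf_sup a.
Proof. exact: le_trans (rnorm_ge0 _) (linf_sup_ge a 0%N). Qed.

Definition linf_norm (a : linf) : R[i] := (linf_sup a)%:C%C.

Lemma linf_normD (a b : linf) : linf_norm (a + b) <= linf_norm a + linf_norm b.
Proof.
rewrite -rmorphD lecR; apply: linf_sup_le => n.
by rewrite (le_trans (rnormD _ _))// lerD// linf_sup_ge.
Qed.

Lemma linf_supZ_le (c : R[i]) (a : linf) :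
  linf_sup (c *: a) <= rnorm (c : R[i]) * linf_sup a.
Proof.
apply: linf_sup_le => n; rewrite [X in rnorm X]/(c *: a n) rnormZ.
by rewrite ler_wpM2l ?rnorm_ge0 ?linf_sup_ge.
Qed.

Lemma linf_normZ (c : R[i]) (a : linf) : linf_norm (c *: a) = `|c| * linf_norm a.
Proof.
rewrite -rnormR -rmorphM; congr (_%:C%C); apply/le_anti; rewrite linf_supZ_le /=.
have [->|c0] := eqVneq c 0; first by rewrite rnorm0 mul0r linf_sup_ge0.
have cp : 0 < rnorm c.
  by rewrite lt_neqAle rnorm_ge0 andbT eq_sym; apply: contra_neq c0 => /rnorm0_eq0.
rewrite -ler_pdivlMl//; apply: linf_sup_le => n.
by rewrite ler_pdivlMl// -rnormZ; exact: (linf_sup_ge (c *: a) n).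
Qed.

Lemma linf_norm0_eq0 (a : linf) : linf_norm a = 0 -> a = 0.
Proof.
case=> a0; apply: linf_ext => n; apply: rnorm0_eq0.
by apply/le_anti; rewrite rnorm_ge0 -{1}a0 linf_sup_ge.
Qed.

HB.instance Definition _ := Lmodule_isNormed.Build R[i] linf
  linf_normD linf_normZ linf_norm0_eq0.

Lemma linf_mulA : associative linf_mul.
Proof. by move=> a b c; apply: linf_ext => n; exact: smulA. Qed.
Lemma linf_mulDl : left_distributive linf_mul +%R.
Proof. by move=> a b c; apply: linf_ext => n; exact: smulDl. Qed.
Lemma linf_mulDr : right_distributive linf_mul +%R.
Proof. by move=> a b c; apply: linf_ext => n; exact: smulDr. Qed.
Lemma linf_mulZl (c : R[i]) a b : linf_mul (c *: a) b = c *: linf_mul a b.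
Proof. by apply: linf_ext => n; exact: smulZl. Qed.
Lemma linf_mulZr (c : R[i]) a b : linf_mul a (c *: b) = c *: linf_mul a b.
Proof. by apply: linf_ext => n; exact: smulZr. Qed.
Lemma linf_starK : involutive linf_star.
Proof. by move=> a; apply: linf_ext => n; exact: starK. Qed.
Lemma linf_starD : {morph linf_star : a b / a + b}.
Proof. by move=> a b; apply: linf_ext => n; exact: starD. Qed.
Lemma linf_starZ (c : R[i]) a : linf_star (c *: a) = conjc c *: linf_star a.
Proof. by apply: linf_ext => n; exact: starZ. Qed.
Lemma linf_starM a b : linf_star (linf_mul a b) = linf_mul (linf_star b) (linf_star a).
Proof. by apply: linf_ext => n; exact: starM. Qed.
Lemma linf_norm_mul (a b : linf) : `|linf_mul a b| <= `|a| * `|b|.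
Proof.
rewrite -[`|a|]/(linf_norm a) -[`|b|]/(linf_norm b) -rmorphM lecR.
apply: linf_sup_le => n; rewrite (le_trans (rnorm_smul _ _))//.
by rewrite ler_pM ?rnorm_ge0 ?linf_sup_ge.
Qed.
Lemma linf_norm_star (a : linf) : `|linf_star a| = `|a|.
Proof.
congr (_%:C%C); rewrite /linf_sup; congr sup; apply/seteqP.
by split=> _ [n _ <-]; exists n; rewrite //= rnorm_star.
Qed.

HB.instance Definition _ := NormedModule_isNormedStarAlg.Build R linf
  linf_mulA linf_mulDl linf_mulDr linf_mulZl linf_mulZr
  linf_starK linf_starD linf_starZ linf_starM linf_norm_mul linf_norm_star.

Lemma rnorm_linf (a : linf) : rnorm a = linf_sup a.
Proof. by []. Qed.

Lemma linf_nth_le (a : linf) n : rnorm (a n) <= rnorm a.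
Proof. exact: linf_sup_ge. Qed.

Lemma linfDE (a b : linf) n : (a + b) n = a n + b n. Proof. by []. Qed.
Lemma linfNE (a : linf) n : (- a) n = - a n. Proof. by []. Qed.
Lemma linfZE (c : R[i]) (a : linf) n : (c *: a) n = c *: a n. Proof. by []. Qed.
Lemma linfME (a b : linf) n : (a ** b) n = a n ** b n. Proof. by []. Qed.
Lemma linfSE (a : linf) n : (star a) n = star (a n). Proof. by []. Qed.

Lemma bounded_cst (x : B) : bounded_seq (fun=> x).
Proof. by exists (rnorm x). Qed.

Definition linf_cst (x : B) : linf := mk_linf (bounded_cst x).

End BoundedSequences.

Section CStarFacts.
Variables (R : realType).

(* For small self-adjoint k, c below plays the role of 1 - sqrt (1 - k), so that
   positivity arguments need neither a unit nor functional calculus. *)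
Section SquareRoot.
Variables (A : cstarAlgType R) (k : A).
Hypotheses (ks : star k = k) (k1 : rnorm k < 1).

Fixpoint sqrt_seq (n : nat) : A :=
  if n is m.+1 then (2^-1 : R[i]) *: (k + sqrt_seq m ** sqrt_seq m) else 0.

Lemma rnorm_half (x : A) : rnorm ((2^-1 : R[i]) *: x) = 2^-1 * rnorm x.
Proof.
have : (rnorm ((2^-1 : R[i]) *: x))%:C%C = (2^-1 * rnorm x)%:C%C.
  by rewrite rmorphM /= !rnormE normrZ fmorphV rmorph_nat normfV normr_nat.
by case.
Qed.

Lemma sqrt_seq_star n : star (sqrt_seq n) = sqrt_seq n.
Proof.
elim: n => [|n ih] /=; first by rewrite -[0 : A](scale0r 0) starZ conjc0 !scale0r.
by rewrite starZ starD starM ih ks; congr (_ *: _); rewrite fmorphV rmorph_nat.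
Qed.

Lemma sqrt_seq_comm n (y : A) : y ** k = k ** y -> y ** sqrt_seq n = sqrt_seq n ** y.
Proof.
move=> yk; elim: n => [|n ih] /=.
  by rewrite -[0 : A](scale0r 0) smulZr smulZl !scale0r.
by rewrite smulZr smulZl smulDl smulDr yk smulA ih -smulA ih smulA.
Qed.

Lemma sqrt_seq_norm n : rnorm (sqrt_seq n) <= rnorm k.
Proof.
elim: n => [|n ih] /=; first by rewrite rnorm0 rnorm_ge0.
rewrite rnorm_half ler_pdivrMl// mulr_natl mulr2n (le_trans (rnormD _ _))// lerD2l.
rewrite (le_trans (rnorm_smul _ _))// -[leRHS]mulr1 ler_pM ?rnorm_ge0//.
exact: le_trans ih (ltW k1).
Qed.

Lemma sqr_diff (x y : A) : x ** x - y ** y = x ** (x - y) + (x - y) ** y.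
Proof. by rewrite smulDr smulN smulDl sNmul addrA subrK. Qed.

Lemma sqr_diff_norm (x y : A) (M : R) : rnorm x <= M -> rnorm y <= M ->
  rnorm (x ** x - y ** y) <= (M *+ 2) * rnorm (x - y).
Proof.
move=> xM yM; rewrite sqr_diff (le_trans (rnormD _ _))// mulr2n mulrDl lerD//.
  by rewrite (le_trans (rnorm_smul _ _))// ler_wpM2r ?rnorm_ge0.
by rewrite (le_trans (rnorm_smul _ _))// mulrC ler_wpM2r ?rnorm_ge0.
Qed.

Lemma sqrt_seq_step n : rnorm (sqrt_seq n.+1 - sqrt_seq n) <= rnorm k ^+ n.
Proof.
elim: n => [|n ih].
  by rewrite /= subr0 expr0 (le_trans (sqrt_seq_norm 1))// ltW.
rewrite /= -/(sqrt_seq n.+1) -scalerBr rnorm_half opprD addrACA subrr add0r.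
rewrite ler_pdivrMl//.
rewrite (le_trans (sqr_diff_norm (sqrt_seq_norm n.+1) (sqrt_seq_norm n)))//.
rewrite -[rnorm k *+ 2]mulr_natl -mulrA ler_wpM2l// exprS ler_wpM2l ?rnorm_ge0//.
Qed.

Lemma sqrt_seq_diff n m :
  rnorm (sqrt_seq (n + m) - sqrt_seq n) * (1 - rnorm k) <= rnorm k ^+ n.
Proof.
suff h : rnorm (sqrt_seq (n + m) - sqrt_seq n) * (1 - rnorm k)
    <= rnorm k ^+ n - rnorm k ^+ (n + m).
  by rewrite (le_trans h)// gerBl exprn_ge0 ?rnorm_ge0.
have k0 : 0 <= 1 - rnorm k by rewrite subr_ge0 ltW.
elim: m => [|m ih]; first by rewrite addn0 !subrr rnorm0 mul0r.
rewrite addnS -[X in rnorm X](subrKA (sqrt_seq (n + m))).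
rewrite (le_trans (ler_wpM2r k0 (rnormD _ _)))// mulrDl.
rewrite -(subrKA (rnorm k ^+ (n + m)) (rnorm k ^+ n)) [leRHS]addrC lerD//.
rewrite (le_trans (ler_wpM2r k0 (sqrt_seq_step _)))//.
by rewrite mulrBr mulr1 exprSr.
Qed.

Lemma sqrt_seq_cvg : exists c : A, forall e : R, 0 < e ->
  \forall n \near \oo, rnorm (c - sqrt_seq n) < e.
Proof.
have k0 : 0 < 1 - rnorm k by rewrite subr_gt0.
have /cvg_ex[c hc] : cvg (sqrt_seq @ \oo).
  apply/cauchy_cvgP/cauchy_exP => e e0.
  have e0' : 0 < complex.Re e by move: e0; rewrite ltcE /= => /andP[].
  have : (fun n => rnorm k ^+ n) @ \oo --> (0 : R).
    by apply: cvg_expr; rewrite ger0_norm ?rnorm_ge0.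
  move/cvgr0Pnorm_lt => /(_ (complex.Re e * (1 - rnorm k))).
  rewrite mulr_gt0// => /(_ isT) [N _ hN].
  exists (sqrt_seq N); exists N => // n /= Nn.
  rewrite -ball_normE /ball_ /= distrC -rnormE.
  have : rnorm (sqrt_seq n - sqrt_seq N) < complex.Re e.
    rewrite -(ltr_pM2r k0) -(subnKC Nn) (le_lt_trans (sqrt_seq_diff _ _))//.
    by have := hN N (leqnn N); rewrite /= ger0_norm// exprn_ge0// rnorm_ge0.
  by move: e0; rewrite !ltcE /= => /andP[/eqP-> _] ->; rewrite eqxx.
exists c => e e0.
move/cvgrPdist_lt : hc => /(_ e%:C%C); rewrite ltcR => /(_ e0).
by apply: filterS => n; rewrite -rnormE ltcR.
Qed.

Lemma cstar_sqrt : exists c : A, [/\ star c = c, c + c - c ** c = k &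
  forall y, y ** k = k ** y -> y ** c = c ** y].
Proof.
have [c hc] := sqrt_seq_cvg; exists c.
have eq0 (x : A) (K : R) : (forall e : R, 0 < e -> rnorm x <= K * e) -> x = 0.
  move=> h; apply: rnorm0_eq0; apply/le_anti; rewrite rnorm_ge0 andbT.
  apply/ler_addgt0Pr => e e0; rewrite add0r.
  have K0 : 0 < `|K| + 1 by rewrite ltr_wpDl.
  apply: (le_trans (h (e / (`|K| + 1)) _)); first by rewrite divr_gt0.
  rewrite mulrA ler_pdivrMr// mulrC ler_wpM2l ?ltW//.
  by rewrite (le_lt_trans (ler_norm K))// ltrDl.
split.
- apply/eqP; rewrite -subr_eq0; apply/eqP/(eq0 _ 2) => e e0.
  have [n _ /(_ n (leqnn n)) hn] := hc e e0.
  have -> : star c - c = star (c - sqrt_seq n) - (c - sqrt_seq n).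
    by rewrite starD starN sqrt_seq_star opprB addrA subrK.
  rewrite (le_trans (rnormD _ _))// rnormN rnorm_star mulr_natl mulr2n.
  by rewrite lerD// ltW.
- apply/eqP; rewrite -subr_eq0; apply/eqP.
  apply: (eq0 _ (2 + (rnorm c + 1) *+ 2)) => e e0.
  have [N _ hN] := hc e e0.
  have h1 : rnorm (c - sqrt_seq N) < e := hN N (leqnn N).
  have h2 : rnorm (c - sqrt_seq N.+1) < e := hN N.+1 (leqnSn N).
  have -> : c + c - c ** c - k = (c - sqrt_seq N.+1) + (c - sqrt_seq N.+1)
      - (c ** c - sqrt_seq N ** sqrt_seq N).
    have : sqrt_seq N.+1 + sqrt_seq N.+1 = k + sqrt_seq N ** sqrt_seq N.
      by rewrite /= -scalerDl -[RHS]scale1r; congr (_ *: _); rewrite [RHS]splitr !mul1r.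
    move=> h; rewrite addrACA -opprD h opprB opprD -!addrA; congr (c + (c + _)).
    by rewrite addKr addrC.
  have sN : rnorm (sqrt_seq N) <= rnorm c + 1.
    apply: (le_trans (sqrt_seq_norm N)); apply: (le_trans (ltW k1)).
    by rewrite lerDr rnorm_ge0.
  have cc : rnorm c <= rnorm c + 1 by rewrite lerDl.
  rewrite (le_trans (rnormD _ _))// rnormN mulrDl lerD//.
    by rewrite (le_trans (rnormD _ _))// mulr_natl mulr2n lerD// ltW.
  rewrite (le_trans (sqr_diff_norm cc sN))// ler_wpM2l//; last exact: ltW.
  by rewrite mulrn_wge0// addr_ge0 ?rnorm_ge0.
- move=> y yk; apply/eqP; rewrite -subr_eq0; apply/eqP.
  apply: (eq0 _ (rnorm y *+ 2)) => e e0.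
  have [n _ /(_ n (leqnn n)) hn] := hc e e0.
  have -> : y ** c - c ** y = y ** (c - sqrt_seq n) - (c - sqrt_seq n) ** y.
    by rewrite smulDr smulDl sNmul smulN (sqrt_seq_comm n yk) opprB addrA subrK.
  rewrite (le_trans (rnormD _ _))// rnormN mulr2n mulrDl lerD//.
    by rewrite (le_trans (rnorm_smul _ _))// ler_wpM2l ?rnorm_ge0// ltW.
  by rewrite (le_trans (rnorm_smul _ _))// mulrC ler_wpM2l ?rnorm_ge0// ltW.
Qed.

End SquareRoot.

Record star_hom (A B : normedStarAlgType R) := StarHom {
  star_hom_fun :> A -> B;
  star_homP : linear star_hom_fun;
  star_homM : {morph star_hom_fun : x y / x ** y};
  star_homS : {morph star_hom_fun : x / star x}
}.

Section Contractive.
Variables (A B : cstarAlgType R) (f : star_hom A B).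

Lemma star_hom0 : f 0 = 0.
Proof. by have := star_homP f (-1) 0 0; rewrite !scaleN1r !addNr. Qed.
Lemma star_homD x y : f (x + y) = f x + f y.
Proof. by have := star_homP f 1 x y; rewrite !scale1r. Qed.
Lemma star_homZ (c : R[i]) x : f (c *: x) = c *: f x.
Proof. by have := star_homP f c x 0; rewrite star_hom0 !addr0. Qed.
Lemma star_homN x : f (- x) = - f x.
Proof. by rewrite -scaleN1r star_homZ scaleN1r. Qed.

Lemma rnorm_sqr (D : cstarAlgType R) (x : D) : rnorm (star x ** x) = rnorm x ^+ 2.
Proof.
have : (rnorm (star x ** x))%:C%C = (rnorm x ^+ 2)%:C%C.
  by rewrite rmorphXn /= !rnormE cstar_norm.
by case.
Qed.

Lemma unitary_mult (b d x : B) (i : R[i]) : star b = b -> star d = d ->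
  b ** d = d ** b -> d + d - d ** d = b ** b -> conjc i = - i -> i * i = -1 ->
  rnorm (b ** x + i *: (x - d ** x)) = rnorm x.
Proof.
move=> sb sd bd dd ci ii; apply/eqP.
rewrite -(@eqrXn2 _ 2) ?rnorm_ge0// -!rnorm_sqr; apply/eqP; congr rnorm.
set y := b ** x; set z := x - d ** x.
have bdx : b ** (d ** x) = d ** (b ** x) by rewrite !smulA bd.
have bbx : b ** (b ** x) = d ** x + d ** x - d ** (d ** x).
  by rewrite smulA -dd !smulDl sNmul -smulA.
have yz : star y ** z = star z ** y.
  rewrite /y /z starM sb starD starN starM sd !smulDr !smulDl !smulN !sNmul.
  by rewrite -!smulA bdx.
have yyzz : star y ** y + star z ** z = star x ** x.
  rewrite /y /z starM sb starD starN starM sd !smulDr !smulDl !smulN !sNmul opprK.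
  rewrite -!smulA bbx !smulDr !smulN.
  set p := star x ** (d ** x); set q := star x ** (d ** (d ** x)); set s := star x ** x.
  have -> : s - p + (- p + q) = s - (p + p - q) by rewrite !opprD opprK !addrA.
  by rewrite addrC subrK.
rewrite starD starZ ci smulDl !smulDr !smulZr !smulZl yz.
rewrite scalerA mulrN ii opprK scale1r scaleNr addrA addrK.
exact: yyzz.
Qed.

Lemma star_hom_sa (h : A) : star h = h -> rnorm h < 1 -> rnorm (f h) <= 1.
Proof.
move=> hs h1; pose k := h ** h.
have ks : star k = k by rewrite starM hs.
have k1 : rnorm k < 1.
  rewrite /k -{1}hs rnorm_sqr -(expr1n _ 2%N) ltrXn2r ?rnorm_ge0//.
have [c [cs ck cc]] := cstar_sqrt ks k1.
have hc : h ** c = c ** h by apply: cc; rewrite /k smulA.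
pose b := f h; pose d := f c.
have sb : star b = b by rewrite /b -star_homS hs.
have sd : star d = d by rewrite /d -star_homS cs.
have bd : b ** d = d ** b by rewrite /b /d -!star_homM hc.
have dd : d + d - d ** d = b ** b.
  by rewrite /b /d -!star_homM -star_homD -star_homN -star_homD ck.
have ii : ('i : R[i])%C * 'i%C = -1 by exact: sqr_i.
have ci : conjc ('i%C : R[i]) = - 'i%C by apply/eqP; rewrite eq_complex /= oppr0 !eqxx.
have e1 := @unitary_mult b d b 'i%C sb sd bd dd ci ii.
have e2 : rnorm (b ** b + (- 'i%C) *: (b - d ** b)) = rnorm b.
  apply: unitary_mult => //; last by rewrite mulrNN.
  by apply/eqP; rewrite eq_complex /= !oppr0 !eqxx.
have h2 : rnorm (b ** b) *+ 2 <= rnorm b *+ 2.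
  rewrite [leRHS]mulr2n -{1}e1 -e2 (le_trans _ (rnormD _ _))//.
  rewrite scaleNr addrACA subrr addr0.
  have -> : b ** b + b ** b = (2%:R : R[i]) *: (b ** b) by rewrite scaler_nat mulr2n.
  rewrite rnormZ -[rnorm _ *+ 2]mulr_natl.
  rewrite ler_wpM2r ?rnorm_ge0// -lecR rnormR normr_nat rmorph_nat//.
move: h2; rewrite lerMn2r /= -{1}sb rnorm_sqr.
have [->|b0] := eqVneq (rnorm b) 0; first by rewrite ler01.
by rewrite expr2 -[leRHS]mulr1 ler_pM2l// lt_neqAle eq_sym b0 rnorm_ge0.
Qed.

Lemma star_hom_contr (a : A) : rnorm (f a) <= rnorm a.
Proof.
suff sa (h : A) : star h = h -> rnorm (f h) <= rnorm h.
  rewrite -(@ler_pXn2r _ 2) ?nnegrE ?rnorm_ge0// -!rnorm_sqr -star_homS -star_homM.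
  by apply: sa; rewrite starM starK.
move=> hs; apply/ler_addgt0Pr => e e0.
pose M := rnorm h + e.
have M0 : 0 < M by rewrite /M ltr_wpDl ?rnorm_ge0.
have rM (D : cstarAlgType R) (x : D) : rnorm ((M^-1)%:C%C *: x) = M^-1 * rnorm x.
  rewrite rnormZ; congr (_ * _).
  have : (rnorm ((M^-1)%:C%C : R[i]))%:C%C = (M^-1)%:C%C.
    by rewrite rnormR ger0_norm// lecR invr_ge0 ltW.
  by case.
have := @star_hom_sa ((M^-1)%:C%C *: h); rewrite starZ hs conjc_real star_homZ !rM.
move=> /(_ erefl); rewrite ltr_pdivrMl// mulr1 ler_pdivrMl// mulr1; apply.
by rewrite /M ltrDl.
Qed.

End Contractive.
End CStarFacts.

Section Traces.
Variables (R : realType).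

(* The last clause is the norm of t being 1; it forces t to be bounded, since sup
   is 0 on unbounded sets. *)
Definition tracial_state (B : normedStarAlgType R) : set (B -> R[i]) :=
  [set t | [/\ scalar t,
               forall x, 0 <= t (star x ** x),
               forall x y, t (x ** y) = t (y ** x) &
               sup [set rnorm (t x) | x in [set x | rnorm x <= 1]] = 1]].

Definition norm2 (B : normedStarAlgType R) (t : B -> R[i]) (x : B) : R :=
  Num.sqrt (complex.Re (t (star x ** x))).

Definition norm2X (B : normedStarAlgType R) (X : set (B -> R[i])) (x : B) : R :=
  sup [set norm2 t x | t in X].

Section Basics.
Variables (B : normedStarAlgType R) (t : B -> R[i]).
Hypothesis tt : tracial_state t.

Lemma trace0 : t 0 = 0.
Proof. by case: tt => + _ _ _ => /(_ (-1) 0 0); rewrite scaleN1r addNr mulN1r addNr. Qed.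
Lemma traceD x y : t (x + y) = t x + t y.
Proof. by case: tt => + _ _ _ => /(_ 1 x y); rewrite scale1r mul1r. Qed.
Lemma traceZ c x : t (c *: x) = c * t x.
Proof. by case: tt => + _ _ _ => /(_ c x 0); rewrite trace0 !addr0. Qed.
Lemma traceN x : t (- x) = - t x.
Proof. by rewrite -scaleN1r traceZ mulN1r. Qed.

Lemma Re_trace_ge0 x : 0 <= complex.Re (t (star x ** x)).
Proof. by case: tt => _ /(_ x) + _ _; rewrite lecE => /andP[]. Qed.

Lemma norm2_ge0 x : 0 <= norm2 t x. Proof. exact: sqrtr_ge0. Qed.

Lemma norm2_sqr x : norm2 t x ^+ 2 = complex.Re (t (star x ** x)).
Proof. by rewrite sqr_sqrtr// Re_trace_ge0. Qed.

Lemma norm2_star x : norm2 t (star x) = norm2 t x.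
Proof. by rewrite /norm2 starK; case: tt => _ _ -> _. Qed.

Lemma trace_le1 x : rnorm x <= 1 -> rnorm (t x) <= 1.
Proof.
move=> x1; case: tt => _ _ _ s1.
have hs : has_sup [set rnorm (t x) | x in [set x | rnorm x <= 1]].
  by apply: contrapT => h; move: s1; rewrite sup_out// => /esym/eqP; rewrite oner_eq0.
by rewrite -s1; apply: sup_upper_bound => //; exists x.
Qed.

Lemma Re_le_rnorm (z : R[i]) : complex.Re z <= rnorm z.
Proof.
rewrite -lecR rnormR; case: z => a b /=.
rewrite normc_def /= lecR (le_trans (ler_norm a))// -sqrtr_sqr ler_wsqrtr// lerDl sqr_ge0//.
Qed.

Lemma norm2_le x : norm2 t x <= rnorm x.
Proof.
suff h y : rnorm y <= 1 -> norm2 t y <= 1.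
  apply/ler_addgt0Pr => e e0; set M := rnorm x + e.
  have M0 : 0 < M by rewrite ltr_wpDl ?rnorm_ge0.
  have Mi : 0 <= M^-1 by rewrite invr_ge0 ltW.
  have := h ((M^-1)%:C%C *: x).
  have rM : rnorm ((M^-1)%:C%C *: x) = M^-1 * rnorm x.
    rewrite rnormZ; congr (_ * _).
    have : (rnorm ((M^-1)%:C%C : R[i]))%:C%C = (M^-1)%:C%C.
      by rewrite rnormR ger0_norm// lecR invr_ge0 ltW.
    by case.
  rewrite rM ler_pdivrMl// mulr1 lerDl (ltW e0) => /(_ isT).
  rewrite /norm2 starZ conjc_real smulZl smulZr !traceZ mulrA -rmorphM /=.
  rewrite [complex.Re _](_ : _ = (M^-1 * M^-1) * complex.Re (t (star x ** x))); last first.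
    by case: (t _) => a b /=; rewrite mul0r subr0.
  rewrite sqrtrM -?expr2 ?sqr_ge0// sqrtr_sqr (ger0_norm Mi).
  by rewrite ler_pdivrMl// mulr1.
move=> y1; rewrite /norm2 -[leRHS]sqrtr1 ler_wsqrtr// (le_trans (Re_le_rnorm _))//.
apply: trace_le1; rewrite (le_trans (rnorm_smul _ _))// rnorm_star.
by rewrite -[leRHS]mulr1 ler_pM// rnorm_ge0.
Qed.

Lemma norm2D x y : norm2 t (x + y) <= 2 * (norm2 t x + norm2 t y).
Proof.
rewrite -(@ler_pXn2r _ 2) ?nnegrE ?mulr_ge0 ?addr_ge0 ?norm2_ge0//.
apply: (@le_trans _ _ ((norm2 t x ^+ 2 + norm2 t y ^+ 2) *+ 2)); last first.
  have := norm2_ge0 x; have := norm2_ge0 y; move: (norm2 t x) (norm2 t y) => a b b0 a0.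
  rewrite exprMn [(a + b) ^+ 2]sqrrD -[(_ + _) *+ 2]mulr_natl.
  have ab : 0 <= a * b by rewrite mulr_ge0.
  have a2 := sqr_ge0 a; have b2 := sqr_ge0 b.
  apply: (@le_trans _ _ (2 ^+ 2 * (a ^+ 2 + b ^+ 2))).
    by rewrite ler_wpM2r ?addr_ge0// -natrX ler_nat.
  by rewrite ler_wpM2l ?exprn_ge0// lerD2r lerDl mulrn_wge0.
rewrite !norm2_sqr -raddfD -raddfMn /=.
have -> : (t (star x ** x) + t (star y ** y)) *+ 2 =
    t (star (x + y) ** (x + y)) + t (star (x - y) ** (x - y)).
  rewrite mulr2n -!traceD; congr t.
  rewrite !starD !starN !smulDl !smulDr !smulN !sNmul opprK.
  set u := star x ** y; set v := star y ** x.
  rewrite [RHS]addrACA (addrACA _ u) (addrACA v) !subrr addr0 add0r.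
  by rewrite addrACA.
rewrite raddfD /= lerDl; exact: Re_trace_ge0.
Qed.

End Basics.
End Traces.

Record freeUltrafilter := FreeUltrafilter {
  ultra_sets :> set_system nat;
  ultra_ultra : UltraFilter ultra_sets;
  ultra_free : forall n, ~ ultra_sets [set n]
}.

Global Instance freeUltrafilter_proper (w : freeUltrafilter) :
  ProperFilter (ultra_sets w) := @ultra_proper _ _ (ultra_ultra w).

Definition ulim (T : topologicalType) (w : freeUltrafilter) (f : nat -> T) (l : T) : Prop :=
  f @ (ultra_sets w) --> l.

Section Ultrapower.
Variables (R : realType) (w : freeUltrafilter) (A : cstarAlgType R).

Lemma ulim0P (f : nat -> R) : (forall n, 0 <= f n) ->
  ulim w f 0 <-> forall e : R, 0 < e -> ultra_sets w [set n | f n < e].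
Proof.
move=> f0; rewrite /ulim; split=> [/cvgr0Pnorm_lt h e e0|h].
  by apply: filterS (h _ e0) => n /=; rewrite ger0_norm.
apply/cvgr0Pnorm_lt => e e0; apply: filterS (h _ e0) => n /=.
by rewrite ger0_norm.
Qed.

Lemma ulim0_le (f g : nat -> R) (K : R) : (forall n, 0 <= f n) -> (forall n, 0 <= g n) ->
  (forall n, g n <= K * f n) -> ulim w f 0 -> ulim w g 0.
Proof.
move=> f0 g0 gf /(ulim0P f0) h; apply/(ulim0P g0) => e e0.
have K0 : 0 < `|K| + 1 by rewrite ltr_wpDl.
apply: filterS (h (e / (`|K| + 1)) _); last by rewrite divr_gt0.
move=> n /=; rewrite ltr_pdivlMr// => hn; apply: le_lt_trans hn.
rewrite (le_trans (gf n))// mulrC ler_wpM2l// (le_trans (ler_norm K))// lerDl//.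
Qed.

Lemma ulim0D (f g : nat -> R) : (forall n, 0 <= f n) -> (forall n, 0 <= g n) ->
  ulim w f 0 -> ulim w g 0 -> ulim w (fun n => f n + g n) 0.
Proof.
move=> f0 g0 /(ulim0P f0) hf /(ulim0P g0) hg.
apply/ulim0P => [n|e e0]; first by rewrite addr_ge0.
have e2 : 0 < e / 2 by rewrite divr_gt0.
apply: filterS2 (hf _ e2) (hg _ e2) => n /= h1 h2.
by rewrite (splitr e) ltrD.
Qed.

Lemma closure_approx (B : normedStarAlgType R) (I : set B) (x : B) : closure I x ->
  forall e : R, 0 < e -> exists2 y, I y & rnorm (x - y) < e.
Proof.
move=> cx e e0; have [|y [Iy xy]] := cx (ball x e%:C%C).
  by apply: nbhsx_ballx; rewrite ltcR.
exists y => //; move: xy; rewrite -ball_normE /ball_ /= -rnormE ltcR//.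
Qed.

Definition c_omega_set : set (linf A) := [set a | ulim w (fun n => rnorm (a n)) 0].

Let rn0 (a : linf A) n : 0 <= rnorm (a n). Proof. exact: rnorm_ge0. Qed.

Lemma c_omega0 : c_omega_set 0.
Proof. by apply/ulim0P => // e e0; apply: filterS filterT => n _ /=; rewrite rnorm0. Qed.
Lemma c_omegaD a b : c_omega_set a -> c_omega_set b -> c_omega_set (a + b).
Proof.
move=> ha hb; have := ulim0D (rn0 a) (rn0 b) ha hb.
apply: (@ulim0_le _ _ 1) => // n; first by rewrite addr_ge0.
by rewrite mul1r rnormD.
Qed.
Lemma c_omegaZ (c : R[i]) a : c_omega_set a -> c_omega_set (c *: a).
Proof. by apply: (@ulim0_le _ _ (rnorm c)) => // n; rewrite linfZE rnormZ. Qed.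
Lemma c_omegaMl a b : c_omega_set b -> c_omega_set (a ** b).
Proof.
apply: (@ulim0_le _ _ (rnorm a)) => // n.
by rewrite (le_trans (rnorm_smul _ _))// ler_wpM2r// linf_nth_le.
Qed.
Lemma c_omegaMr a b : c_omega_set a -> c_omega_set (a ** b).
Proof.
apply: (@ulim0_le _ _ (rnorm b)) => // n.
by rewrite (le_trans (rnorm_smul _ _))// mulrC ler_wpM2r// linf_nth_le.
Qed.
Lemma c_omegaS a : c_omega_set a -> c_omega_set (star a).
Proof. by apply: (@ulim0_le _ _ 1) => // n; rewrite mul1r linfSE rnorm_star. Qed.
Lemma c_omega_closed : closed c_omega_set.
Proof.
move=> a ca; apply/ulim0P => // e e0.
have e2 : 0 < e / 2 by rewrite divr_gt0.
have [b /(ulim0P (rn0 b)) hb ab] := closure_approx ca e2.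
apply: filterS (hb _ e2) => n /= hn.
rewrite -(subrK (b n) (a n)) (le_lt_trans (rnormD _ _))// (splitr e) ltrD//.
exact: le_lt_trans (linf_nth_le (a - b) n) ab.
Qed.

Definition c_omega : star_ideal (linf A) :=
  StarIdeal c_omega0 c_omegaD c_omegaZ c_omegaMl c_omegaMr c_omegaS c_omega_closed.

Definition A_omega : normedStarAlgType R := star_quot c_omega.

Definition acls (a : linf A) : A_omega := qcls c_omega a.

Local Notation T := (@tracial_state R A).

Lemma norm2X_le (x : A) (c : R) :
  0 <= c -> (forall t, T t -> norm2 t x <= c) -> norm2X T x <= c.
Proof.
move=> c0 h; rewrite /norm2X.
have [[t Tt]|nT] := pselect (exists t, T t).
  by apply: ge_sup; [exists (norm2 t x), t|move=> _ [s Ts <-]; exact: h].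
rewrite (_ : [set _ | _ in _] = set0) ?sup0//.
by apply/seteqP; split=> // z [t Tt _]; case: nT; exists t.
Qed.

Lemma norm2X_ge (x : A) t : T t -> norm2 t x <= norm2X T x.
Proof.
move=> Tt; apply: ub_le_sup; last by exists t.
by exists (rnorm x) => _ [s Ts <-]; exact: norm2_le.
Qed.

Lemma norm2X_ge0 (x : A) : 0 <= norm2X T x.
Proof.
have [[t Tt]|nT] := pselect (exists t, T t).
  by rewrite (le_trans _ (norm2X_ge x Tt))// norm2_ge0.
rewrite /norm2X (_ : [set _ | _ in _] = set0) ?sup0//.
by apply/seteqP; split=> // z [t Tt _]; case: nT; exists t.
Qed.

Lemma norm2X_rnorm (x : A) : norm2X T x <= rnorm x.
Proof. by apply: norm2X_le; [exact: rnorm_ge0|move=> t Tt; exact: norm2_le]. Qed.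

Lemma norm2XD (x y : A) : norm2X T (x + y) <= 2 * (norm2X T x + norm2X T y).
Proof.
apply: norm2X_le => [|t Tt]; first by rewrite mulr_ge0 ?addr_ge0 ?norm2X_ge0.
by rewrite (le_trans (norm2D Tt x y))// ler_wpM2l// lerD// norm2X_ge.
Qed.

Lemma norm2X_star (x : A) : norm2X T (star x) <= norm2X T x.
Proof.
apply: norm2X_le => [|t Tt]; first exact: norm2X_ge0.
by rewrite (norm2_star Tt) norm2X_ge.
Qed.

Lemma norm2XZ (c : R[i]) : exists2 K : R, 0 <= K &
  forall x : A, norm2X T (c *: x) <= K * norm2X T x.
Proof.
exists (Num.sqrt (complex.Re (conjc c * c))) => [|x]; first exact: sqrtr_ge0.
apply: norm2X_le => [|t Tt]; first by rewrite mulr_ge0 ?sqrtr_ge0 ?norm2X_ge0.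
apply: (@le_trans _ _ (Num.sqrt (complex.Re (conjc c * c)) * norm2 t x)); last first.
  by rewrite ler_wpM2l ?sqrtr_ge0 ?norm2X_ge.
rewrite /norm2 starZ smulZl smulZr !(traceZ Tt) mulrA -sqrtrM; last first.
  by case: c => a b /=; rewrite mulNr opprK -!expr2 addr_ge0 ?sqr_ge0.
case: c => a b; case: (t _) => u v /=.
by rewrite [a * b]mulrC [- b * a]mulNr subrr mul0r subr0.
Qed.

Lemma norm2_mul (t : A -> R[i]) (a b : A) : T t ->
  norm2 t (a ** b) <= (rnorm a + 1) * norm2 t b.
Proof.
move=> Tt; set M := rnorm a + 1.
have M0 : 0 < M by rewrite ltr_wpDl ?rnorm_ge0.
pose N := M^-1 * M^-1.
have N0 : 0 < N by rewrite mulr_gt0 ?invr_gt0.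
pose k := N%:C%C *: (star a ** a).
have ks : star k = k by rewrite starZ conjc_real starM starK.
have k1 : rnorm k < 1.
  rewrite /k rnormZ rnorm_sqr.
  have -> : rnorm (N%:C%C : R[i]) = N.
    have : (rnorm (N%:C%C : R[i]))%:C%C = N%:C%C.
      by rewrite rnormR ger0_norm// lecR ltW.
    by case.
  have Mi : 0 <= M^-1 by rewrite invr_ge0 ltW.
  rewrite /N -expr2 -exprMn exprn_ilt1 ?(mulr_ge0 Mi) ?rnorm_ge0//.
  by rewrite ltr_pdivrMl// mulr1 ltrDl.
have [c [cs ck _]] := cstar_sqrt ks k1.
have := Re_trace_ge0 Tt (b - c ** b).
have -> : star (b - c ** b) ** (b - c ** b) = star b ** b - star b ** (k ** b).
  rewrite -ck starD starN starM cs !smulDl !smulDr !sNmul !smulN -!smulA.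
  set p := star b ** (c ** b); set q := star b ** (c ** (c ** b)).
  by rewrite !opprD !opprK !addrA.
rewrite (traceD Tt) (traceN Tt) {1}/k smulZl smulZr (traceZ Tt) => h.
have h' : N * complex.Re (t (star (a ** b) ** (a ** b))) <= complex.Re (t (star b ** b)).
  move: h; rewrite starM -!smulA.
  case: (t (star b ** b)) => u v; case: (t _) => u' v' /=.
  by rewrite mul0r subr0 subr_ge0.
rewrite -(@ler_pXn2r _ 2) ?nnegrE ?mulr_ge0 ?norm2_ge0//; last exact: ltW.
by rewrite exprMn !(norm2_sqr Tt) -ler_pdivrMl ?exprn_gt0// -exprVn expr2.
Qed.

Lemma norm2X_mulr (a b : A) : norm2X T (a ** b) <= (rnorm a + 1) * norm2X T b.
Proof.
have a1 : 0 <= rnorm a + 1 by rewrite addr_ge0 ?rnorm_ge0.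
apply: norm2X_le => [|t Tt]; first by rewrite mulr_ge0 ?norm2X_ge0.
by rewrite (le_trans (norm2_mul a b Tt))// ler_wpM2l// norm2X_ge.
Qed.

Lemma norm2X_mull (a b : A) : norm2X T (a ** b) <= (rnorm b + 1) * norm2X T a.
Proof.
rewrite -(starK (a ** b)) (le_trans (norm2X_star _))// starM.
rewrite (le_trans (norm2X_mulr _ _))// rnorm_star ler_wpM2l ?norm2X_star//.
by rewrite addr_ge0 ?rnorm_ge0.
Qed.

Definition trace_null (a : linf A) : Prop := ulim w (fun n => norm2X T (a n)) 0.

Definition trace_ideal_set : set A_omega :=
  [set x | exists2 a : linf A, acls a = x & trace_null a].

Let tn0 (a : linf A) n : 0 <= norm2X T (a n). Proof. exact: norm2X_ge0. Qed.

Lemma trace_nullD a b : trace_null a -> trace_null b -> trace_null (a + b).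
Proof.
move=> ha hb; have := ulim0D (tn0 a) (tn0 b) ha hb.
apply: (@ulim0_le _ _ 2) => // n; first by rewrite addr_ge0.
exact: norm2XD.
Qed.
Lemma c_omega_null a : c_omega a -> trace_null a.
Proof. by apply: (@ulim0_le _ _ 1) => // n; rewrite mul1r norm2X_rnorm. Qed.

Lemma trace_idealE (a : linf A) : trace_ideal_set (acls a) <-> trace_null a.
Proof.
split=> [[b /esym /qcls_eq /c_omega_null h hb]|h]; last by exists a.
by rewrite -(subrK b a); exact: trace_nullD.
Qed.

Lemma aclsP (x : A_omega) : exists a, x = acls a. Proof. exact: qclsP. Qed.

Lemma trace_ideal0 : trace_ideal_set 0.
Proof. by exists 0; [exact: qcls0|apply: c_omega_null; exact: c_omega0]. Qed.
Lemma trace_idealD x y : trace_ideal_set x -> trace_ideal_set y -> trace_ideal_set (x + y).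
Proof.
move=> [a <- ha] [b <- hb]; exists (a + b); first exact: qclsD.
exact: trace_nullD.
Qed.
Lemma trace_idealZ (c : R[i]) x : trace_ideal_set x -> trace_ideal_set (c *: x).
Proof.
move=> [a <- ha]; exists (c *: a); first exact: qclsZ.
have [K _ hK] := norm2XZ c.
by move: ha; apply: (@ulim0_le _ _ K) => // n; exact: hK.
Qed.
Lemma trace_idealMl x y : trace_ideal_set y -> trace_ideal_set (x ** y).
Proof.
have [b ->] := aclsP x; move=> [a <- ha]; exists (b ** a); first exact: qclsM.
move: ha; apply: (@ulim0_le _ _ (rnorm b + 1)) => // n.
by rewrite (le_trans (norm2X_mulr _ _))// ler_wpM2r// lerD2r linf_nth_le.
Qed.
Lemma trace_idealMr x y : trace_ideal_set x -> trace_ideal_set (x ** y).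
Proof.
have [b ->] := aclsP y; move=> [a <- ha]; exists (a ** b); first exact: qclsM.
move: ha; apply: (@ulim0_le _ _ (rnorm b + 1)) => // n.
by rewrite (le_trans (norm2X_mull _ _))// ler_wpM2r// lerD2r linf_nth_le.
Qed.
Lemma trace_idealS x : trace_ideal_set x -> trace_ideal_set (star x).
Proof.
move=> [a <- ha]; exists (star a); first exact: qclsS.
by move: ha; apply: (@ulim0_le _ _ 1) => // n; rewrite mul1r norm2X_star.
Qed.
Lemma trace_ideal_closed : closed trace_ideal_set.
Proof.
move=> x cx; have [a xa] := aclsP x; rewrite xa; apply/trace_idealE.
apply/ulim0P => // e e0.
have e4 : 0 < e / 2 / 2 by rewrite !divr_gt0.
have [y Jy xy] := closure_approx cx e4.
have d0 : 0 < e / 2 / 2 - rnorm (x - y) by rewrite subr_gt0.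
have [b yb] := aclsP y; move: Jy; rewrite yb => /trace_idealE.
have [z zxy] := rnorm_quot_lt (x - y) d0; rewrite addrC subrK => hz.
have hc : c_omega (a - b - z).
  by apply/qcls_eq; rewrite zxy xa yb /acls qclsD qclsN.
move/(trace_nullD (c_omega_null hc)); rewrite [a - b - z]addrAC subrK.
move=> /(ulim0P (tn0 _)) /(_ _ e4); apply: filterS => n /= hn.
rewrite -(subrK (z n) (a n)) (le_lt_trans (norm2XD _ _))//.
rewrite mulrC -ltr_pdivlMr// (splitr (e / 2)) ltrD//.
apply: le_lt_trans (norm2X_rnorm _) _.
exact: le_lt_trans (linf_nth_le z n) hz.
Qed.

Definition trace_ideal : star_ideal A_omega :=
  StarIdeal trace_ideal0 trace_idealD trace_idealZ trace_idealMl trace_idealMr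
    trace_idealS trace_ideal_closed.

(* A C*-algebra, like any quotient of a C*-algebra by a closed ideal, but only the
   norm and the *-algebra structure are recorded in the type. *)
Definition A_omega_b : normedStarAlgType R := star_quot trace_ideal.

Definition bcls (a : linf A) : A_omega_b := qcls trace_ideal (acls a).

Lemma bcls_eq (a b : linf A) : bcls a = bcls b <-> trace_null (a - b).
Proof.
by rewrite qcls_eq -trace_idealE /acls qclsD qclsN.
Qed.

Lemma bclsP (x : A_omega_b) : exists a, x = bcls a.
Proof. by have [y ->] := qclsP x; have [a ->] := aclsP y; exists a. Qed.

End Ultrapower.

(* By rnorm_act below such maps are automatically isometric when A is a
   C*-algebra. *)
Record action (R : realType) (G : groupType) (A : normedStarAlgType R) := Action {
  act :> G -> star_hom A A;
  act1 : forall x, act 1%g x = x;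
  actM : forall g h x, act (g * h)%g x = act g (act h x)
}.

Section InducedAction.
Variables (R : realType) (w : freeUltrafilter) (A : cstarAlgType R).
Variables (G : groupType) (alpha : action G A).

Lemma rnorm_act g (x : A) : rnorm (alpha g x) = rnorm x.
Proof.
apply/le_anti; rewrite star_hom_contr /=.
by rewrite -{1}(act1 alpha x) -(mulVg g) actM star_hom_contr.
Qed.

Lemma tracial_state_act g (t : A -> R[i]) : tracial_state t -> tracial_state (t \o alpha g).
Proof.
move=> [t1 t2 t3 t4]; split.
- by move=> c x y /=; rewrite star_homP t1.
- by move=> x /=; rewrite star_homM star_homS t2.
- by move=> x y /=; rewrite !star_homM t3.
- rewrite -[RHS]t4; congr sup; apply/seteqP; split=> _ [x x1 <-].
    by exists (alpha g x) => //=; rewrite rnorm_act.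
  exists (alpha g^-1%g x) => /=; first by rewrite rnorm_act.
  by rewrite -actM mulgV act1.
Qed.

Lemma norm2X_act g (x : A) : norm2X (@tracial_state R A) (alpha g x) <= norm2X (@tracial_state R A) x.
Proof.
apply: norm2X_le => [|t Tt]; first exact: norm2X_ge0.
have := norm2X_ge x (tracial_state_act g Tt); apply: le_trans.
by rewrite /norm2 /= star_homM star_homS.
Qed.

Lemma bounded_act g (a : linf A) : bounded_seq (fun n => alpha g (a n)).
Proof. by have [M aM] := linf_bounded a; exists M => n; rewrite rnorm_act; exact: aM. Qed.

Definition linf_act g (a : linf A) : linf A := mk_linf (bounded_act g a).

(* Independent of the representative, by act_omegaE. *)
Definition act_omega (g : G) (x : A_omega_b w A) : A_omega_b w A :=
  bcls w (linf_act g (qrep (qrep x))).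

Lemma act_omegaE g (a : linf A) : act_omega g (bcls w a) = bcls w (linf_act g a).
Proof.
set b := qrep (qrep (bcls w a)).
have /bcls_eq ba : bcls w b = bcls w a by rewrite /b /bcls /acls !qrepK.
apply/bcls_eq; move: ba; apply: (@ulim0_le _ _ _ _ 1) => n; try exact: norm2X_ge0.
rewrite mul1r; apply: le_trans (norm2X_act g _).
by rewrite star_homD star_homN.
Qed.

End InducedAction.

Section Hypotheses.
Variables (R : realType).

Definition positive (B : normedStarAlgType R) (x : B) : Prop :=
  exists y, x = star y ** y.

Definition sigma_unital (A : cstarAlgType R) : Prop :=
  exists e : nat -> A,
    [/\ forall n, positive (e n) /\ `|e n| <= 1,
        forall n, positive (e n.+1 - e n),
        forall a, (fun n => e n ** a) @ \oo --> a &
        forall a, (fun n => a ** e n) @ \oo --> a].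

(* Existence of a left-invariant mean on the bounded real functions; m is
   unconstrained on unbounded functions. *)
Definition amenable (G : groupType) : Prop :=
  let bounded (f : G -> R) := exists M, forall g, `|f g| <= M in
  exists m : (G -> R) -> R,
    [/\ forall c f f', bounded f -> bounded f' ->
          m (fun g => c * f g + f' g) = c * m f + m f',
        forall f, bounded f -> (forall g, 0 <= f g) -> 0 <= m f,
        m (fun=> 1) = 1 &
        forall h f, bounded f -> m (fun g => f (h * g)%g) = m f].

Definition commutant (B : normedStarAlgType R) (S : set B) : set B :=
  [set x | forall s, S s -> x ** s = s ** x].

Definition projection (B : normedStarAlgType R) (p : B) : Prop :=
  star p = p /\ p ** p = p.

Definition norm2X_separable (B : normedStarAlgType R) (X : set (B -> R[i]))
    (S : set B) : Prop :=
  exists D : set B, [/\ countable D, D `<=` S &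
    forall x, S x -> forall e : R, 0 < e -> exists2 d, D d & norm2X X (x - d) < e].

Section Ultra.
Variables (w : freeUltrafilter) (A : cstarAlgType R).
Local Notation B := (A_omega_b w A).

Definition limit_traces : set (B -> R[i]) :=
  [set t | exists tn : nat -> A -> R[i], (forall n, tracial_state (tn n)) /\
    forall a : linf A, ulim w (fun n => tn n (a n)) (t (bcls w a))].

Definition limit_traces_closure : set (B -> R[i]) :=
  @tracial_state R B `&` @closure {ptws B -> R[i]} limit_traces.

Definition cst_embed (a : A) : B := bcls w (linf_cst a).

(* The family is indexed by k.+1 because a minimum over no index is +oo, which
   makes the case of an empty family vacuous. *)
Definition weak_CPoU : Prop :=
  forall (S : set B), norm2X_separable limit_traces S ->
  forall (k : nat) (a : 'I_k.+1 -> A), (forall i, positive (a i)) ->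
  forall delta : R,
    sup [set \big[Num.min/complex.Re (t (a ord0))]_(i < k.+1) complex.Re (t (a i))
         | t in @tracial_state R A] < delta ->
  exists e : 'I_k.+1 -> B,
    (forall i, [/\ positive (e i), `|e i| <= 1 & commutant S (e i)]) /\
    forall t, limit_traces t ->
      t (\sum_i e i) = 1 /\
      forall i, t (cst_embed (a i) ** e i) <= delta%:C%C * t (e i).

Definition local_equivariant_Gamma (G : groupType) (alpha : action G A) : Prop :=
  forall (n : nat) (S : set B), norm2X_separable limit_traces S ->
  exists p : 'I_n -> B,
    [/\ forall i, projection (p i),
        forall i j, i != j -> p i ** p j = 0,
        forall i g, act_omega alpha g (p i) = p i,
        forall i, commutant S (p i) &
        forall i a t, S a -> limit_traces t -> t (a ** p i) = n%:R^-1 * t a].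

End Ultra.
End Hypotheses.

Section GStarPolynomials.
Variables (R : realType) (G : groupType) (X : Type).

(* The letter (s, g, x) is g . x, or its adjoint when s holds; a polynomial is a
   list of coefficients and words, the empty word being the constant monomial. *)
Definition gstar_letter : Type := bool * G * X.
Definition gstar_poly : Type := seq (R[i] * seq gstar_letter).

Section Eval.
Variables (B : normedStarAlgType R) (beta : G -> B -> B) (v : X -> B).

(* The unit of B, and 0 when B has none. *)
Definition alg_unit : B := xget 0 [set e | forall x, e ** x = x /\ x ** e = x].

Definition eval_letter (l : gstar_letter) : B :=
  let y := beta l.1.2 (v l.2) in if l.1.1 then star y else y.

Definition eval_word (u : seq gstar_letter) : B :=
  if u is l :: u' then foldl (fun y l' => y ** eval_letter l') (eval_letter l) u'
  else alg_unit.

Definition eval_poly (p : gstar_poly) : B := \sum_(cu <- p) cu.1 *: eval_word cu.2.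

End Eval.
End GStarPolynomials.

Definition join_vals (B : Type) (r s : nat) (a y : nat -> B) (v : 'I_r + 'I_s) : B :=
  match v with inl i => a i | inr j => y j end.

(* Main.v *)
(* The limit traces on B = A^{omega,b} are closed under finite averages, and B is
   saturated: countably many conditions f(expression) <= 0, f ranging over the limit
   traces, that can be solved up to every epsilon can be solved. Given a finite cover
   of the limit traces by the conditions f(a_i) < d, weak CPoU, applied repeatedly to
   what the previous applications have left over, gives positive u_i with sum 1, with
   commuting translates and with f(a_i u_i) <= 2 d f(u_i). Averaging the translates of
   the u_i over a probability on G that almost satisfies Reiter's condition makes them
   nearly invariant. Property Gamma replaces commuting positive contractions by
   projections with the same traces, and then, in rounds, makes these orthogonal: one
   obtains orthogonal projections q_i, nearly invariant in the 2-norms, with sum nearly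
   1, and almost carried by the traces on which a_i is small. Solutions y^i on the pieces
   of the cover are patched to the contraction y = sum_i q_i y^i; the value of an
   expression at y is, up to a small 2-norm error, the sum of the q_i times its values
   at the y^i. *)

Require Import Defs.
From HB Require Import structures.
From mathcomp Require Import all_boot all_order all_algebra.
From mathcomp Require Import all_classical all_reals.
From mathcomp Require Import topology normedtype sequences.
From mathcomp Require Import complex.
From mathcomp Require Import ring lra.

Set Implicit Arguments.
Unset Strict Implicit.
Unset Printing Implicit Defensive.

Import Order.TTheory GRing.Theory Num.Theory numFieldNormedType.Exports.

Local Open Scope classical_set_scope.
Local Open Scope ring_scope.

(** * Normalisation in noncommutative *-algebras *)

(** [A_omega_b] is available only as a normed *-algebra, without C*-identity or functional calculus.
    Its order and unit ball are therefore read off from the limit traces: x is positive if f(z* x z)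
    >= 0 for all f and z, and a contraction if left multiplication by x shrinks every 2-norm. The
    second criterion is tied to the quotient norm by cutting lifts down in A with a resolvent;
    square roots are likewise taken in the coordinates. Weak CPoU accepts only elements of A and
    ignores G. It is applied coordinatewise to lifts, and translates are made to commute by
    averaging N successive partitions, each commuting with all translates of the earlier ones, which
    leaves commutators of order 1/N. Near invariance is measured by how close sum_i f(q_i (h q_i))
    is to 1, a quantity that survives orthogonalisation: it is bounded below through elements z_i
    under both x_i and h x_i, and the passage to projections preserves order. Amenability is given
    by an invariant mean; Reiter's condition is drawn from it by a game argument. *)

Section NoncommutativeNormalForm.
Variables (R : realType) (B : normedStarAlgType R).

Inductive ncexpr :=
  | NCvar of nat | NCone | NCzero | NCadd of ncexpr & ncexpr | NCopp of ncexpr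
  | NCmul of ncexpr & ncexpr | NCmuln of ncexpr & nat.

Variables (one : B) (v : nat -> B).

Fixpoint nc_eval (e : ncexpr) : B :=
  match e with
  | NCvar i => v i
  | NCone => one
  | NCzero => 0
  | NCadd a b => nc_eval a + nc_eval b
  | NCopp a => - nc_eval a
  | NCmul a b => nc_eval a ** nc_eval b
  | NCmuln a n => nc_eval a *+ n
  end.

Definition monom : Type := int * seq nat.

Fixpoint nc_nf (e : ncexpr) : seq monom :=
  match e with
  | NCvar i => [:: (1%:Z, [:: i])]
  | NCone => [:: (1%:Z, [::])]
  | NCzero => [::]
  | NCadd a b => nc_nf a ++ nc_nf b
  | NCopp a => [seq (- m.1, m.2) | m <- nc_nf a]
  | NCmul a b => flatten [seq [seq (m.1 * m'.1, m.2 ++ m'.2) | m' <- nc_nf b] | m <- nc_nf a]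
  | NCmuln a n => [seq (n%:Z * m.1, m.2) | m <- nc_nf a]
  end.

(** The last letter is not multiplied by [one], so that nonempty words make sense in an algebra
    without unit; the flag [un] below says whether [one] may be used as a unit. *)
Fixpoint word_eval (s : seq nat) : B :=
  if s is i :: s' then (if s' is [::] then v i else v i ** word_eval s') else one.

Definition nf_eval (l : seq monom) : B := \sum_(m <- l) word_eval m.2 *~ m.1.

Variable un : bool.
Hypothesis unP : un -> forall x, one ** x = x /\ x ** one = x.

Fixpoint nc_wf (e : ncexpr) : bool :=
  match e with
  | NCone => un
  | NCadd a b | NCmul a b => nc_wf a && nc_wf b
  | NCopp a | NCmuln a _ => nc_wf a
  | _ => true
  end.

Lemma word_evalS i s : un || (s != [::]) -> word_eval (i :: s) = v i ** word_eval s.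
Proof. by case: s => //=; rewrite orbF => u; have [_ ->] := unP u (v i). Qed.

Lemma word_eval_cat s s' : un || (s != [::]) && (s' != [::]) ->
  word_eval (s ++ s') = word_eval s ** word_eval s'.
Proof.
elim: s => [|i s ih].
  by rewrite andFb orbF => u; have [-> _] := unP u (word_eval s').
move=> h; rewrite cat_cons word_evalS; last first.
  by move: h => /orP[->//|/andP[_ h]]; case: s {ih} => //=; rewrite ?h ?orbT//.
have [s0|s0] := eqVneq s [::].
  by rewrite s0 /=.
rewrite ih; last by move: h => /orP[->//|/andP[_ ->]]; rewrite s0 orbT.
by rewrite smulA word_evalS ?s0 ?orbT.
Qed.

Definition nf_ok (l : seq monom) := un || all (fun m => m.2 != [::]) l.

Lemma nc_nf_ok e : nc_wf e -> nf_ok (nc_nf e).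
Proof.
rewrite /nf_ok; elim: e => //=.
- by rewrite orbT.
- by move=> ->.
- by rewrite orbT.
- move=> a iha b ihb /andP[/iha + /ihb]; rewrite all_cat.
  by case: un => //= -> ->.
- by move=> a ih /ih; rewrite all_map.
- move=> a iha b ihb /andP[/iha + /ihb]; case: un => //= ha hb.
  apply/allP => m /flattenP[_ /mapP[m1 m1a ->] /mapP[m2 m2b ->]] /=.
  have /allP/(_ _ m1a) := ha; by case: (m1.2).
- by move=> a ih n /ih; rewrite all_map.
Qed.

Lemma smul0 (x : B) : x ** 0 = 0.
Proof. by have := smulZr 0 x 0; rewrite !scale0r. Qed.
Lemma s0mul (x : B) : 0 ** x = 0.
Proof. by have := smulZl 0 0 x; rewrite !scale0r. Qed.

Lemma smulMz (x y : B) (m : int) : x ** (y *~ m) = (x ** y) *~ m.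
Proof.
have smulMn n : x ** (y *+ n) = (x ** y) *+ n.
  by elim: n => [|n ih]; rewrite ?mulr0n ?smul0// !mulrS smulDr ih.
by case: m => n; rewrite ?NegzE ?mulrNz ?smulN -?pmulrn smulMn.
Qed.
Lemma sMzmul (x y : B) (m : int) : (x *~ m) ** y = (x ** y) *~ m.
Proof.
have smulMn n : (x *+ n) ** y = (x ** y) *+ n.
  by elim: n => [|n ih]; rewrite ?mulr0n ?s0mul// !mulrS smulDl ih.
by case: m => n; rewrite ?NegzE ?mulrNz ?sNmul -?pmulrn smulMn.
Qed.

Lemma nc_nfE e : nc_wf e -> nc_eval e = nf_eval (nc_nf e).
Proof.
rewrite /nf_eval; elim: e => /=.
- by move=> i _; rewrite big_seq1.
- by move=> _; rewrite big_seq1.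
- by rewrite big_nil.
- by move=> a iha b ihb /andP[/iha -> /ihb ->]; rewrite big_cat.
- move=> a ih /ih ->; rewrite big_map -sumrN; apply: eq_bigr => m _.
  by rewrite mulrNz.
- move=> a iha b ihb /andP[wa wb]; rewrite iha// ihb//.
  have := nc_nf_ok wa; have := nc_nf_ok wb.
  elim: (nc_nf a) => [|m l ih]; first by rewrite /= !big_nil s0mul.
  move=> ob oa; rewrite /= big_cat /= big_cons smulDl ih//; last first.
    by move: oa; rewrite /nf_ok /=; case: un => //= /andP[].
  congr (_ + _); rewrite big_map.
  have om : un || (m.2 != [::]) by move: oa; rewrite /nf_ok /=; case: un => //= /andP[].
  elim: (nc_nf b) ob => [|m' l' ih'] ob; first by rewrite !big_nil smul0.
  rewrite !big_cons smulDr ih'; last first.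
    by move: ob; rewrite /nf_ok /=; case: un => //= /andP[].
  congr (_ + _); rewrite smulMz sMzmul /= word_eval_cat ?mulrzA//.
  by move: ob om; rewrite /nf_ok /=; case: un => //= /andP[-> _] ->.
- move=> a ih n /ih ->; rewrite big_map -sumrMnl; apply: eq_bigr => m _.
  by rewrite mulrC mulrzA -pmulrn.
Qed.

Variables (cm : seq (nat * nat)) (idem : seq nat).

Definition nc_comm i j := ((i, j) \in cm) || ((j, i) \in cm).

Fixpoint all_comm (l : seq (nat * nat)) : Prop :=
  if l is (i, j) :: l' then v i ** v j = v j ** v i /\ all_comm l' else True.
Fixpoint all_idem (l : seq nat) : Prop :=
  if l is i :: l' then v i ** v i = v i /\ all_idem l' else True.

(** A letter moves only past smaller letters listed as commuting with it. Sorting keeps the value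
    but gives no canonical form; a mismatch merely makes [nc_check] fail. *)
Fixpoint word_insert i s :=
  if s is j :: s' then
    if (i == j) && (i \in idem) then s
    else if (j < i)%N && nc_comm i j then j :: word_insert i s' else i :: s
  else [:: i].

Definition word_sort (s : seq nat) := foldr word_insert [::] s.

Hypothesis cmP : all_comm cm.
Hypothesis idemP : all_idem idem.

Lemma nc_commP i j : nc_comm i j -> v i ** v j = v j ** v i.
Proof.
rewrite /nc_comm; elim: cm cmP => //= -[a b] l ih [ab /ih {}ih].
by rewrite !inE !xpair_eqE => /orP[/orP[/andP[/eqP-> /eqP->]//|h]|
  /orP[/andP[/eqP-> /eqP->]//|h]]; apply: ih; rewrite h ?orbT.
Qed.

Lemma nc_idemP i : i \in idem -> v i ** v i = v i.
Proof.
by elim: idem idemP => //= a l ih [ha /ih {}ih]; rewrite inE => /orP[/eqP ->|].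
Qed.

Lemma word_insertE i s : word_eval (word_insert i s) = word_eval (i :: s).
Proof.
have we j l : l != [::] -> word_eval (j :: l) = v j ** word_eval l by case: l.
have ne j l : word_insert j l != [::].
  by case: l => //= a l; case: ifP => // _; case: ifP.
elim: s => //= j s ih; case: ifP => [/andP[/eqP <- hi]|_].
  case: s {ih} => [|k s]; first by rewrite nc_idemP.
  by rewrite smulA nc_idemP.
case: ifP => // /andP[_ /nc_commP ij].
rewrite we// ih; case: s {ih} => [|k s]; first by rewrite /= ij.
by rewrite !smulA ij.
Qed.

Lemma word_sortE s : word_eval (word_sort s) = word_eval s.
Proof.
elim: s => //= i s ih; rewrite word_insertE /= -ih.
case: s ih => // j s _.
have : word_sort (j :: s) != [::].
  by rewrite /=; case: (word_sort s) => //= a l; case: ifP => // _; case: ifP.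
by case: (word_sort _).
Qed.

Fixpoint collect_add (c : int) (s : seq nat) (l : seq monom) : seq monom :=
  if l is m :: l' then
    if m.2 == s then (c + m.1, s) :: l' else m :: collect_add c s l'
  else [:: (c, s)].

Definition nf_collect (l : seq monom) : seq monom :=
  foldr (fun m acc => collect_add m.1 (word_sort m.2) acc) [::] l.

Lemma collect_addE c s l : nf_eval (collect_add c s l) = word_eval s *~ c + nf_eval l.
Proof.
rewrite /nf_eval; elim: l => [|m l ih] /=; first by rewrite big_seq1 big_nil addr0.
case: eqP => [<-|_]; first by rewrite !big_cons /= mulrzDr addrA.
by rewrite !big_cons ih addrCA.
Qed.

Lemma nf_collectE l : nf_eval (nf_collect l) = nf_eval l.
Proof.
elim: l => //= m l ih; rewrite collect_addE ih word_sortE.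
by rewrite /nf_eval big_cons.
Qed.

Definition nc_check (a b : ncexpr) : bool :=
  [&& nc_wf a, nc_wf b &
   all (fun m => m.1 == 0) (nf_collect (nc_nf (NCadd a (NCopp b))))].

Lemma nc_check_sound a b : nc_check a b -> nc_eval a = nc_eval b.
Proof.
move=> /and3P[wa wb /allP h]; apply/eqP; rewrite -subr_eq0; apply/eqP.
rewrite -[LHS]/(nc_eval (NCadd a (NCopp b))) nc_nfE /= ?wa// -nf_collectE.
rewrite /nf_eval big_seq big1// => m /h /eqP ->.
by rewrite mulr0z.
Qed.

End NoncommutativeNormalForm.

(* Two inference paths to the scaling of an algebra give syntactically different
   terms, hence the second alternative. *)
Ltac nc_same x y :=
  first [ constr_eq x y
        | lazymatch x with
          | GRing.scale ?c ?u => lazymatch y with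
            | GRing.scale ?c' ?u' => unify c c'; nc_same u u' end end ].
Ltac nc_mem x l :=
  lazymatch l with
  | nil => constr:(false)
  | cons ?y ?l' =>
    match goal with
    | _ => let _ := match goal with _ => nc_same x y end in constr:(true)
    | _ => nc_mem x l'
    end
  end.
Ltac nc_index x l :=
  lazymatch l with
  | cons ?y ?l' =>
    match goal with
    | _ => let _ := match goal with _ => nc_same x y end in constr:(0%N)
    | _ => let n := nc_index x l' in constr:(S n)
    end
  end.
Ltac nc_atoms one t l :=
  lazymatch t with
  | 0 => l
  | one => l
  | ?a + ?b => let l1 := nc_atoms one a l in nc_atoms one b l1
  | - ?a => nc_atoms one a l
  | ?a *+ ?n => nc_atoms one a l
  | smul ?a ?b => let l1 := nc_atoms one a l in nc_atoms one b l1
  | _ => let b := nc_mem t l in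
         lazymatch b with true => l | false => constr:(cons t l) end
  end.
Ltac nc_reify one t l :=
  lazymatch t with
  | 0 => constr:(NCzero)
  | one => constr:(NCone)
  | ?a + ?b => let a' := nc_reify one a l in let b' := nc_reify one b l in constr:(NCadd a' b')
  | - ?a => let a' := nc_reify one a l in constr:(NCopp a')
  | ?a *+ ?n => let a' := nc_reify one a l in constr:(NCmuln a' n)
  | smul ?a ?b => let a' := nc_reify one a l in let b' := nc_reify one b l in constr:(NCmul a' b')
  | _ => let i := nc_index t l in constr:(NCvar i)
  end.
Ltac nc_has_comm a b :=
  match goal with
  | _ => let _ := constr:(ltac:(solve [assumption | symmetry; assumption]) : a ** b = b ** a) in
         constr:(true)
  | _ => constr:(false)
  end.
Ltac nc_pairs_with a i l j acc :=
  lazymatch l with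
  | nil => acc
  | cons ?b ?l' =>
    let acc' := match nc_has_comm a b with
                | true => constr:(cons (i, j) acc)
                | false => acc end in
    nc_pairs_with a i l' (S j) acc'
  end.
Ltac nc_pairs l i acc :=
  lazymatch l with
  | nil => acc
  | cons ?a ?l' =>
    let acc' := nc_pairs_with a i l' (S i) acc in nc_pairs l' (S i) acc'
  end.
Ltac nc_idems l i acc :=
  lazymatch l with
  | nil => acc
  | cons ?a ?l' =>
    let acc' := match goal with
                | _ : a ** a = a |- _ => constr:(cons i acc)
                | _ => acc end in
    nc_idems l' (S i) acc'
  end.
Ltac nc_gen one un unP :=
  match goal with
  | |- @eq ?T ?a ?b =>
    let l := nc_atoms one a (@nil T) in
    let l := nc_atoms one b l in
    let a' := nc_reify one a l in
    let b' := nc_reify one b l in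
    let cm := nc_pairs l 0%N (@nil (nat * nat)) in
    let idm := nc_idems l 0%N (@nil nat) in
    refine (@nc_check_sound _ _ one (nth 0 l) un unP cm idm _ _ a' b' _);
      [ cbn [all_comm nth]; repeat split; first [assumption | symmetry; assumption]
      | cbn [all_idem nth]; repeat split; assumption
      | vm_compute; reflexivity ]
  end.
Lemma no_unit (R : realType) (B : normedStarAlgType R) (one : B) :
  false -> forall x, one ** x = x /\ x ** one = x.
Proof. by []. Qed.
(* Decides equalities of noncommutative polynomials, up to the commutations a ** b = b ** a
   and the idempotents a ** a = a found among the hypotheses. *)
Ltac nc :=
  match goal with |- @eq ?T _ _ => nc_gen (0 : T) false (@no_unit _ _ (0 : T)) end.

(** * Ultralimits and positive functionals *)

Section UltraLimits.
Variables (R : realType) (I : Type) (U : set_system I).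
Context {UU : UltraFilter U}.

Definition ucv (f : I -> R) (l : R) : Prop :=
  forall e : R, 0 < e -> U [set i | `|f i - l| < e].

Lemma ucv_ex (f : I -> R) (M : R) : (forall i, `|f i| <= M) -> exists l, ucv f l.
Proof.
move=> fM; have := @segment_compact R (- M) M; rewrite compact_ultra.
have UF : UltraFilter (f @ U).
  split=> [|G GP /= FG]; first exact: fmap_proper_filter.
  apply/seteqP; split=> // A GA.
  have [//|UnA] := in_ultra_setVsetC (f @^-1` A) UU.
  have : G (~` A) by apply: FG.
  by move=> /(filterI GA); rewrite setICr => /filter_not_empty.
move=> /(_ _ UF); case.
  rewrite /fmap /=; apply: (@filterS _ U _ setT) filterT => i _ /=.
  by rewrite in_itv /= -ler_norml.
move=> l [_ fl]; exists l => e e0.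
move/cvgrPdist_lt: fl => /(_ e e0); apply: filterS => i /=.
by rewrite distrC.
Qed.

Lemma ucv_le (f g : I -> R) (a b : R) :
  ucv f a -> ucv g b -> U [set i | f i <= g i] -> a <= b.
Proof.
move=> fa gb fg; apply/ler_addgt0Pr => e e0.
have e2 : 0 < e / 2 by rewrite divr_gt0.
have hU : U ([set i | `|f i - a| < e / 2] `&` [set i | `|g i - b| < e / 2]
    `&` [set i | f i <= g i]).
  by apply: filterI => //; apply: filterI; [exact: fa|exact: gb].
have [i [[/= h1 h2] h3]] := filter_ex hU.
move: h1 h2; rewrite !ltr_norml => /andP[h1 h1'] /andP[h2 h2']; lra.
Qed.

Lemma ucv_cst (a : R) : ucv (fun=> a) a.
Proof. by move=> e e0; apply: filterS filterT => i _ /=; rewrite subrr normr0. Qed.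

Lemma ucv_unique (f : I -> R) (a b : R) : ucv f a -> ucv f b -> a = b.
Proof.
by move=> fa fb; apply/le_anti/andP; split; [apply: (ucv_le fa fb)|apply: (ucv_le fb fa)];
  apply: filterS filterT => i _ /=.
Qed.

Lemma ucvD (f g : I -> R) (a b : R) : ucv f a -> ucv g b -> ucv (fun i => f i + g i) (a + b).
Proof.
move=> fa gb e e0; have e2 : 0 < e / 2 by rewrite divr_gt0.
apply: filterS (filterI (fa _ e2) (gb _ e2)) => i /= [].
rewrite !ltr_norml => /andP[h1 h1'] /andP[h2 h2']; apply/andP; split; lra.
Qed.

Lemma ucvZ (f : I -> R) (a c : R) : ucv f a -> ucv (fun i => c * f i) (c * a).
Proof.
move=> fa e e0; have c0 : 0 < `|c| + 1 by rewrite ltr_wpDl.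
apply: filterS (fa (e / (`|c| + 1)) _) => [i /=|]; last by rewrite divr_gt0.
rewrite -mulrBr normrM ltr_pdivlMr// => h; apply: le_lt_trans h.
by rewrite mulrC ler_wpM2l// lerDl.
Qed.

Lemma ucv_eq (f g : I -> R) (a : R) : f =1 g -> ucv f a -> ucv g a.
Proof. by move=> /funext ->. Qed.

Lemma ucv_near (f g : I -> R) (a : R) : (forall e, 0 < e -> U [set i | `|f i - g i| < e]) ->
  ucv f a -> ucv g a.
Proof.
move=> fg fa e e0; have e2 : 0 < e / 2 by rewrite divr_gt0.
apply: filterS (filterI (fa _ e2) (fg _ e2)) => i /= [].
rewrite !ltr_norml => /andP[h1 h1'] /andP[h2 h2']; apply/andP; split; lra.
Qed.

End UltraLimits.

(** * Real and imaginary parts of complex ultralimits *)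

Section Complex.
Variable R : realType.

Lemma Re_le_normC (z : R[i]) : `|complex.Re z| <= rnorm z.
Proof.
rewrite -lecR rnormE; case: z => a b /=; rewrite normc_def /= lecR.
by rewrite -sqrtr_sqr ler_wsqrtr// lerDl sqr_ge0.
Qed.

Lemma Im_le_normC (z : R[i]) : `|complex.Im z| <= rnorm z.
Proof.
rewrite -lecR rnormE; case: z => a b /=; rewrite normc_def /= lecR.
by rewrite -sqrtr_sqr ler_wsqrtr// lerDr sqr_ge0.
Qed.

Lemma normC_le (z : R[i]) : rnorm z <= `|complex.Re z| + `|complex.Im z|.
Proof.
rewrite -lecR rnormE; case: z => a b /=; rewrite normc_def /= lecR.
rewrite -(@ler_pXn2r _ 2) ?nnegrE ?addr_ge0 ?sqrtr_ge0//.
rewrite sqr_sqrtr ?addr_ge0 ?sqr_ge0// sqrrD !real_normK ?num_real//.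
by rewrite lerD2r lerDl mulrn_wge0// mulr_ge0.
Qed.

Lemma ulimCP (w : freeUltrafilter) (f : nat -> R[i]) (l : R[i]) :
  ulim w f l <-> (ucv w (fun n => complex.Re (f n)) (complex.Re l) /\
                  ucv w (fun n => complex.Im (f n)) (complex.Im l)).
Proof.
split=> [/cvgrPdist_lt h|[h1 h2]].
  split=> e e0.
    apply: filterS (h e%:C%C _) => [n /=|]; last by rewrite ltcR.
    rewrite -rnormE ltcR; apply: le_lt_trans; rewrite distrC.
    by apply: le_trans (Re_le_normC _); rewrite raddfB.
  apply: filterS (h e%:C%C _) => [n /=|]; last by rewrite ltcR.
  rewrite -rnormE ltcR; apply: le_lt_trans; rewrite distrC.
  by apply: le_trans (Im_le_normC _); rewrite raddfB.
apply/cvgrPdist_lt => e e0.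
have e0' : 0 < complex.Re e by move: e0; rewrite ltcE /= => /andP[].
have -> : e = (complex.Re e)%:C%C.
  by move: e0; rewrite ltcE /= => /andP[/eqP h _]; case: (e) h => a b /= ->.
have e2 : 0 < complex.Re e / 2 by rewrite divr_gt0.
apply: filterS (filterI (h1 _ e2) (h2 _ e2)) => n /= [g1 g2].
rewrite -rnormE ltcR; apply: le_lt_trans (normC_le _) _.
rewrite (splitr (complex.Re e)) !raddfB /=.
by rewrite ltrD// distrC.
Qed.

End Complex.

Section PositiveFunctionals.
Variables (R : realType) (B : normedStarAlgType R).

(** Real parts of positive functionals. Only real scalars and real inequalities then occur, and
    [rposS] replaces hermitian symmetry in the Cauchy-Schwarz inequality. *)
Record rpos (f : B -> R) : Prop := RPos {
  rposD : forall x y, f (x + y) = f x + f y;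
  rposZ : forall c x, f (c%:C%C *: x) = c * f x;
  rposS : forall x y, f (star x ** y) = f (star y ** x);
  rpos_ge0 : forall x, 0 <= f (star x ** x)
}.

Definition fnorm (f : B -> R) (x : B) : R := Num.sqrt (f (star x ** x)).

Variable f : B -> R.
Hypothesis fp : rpos f.

Lemma rpos0 : f 0 = 0.
Proof. by have := rposZ fp 0 0; rewrite scaler0 mul0r. Qed.

Lemma rposN x : f (- x) = - f x.
Proof.
have := rposZ fp (-1) x; rewrite mulN1r => <-; congr f.
by rewrite rmorphN rmorph1 scaleN1r.
Qed.

Lemma rposB x y : f (x - y) = f x - f y.
Proof. by rewrite (rposD fp) rposN. Qed.

Lemma rpos_sum (J : Type) (s : seq J) (P : pred J) (F : J -> B) :
  f (\sum_(i <- s | P i) F i) = \sum_(i <- s | P i) f (F i).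
Proof. by apply: (big_morph f (rposD fp) rpos0). Qed.

Lemma fnorm_ge0 x : 0 <= fnorm f x. Proof. exact: sqrtr_ge0. Qed.

Lemma fnorm_sqr x : fnorm f x ^+ 2 = f (star x ** x).
Proof. by rewrite sqr_sqrtr// rpos_ge0. Qed.

Lemma fnormZ c x : fnorm f (c%:C%C *: x) = `|c| * fnorm f x.
Proof.
rewrite /fnorm starZ conjc_real smulZl smulZr !(rposZ fp) mulrA -expr2.
by rewrite sqrtrM ?sqr_ge0// sqrtr_sqr.
Qed.

Lemma fnormN x : fnorm f (- x) = fnorm f x.
Proof. by rewrite /fnorm starN smulN sNmul opprK. Qed.

Lemma cauchy_schwarz x y : `|f (star x ** y)| <= fnorm f x * fnorm f y.
Proof.
have key (a b c : R) : 0 <= a -> 0 <= b ->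
    (forall s, 0 <= a + s * c *+ 2 + s ^+ 2 * b) -> c ^+ 2 <= a * b.
  move=> a0 b0 h; have [bz|bn] := eqVneq b 0.
    have [->|cn] := eqVneq c 0; first by rewrite expr0n /= mulr_ge0.
    have := h (- (a + 1) / (c *+ 2)); rewrite bz mulr0 addr0.
    have -> : - (a + 1) / (c *+ 2) * c *+ 2 = - (a + 1) by field.
    by rewrite opprD addrA subrr add0r oppr_ge0 ler10.
  have bp : 0 < b by rewrite lt_neqAle eq_sym bn.
  have := h (- c / b).
  have -> : a + - c / b * c *+ 2 + (- c / b) ^+ 2 * b = a - c ^+ 2 / b by field.
  by rewrite subr_ge0 ler_pdivrMr.
rewrite -(@ler_pXn2r _ 2) ?nnegrE ?mulr_ge0 ?fnorm_ge0//.
rewrite exprMn !fnorm_sqr real_normK ?num_real//.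
apply: key; [exact: rpos_ge0..|] => s.
have := rpos_ge0 fp (x + s%:C%C *: y).
rewrite starD starZ conjc_real smulDl !smulDr !smulZl !smulZr.
rewrite !(rposD fp, rposZ fp) (rposS fp y x) => h.
by apply: le_trans h _; rewrite le_eqVlt; apply/orP; left; apply/eqP; ring.
Qed.

Lemma fnormD x y : fnorm f (x + y) <= fnorm f x + fnorm f y.
Proof.
rewrite -(@ler_pXn2r _ 2) ?nnegrE ?addr_ge0 ?fnorm_ge0//.
rewrite sqrrD !fnorm_sqr starD smulDl !smulDr !(rposD fp) (rposS fp y x).
have := cauchy_schwarz x y => /(le_trans (ler_norm _)) h; lra.
Qed.

Lemma fnorm0 : fnorm f 0 = 0.
Proof. by have := fnormZ 0 0; rewrite scaler0 normr0 mul0r. Qed.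


End PositiveFunctionals.

Section TracesReal.
Variables (R : realType) (B : normedStarAlgType R) (t : B -> R[i]).
Hypothesis tt : tracial_state t.

Definition ret : B -> R := fun x => complex.Re (t x).

Lemma retC x y : ret (x ** y) = ret (y ** x).
Proof. by rewrite /ret; case: tt => _ _ -> _. Qed.

Lemma ret_rpos : rpos ret.
Proof.
have re0 z : complex.Im (t (star z ** z)) = 0.
  by case: tt => _ /(_ z) + _ _; rewrite lecE => /andP[/eqP ->].
split=> [x y|c x|x y|x]; rewrite /ret.
- by rewrite (traceD tt) raddfD.
- by rewrite (traceZ tt); case: (t x) => a b /=; rewrite mul0r subr0.
(* Polarisation: the imaginary part of t at star (x + iy) ** (x + iy) vanishes, and it is the
   difference of the two sides. *)
- have := re0 (x + 'i%C *: y); rewrite starD starZ smulDl !smulDr !smulZl !smulZr.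
  rewrite scalerA !(traceD tt) !(traceZ tt).
  have := re0 x; have := re0 y.
  move: (t (star x ** x)) (t (star y ** y)) (t (star x ** y)) (t (star y ** x)).
  by move=> [a1 a2] [b1 b2] [c1 c2] [d1 d2] /= -> ->; lra.
- exact: Re_trace_ge0.
Qed.

Lemma ret_le x : `|ret x| <= rnorm x.
Proof.
have h : rnorm (t x) <= rnorm x.
  apply/ler_addgt0Pr => e e0; pose M := rnorm x + e.
  have M0 : 0 < M by rewrite ltr_wpDl ?rnorm_ge0.
  have Mi : 0 <= M^-1 by rewrite invr_ge0 ltW.
  have rM : rnorm ((M^-1)%:C%C : R[i]) = M^-1.
    have : (rnorm ((M^-1)%:C%C : R[i]))%:C%C = (M^-1)%:C%C by rewrite rnormE ger0_norm// lecR.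
    by case.
  have := @trace_le1 _ _ _ tt ((M^-1)%:C%C *: x); rewrite (traceZ tt) rnormZ rM.
  have -> : rnorm ((M^-1)%:C%C * t x) = M^-1 * rnorm (t x) by rewrite (@rnormZ _ R[i]) rM.
  rewrite ler_pdivrMl// mulr1 ler_pdivrMl// mulr1; apply; rewrite /M lerDl ltW//.
exact: le_trans (Re_le_normC _) h.
Qed.

End TracesReal.

(** * Limit traces *)

Section LimitTraces.
Variables (R : realType) (w : freeUltrafilter) (A : cstarAlgType R).
Hypothesis hsigma : sigma_unital A.
Local Notation B := (A_omega_b w A).
Local Notation T := (@tracial_state R A).

Local Instance w_ultra : UltraFilter (ultra_sets w) := ultra_ultra w.

Lemma bclsD (a b : linf A) : bcls w (a + b) = bcls w a + bcls w b.
Proof. by rewrite /bcls /acls !qclsD. Qed.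
Lemma bclsN (a : linf A) : bcls w (- a) = - bcls w a.
Proof. by rewrite /bcls /acls !qclsN. Qed.
Lemma bclsB (a b : linf A) : bcls w (a - b) = bcls w a - bcls w b.
Proof. by rewrite bclsD bclsN. Qed.
Lemma bclsM (a b : linf A) : bcls w (a ** b) = bcls w a ** bcls w b.
Proof. by rewrite /bcls /acls !qclsM. Qed.
Lemma bclsS (a : linf A) : bcls w (star a) = star (bcls w a).
Proof. by rewrite /bcls /acls !qclsS. Qed.
Lemma bclsZ c (a : linf A) : bcls w (c *: a) = c *: bcls w a.
Proof. by rewrite /bcls /acls !qclsZ. Qed.
Lemma bcls0 : bcls w (0 : linf A) = 0.
Proof. by rewrite /bcls /acls !qcls0. Qed.

Lemma rnorm_bcls (a : linf A) : rnorm (bcls w a) <= rnorm a.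
Proof. exact: le_trans (rnorm_qcls _ _) (rnorm_qcls _ _). Qed.

Lemma bcls_lift_lt (x : B) (e : R) : 0 < e ->
  exists2 a : linf A, bcls w a = x & rnorm a < rnorm x + e.
Proof.
move=> e0; have e2 : 0 < e / 2 by rewrite divr_gt0.
have [y <- hy] := rnorm_quot_lt x e2.
move: hy; have [a <- ha] := rnorm_quot_lt y e2; move=> hy.
exists a => //; apply: lt_trans ha _; rewrite [X in _ < _ + X]splitr addrA ltrD2r; exact: hy.
Qed.

Lemma ultra_ge N : ultra_sets w [set n | (N <= n)%N].
Proof.
elim: N => [|N ih]; first by apply: filterS filterT => n.
have h : ultra_sets w (~` [set N]).
  have [|//] := in_ultra_setVsetC [set N] (ultra_ultra w).
  by move=> /ultra_free.
apply: filterS (filterI ih h) => n /= [Nn nN].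
by rewrite ltn_neqAle Nn andbT; apply/eqP => e; exact: nN.
Qed.

(** Kirchberg's epsilon-test. Coordinate n solves the highest level up to n that is solvable there;
    as the ultrafilter is free, almost every n exceeds a given level. *)
Lemma eps_test (X : Type) (x0 : X) (P : nat -> nat -> X -> Prop) :
  (forall l n x, P l.+1 n x -> P l n x) ->
  (forall l, ultra_sets w [set n | exists x, P l n x]) ->
  exists x : nat -> X, forall l, ultra_sets w [set n | P l n (x n)].
Proof.
move=> Pmon hP.
have mon l m n x : (l <= m)%N -> P m n x -> P l n x.
  by move=> /subnKC <-; elim: (m - l)%N => [|d ih]; rewrite ?addn0 ?addnS// => /Pmon.
have [x hx] : {x : nat -> X & forall n l, (l <= n)%N -> (exists y, P l n y) -> P l n (x n)}.
  apply: (@choice _ _ (fun n x => forall l, (l <= n)%N -> (exists y, P l n y) -> P l n x)) => n.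
  suff h N : exists x, forall l, (l <= N)%N -> (exists y, P l n y) -> P l n x by exact: h.
  elim: N => [|N [x hx]].
    have [[y hy]|no] := pselect (exists y, P 0%N n y).
      by exists y => l; rewrite leqn0 => /eqP ->.
    by exists x0 => l; rewrite leqn0 => /eqP -> /no.
  have [[y hy]|no] := pselect (exists y, P N.+1 n y).
    by exists y => l lN _; exact: mon lN hy.
  by exists x => l; rewrite leq_eqVlt => /orP[/eqP -> /no //|]; exact: hx.
exists x => l; apply: filterS (filterI (ultra_ge l) (hP l)) => n [ln].
exact: hx.
Qed.

(** Cauchy-Schwarz against the approximate unit, in place of a unit of A. It makes ultralimits of
    traces vanish on the trace ideal. *)
Lemma tracial_le_fnorm t (x : A) : T t -> `|ret t x| <= fnorm (ret t) x.
Proof.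
move=> Tt; have fp := ret_rpos Tt.
have [e [he _ hl _]] := hsigma.
apply/ler_addgt0Pr => d d0.
have [n _ /(_ n (leqnn n)) /=] : \forall n \near \oo, rnorm (x - e n ** x) < d.
  have /cvgrPdist_lt/(_ d%:C%C) := hl x; rewrite ltcR => /(_ d0).
  by apply: filterS => n; rewrite -rnormE ltcR.
move=> hn; have [[y ey] en1] := he n.
have es : star (e n) = e n by rewrite ey starM starK.
have -> : x = star (e n) ** x + (x - e n ** x) by rewrite es addrC subrK.
rewrite (rposD fp) (le_trans (ler_normD _ _))// es [_ ** x + _]addrC subrK lerD//.
  rewrite -{1}es (le_trans (cauchy_schwarz fp _ _))// ler_piMl ?fnorm_ge0//.
  by apply: le_trans (norm2_le Tt _) _; rewrite -lecR rnormE.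
exact: le_trans (ret_le Tt _) (ltW hn).
Qed.

Definition TF : set (B -> R) := [set f | exists tn : nat -> A -> R[i],
  (forall n, T (tn n)) /\
  forall a : linf A, ucv w (fun n => ret (tn n) (a n)) (f (bcls w a))].

(** The ultralimits exist by boundedness, and they depend only on the class of [a] because |t x| is
    at most the 2-norm of x. Imaginary parts are real parts at -i x. *)
Lemma limit_trace_ex (tn : nat -> A -> R[i]) : (forall n, T (tn n)) ->
  exists t : B -> R[i], forall a : linf A, ulim w (fun n => tn n (a n)) (t (bcls w a)).
Proof.
move=> Ttn.
have bd (a : linf A) : exists z : R[i], ulim w (fun n => tn n (a n)) z.
  have hI n : complex.Im (tn n (a n)) = ret (tn n) ((- 'i%C) *: a n).
    rewrite /ret (traceZ (Ttn n)); case: (tn n (a n)) => u v /=.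
    by rewrite oppr0 mul0r sub0r mulN1r opprK.
  have [|l1 h1] := @ucv_ex R _ (ultra_sets w) _ (fun n => complex.Re (tn n (a n))) (rnorm a).
    by move=> n; apply: le_trans (ret_le (Ttn n) _) (linf_nth_le _ _).
  have [|l2 h2] := @ucv_ex R _ (ultra_sets w) _ (fun n => complex.Im (tn n (a n)))
      (rnorm ((- 'i%C : R[i]) *: a)).
    move=> n; rewrite hI; apply: le_trans (ret_le (Ttn n) _) _.
    exact: (linf_nth_le ((- 'i%C : R[i]) *: a) n).
  by exists (l1 +i* l2)%C; apply/ulimCP.
have [L hL] := choice bd.
exists (fun x => L (qrep (qrep x))) => a.
set b := qrep _.
have /bcls_eq ba : bcls w b = bcls w a by rewrite /b /bcls /acls !qrepK.
have small (c : R[i]) e : 0 < e ->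
    ultra_sets w [set n | `|ret (tn n) (c *: (b n - a n))| < e].
  move=> e0; have [K K0 hK] := norm2XZ A c.
  have K1 : 0 < K + 1 by rewrite ltr_wpDl.
  have n0 n : 0 <= norm2X T ((b - a) n) by exact: norm2X_ge0.
  have /(ulim0P _ n0)/(_ (e / (K + 1))) := ba; rewrite divr_gt0// => /(_ isT).
  apply: filterS => n /=; rewrite ltr_pdivlMr// => h; apply: le_lt_trans h.
  apply: le_trans (tracial_le_fnorm _ (Ttn n)) _.
  apply: le_trans (norm2X_ge _ (Ttn n)) _.
  by apply: le_trans (hK _) _; rewrite mulrC ler_wpM2l ?norm2X_ge0// lerDl.
have /ulimCP[h1 h2] := hL b; apply/ulimCP; split.
  apply: ucv_near h1 => e e0; apply: filterS (small 1 e e0) => n /=.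
  rewrite scale1r (rposB (ret_rpos (Ttn n))).
  by rewrite /ret.
apply: ucv_near h2 => e e0; apply: filterS (small (- 'i%C) e e0) => n /=.
rewrite /ret (traceZ (Ttn n)) (traceD (Ttn n)) (traceN (Ttn n)).
case: (tn n (b n)) => u v; case: (tn n (a n)) => u' v' /=.
by rewrite oppr0 mul0r sub0r mulN1r opprK.
Qed.

Lemma TF_limit t : limit_traces t -> TF (ret t).
Proof.
by move=> [tn [Ttn h]]; exists tn; split=> // a; have /ulimCP[] := h a.
Qed.

Lemma TF_ex (tn : nat -> A -> R[i]) : (forall n, T (tn n)) ->
  exists2 f, TF f & forall a : linf A, ucv w (fun n => ret (tn n) (a n)) (f (bcls w a)).
Proof.
move=> Ttn; have [t ht] := limit_trace_ex Ttn.
exists (ret t); first by apply: TF_limit; exists tn.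
by move=> a; have /ulimCP[] := ht a.
Qed.

Lemma limit_TF f : TF f -> exists2 t, limit_traces t & f = ret t.
Proof.
move=> [tn [Ttn h]]; have [t ht] := limit_trace_ex Ttn.
exists t; first by exists tn.
apply/funext => x; have [a ->] := bclsP x.
by have /ulimCP[h1 _] := ht a; apply: ucv_unique (h a) h1.
Qed.

Section OneTrace.
Variables (f : B -> R) (Tf : TF f).

Lemma TF_rpos : rpos f.
Proof.
have [tn [Ttn h]] := Tf; have fp n := ret_rpos (Ttn n).
split=> [x y|c x|x y|x].
- have [a ->] := bclsP x; have [b ->] := bclsP y; rewrite -bclsD.
  apply: ucv_unique (h _) _; apply: ucv_eq (ucvD (h a) (h b)) => n.
  by rewrite linfDE (rposD (fp n)).
- have [a ->] := bclsP x; rewrite -bclsZ.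
  apply: ucv_unique (h _) _; apply: ucv_eq (ucvZ c (h a)) => n.
  by rewrite linfZE (rposZ (fp n)).
- have [a ->] := bclsP x; have [b ->] := bclsP y; rewrite -!bclsS -!bclsM.
  apply: ucv_unique (h _) _; apply: ucv_eq (h _) => n.
  by rewrite !linfME (rposS (fp n)).
- have [a ->] := bclsP x; rewrite -!bclsS -!bclsM.
  apply: ucv_le (ucv_cst 0) (h _) _; apply: filterS filterT => n _ /=.
  exact: rpos_ge0 (fp n) _.
Qed.

Lemma TF_C x y : f (x ** y) = f (y ** x).
Proof.
have [tn [Ttn h]] := Tf; have [a ->] := bclsP x; have [b ->] := bclsP y.
rewrite -!bclsM; apply: ucv_unique (h _) _; apply: ucv_eq (h _) => n.
by rewrite !linfME (retC (Ttn n)).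
Qed.

Lemma TF_le x : `|f x| <= rnorm x.
Proof.
have [tn [Ttn h]] := Tf; apply/ler_addgt0Pr => e e0.
have [a <- ha] := bcls_lift_lt x e0; apply: le_trans (ltW ha).
have bd n : `|ret (tn n) (a n)| <= rnorm a.
  exact: le_trans (ret_le (Ttn n) _) (linf_nth_le _ _).
rewrite ler_norml; apply/andP; split.
  apply: ucv_le (ucv_cst _) (h a) _; apply: filterS filterT => n _ /=.
  by have := bd n; rewrite ler_norml => /andP[].
apply: ucv_le (h a) (ucv_cst _) _; apply: filterS filterT => n _ /=.
by have := bd n; rewrite ler_norml => /andP[].
Qed.

(** Applying [norm2_mul] to a large multiple N a and dividing by N removes the additive 1 of that
    bound. *)
Lemma tracial_mul_le t (a b : A) : T t -> fnorm (ret t) (a ** b) <= rnorm a * fnorm (ret t) b.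
Proof.
move=> Tt; apply/ler_addgt0Pr => e e0; have fp := ret_rpos Tt.
have b0 := fnorm_ge0 (ret t) b.
pose N := (fnorm (ret t) b + 1) / e.
have N0 : 0 < N by rewrite divr_gt0// ltr_wpDl.
have := norm2_mul (N%:C%C *: a) b Tt; rewrite smulZl.
rewrite -![norm2 t _]/(fnorm (ret t) _) (fnormZ fp).
rewrite gtr0_norm// rnormZ.
have -> : rnorm (N%:C%C : R[i]) = N.
  have : (rnorm (N%:C%C : R[i]))%:C%C = N%:C%C by rewrite rnormE ger0_norm// lecR ltW.
  by case.
move=> h; rewrite -(ler_pM2l N0) (le_trans h)// mulrDl mul1r mulrDr mulrA lerD2l.
by rewrite /N divfK ?gt_eqF// lerDl.
Qed.

Lemma TF_mul_le (x y : B) : fnorm f (x ** y) <= rnorm x * fnorm f y.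
Proof.
have [tn [Ttn h]] := Tf; have fp := TF_rpos.
suff H e : 0 < e -> f (star (x ** y) ** (x ** y)) <= (rnorm x + e) ^+ 2 * f (star y ** y).
  apply/ler_addgt0Pr => d d0; have y1 : 0 < fnorm f y + 1 by rewrite ltr_wpDl ?fnorm_ge0.
  have := H (d / (fnorm f y + 1)); rewrite divr_gt0// => /(_ isT).
  rewrite -!(fnorm_sqr fp) -exprMn ler_pXn2r ?nnegrE ?mulr_ge0 ?addr_ge0 ?rnorm_ge0 ?fnorm_ge0//;
    last by rewrite divr_ge0 ?ltW.
  move=> /le_trans; apply; rewrite mulrDl lerD2l mulrAC ler_pdivrMr// ler_wpM2l ?lerDl// ltW//.
move=> e0; have [a <- ha] := bcls_lift_lt x e0; have [b ->] := bclsP y.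
have -> : star (bcls w a ** bcls w b) ** (bcls w a ** bcls w b) =
    bcls w (star (a ** b) ** (a ** b)) by rewrite bclsM bclsS bclsM.
have -> : star (bcls w b) ** bcls w b = bcls w (star b ** b) by rewrite bclsM bclsS.
apply: ucv_le (h _) (ucvZ _ (h _)) _; apply: filterS filterT => n _ /=.
rewrite -!(fnorm_sqr (ret_rpos (Ttn n))) -exprMn.
have r0 : 0 <= rnorm (bcls w a) + e by rewrite addr_ge0 ?rnorm_ge0 ?ltW.
rewrite ler_pXn2r ?nnegrE ?mulr_ge0 ?fnorm_ge0//.
apply: le_trans (tracial_mul_le _ _ (Ttn n)) _; rewrite ler_wpM2r ?fnorm_ge0//.
exact: le_trans (linf_nth_le _ _) (ltW ha).
Qed.

End OneTrace.

(** Passes from sequences to uniformity: in every coordinate with a counterexample one is selected,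
    and the hypothesis for the selected sequences shows that almost no coordinate has any. *)
Lemma pick_bad (t0 : A -> R[i]) (Q : nat -> (A -> R[i]) -> A -> Prop) : T t0 ->
  (forall (tn : nat -> A -> R[i]) (z : nat -> A), (forall n, T (tn n)) ->
     (forall n, rnorm (z n) <= 1) -> ultra_sets w [set n | Q n (tn n) (z n)]) ->
  ultra_sets w [set n | forall t z, T t -> rnorm z <= 1 -> Q n t z].
Proof.
move=> Tt0 h.
have [F hF] : {F : nat -> (A -> R[i]) * A & forall n, [/\ T (F n).1, rnorm (F n).2 <= 1 &
    Q n (F n).1 (F n).2 -> forall t z, T t -> rnorm z <= 1 -> Q n t z]}.
  apply: (@choice _ _ (fun n F => [/\ T F.1, rnorm F.2 <= 1 &
    Q n F.1 F.2 -> forall t z, T t -> rnorm z <= 1 -> Q n t z])) => n.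
  have [[[t z] [Tt z1 nQ]]|no] := pselect (exists F : (A -> R[i]) * A,
      [/\ T F.1, rnorm F.2 <= 1 & ~ Q n F.1 F.2]).
    by exists (t, z); split.
  exists (t0, 0); split=> //=; first by rewrite rnorm0.
  by move=> _ t z Tt z1; apply: contrapT => nQ; apply: no; exists (t, z).
have := h (fun n => (F n).1) (fun n => (F n).2).
move=> H; apply: filterS (H _ _) => [n /=|n|n]; by have [] := hF n.
Qed.

Lemma transfer_lt (t0 : A -> R[i]) (a : linf A) (c : R) : T t0 ->
  (forall f, TF f -> f (bcls w a) < c) ->
  ultra_sets w [set n | forall t, T t -> ret t (a n) < c].
Proof.
move=> Tt0 h; have := @pick_bad t0 (fun n t _ => ret t (a n) < c) Tt0.
move=> H; apply: filterS (H _) => [n /= hn t Tt|tn z Ttn _].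
  by apply: (hn t 0) => //; rewrite rnorm0.
have [f Tf hf] := TF_ex Ttn; have := h f Tf; rewrite -subr_gt0 => d0.
apply: filterS (hf a _ d0) => n /=; rewrite ltr_norml => /andP[_]; lra.
Qed.

Lemma trace_null_small (a : linf A) :
  (forall e : R, 0 < e -> ultra_sets w [set n | forall t, T t -> ret t (star (a n) ** a n) < e]) ->
  bcls w a = 0.
Proof.
move=> h; rewrite -bcls0; apply/bcls_eq; rewrite subr0.
apply/ulim0P => [n|e e0]; first exact: norm2X_ge0.
have e2 : 0 < e / 2 by rewrite divr_gt0.
apply: filterS (h ((e / 2) ^+ 2) _) => [n /= hn|]; last by rewrite exprn_gt0.
apply: (@le_lt_trans _ _ (e / 2)); last by rewrite ltr_pdivrMr// mulr_natr mulr2n ltrDl.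
apply: norm2X_le => [|t Tt]; first exact: ltW.
rewrite -(@ler_pXn2r _ 2) ?nnegrE ?norm2_ge0 ?ltW// (norm2_sqr Tt).
exact: hn.
Qed.

Lemma TF_separating (t0 : A -> R[i]) (x : B) : T t0 ->
  (forall f, TF f -> f (star x ** x) <= 0) -> x = 0.
Proof.
move=> Tt0; have [a ->] := bclsP x => h; apply: trace_null_small => e e0.
apply: (@transfer_lt t0 (star a ** a)) => // f Tf.
by rewrite bclsM bclsS; apply: le_lt_trans (h f Tf) e0.
Qed.

(** Classes of contractive sequences are closed in the uniform 2-norm, by a diagonal choice with
    [eps_test]. *)
Lemma lift_unit_ball_approx (t0 : A -> R[i]) (x : B) : T t0 ->
  (forall e : R, 0 < e -> exists2 a : linf A, (forall n, rnorm (a n) <= 1) &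
     forall f, TF f -> fnorm f (x - bcls w a) <= e) ->
  exists2 a : linf A, bcls w a = x & forall n, rnorm (a n) <= 1.
Proof.
move=> Tt0 h; have [b xb] := bclsP x.
pose P (l n : nat) (a : A) := rnorm a <= 1 /\
  forall t, T t -> ret t (star (b n - a) ** (b n - a)) < l.+1%:R^-1.
have [||c hc] := @eps_test A 0 P.
- move=> l n a [a1 ha]; split=> // t Tt; apply: lt_le_trans (ha t Tt) _.
  by rewrite lef_pV2 ?posrE ?ltr0n// ler_nat.
- move=> l; have d0 : 0 < (l.+1%:R : R)^-1 / 2 by rewrite divr_gt0 ?invr_gt0 ?ltr0n.
  pose e := Num.min 1 ((l.+1%:R : R)^-1 / 2).
  have e0 : 0 < e by rewrite lt_min ltr01.
  have [a a1 ha] := h e e0.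
  have := @transfer_lt t0 (star (b - a) ** (b - a)) l.+1%:R^-1 Tt0.
  move=> H; apply: filterS (H _) => [n /= hn|f Tf]; first by
    exists (a n); split=> [|t Tt]; [exact: a1|exact: hn].
  rewrite bclsM bclsS bclsB -xb -(fnorm_sqr (TF_rpos Tf)).
  apply: (@le_lt_trans _ _ (1 * e)).
    rewrite expr2 ler_pM ?fnorm_ge0//; last exact: ha.
    by apply: le_trans (ha f Tf) _; rewrite ge_min lexx.
  rewrite mul1r; apply: (@le_lt_trans _ _ ((l.+1%:R : R)^-1 / 2)).
    by rewrite ge_min lexx orbT.
  by rewrite ltr_pdivrMr// mulr_natr mulr2n ltrDl invr_gt0 ltr0n.
(* The default 0 is taken only outside a set of the ultrafilter, so the class is unaffected. *)
pose c' n := if `[< rnorm (c n) <= 1 >] then c n else 0.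
have c1 n : rnorm (c' n) <= 1.
  by rewrite /c'; case: asboolP => //; rewrite rnorm0.
have bc : bounded_seq c' by exists 1.
exists (mk_linf bc) => //; rewrite xb; apply/eqP; rewrite -subr_eq0 -oppr_eq0 opprB; apply/eqP.
rewrite -bclsB; apply: trace_null_small => e e0.
have [l hl] : exists l, (l.+1%:R : R)^-1 < e.
  exists (Num.truncn e^-1); rewrite invf_plt ?posrE ?ltr0n//.
  by rewrite truncnS_gt.
apply: filterS (hc l) => n [cn1 hn] t Tt; apply: lt_trans hl.
have -> : (b - mk_linf bc) n = b n - c n.
  by rewrite linfDE linfNE /= /c' asboolT.
exact: hn.
Qed.

(** The quotient norm gives lifts of norm up to 1 + e only; scaling them back costs at most e in the
    2-norms, and the unit ball of sequences is closed for these. *)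
Lemma lift_unit_ball (t0 : A -> R[i]) (x : B) : T t0 -> rnorm x <= 1 ->
  exists2 a : linf A, bcls w a = x & forall n, rnorm (a n) <= 1.
Proof.
move=> Tt0 x1; apply: (lift_unit_ball_approx Tt0) => e e0.
have [a ax ha] := bcls_lift_lt x e0.
pose s := (1 + e)^-1; have s0 : 0 < 1 + e by rewrite addr_gt0.
have sp : 0 < s by rewrite invr_gt0.
exists (s%:C%C *: a) => [n|f Tf].
  rewrite linfZE rnormZ.
  have -> : rnorm (s%:C%C : R[i]) = s.
    have : (rnorm (s%:C%C : R[i]))%:C%C = s%:C%C by rewrite rnormE ger0_norm// lecR ltW.
    by case.
  rewrite /s ler_pdivrMl// mulr1; apply: le_trans (linf_nth_le _ _) _.
  by apply: le_trans (ltW ha) _; rewrite lerD2r.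
have fp := TF_rpos Tf; rewrite bclsZ ax.
have -> : x - s%:C%C *: x = (1 - s)%:C%C *: x by rewrite rmorphB rmorph1 scalerBl scale1r.
rewrite (fnormZ fp) ger0_norm; last by rewrite subr_ge0 invf_le1// lerDl ltW.
have x2 : fnorm f x <= 1.
  have := TF_le Tf (star x ** x); rewrite ger0_norm ?(rpos_ge0 fp)// => h.
  rewrite -[leRHS]sqrtr1 ler_wsqrtr// (le_trans h)// (le_trans (rnorm_smul _ _))//.
  by rewrite rnorm_star -[leRHS]mulr1 ler_pM ?rnorm_ge0.
apply: (@le_trans _ _ ((1 - s) * 1)).
  by rewrite ler_wpM2l// subr_ge0 invf_le1// lerDl ltW.
have -> : (1 - s) * 1 = e / (1 + e) by rewrite /s; field; rewrite gt_eqF.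
by rewrite ler_pdivrMr// ler_peMr// ?lerDl; exact: ltW.
Qed.

End LimitTraces.

(** * A resolvent in a C*-algebra *)

Lemma rnorm_ofR (R : realType) (c : R) : rnorm (c%:C%C : R[i]) = `|c|.
Proof.
have : (rnorm (c%:C%C : R[i]))%:C%C = `|c|%:C%C.
  by rewrite rnormE normc_def /= expr0n addr0 sqrtr_sqr.
by case.
Qed.

Lemma rnormZr (R : realType) (B : normedModType R[i]) (c : R) (x : B) :
  rnorm (c%:C%C *: x) = `|c| * rnorm x.
Proof. by rewrite rnormZ rnorm_ofR. Qed.

Lemma rnorm_i (R : realType) : rnorm ('i%C : R[i]) = 1.
Proof.
have : (rnorm ('i%C : R[i]))%:C%C = 1%:C%C.
  by rewrite rnormE normc_def /= expr0n add0r expr1n sqrtr1.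
by case.
Qed.

Lemma rnorm_nat (R : realType) n : rnorm (n%:R : R[i]) = n%:R.
Proof.
have : (rnorm (n%:R : R[i]))%:C%C = n%:R%:C%C by rewrite rnormE normr_nat rmorph_nat.
by case.
Qed.

Section RealScalars.
Variables (R : realType) (B : normedStarAlgType R).
Implicit Types (a b : R) (x : B).
Lemma rZD a b x : (a + b)%:C%C *: x = a%:C%C *: x + b%:C%C *: x.
Proof. by rewrite rmorphD scalerDl. Qed.
Lemma rZB a b x : (a - b)%:C%C *: x = a%:C%C *: x - b%:C%C *: x.
Proof. by rewrite rmorphB scalerBl. Qed.
Lemma rZ1 x : 1%:C%C *: x = x.
Proof. by rewrite rmorph1 scale1r. Qed.
Lemma rZ0 x : 0%:C%C *: x = 0.
Proof. by rewrite rmorph0 scale0r. Qed.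
Lemma rZM a b x : a%:C%C *: (b%:C%C *: x) = (a * b)%:C%C *: x.
Proof. by rewrite scalerA -rmorphM. Qed.
Lemma rZn n x : n%:R%:C%C *: x = x *+ n.
Proof. by rewrite rmorph_nat scaler_nat. Qed.
End RealScalars.

Section CStarResolvent.
Variables (R : realType) (A : cstarAlgType R).
Implicit Types x y v e h : A.

Lemma rnormB_C x y : rnorm (x - y) = rnorm (y - x).
Proof. by rewrite -rnormN opprB. Qed.

Lemma lipschitz_fixed_point (F : A -> A) (q : R) : 0 <= q -> q < 1 ->
  (forall x y, rnorm (F x - F y) <= q * rnorm (x - y)) -> exists e, F e = e.
Proof.
move=> q0 q1 hF; have q1' : 0 < 1 - q by rewrite subr_gt0.
pose y n := iter n F 0; pose C := rnorm (F 0).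
have C0 : 0 <= C := rnorm_ge0 _.
have step n : rnorm (y n.+1 - y n) <= C * q ^+ n.
  elim: n => [|n ih]; first by rewrite /y /= subr0 expr0 mulr1.
  by apply: le_trans (hF _ _) _; rewrite exprS mulrCA ler_wpM2l.
have dist n m : rnorm (y (n + m)%N - y n) * (1 - q) <= C * q ^+ n.
  suff h : rnorm (y (n + m)%N - y n) * (1 - q) <= C * q ^+ n - C * q ^+ (n + m).
    by rewrite (le_trans h)// gerBl mulr_ge0 ?exprn_ge0.
  elim: m => [|m ih]; first by rewrite addn0 !subrr rnorm0 mul0r.
  rewrite addnS -[X in rnorm X](subrKA (y (n + m)%N)).
  apply: le_trans (ler_wpM2r (ltW q1') (rnormD _ _)) _; rewrite mulrDl.
  have := ler_wpM2r (ltW q1') (step (n + m)%N); rewrite exprSr.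
  move: ih; move: (rnorm _) (rnorm _) (q ^+ n) (q ^+ (n + m)) => a b c d; nra.
have [e0|Cn] := eqVneq C 0.
  by exists 0; apply: rnorm0_eq0.
have Cp : 0 < C by rewrite lt_neqAle eq_sym Cn.
have small d : 0 < d -> exists N, forall n, (N <= n)%N -> rnorm (y n - y N) < d.
  move=> d0.
  have : (fun n => q ^+ n) @ \oo --> (0 : R) by apply: cvg_expr; rewrite ger0_norm.
  move/cvgr0Pnorm_lt => /(_ (d * (1 - q) / C)); rewrite divr_gt0 ?mulr_gt0// => /(_ isT).
  move=> [N _ /(_ N (leqnn N)) /=]; rewrite ger0_norm ?exprn_ge0// ltr_pdivlMr// => hN.
  exists N => n Nn; rewrite -(ltr_pM2r q1') -(subnKC Nn).
  by apply: le_lt_trans (dist _ _) _; rewrite mulrC.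
have /cvg_ex[e he] : cvg (y @ \oo).
  apply/cauchy_cvgP/cauchy_exP => d d0.
  have d0' : 0 < complex.Re d by move: d0; rewrite ltcE /= => /andP[].
  have [N hN] := small _ d0'; exists (y N); exists N => // n /= Nn.
  rewrite -ball_normE /ball_ /= distrC -rnormE.
  by move: d0 (hN n Nn); rewrite !ltcE /= => /andP[/eqP-> _] ->; rewrite eqxx.
exists e; apply/eqP; rewrite -subr_eq0; apply/eqP/rnorm0_eq0/le_anti.
rewrite rnorm_ge0 andbT; apply/ler_addgt0Pr => d d0; rewrite add0r.
have d2 : 0 < d / 2 by rewrite divr_gt0.
move/cvgrPdist_lt : he => /(_ (d / 2)%:C%C); rewrite ltcR => /(_ d2) [N _ hN].
have h1 : rnorm (e - y N) < d / 2 by have := hN N (leqnn N); rewrite /= -rnormE ltcR.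
have h2 : rnorm (e - y N.+1) < d / 2 by have := hN N.+1 (leqnSn N); rewrite /= -rnormE ltcR.
rewrite -(subrKA (y N.+1)); apply: le_trans (rnormD _ _) _.
rewrite [d]splitr lerD//; last by rewrite rnormB_C ltW.
apply: le_trans (hF _ _) _; apply: le_trans (ltW h1); rewrite ler_piMl ?rnorm_ge0// ltW//.
Qed.

Lemma rnorm_op_le x (M : R) : 0 <= M ->
  (forall v, rnorm (x ** v) <= M * rnorm v) -> rnorm x <= M.
Proof.
move=> M0 h; have := h (star x); rewrite -{1}(starK x) rnorm_sqr rnorm_star expr2.
have [->//|x0] := eqVneq (rnorm x) 0.
by rewrite ler_pM2r// lt_neqAle eq_sym x0 rnorm_ge0.
Qed.

(** With c = 1 - sqrt(1 - x^2), multiplication by x + i(1 - c) and by x - i(1 - c) is isometric.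
    Half their difference gives that 1 - c is contractive, and 1 - x^2 is its square. *)
Lemma rnorm_sub_sqr x v : star x = x -> rnorm x < 1 -> rnorm (v - x ** (x ** v)) <= rnorm v.
Proof.
move=> xs x1; pose k := x ** x.
have ks : star k = k by rewrite starM xs.
have k1 : rnorm k < 1.
  by rewrite /k -{1}xs rnorm_sqr -(expr1n _ 2%N) ltrXn2r ?rnorm_ge0.
have [c [cs ck cc]] := cstar_sqrt ks k1.
have xc : x ** c = c ** x by apply: cc; rewrite /k smulA.
have ii : ('i : R[i])%C * 'i%C = -1 by exact: sqr_i.
have ci : conjc ('i%C : R[i]) = - 'i%C by apply/eqP; rewrite eq_complex /= oppr0 !eqxx.
have D1 u : rnorm (u - c ** u) <= rnorm u.
  have e1 := @unitary_mult R A x c u 'i%C xs cs xc ck ci ii.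
  have e2 : rnorm (x ** u + (- 'i%C) *: (u - c ** u)) = rnorm u.
    apply: unitary_mult => //; last by rewrite mulrNN.
    by apply/eqP; rewrite eq_complex /= !oppr0 !eqxx.
  have : rnorm (('i%C : R[i]) *: (u - c ** u) *+ 2) <= rnorm u + rnorm u.
    rewrite -{1}e1 -e2 -[X in _ <= _ + X]rnormN (le_trans _ (rnormD _ _))//.
    by rewrite scaleNr opprD opprK addrACA subrr add0r mulr2n.
  have -> : ('i%C : R[i]) *: (u - c ** u) *+ 2 = (2%:R : R[i]) *: ('i%C *: (u - c ** u)).
    by rewrite scaler_nat.
  rewrite !rnormZ.
  rewrite rnorm_i rnorm_nat.
  lra.
have -> : v - x ** (x ** v) = (v - c ** v) - c ** (v - c ** v).
  rewrite smulA -/k -ck smulDl sNmul smulDl smulDr smulN -smulA.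
  by rewrite !opprD !opprK !addrA.
exact: le_trans (D1 _) (D1 _).
Qed.

(** The squared norm of (1 + ih)w, like that of (1 - ih)w, is the norm of w*(1 + h^2)w, hence at
    most |w| |w + h^2 w|; w and ihw are half the sum and half the difference of these two
    elements. *)
Lemma cayley h w : star h = h ->
  rnorm w <= rnorm (w + h ** (h ** w)) /\ rnorm (h ** w) <= rnorm (w + h ** (h ** w)).
Proof.
move=> hs; set v := w + h ** (h ** w).
have ii : ('i : R[i])%C * 'i%C = -1 by exact: sqr_i.
have ci : conjc ('i%C : R[i]) = - 'i%C by apply/eqP; rewrite eq_complex /= oppr0 !eqxx.
have ni := rnorm_i R; have n2 := rnorm_nat R 2.
have key (j : R[i]) : conjc j = - j -> j * j = -1 ->
    rnorm (w + j *: (h ** w)) ^+ 2 <= rnorm w * rnorm v.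
  move=> cj jj; rewrite -rnorm_sqr -(rnorm_star w) (le_trans _ (rnorm_smul _ _))//.
  rewrite le_eqVlt; apply/orP; left; apply/eqP; congr rnorm.
  rewrite starD starZ starM hs cj !smulDl !smulDr !smulZl !smulZr scalerA.
  have -> : - j * j = 1 by rewrite mulNr jj opprK.
  by rewrite scale1r scaleNr -!smulA addrA addrK.
have h1 := key 'i%C ci ii.
have h2 : rnorm (w - 'i%C *: (h ** w)) ^+ 2 <= rnorm w * rnorm v.
  rewrite -scaleNr; apply: key; last by rewrite mulrNN.
  by apply/eqP; rewrite eq_complex /= !oppr0 !eqxx.
have s1 : rnorm w *+ 2 <= rnorm (w + 'i%C *: (h ** w)) + rnorm (w - 'i%C *: (h ** w)).
  apply: le_trans (rnormD _ _); rewrite addrACA subrr addr0.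
  have -> : w + w = (2%:R : R[i]) *: w by rewrite scaler_nat mulr2n.
  by rewrite rnormZ n2 mulr_natl.
have s2 : rnorm (h ** w) *+ 2 <= rnorm (w + 'i%C *: (h ** w)) + rnorm (w - 'i%C *: (h ** w)).
  rewrite -[X in _ <= _ + X]rnormN; apply: le_trans (rnormD _ _).
  rewrite opprB.
  have -> : w + 'i%C *: (h ** w) + ('i%C *: (h ** w) - w) = (2%:R : R[i]) *: ('i%C *: (h ** w)).
    by rewrite scaler_nat; nc.
  by rewrite !rnormZ n2 ni mul1r mulr_natl.
have p0 := rnorm_ge0 (w + 'i%C *: (h ** w)); have q0 := rnorm_ge0 (w - 'i%C *: (h ** w)).
have a0 := rnorm_ge0 w; have b0 := rnorm_ge0 v; have c0 := rnorm_ge0 (h ** w).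
move: s1 s2 h1 h2 p0 q0 a0 b0 c0.
move: (rnorm (w + _)) (rnorm (w - _)) (rnorm w) (rnorm v) (rnorm (h ** w)) => p q a b c.
move=> s1 s2 h1 h2 p0 q0 a0 b0 c0.
have sq (x y : R) : 0 <= x -> 0 <= y -> x ^+ 2 <= y ^+ 2 -> x <= y.
  by move=> x0 y0; rewrite ler_pXn2r.
have ab : a <= b.
  apply: sq => //; have [->|an] := eqVneq a 0; first by rewrite expr0n /= exprn_ge0.
  have ap : 0 < a by rewrite lt_neqAle eq_sym an.
  have : a ^+ 2 <= a * b.
    have : (a *+ 2) ^+ 2 <= (p + q) ^+ 2 by rewrite ler_pXn2r ?nnegrE ?mulrn_wge0 ?addr_ge0.
    nra.
  move=> aab; have ab : a <= b by rewrite -(ler_pM2l ap) -expr2.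
  by rewrite ler_pXn2r.
split=> //; apply: sq => //.
have : (c *+ 2) ^+ 2 <= (p + q) ^+ 2 by rewrite ler_pXn2r ?nnegrE ?mulrn_wge0 ?addr_ge0.
have abb : a * b <= b ^+ 2 by rewrite expr2 ler_wpM2r.
have := sqr_ge0 (p - q); nra.
Qed.

(** Here e = h^2 (1 + h^2)^-1. It is the fixed point of v |-> (k + m v - v k)/(1 + m) with k = h^2
    and m > |k|, a map of Lipschitz constant m/(1 + m) because v |-> v - v k/m is contractive. *)
Lemma resolvent_ex h : star h = h -> exists e : A,
  [/\ star e = e, e + e ** (h ** h) = h ** h,
      forall y, y ** h = h ** y -> y ** e = e ** y,
      forall v, rnorm (v - e ** v) <= rnorm v &
      forall v, rnorm (h ** (v - e ** v)) <= rnorm v].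
Proof.
move=> hs; pose k := h ** h; have ks : star k = k by rewrite starM hs.
pose M := rnorm h + 1; have M0 : 0 < M by rewrite ltr_wpDl ?rnorm_ge0.
pose m := M ^+ 2; have m0 : 0 < m by rewrite exprn_gt0.
have m1 : 0 < 1 + m by rewrite addr_gt0.
pose x := (M^-1)%:C%C *: h.
have xs : star x = x by rewrite starZ conjc_real hs.
have x1 : rnorm x < 1.
  by rewrite rnormZr gtr0_norm ?invr_gt0// ltr_pdivrMl// mulr1 ltrDl.
have kx v : m%:C%C *: ((v ** x) ** x) = v ** k.
  rewrite /x !smulZr smulZl !scalerA -!rmorphM -smulA.
  have -> : m * (M^-1 / M) = 1 by rewrite /m; field; rewrite gt_eqF.
  by rewrite rmorph1 scale1r.
have cr v : rnorm (v - (v ** x) ** x) <= rnorm v.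
  rewrite -rnorm_star -[leRHS]rnorm_star starD starN !starM xs.
  exact: rnorm_sub_sqr.
pose F v := ((1 + m)^-1)%:C%C *: (k + m%:C%C *: (v - (v ** x) ** x)).
have [||u v|e Fe] := @lipschitz_fixed_point F (m / (1 + m)).
- by rewrite divr_ge0 ?ltW.
- by rewrite ltr_pdivrMr// mul1r ltrDr.
- rewrite /F -scalerBr opprD addrACA subrr add0r -scalerBr !rnormZr.
  rewrite !gtr0_norm ?invr_gt0// mulrA [_^-1 * m]mulrC.
  apply: ler_wpM2l; first by rewrite divr_ge0// ltW.
  have -> : u - u ** x ** x - (v - v ** x ** x) = (u - v) - ((u - v) ** x) ** x.
    by nc.
  exact: cr.
have ek : e + e ** k = k.
  have : (1 + m)%:C%C *: e = k + m%:C%C *: e - e ** k.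
    rewrite -{1}Fe /F scalerA -rmorphM mulfV ?gt_eqF// rmorph1 scale1r scalerBr kx.
    by rewrite addrA.
  rewrite rmorphD rmorph1 scalerDl scale1r.
  move=> H; have {}H : e + m%:C%C *: e = k + m%:C%C *: e - e ** k := H.
  have -> : e + e ** k = (e + m%:C%C *: e) - m%:C%C *: e + e ** k by nc.
  by rewrite H; nc.
have inj w : w + k ** w = 0 -> w = 0.
  rewrite -smulA => h0; have [] := cayley w hs; rewrite h0 rnorm0 => wl _.
  by apply: rnorm0_eq0; apply/le_anti; rewrite wl rnorm_ge0.
have injr w : w + w ** k = 0 -> w = 0.
  move=> h0; rewrite -(starK w) -[RHS](starK 0); congr star.
  have s0 : star (0 : A) = 0 by rewrite -[0 : A](scale0r 0) starZ conjc0 !scale0r.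
  by rewrite s0; apply: inj; rewrite -{1}ks -starM -starD h0.
have ec y : y ** h = h ** y -> y ** e = e ** y.
  move=> yh; have yk : y ** k = k ** y by rewrite /k smulA yh -smulA yh smulA.
  apply/eqP; rewrite -subr_eq0; apply/eqP/injr.
  rewrite smulDl sNmul addrACA -opprD -!smulA -smulDr ek yk smulA -smulDl ek.
  by rewrite subrr.
have kh : k ** h = h ** k by rewrite /k smulA.
have ke : k ** e = e ** k by exact: ec.
have es : star e = e.
  apply/eqP; rewrite -subr_eq0; apply/eqP/inj.
  rewrite smulDr smulN addrACA -opprD ke ek.
  have -> : star e + k ** star e = k by rewrite -{1}ks -starM -starD ek ks.
  by rewrite subrr.
have Rv v : (v - e ** v) + h ** (h ** (v - e ** v)) = v.
  rewrite smulA -/k smulDr smulN smulA ke addrACA -opprD -smulDl ek.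
  by rewrite addrK.
exists e; split=> // v; have [] := cayley (v - e ** v) hs; by rewrite Rv.
Qed.

Definition sq (x : A) := x ** x.

Lemma star_iter_sq m x : star x = x -> star (iter m sq x) = iter m sq x.
Proof. by move=> xs; elim: m => //= m ih; rewrite /sq starM ih. Qed.

Lemma comm_iter_sq m x y : y ** x = x ** y -> y ** iter m sq x = iter m sq x ** y.
Proof. by move=> yx; elim: m => //= m ih; rewrite /sq smulA ih -smulA ih smulA. Qed.

Lemma rnorm_iter_sq m x : star x = x -> rnorm (iter m sq x) = rnorm x ^+ (2 ^ m).
Proof.
move=> xs; elim: m => [|m ih] /=; first by rewrite expn0 expr1.
by rewrite /sq -{1}(star_iter_sq m xs) rnorm_sqr ih -exprM expnSr.
Qed.

(* The factor 1 - e = (1 + h^2)^-1 is almost 1 where b < 1 and kills b > 1; the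
   norm bound is checked on the 2^m-th power, where h (1 + h^2)^-1 appears. *)
Lemma resolvent_cut x m : exists e : A,
  let b := star x ** x in let h := iter m sq b in
  [/\ e = (h ** h) - e ** (h ** h), rnorm e <= 2 & rnorm (x - x ** e) <= 1].
Proof.
set b := star x ** x; set h := iter m sq b.
have bs : star b = b by rewrite starM starK.
have hs : star h = h by exact: star_iter_sq.
have [e [es ek ec e1 eh]] := resolvent_ex hs.
exists e => /=; split.
- by rewrite -[in X in X - _]ek addrK.
- apply: rnorm_op_le => // v.
  have -> : e ** v = v - (v - e ** v) by rewrite opprB addrC subrK.
  by apply: le_trans (rnormD _ _) _; rewrite rnormN mulr_natl mulr2n lerD2l; exact: e1.
pose Rf v := v - e ** v.
have be : b ** e = e ** b by apply: ec; apply: comm_iter_sq.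
have bR y v : y ** e = e ** y -> y ** Rf v = Rf (y ** v).
  by move=> ye; rewrite /Rf smulDr smulN !smulA ye.
have bRi n y v : y ** e = e ** y -> y ** iter n Rf v = iter n Rf (y ** v).
  by move=> ye; elim: n => //= n ih; rewrite bR// ih.
pose g := star (x - x ** e) ** (x - x ** e).
have gE v : g ** v = Rf (Rf (b ** v)).
  have be2 : star x ** x ** e = e ** (star x ** x) := be.
  rewrite /g starD starN starM es /Rf /b.
  have -> : (star x - e ** star x) ** (x - x ** e) ** v =
      b ** v - b ** e ** v - e ** b ** v + e ** (b ** e) ** v by rewrite /b; nc.
  by rewrite -!/b be; nc.
have gs : star g = g by rewrite starM starK.
have be' n : iter n sq b ** e = e ** iter n sq b.
  by rewrite (comm_iter_sq n (esym be)).
have giE n v : iter n sq g ** v = iter (2 ^ n).*2 Rf (iter n sq b ** v).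
  elim: n v => [|n ih] v; first by rewrite /= gE.
  rewrite iterS /sq -smulA !ih bRi// -iterD addnn.
  by rewrite iterS /sq -smulA expnS mul2n.
have Rfl n v : rnorm (iter n Rf v) <= rnorm v.
  by elim: n => //= n ih; apply: le_trans (e1 _) ih.
have : rnorm (iter m sq g) <= 1.
  apply: rnorm_op_le => // v; rewrite giE mul1r -/h.
  have [n ->] : exists n, (2 ^ m).*2 = n.+1.
    by exists (2 ^ m).*2.-1; rewrite prednK// double_gt0 expn_gt0.
  by rewrite iterSr; apply: le_trans (Rfl _ _) _; rewrite -(bR h _ (be' m)); exact: eh.
rewrite rnorm_iter_sq// => g1.
have : rnorm g <= 1.
  rewrite leNgt; apply/negP => g1'; move: g1; apply/negP; rewrite -ltNge.
  by rewrite exprn_egt1// -lt0n expn_gt0.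
by rewrite /g rnorm_sqr -{1}(expr1n _ 2%N) ler_pXn2r ?nnegrE ?rnorm_ge0.
Qed.

End CStarResolvent.

(** * Lifting contractions *)

Section Contractions.
Variables (R : realType) (w : freeUltrafilter) (A : cstarAlgType R).
Hypothesis hsigma : sigma_unital A.
Variable t0 : A -> R[i].
Hypothesis Tt0 : tracial_state t0.
Local Notation B := (A_omega_b w A).

Section Powers.
Variables (f : B -> R) (x : B).
Hypothesis Tf : TF f.
Hypothesis x1 : forall z, fnorm f (x ** z) <= fnorm f z.
Let fp := TF_rpos Tf.

Lemma fnorm_adj z : fnorm f (star x ** z) <= fnorm f z.
Proof.
have h : fnorm f (star x ** z) ^+ 2 <= fnorm f z * fnorm f (star x ** z).
  rewrite (fnorm_sqr fp) starM starK.
  have -> : star z ** x ** (star x ** z) = star z ** (x ** (star x ** z)) by nc.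
  apply: le_trans (ler_norm _) _; apply: le_trans (cauchy_schwarz fp _ _) _.
  by rewrite ler_wpM2l ?fnorm_ge0.
have [->|n0] := eqVneq (fnorm f (star x ** z)) 0; first exact: fnorm_ge0.
have p0 : 0 < fnorm f (star x ** z) by rewrite lt_neqAle eq_sym n0 fnorm_ge0.
by rewrite -(ler_pM2r p0) -expr2.
Qed.

Definition bsq (y : B) := y ** y.

Lemma fnorm_iter_bsq m z : fnorm f (iter m bsq (star x ** x) ** z) <= fnorm f z.
Proof.
elim: m z => [|m ih] z /=.
  by rewrite -smulA; apply: le_trans (fnorm_adj _) (x1 _).
by rewrite /bsq -smulA; apply: le_trans (ih _) (ih _).
Qed.

Lemma fnorm_iter_bsq_le m : fnorm f (iter m bsq (star x ** x)) <= fnorm f (star x ** x).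
Proof. by elim: m => //= m ih; apply: le_trans (fnorm_iter_bsq m _) ih. Qed.

Lemma fnorm_rnorm (y : B) : fnorm f y <= rnorm y.
Proof.
rewrite -(@ler_pXn2r _ 2) ?nnegrE ?fnorm_ge0 ?rnorm_ge0// (fnorm_sqr fp).
apply: le_trans (ler_norm _) _; apply: le_trans (TF_le Tf _) _.
by apply: le_trans (rnorm_smul _ _) _; rewrite rnorm_star expr2.
Qed.
End Powers.

Lemma bsq_scale m (c : R) (b : B) :
  iter m bsq (c%:C%C *: b) = (c ^+ (2 ^ m))%:C%C *: iter m bsq b.
Proof.
elim: m => [|m ih] /=; first by rewrite expn0 expr1.
rewrite /bsq ih smulZl smulZr scalerA -rmorphM; congr (_%:C%C *: _).
by rewrite -exprD addnn -mul2n -expnS.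
Qed.

(** A bounded lift of x need not be contractive. It is scaled by s < 1 and multiplied by the factor
    1 - E of [resolvent_cut], which makes every coordinate a contraction. The 2-norms hardly see the
    cut: x shrinks them, hence so do the powers of star x ** x, and the 2^m-th power of s^2 (star x
    ** x) tends to 0 in 2-norm. *)
Lemma lift_contraction (x : B) :
  (forall f z, TF f -> fnorm f (x ** z) <= fnorm f z) ->
  exists2 a : linf A, bcls w a = x & forall n, rnorm (a n) <= 1.
Proof.
move=> x1; apply: (lift_unit_ball_approx hsigma Tt0) => e e0.
have [X Xx] := bclsP x.
pose C := rnorm x + 1; have C0 : 0 < C by rewrite ltr_wpDl ?rnorm_ge0.
pose s := Num.max (1 / 2) (1 - e / (2 * C)).
have s0 : 0 < s by rewrite lt_max divr_gt0.
have s1 : s < 1.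
  rewrite gt_max; apply/andP; split; first by rewrite ltr_pdivrMr//; lra.
  by rewrite gtrBl divr_gt0// mulr_gt0.
have sC : (1 - s) * C <= e / 2.
  have : 1 - e / (2 * C) <= s by rewrite le_max lexx orbT.
  rewrite lerBlDl -lerBlDr => h; apply: le_trans (ler_wpM2r (ltW C0) h) _.
  by rewrite le_eqVlt; apply/orP; left; apply/eqP; field; rewrite gt_eqF.
(* The cut costs at most C times the 2-norm of [ee]. From ee = h^2 - ee h^2 and |ee| <= 2 that
   2-norm is at most 3 times that of h^2, itself at most s^(2^m) C^2. *)
pose D := C * 3 * (C * C); have D0 : 0 < D by rewrite !mulr_gt0.
have [m hm] : exists m, s ^+ (2 ^ m) * D <= e / 2.
  have : (fun n => s ^+ n) @ \oo --> (0 : R) by apply: cvg_expr; rewrite ger0_norm// ltW.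
  move/cvgr0Pnorm_lt => /(_ (e / 2 / D)); rewrite !divr_gt0// => /(_ isT).
  move=> [N _ hN]; exists N; have := hN (2 ^ N)%N; rewrite /=.
  have -> : (N <= 2 ^ N)%N by apply: ltnW; exact: ltn_expl.
  move=> /(_ isT); rewrite ger0_norm ?exprn_ge0 ?(ltW s0)// ltr_pdivlMr// => h.
  exact: ltW.
pose Y n := s%:C%C *: X n.
have [E hE] := choice (fun n => resolvent_cut (Y n) m).
have Eb : bounded_seq E by exists 2 => n; have [] := hE n.
pose Y' : linf A := s%:C%C *: X.
exists (Y' - Y' ** mk_linf Eb) => [n|f Tf]; first by have [] := hE n.
have fp := TF_rpos Tf.
pose b := star (bcls w Y') ** bcls w Y'.
pose h := iter m bsq b; pose ee := bcls w (mk_linf Eb).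
have eE : ee = h ** h - ee ** (h ** h).
  pose bL := star Y' ** Y'; pose hL := iter m (fun y : linf A => y ** y) bL.
  have hLE : bcls w hL = h.
    rewrite /hL /h /b -bclsS -bclsM -/bL.
    by elim: m {hm hE E Eb ee h hL} => //= m' ih; rewrite bclsM ih.
  rewrite -hLE /ee -!bclsM -bclsB; congr (bcls w _); apply: linf_ext => n.
  rewrite linfDE linfNE !linfME /=; have [+ _ _] := hE n.
  have -> : hL n = iter m (@sq R A) (star (Y n) ** Y n).
    by rewrite /hL; elim: m {hm hE E Eb ee h hL hLE} => //= m' ih; rewrite /sq -ih.
  by move=> <-.
have xC : rnorm x <= C by rewrite /C lerDl.
have e2 : rnorm ee <= 2.
  apply: le_trans (rnorm_bcls _ _) _; rewrite rnorm_linf; apply: linf_sup_le => n.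
  by have [] := hE n.
have YE : bcls w Y' = s%:C%C *: x by rewrite /Y' bclsZ Xx.
have bE : b = (s * s)%:C%C *: (star x ** x).
  by rewrite /b YE starZ conjc_real smulZl smulZr scalerA -rmorphM.
have hh : fnorm f (h ** h) <= s ^+ (2 ^ m) * (C * C).
  rewrite -[h ** h]/(iter m.+1 bsq b) bE bsq_scale (fnormZ fp).
  rewrite ger0_norm ?exprn_ge0 ?mulr_ge0 ?(ltW s0)//.
  apply: ler_pM; rewrite ?fnorm_ge0 ?exprn_ge0 ?mulr_ge0 ?(ltW s0)//.
    rewrite -expr2 -exprM; apply: ler_wiXn2l; [exact: ltW|exact: ltW|].
    by rewrite expnS mulnA leq_pmull.
  apply: le_trans (fnorm_iter_bsq_le _ _ _) _ => //; first by move=> z; exact: x1.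
  apply: le_trans (fnorm_rnorm Tf _) _; apply: le_trans (rnorm_smul _ _) _.
  by rewrite rnorm_star ler_pM ?rnorm_ge0.
rewrite bclsB bclsM -/ee.
have -> : x - (bcls w Y' - bcls w Y' ** ee) = (1 - s)%:C%C *: x + bcls w Y' ** ee.
  by rewrite YE rZB rZ1; nc.
apply: le_trans (fnormD fp _ _) _; rewrite [e]splitr; apply: lerD.
  rewrite (fnormZ fp) ger0_norm ?subr_ge0 ?(ltW s1)//.
  apply: le_trans sC; rewrite ler_wpM2l ?subr_ge0 ?(ltW s1)//.
  exact: le_trans (fnorm_rnorm Tf _) xC.
apply: le_trans hm; apply: le_trans (TF_mul_le Tf _ _) _.
have Yn : rnorm (bcls w Y') <= C.
  rewrite YE rnormZr ger0_norm ?(ltW s0)//; apply: le_trans xC.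
  by rewrite ler_piMl ?rnorm_ge0// ltW.
have eh3 : fnorm f ee <= 3 * (s ^+ (2 ^ m) * (C * C)).
  rewrite eE; apply: le_trans (fnormD fp _ _) _; rewrite fnormN.
  have : fnorm f (ee ** (h ** h)) <= 2 * fnorm f (h ** h).
    by apply: le_trans (TF_mul_le Tf _ _) _; rewrite ler_wpM2r ?fnorm_ge0.
  lra.
apply: le_trans (ler_pM (rnorm_ge0 _) (fnorm_ge0 _ _) Yn eh3) _.
by rewrite /D le_eqVlt; apply/orP; left; apply/eqP; ring.
Qed.

Lemma rnorm_contraction (x : B) :
  (forall f z, TF f -> fnorm f (x ** z) <= fnorm f z) -> rnorm x <= 1.
Proof.
move=> /lift_contraction[a <- ha]; apply: le_trans (rnorm_bcls _ _) _.
by rewrite rnorm_linf; exact: linf_sup_le.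
Qed.

End Contractions.

(** * Order calculus under a separating family of traces *)

(** All that the order calculus uses of A^{omega,b} and of the real parts of its limit traces.
    [ta_contr] takes the place of the C*-norm. *)
Record tracial_alg (R : realType) (B : normedStarAlgType R) (one : B) (TF : set (B -> R)) : Prop :=
  TracialAlg {
  ta_unit : forall x, one ** x = x /\ x ** one = x;
  ta_pos : forall f, TF f -> rpos f;
  ta_C : forall f, TF f -> forall x y, f (x ** y) = f (y ** x);
  ta_one : forall f, TF f -> f one = 1;
  ta_le : forall f, TF f -> forall x, `|f x| <= rnorm x;
  ta_mul : forall f, TF f -> forall x y, fnorm f (x ** y) <= rnorm x * fnorm f y;
  ta_sep : forall x, (forall f, TF f -> f (star x ** x) <= 0) -> x = 0;
  ta_contr : forall x, (forall f z, TF f -> fnorm f (x ** z) <= fnorm f z) -> rnorm x <= 1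
}.

Ltac nc1 :=
  match goal with
  | H : tracial_alg ?one _ |- _ => nc_gen one true (fun _ : true => ta_unit H)
  end.

Section StarBasics.
Variables (R : realType) (B : normedStarAlgType R).
Implicit Types x y : B.
Lemma star0 : star (0 : B) = 0.
Proof. by rewrite -[0 : B](scale0r 0) starZ conjc0 !scale0r. Qed.
Lemma starB x y : star (x - y) = star x - star y.
Proof. by rewrite starD starN. Qed.
Lemma starZr (c : R) x : star (c%:C%C *: x) = c%:C%C *: star x.
Proof. by rewrite starZ conjc_real. Qed.
Lemma star_sum (J : Type) (s : seq J) (P : pred J) (F : J -> B) :
  star (\sum_(i <- s | P i) F i) = \sum_(i <- s | P i) star (F i).
Proof. by apply: (big_morph star (@starD _ _) star0). Qed.
Lemma smul_suml (J : Type) (s : seq J) (P : pred J) (F : J -> B) x :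
  (\sum_(i <- s | P i) F i) ** x = \sum_(i <- s | P i) F i ** x.
Proof. by apply: (big_morph (smul^~ x) (fun a b => smulDl a b x) (s0mul x)). Qed.
Lemma smul_sumr (J : Type) (s : seq J) (P : pred J) (F : J -> B) x :
  x ** (\sum_(i <- s | P i) F i) = \sum_(i <- s | P i) x ** F i.
Proof. by apply: (big_morph (smul x) (smulDr x) (smul0 x)). Qed.
Lemma smulC_sum (J : Type) (s : seq J) (P : pred J) (F : J -> B) x :
  (forall i, P i -> x ** F i = F i ** x) ->
  x ** (\sum_(i <- s | P i) F i) = (\sum_(i <- s | P i) F i) ** x.
Proof. by move=> h; rewrite smul_sumr smul_suml; apply: eq_bigr. Qed.
End StarBasics.

Section OrderCalculus.
Variables (R : realType) (B : normedStarAlgType R) (one : B) (TF : set (B -> R)).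
Hypothesis ta : tracial_alg one TF.
Implicit Types (x y z p q : B) (f : B -> R).

Let fp f (Tf : TF f) := ta_pos ta Tf.

Lemma smul1l x : one ** x = x. Proof. by have [] := ta_unit ta x. Qed.
Lemma smul1r x : x ** one = x. Proof. by have [] := ta_unit ta x. Qed.

Lemma star_one : star one = one.
Proof. by rewrite -[LHS]smul1l -{1}(starK one) -starM smul1l starK. Qed.

(** Positivity in the GNS representations of all traces in [TF]. It asks for no square root, and it
    can be imposed by the universally quantified condition [enonneg]. *)
Definition Pos x : Prop := star x = x /\ forall f z, TF f -> 0 <= f (star z ** (x ** z)).

Lemma tr_star f x : TF f -> f (star x) = f x.
Proof. by move=> Tf; have := rposS (fp Tf) x one; rewrite smul1r star_one smul1l. Qed.

Lemma pos_sa x : Pos x -> star x = x. Proof. by case. Qed.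

Lemma pos_tr f x : TF f -> Pos x -> 0 <= f x.
Proof. by move=> Tf [_ /(_ f one Tf)]; rewrite smul1r star_one smul1l. Qed.

Lemma posD x y : Pos x -> Pos y -> Pos (x + y).
Proof.
move=> [sx hx] [sy hy]; split; first by rewrite starD sx sy.
by move=> f z Tf; rewrite smulDl smulDr (rposD (fp Tf)) addr_ge0 ?hx ?hy.
Qed.

Lemma pos0 : Pos 0.
Proof. by split=> [|f z Tf]; rewrite ?star0// s0mul smul0 (rpos0 (fp Tf)). Qed.

Lemma posZ (c : R) x : 0 <= c -> Pos x -> Pos (c%:C%C *: x).
Proof.
move=> c0 [sx hx]; split; first by rewrite starZr sx.
move=> f z Tf; rewrite smulZl smulZr (rposZ (fp Tf)).
by apply: mulr_ge0 => //; exact: hx.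
Qed.

Lemma pos_sum (J : Type) (s : seq J) (P : pred J) (F : J -> B) :
  (forall i, P i -> Pos (F i)) -> Pos (\sum_(i <- s | P i) F i).
Proof. by move=> h; elim/big_ind: _ => //; [exact: pos0|exact: posD]. Qed.

Lemma pos_conj x y : Pos x -> Pos (star y ** x ** y).
Proof.
move=> [sx hx]; split; first by rewrite !starM starK sx; nc.
move=> f z Tf.
have -> : star z ** (star y ** x ** y ** z) = star (y ** z) ** (x ** (y ** z)).
  by rewrite starM; nc.
exact: hx.
Qed.

Lemma pos_sqr x : Pos (star x ** x).
Proof.
split=> [|f z Tf]; first by rewrite starM starK.
have -> : star z ** (star x ** x ** z) = star (x ** z) ** (x ** z) by rewrite starM; nc.
exact: (rpos_ge0 (fp Tf)).
Qed.

Lemma pos_sq x : star x = x -> Pos (x ** x).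
Proof. by move=> sx; rewrite -{1}sx; exact: pos_sqr. Qed.

Lemma pos1 : Pos one.
Proof. by have := pos_sqr one; rewrite star_one smul1l. Qed.

Lemma norm_pos x (M : R) : star x = x -> rnorm x <= M -> Pos (M%:C%C *: one - x).
Proof.
move=> sx xM; split; first by rewrite starB starZr star_one sx.
move=> f z Tf; rewrite smulDl sNmul smulZl smul1l smulDr smulN smulZr.
rewrite (rposB (fp Tf)) (rposZ (fp Tf)) subr_ge0.
apply: le_trans (ler_norm _) _; apply: le_trans (cauchy_schwarz (fp Tf) _ _) _.
rewrite -(fnorm_sqr (fp Tf)) expr2 mulrCA ler_wpM2l ?fnorm_ge0//.
by apply: le_trans (ta_mul ta Tf _ _) _; rewrite ler_wpM2r ?fnorm_ge0.
Qed.

Lemma norm1_pos x : star x = x -> rnorm x <= 1 -> Pos (one - x).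
Proof. by move=> sx /(norm_pos sx); rewrite rZ1. Qed.

Lemma norm1_possq x : rnorm x <= 1 -> Pos (one - star x ** x).
Proof.
move=> x1; apply: norm1_pos; first by rewrite starM starK.
apply: le_trans (rnorm_smul _ _) _; rewrite rnorm_star -[leRHS]mulr1.
by rewrite ler_pM ?rnorm_ge0.
Qed.

Lemma possq_norm1 x : Pos (one - star x ** x) -> rnorm x <= 1.
Proof.
move=> [_ h]; apply: (ta_contr ta) => f z Tf.
rewrite -(@ler_pXn2r _ 2) ?nnegrE ?fnorm_ge0// !(fnorm_sqr (fp Tf)) -subr_ge0.
rewrite -(rposB (fp Tf)); have := h f z Tf; congr (_ <= f _).
by rewrite starM; nc1.
Qed.

Lemma pos_xx x : Pos x -> Pos (one - x) -> Pos (x - x ** x).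
Proof.
move=> px p1; have sx := pos_sa px.
have -> : x - x ** x = star x ** (one - x) ** x + star (one - x) ** x ** (one - x).
  by rewrite starB star_one sx; nc1.
by apply: posD; exact: pos_conj.
Qed.

Lemma pos_norm1 x : Pos x -> Pos (one - x) -> rnorm x <= 1.
Proof.
move=> px p1; apply: possq_norm1; rewrite (pos_sa px).
have -> : one - x ** x = (one - x) + (x - x ** x) by nc1.
by apply: posD => //; exact: pos_xx.
Qed.


Lemma fnorm_one f : TF f -> fnorm f one = 1.
Proof. by move=> Tf; rewrite /fnorm star_one smul1l (ta_one ta Tf) sqrtr1. Qed.

Lemma tr_fnorm f x : TF f -> `|f x| <= fnorm f x.
Proof.
move=> Tf; have := cauchy_schwarz (fp Tf) one x; rewrite star_one smul1l.
by rewrite fnorm_one// mul1r.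
Qed.

(* Riesz's decomposition x = sum r_n^2 with r_0 = x, r_(n+1) = r_n - r_n^2. *)
Lemma pos_mul_contr x y : Pos x -> Pos (one - x) -> Pos y -> x ** y = y ** x -> Pos (x ** y).
Proof.
move=> px p1 py xy; split; first by rewrite starM (pos_sa px) (pos_sa py).
move=> f z Tf; pose r n := iter n (fun u => u - u ** u) x.
have rP n : [/\ Pos (r n), Pos (one - r n) & r n ** y = y ** r n].
  elim: n => [|n [rp rp1 ry]]; first by split.
  have rr := pos_xx rp rp1; split=> //.
    have -> : one - r n.+1 = (one - r n) + r n ** r n by rewrite [r _.+1]/=; nc1.
    by apply: posD => //; apply: pos_sq; exact: pos_sa.
  by rewrite [r _.+1]/=; set u := r n in ry *; nc.
have rx n : Pos (x - r n - (r n ** r n) *+ n).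
  elim: n => [|n ih].
    have -> : x - r 0 - r 0 ** r 0 *+ 0 = 0 by rewrite [r 0]/= mulr0n; nc.
    exact: pos0.
  have [rp rp1 _] := rP n; have sr := pos_sa rp.
  have -> : x - r n.+1 - r n.+1 ** r n.+1 *+ n.+1 =
      (x - r n - r n ** r n *+ n) + (r n ** r n - r n.+1 ** r n.+1) *+ n.+1.
    rewrite [r _.+1]/=; set u := r n; rewrite mulrnBl !mulrSr.
    set a := u ** u *+ n; set b := (_ ** _) *+ n; set c := (_ - _) ** _; nc.
  apply: posD => //.
  have h : Pos (r n ** r n - r n.+1 ** r n.+1).
    have -> : r n ** r n - r n.+1 ** r n.+1 =
        star (r n) ** (r n + (r n - r n ** r n)) ** r n.
      by rewrite sr [r _.+1]/=; nc.
    by apply: pos_conj; apply: posD => //; exact: pos_xx.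
  by rewrite -rZn; apply: posZ.
have split_n n : 0 <= f (star z ** (x ** y ** z)) - f (star z ** (r n ** y ** z)).
  elim: n => [|n ih]; first by rewrite subrr.
  apply: le_trans ih _; rewrite lerD2l lerN2 -subr_ge0 -(rposB (fp Tf)).
  have [rp rp1 ry] := rP n; have sr := pos_sa rp.
  have -> : star z ** (r n ** y ** z) - star z ** (r n.+1 ** y ** z) =
      star (r n ** z) ** (y ** (r n ** z)).
    by rewrite starM sr [r _.+1]/=; set u := r n in ry *; nc.
  by case: py => _; apply.
have small n : `|f (star z ** (r n ** y ** z))| ^+ 2 *+ n <=
    f (star z ** (x ** z)) * fnorm f (y ** z) ^+ 2.
  have [rp _ _] := rP n; have sr := pos_sa rp.
  have h1 : `|f (star z ** (r n ** y ** z))| <= fnorm f (r n ** z) * fnorm f (y ** z).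
    have -> : star z ** (r n ** y ** z) = star (r n ** z) ** (y ** z).
      by rewrite starM sr; nc.
    exact: cauchy_schwarz (fp Tf) _ _.
  have h2 : fnorm f (r n ** z) ^+ 2 *+ n <= f (star z ** (x ** z)).
    rewrite (fnorm_sqr (fp Tf)) starM sr.
    have [_ /(_ f z Tf)] := posD (rx n) rp.
    have -> : star z ** ((x - r n - r n ** r n *+ n + r n) ** z) =
       star z ** (x ** z) - (star z ** r n ** (r n ** z)) *+ n.
      rewrite -!rZn; have -> : x - r n - n%:R%:C%C *: (r n ** r n) + r n =
        x - n%:R%:C%C *: (r n ** r n) by set u := _ *: _; nc.
      rewrite smulDl sNmul smulZl smulDr smulN smulZr; congr (_ - _ *: _); nc.
    by rewrite (rposB (fp Tf)) -rZn (rposZ (fp Tf)) mulr_natl subr_ge0.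
  have := ler_pM (normr_ge0 _) (normr_ge0 _) h1 h1; rewrite -!expr2 exprMn => h3.
  apply: (@le_trans _ _ (fnorm f (r n ** z) ^+ 2 *+ n * fnorm f (y ** z) ^+ 2)).
    by rewrite mulrnAl lerMn2r h3 orbT.
  by rewrite ler_wpM2r ?exprn_ge0 ?fnorm_ge0.
set C := f (star z ** (x ** z)) * _ in small; set F := f (star z ** (x ** y ** z)) in split_n *.
have C0 : 0 <= C by apply: le_trans (small 0%N); rewrite mulr0n.
rewrite leNgt; apply/negP => F0.
have hn n : F ^+ 2 *+ n <= C.
  apply: le_trans (small n); rewrite lerMn2r; apply/orP; right.
  rewrite real_normK ?num_real//; have := split_n n; rewrite subr_ge0 => h.
  by rewrite -[F ^+ 2]sqrrN -[leRHS]sqrrN ler_pXn2r ?nnegrE ?oppr_ge0 ?lerN2// ltW//;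
    apply: le_lt_trans h F0.
have F2 : 0 < F ^+ 2 by rewrite lt_neqAle sqr_ge0 andbT eq_sym sqrf_eq0 lt_eqF.
have := hn (Num.truncn (C / F ^+ 2)).+1; apply/negP; rewrite -ltNge.
by rewrite -mulr_natr -ltr_pdivrMl// mulrC truncnS_gt.
Qed.

Lemma pos_mul x y : Pos x -> Pos y -> x ** y = y ** x -> Pos (x ** y).
Proof.
move=> px py xy; pose M := rnorm x + 1; have M0 : 0 < M by rewrite ltr_wpDl ?rnorm_ge0.
have Mi : 0 <= M^-1 by rewrite invr_ge0 ltW.
have -> : x ** y = M%:C%C *: (((M^-1)%:C%C *: x) ** y).
  by rewrite smulZl rZM mulfV ?gt_eqF// rZ1.
apply: posZ; first exact: ltW.
apply: pos_mul_contr => //; first exact: posZ.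
  apply: norm1_pos; first by rewrite starZr (pos_sa px).
  by rewrite rnormZr ger0_norm// ler_pdivrMl// mulr1 lerDl.
by rewrite smulZl smulZr xy.
Qed.

Lemma tr_pos_sqr f x d : TF f -> Pos x -> 0 <= f (star d ** d ** x).
Proof.
move=> Tf [_ h]; have := h f (star d) Tf; rewrite starK (ta_C ta Tf) => h1.
by move: h1; rewrite -smulA (ta_C ta Tf).
Qed.

(** Positivity of x(|x| - x) bounds f(x^2) by |x| f(x). *)
Lemma pos_eq0 x : Pos x -> (forall f, TF f -> f x <= 0) -> x = 0.
Proof.
move=> px h; apply: (ta_sep ta) => f Tf; rewrite (pos_sa px).
have p : Pos (x ** ((rnorm x)%:C%C *: one - x)).
  apply: pos_mul => //; first by apply: norm_pos => //; exact: pos_sa.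
  by rewrite smulDr smulDl smulN sNmul smulZr smulZl smul1l smul1r.
have := pos_tr Tf p; rewrite smulDr smulN smulZr smul1r (rposB (fp Tf)) (rposZ (fp Tf)).
by rewrite subr_ge0 => /le_trans; apply; rewrite mulr_ge0_le0 ?rnorm_ge0 ?h.
Qed.

Lemma proj_pos p : projection p -> Pos p.
Proof. by move=> [sp pp]; rewrite -pp -{1}sp; exact: pos_sqr. Qed.

Lemma proj_compl p : projection p -> projection (one - p).
Proof. by move=> [sp pp]; split; rewrite ?starB ?star_one ?sp//; nc1. Qed.

Lemma proj_mul p q : projection p -> projection q -> p ** q = q ** p -> projection (p ** q).
Proof. by move=> [sp pp] [sq qq] pq; split; rewrite ?starM ?sp ?sq//; nc. Qed.

Lemma proj_norm1 p : projection p -> rnorm p <= 1.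
Proof. by move=> pp; apply: pos_norm1; apply: proj_pos => //; exact: proj_compl. Qed.

Lemma fnorm_le_norm f x : TF f -> fnorm f x <= rnorm x.
Proof.
move=> Tf; have := ta_mul ta Tf x one; rewrite smul1r.
by rewrite fnorm_one// mulr1.
Qed.

Lemma fnorm_starT f x : TF f -> fnorm f (star x) = fnorm f x.
Proof. by move=> Tf; rewrite /fnorm starK (ta_C ta Tf). Qed.

Lemma fnorm_mulr f x y : TF f -> fnorm f (x ** y) <= fnorm f x * rnorm y.
Proof.
move=> Tf; rewrite -fnorm_starT// starM; apply: le_trans (ta_mul ta Tf _ _) _.
by rewrite rnorm_star fnorm_starT// mulrC.
Qed.

End OrderCalculus.

(** * The ultrapower as a tracial algebra with an action *)

Record tracial_action (R : realType) (B : normedStarAlgType R) (TF : set (B -> R))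
    (G : groupType) (beta : G -> B -> B) : Prop := TracialAction {
  tac_D : forall g x y, beta g (x + y) = beta g x + beta g y;
  tac_Z : forall g (c : R[i]) x, beta g (c *: x) = c *: beta g x;
  tac_M : forall g x y, beta g (x ** y) = beta g x ** beta g y;
  tac_S : forall g x, beta g (star x) = star (beta g x);
  tac_1 : forall x, beta 1%g x = x;
  tac_comp : forall g h x, beta (g * h)%g x = beta g (beta h x);
  tac_norm : forall g x, rnorm (beta g x) <= rnorm x;
  tac_TF : forall g f, TF f -> TF (fun x => f (beta g x))
}.

Lemma first_order_bound (R : realFieldType) (s x y z : R) : 0 < s -> x <= 0 ->
  0 <= x - s * y - s * y + s * (s * z) -> y *+ 2 <= s * z.
Proof. by move=> s0 x0 h; rewrite -(ler_pM2l s0) mulr2n; lra. Qed.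

Section Instance.
Variables (R : realType) (w : freeUltrafilter) (A : cstarAlgType R).
Hypothesis hsigma : sigma_unital A.
Variable t0 : A -> R[i].
Hypothesis Tt0 : tracial_state t0.
Local Notation B := (A_omega_b w A).
Local Notation TFB := (@TF R w A).
Hypothesis hCPoU : weak_CPoU w A.
Variables (G : groupType) (alpha : action G A).
Hypothesis hGamma : local_equivariant_Gamma w alpha.

Lemma norm2X_limit0 : norm2X (@limit_traces R w A) (0 : B) = 0.
Proof.
have [t lt] := limit_trace_ex w hsigma (fun=> Tt0).
rewrite /norm2X (_ : [set _ | _ in _] = [set 0]) ?sup1//.
apply/seteqP; split=> [_ [s ls <-]|_ ->].
  exact: fnorm0 (TF_rpos (TF_limit ls)).
have lT : limit_traces t by exists (fun=> t0).
by exists t => //; exact: fnorm0 (TF_rpos (TF_limit lT)).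
Qed.

Lemma countable_separable (S : set B) : countable S -> norm2X_separable (@limit_traces R w A) S.
Proof.
move=> cS; exists S; split=> // x Sx e e0; exists x => //.
by rewrite subrr norm2X_limit0.
Qed.

Lemma gamma_real (n : nat) (S : set B) : countable S -> exists p : 'I_n -> B,
  [/\ forall i, projection (p i),
      forall i j, i != j -> p i ** p j = 0,
      forall i g, act_omega alpha g (p i) = p i,
      forall i s, S s -> p i ** s = s ** p i &
      forall i a f, S a -> TFB f -> f (a ** p i) = n%:R^-1 * f a].
Proof.
move=> cS; have [p [h1 h2 h3 h4 h5]] := hGamma n (countable_separable cS).
exists p; split=> // i a f Sa /(limit_TF hsigma)[t lt ->].
have := h5 i a t Sa lt; rewrite /ret => ->.
have -> : (n%:R^-1 : R[i]) = (n%:R^-1 : R)%:C%C by rewrite fmorphV rmorph_nat.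
by case: (t a) => u v /=; rewrite mul0r subr0.
Qed.

(** Weak CPoU for the single element 0 gives a positive contraction e0 with trace 1 everywhere. For
    each x, Gamma with n = 1 gives a projection q acting as a unit on x and e0. Then q - e0 is
    positive with traces at most 0, which forces q = e0. *)
Lemma unit_ex : exists e : B, (forall x, e ** x = x /\ x ** e = x) /\
  forall f, TFB f -> f e = 1.
Proof.
have cS0 : countable (set0 : set B) by exact: countable0.
have p0 (i : 'I_1) : positive (0 : A) by exists 0; rewrite star0 smul0.
have [|e [he1 he2]] := hCPoU (countable_separable cS0) (a := fun=> 0) p0 (delta := 1).
  apply: (@le_lt_trans _ _ 0); last exact: ltr01.
  apply: ge_sup => [|_ [t Tt <-]]; first by
    exists 0, t0 => //; rewrite big_ord_recl big_ord0 (trace0 Tt0) /= minxx.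
  by rewrite big_ord_recl big_ord0 (trace0 Tt) /= minxx.
have [[y ey] en _] := he1 ord0; set e0 := e ord0 in ey en.
have se : star e0 = e0 by rewrite ey starM starK.
have e1 f : TFB f -> f e0 = 1.
  by move=> /(limit_TF hsigma)[t /he2[+ _] ->]; rewrite big_ord1 /ret => ->.
have en1 : rnorm e0 <= 1 by rewrite -lecR rnormE.
have efix (x : B) : x ** e0 = x /\ e0 ** x = x.
  pose S : set B := [set e0; star e0 ** e0] `|` [set star x ** x; x ** star x].
  have cS : countable S.
    by apply: finite_set_countable; rewrite !finite_setU; do !split; exact: finite_set1.
  have [p [pp _ _ pS pt]] := gamma_real 1 cS.
  have [{pp}] := pp ord0; set q := p ord0 => sq qq.
  have fq f a : S a -> TFB f -> f (a ** q) = f a.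
    by move=> Sa Tf; rewrite pt// invr1 mul1r.
  have qe : q ** e0 = e0 ** q by apply: pS; left; left.
  have fix_q a : S (star a ** a) -> a ** q = a.
    move=> Sa; apply/eqP; rewrite eq_sym -subr_eq0; apply/eqP.
    apply: (TF_separating hsigma Tt0) => f Tf; have fp := TF_rpos Tf.
    have -> : star (a - a ** q) ** (a - a ** q) =
       star a ** a - star a ** a ** q - (q ** (star a ** a) - q ** (star a ** a ** q)).
      by rewrite starB starM sq; nc.
    set b := star a ** a in Sa *.
    rewrite !(rposB fp) (TF_C Tf q (b ** q)) -(smulA b q q) qq.
    by rewrite (TF_C Tf q) !fq// !subrr.
  have eq : e0 ** q = e0 by apply: fix_q; left; right.
  have xq : x ** q = x by apply: fix_q; right; left.
  have qx : q ** x = x.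
    have : star x ** q = star x by apply: fix_q; rewrite starK; right; right.
    by move=> /(congr1 (@star R B)); rewrite starM starK sq.
  have qn : rnorm q <= 1.
    apply: (rnorm_contraction hsigma Tt0) => f z Tf; have fp := TF_rpos Tf.
    have h : fnorm f (q ** z) ^+ 2 <= fnorm f z * fnorm f (q ** z).
      rewrite (fnorm_sqr fp) starM sq; have -> : star z ** q ** (q ** z) = star z ** (q ** z) by nc.
      by apply: le_trans (ler_norm _) _; exact: cauchy_schwarz.
    have [->|n0] := eqVneq (fnorm f (q ** z)) 0; first exact: fnorm_ge0.
    have nz : 0 < fnorm f (q ** z) by rewrite lt_neqAle eq_sym n0 fnorm_ge0.
    by rewrite -(ler_pM2r nz) -expr2.
  suff <- : q = e0 by [].
  apply/eqP; rewrite -subr_eq0; apply/eqP; set d := q - e0.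
  apply: (TF_separating hsigma Tt0) => f Tf; have fp := TF_rpos Tf.
  have sd : star d = d by rewrite starB sq se.
  have fd : f d <= 0.
    rewrite (rposB fp) e1// subr_le0; apply: le_trans (ler_norm _) _.
    exact: le_trans (TF_le Tf _) qn.
  have dpos z : 0 <= f (star z ** (d ** z)).
    have -> : star z ** (d ** z) = star (q ** z) ** (q ** z) - star (q ** z) ** (e0 ** (q ** z)).
      have eqe : q ** e0 ** q = e0 by rewrite qe -smulA qq.
      rewrite starM sq /d.
      have -> : star z ** q ** (e0 ** (q ** z)) = star z ** (q ** e0 ** q) ** z by nc.
      by rewrite eqe; nc.
    rewrite (rposB fp) subr_ge0; apply: le_trans (ler_norm _) _.
    apply: le_trans (cauchy_schwarz fp _ _) _; rewrite -(fnorm_sqr fp) expr2.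
    rewrite ler_wpM2l ?fnorm_ge0//; apply: le_trans (TF_mul_le Tf _ _) _.
    by rewrite ler_piMl ?fnorm_ge0.
  have dq : d ** q = d by rewrite /d smulDl sNmul qq eq.
  have qd : q ** d = d by rewrite /d smulDr smulN qq qe eq.
  clearbody d.
  (* The order calculus needs a unit and is not yet at hand. Positivity of d at the vector q - s d
     reads 0 <= f(d) - 2 s f(d^2) + s^2 f(d^3); small s then excludes f(d^2) > 0. *)
  have key (s : R) : 0 < s -> f (d ** d) *+ 2 <= s * f (d ** d ** d).
    move=> s0; have := dpos (q - s%:C%C *: d).
    rewrite starB starZr sq sd.
    have -> : (q - s%:C%C *: d) ** (d ** (q - s%:C%C *: d)) =
        d - s%:C%C *: (d ** d) - s%:C%C *: (d ** d) + (s * s)%:C%C *: (d ** d ** d).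
      have -> : d ** (q - s%:C%C *: d) = d - s%:C%C *: (d ** d).
        by rewrite smulDr smulN smulZr dq.
      rewrite smulDl sNmul smulZl.
      have -> : q ** (d - s%:C%C *: (d ** d)) = d - s%:C%C *: (d ** d).
        by rewrite smulDr smulN smulZr smulA qd.
      by rewrite smulDr smulN smulZr scalerBr rZM smulA; nc.
    rewrite (rposD fp) !(rposB fp) !(rposZ fp) => h.
    by apply: (first_order_bound s0 fd); rewrite -mulrA in h.
  rewrite sd leNgt; apply/negP => dd0.
  pose K := `|f (d ** d ** d)| + 1; have K0 : 0 < K by rewrite ltr_wpDl.
  have := key (f (d ** d) / K); rewrite divr_gt0// => /(_ isT).
  apply/negP; rewrite -ltNge; apply: (@le_lt_trans _ _ (f (d ** d))).
    rewrite mulrAC ler_pdivrMr//; apply: ler_wpM2l; first exact: ltW.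
    by apply: le_trans (ler_norm _) _; rewrite lerDl.
  by rewrite mulr2n ltrDl.
by exists e0; split=> // x; have [] := efix x.
Qed.

Lemma alg_unitP : forall x : B, alg_unit B ** x = x /\ x ** alg_unit B = x.
Proof.
have [e [he _]] := unit_ex.
exact: (@xgetPex _ 0 [set e : B | forall x, e ** x = x /\ x ** e = x] (ex_intro _ e he)).
Qed.

Lemma tracial_algB : tracial_alg (alg_unit B) TFB.
Proof.
split=> [||||||x h|x h].
- exact: alg_unitP.
- by move=> f; exact: TF_rpos.
- by move=> f; exact: TF_C.
- move=> f Tf; have [e [he he1]] := unit_ex; rewrite -(he1 f Tf).
  by congr f; have [_ <-] := alg_unitP e; have [-> _] := he (alg_unit B).
- by move=> f; exact: TF_le.
- by move=> f; exact: TF_mul_le.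
- exact: (TF_separating hsigma Tt0).
- exact: (rnorm_contraction hsigma Tt0).
Qed.

Lemma tracial_actionB : tracial_action TFB (act_omega alpha : G -> B -> B).
Proof.
split.
- move=> g x y; have [a ->] := bclsP x; have [b ->] := bclsP y.
  rewrite -bclsD !act_omegaE -bclsD; congr bcls; apply: linf_ext => n /=.
  exact: star_homD.
- move=> g c x; have [a ->] := bclsP x.
  rewrite -bclsZ !act_omegaE -bclsZ; congr bcls; apply: linf_ext => n /=.
  exact: star_homZ.
- move=> g x y; have [a ->] := bclsP x; have [b ->] := bclsP y.
  rewrite -bclsM !act_omegaE -bclsM; congr bcls; apply: linf_ext => n /=.
  exact: star_homM.
- move=> g x; have [a ->] := bclsP x.
  rewrite -bclsS !act_omegaE -bclsS; congr bcls; apply: linf_ext => n /=.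
  exact: star_homS.
- move=> x; have [a ->] := bclsP x.
  rewrite !act_omegaE; congr bcls; apply: linf_ext => n /=; exact: act1.
- move=> g h x; have [a ->] := bclsP x.
  rewrite !act_omegaE; congr bcls; apply: linf_ext => n /=; exact: actM.
- move=> g x; apply/ler_addgt0Pr => e e0; have [a <- ha] := bcls_lift_lt x e0.
  rewrite act_omegaE; apply: le_trans (rnorm_bcls _ _) _; apply: le_trans (ltW ha).
  rewrite !rnorm_linf; apply: linf_sup_le => n /=; rewrite rnorm_act; exact: linf_sup_ge.
- move=> g f [tn [Ttn h]]; exists (fun n => tn n \o alpha g); split.
    by move=> n; exact: tracial_state_act.
  by move=> a; rewrite act_omegaE; exact: (h (linf_act alpha g a)).
Qed.

End Instance.

(** * Saturation and reindexing *)

Section GExpressions.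
Variables (R : realType) (G : groupType) (V U : Type).

(* Par: parameters, Unk: unknowns, Uni: a contraction over which a condition is
   universally quantified. *)
Inductive gexpr :=
  | EPar of V | EUnk of U | EUni | EZero
  | EAdd of gexpr & gexpr | EScale of R[i] & gexpr | EMul of gexpr & gexpr
  | EStar of gexpr | EAct of G & gexpr.

Definition esub a b := EAdd a (EScale (-1) b).
(** A condition e is read as [f e <= 0] for all limit traces f and contractions z in place of
    [EUni]: [esq a] forces a = 0, and [enonneg a] forces a self-adjoint a to be positive. *)
Definition esq a := EMul (EStar a) a.
Definition enonneg a := EScale (-1) (EMul (EStar EUni) (EMul a EUni)).

Section Evaluation.
Variables (B : normedStarAlgType R) (beta : G -> B -> B) (p : V -> B) (y : U -> B) (z : B).

Fixpoint geval (e : gexpr) : B :=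
  match e with
  | EPar i => p i
  | EUnk i => y i
  | EUni => z
  | EZero => 0
  | EAdd a b => geval a + geval b
  | EScale c a => c *: geval a
  | EMul a b => geval a ** geval b
  | EStar a => star (geval a)
  | EAct g a => beta g (geval a)
  end.

Lemma geval_sub a b : geval (esub a b) = geval a - geval b.
Proof. by rewrite /= scaleN1r. Qed.
Lemma geval_nonneg a : geval (enonneg a) = - (star z ** (geval a ** z)).
Proof. by rewrite /= scaleN1r. Qed.
End Evaluation.
End GExpressions.

Arguments EPar {R G V U}. Arguments EUnk {R G V U}.
Arguments EUni {R G V U}. Arguments EZero {R G V U}.

Section Saturation.
Variables (R : realType) (w : freeUltrafilter) (A : cstarAlgType R).
Hypothesis hsigma : sigma_unital A.
Variable t0 : A -> R[i].
Hypothesis Tt0 : tracial_state t0.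
Variables (G : groupType) (alpha : action G A) (V U : Type).
Local Notation B := (A_omega_b w A).
Local Notation TFB := (@TF R w A).
Local Notation T := (@tracial_state R A).
Local Notation evA := (geval (fun g => alpha g : A -> A)).
Local Notation evB := (geval (act_omega alpha : G -> B -> B)).

Let w_ultra : UltraFilter (ultra_sets w) := ultra_ultra w.
Local Existing Instance w_ultra.

Lemma geval_linf (p : V -> linf A) (y : U -> linf A) (z : linf A) (e : gexpr R G V U) :
  exists2 a : linf A, bcls w a = evB (fun i => bcls w (p i)) (fun i => bcls w (y i)) (bcls w z) e &
    forall n, a n = evA (fun i => p i n) (fun i => y i n) (z n) e.
Proof.
elim: e => [i|i|||e1 [a1 b1 h1] e2 [a2 b2 h2]|c e [a b h]|e1 [a1 b1 h1] e2 [a2 b2 h2]|e [a b h]|g e [a b h]] /=.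
- by exists (p i).
- by exists (y i).
- by exists z.
- by exists 0 => //; exact: bcls0.
- by exists (a1 + a2) => [|n]; rewrite ?bclsD ?b1 ?b2// linfDE h1 h2.
- by exists (c *: a) => [|n]; rewrite ?bclsZ ?b// linfZE h.
- by exists (a1 ** a2) => [|n]; rewrite ?bclsM ?b1 ?b2// linfME h1 h2.
- by exists (star a) => [|n]; rewrite ?bclsS ?b// linfSE h.
- by exists (linf_act alpha g a) => [|n]; rewrite -?b ?act_omegaE//= h.
Qed.

Variable conds : nat -> gexpr R G V U.

Definition solA (p : V -> A) (e : R) (l : nat) (y : U -> A) : Prop :=
  (forall i, rnorm (y i) <= 1) /\
  forall j t z, (j < l)%N -> T t -> rnorm z <= 1 -> ret t (evA p y z (conds j)) <= e.

Definition solB (p : V -> B) (e : R) (l : nat) (y : U -> B) : Prop :=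
  (forall i, rnorm (y i) <= 1) /\
  forall j f z, (j < l)%N -> TFB f -> rnorm z <= 1 -> f (evB p y z (conds j)) <= e.

Lemma sol_exact (par : V -> linf A) :
  (forall l e, 0 < e -> ultra_sets w [set n | exists y, solA (fun i => par i n) e l y]) ->
  exists2 y : U -> B, (forall i, rnorm (y i) <= 1) &
    forall j f z, TFB f -> rnorm z <= 1 -> f (evB (fun i => bcls w (par i)) y z (conds j)) <= 0.
Proof.
move=> h; pose P (l n : nat) (y : U -> A) := solA (fun i => par i n) l.+1%:R^-1 l y.
have [||y hy] := @eps_test w (U -> A) (fun=> 0) P.
- move=> l n y [h1 h2]; split=> // j t z jl Tt z1; apply: le_trans (h2 _ _ _ _ Tt z1) _.
    by rewrite ltnS ltnW.
  by rewrite lef_pV2 ?posrE ?ltr0n// ler_nat.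
- by move=> l; apply: h; rewrite invr_gt0 ltr0n.
pose c i n := if `[< rnorm (y n i) <= 1 >] then y n i else 0.
have c1 i n : rnorm (c i n) <= 1.
  by rewrite /c; case: asboolP => //; rewrite rnorm0.
have bc i : bounded_seq (c i) by exists 1 => n; exact: c1.
pose Y i := mk_linf (bc i); exists (fun i => bcls w (Y i)) => [i|j f z Tf z1].
  apply: le_trans (rnorm_bcls _ _) _; rewrite rnorm_linf; apply: linf_sup_le => n.
  exact: c1.
have [zL <- hz] := lift_unit_ball hsigma Tt0 z1.
have [a <- ha] := geval_linf par Y zL (conds j).
have [tn [Ttn hf]] := Tf; apply/ler_addgt0Pr => e e0; rewrite add0r.
(* Level l includes condition j and has tolerance 1/(l + 1) <= e. *)
pose l := (maxn j.+1 (Num.truncn e^-1).+1).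
have le1 : (l.+1%:R : R)^-1 <= e.
  rewrite invf_ple ?posrE ?ltr0n//; apply: le_trans (ltW (truncnS_gt _)) _.
  by rewrite ler_nat /l; apply: leq_trans (leq_maxr _ _) _.
apply: ucv_le (hf a) (ucv_cst e) _; apply: filterS (hy l) => n [yn1 hn] /=.
apply: le_trans le1; rewrite ha.
have -> : (fun i => Y i n) = y n.
  by apply/funext => i; rewrite /= /c asboolT.
by apply: hn => //; rewrite /l; apply: leq_trans (leq_maxl _ _).
Qed.

(** If a bound failed in too many coordinates, the offending traces and contractions would assemble
    to a limit trace and a contraction of B that violate it. *)
Lemma sol_down (par : V -> linf A) (y : U -> B) l e e' : e < e' ->
  solB (fun i => bcls w (par i)) e l y ->
  ultra_sets w [set n | exists y', solA (fun i => par i n) e' l y'].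
Proof.
move=> ee [y1 hy].
have [Y hY] := choice (fun i => let: ex_intro2 a h1 h2 := lift_unit_ball hsigma Tt0 (y1 i) in
   ex_intro (fun a => bcls w a = y i /\ forall n, rnorm (a n) <= 1) a (conj h1 h2)).
have step j : (j < l)%N -> ultra_sets w [set n | forall t z, T t -> rnorm z <= 1 ->
    ret t (evA (fun i => par i n) (fun i => Y i n) z (conds j)) <= e'].
  move=> jl; apply: (pick_bad Tt0) => tn z Ttn z1.
  have [f Tf hf] := TF_ex w hsigma Ttn.
  have bz : bounded_seq z by exists 1.
  have [a ab ha] := geval_linf par Y (mk_linf bz) (conds j).
  have fe : f (bcls w a) <= e.
    have -> : bcls w a = evB (fun i => bcls w (par i)) y (bcls w (mk_linf bz)) (conds j).
      by rewrite ab; congr (geval _ _ _ _ _); apply/funext => i; have [] := hY i.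
    apply: hy => //; apply: le_trans (rnorm_bcls _ _) _; rewrite rnorm_linf; exact: linf_sup_le.
  have d0 : 0 < e' - e by rewrite subr_gt0.
  apply: filterS (hf a _ d0) => n /=; rewrite -ha ltr_norml => /andP[_]; lra.
have all_l : ultra_sets w [set n | forall j, (j < l)%N -> forall t z, T t -> rnorm z <= 1 ->
    ret t (evA (fun i => par i n) (fun i => Y i n) z (conds j)) <= e'].
  elim: l step {hy} => [|l ih] step; first by apply: filterS filterT => n _ j.
  apply: filterS (filterI (ih (fun j jl => step j (ltnW jl))) (step l (ltnSn l))) => n [h1 h2] j; rewrite ltnS leq_eqVlt => /orP[/eqP ->//|]; exact: h1.
apply: filterS all_l => n hn; exists (fun i => Y i n); split=> [i|j t z jl Tt z1].
  by have [_] := hY i; apply.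
exact: hn.
Qed.

Lemma saturation_nat (p : V -> B) : (forall l e, 0 < e -> exists y, solB p e l y) ->
  exists2 y : U -> B, (forall i, rnorm (y i) <= 1) &
    forall j f z, TFB f -> rnorm z <= 1 -> f (evB p y z (conds j)) <= 0.
Proof.
move=> h; have [par hp] := choice (fun i => bclsP (p i)).
have -> : p = fun i => bcls w (par i) by apply/funext => i; exact: hp.
apply: sol_exact => l e e0; have e2 : 0 < e / 2 by rewrite divr_gt0.
have [y hy] := h l _ e2; apply: (@sol_down _ y _ (e / 2)).
  by rewrite ltr_pdivrMr// mulr_natr mulr2n ltrDl.
by move: hy; congr (solB _ _ _ _); apply/funext => i; rewrite hp.
Qed.

(** For almost every n the system is solved in B with the constants [par i n] of A as parameters.
    Each such solution is pushed down to A, and the results form a sequence solving the system for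
    the classes of [par]. In this way a property of B relative to A extends to parameters from B. *)
Lemma reindexing_nat (par : V -> linf A) :
  (forall l e, 0 < e ->
    ultra_sets w [set n | exists y, solB (fun i => cst_embed w (par i n)) e l y]) ->
  exists2 y : U -> B, (forall i, rnorm (y i) <= 1) &
    forall j f z, TFB f -> rnorm z <= 1 -> f (evB (fun i => bcls w (par i)) y z (conds j)) <= 0.
Proof.
move=> h; apply: sol_exact => l e e0; have e2 : 0 < e / 2 by rewrite divr_gt0.
apply: filterS (h l _ e2) => n [y hy].
have ee : e / 2 < e by rewrite ltr_pdivrMr// mulr_natr mulr2n ltrDl.
by have /filter_ex[m [y' hy']] := sol_down ee hy; exists y'.
Qed.

End Saturation.

Section SaturationCountable.
Variables (R : realType) (w : freeUltrafilter) (A : cstarAlgType R).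
Hypothesis hsigma : sigma_unital A.
Variable t0 : A -> R[i].
Hypothesis Tt0 : tracial_state t0.
Variables (G : groupType) (alpha : action G A) (V U : Type).
Local Notation B := (A_omega_b w A).
Local Notation TFB := (@TF R w A).
Local Notation evB := (geval (act_omega alpha : G -> B -> B)).
Variables (K : countType) (conds : K -> gexpr R G V U).

Let conds' (j : nat) := if unpickle j is Some k then conds k else EZero.

Lemma saturation (p : V -> B) :
  (forall e, 0 < e -> exists2 y : U -> B, (forall i, rnorm (y i) <= 1) &
     forall k f z, TFB f -> rnorm z <= 1 -> f (evB p y z (conds k)) <= e) ->
  exists2 y : U -> B, (forall i, rnorm (y i) <= 1) &
    forall k f z, TFB f -> rnorm z <= 1 -> f (evB p y z (conds k)) <= 0.
Proof.
move=> h; have [|y y1 hy] := @saturation_nat R w A hsigma t0 Tt0 G alpha V U conds' p.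
  move=> l e e0; have [y y1 hy] := h e e0; exists y; split=> // j f z _ Tf z1.
  rewrite /conds'; case: unpickle => [k|]; first exact: hy.
  by rewrite /= (rpos0 (TF_rpos Tf)) ltW.
by exists y => // k f z Tf z1; have := hy (pickle k) f z Tf z1; rewrite /conds' pickleK.
Qed.

Lemma reindexing (par : V -> linf A) :
  (forall e, 0 < e -> ultra_sets w [set n | exists2 y : U -> B, (forall i, rnorm (y i) <= 1) &
     forall k f z, TFB f -> rnorm z <= 1 ->
       f (evB (fun i => cst_embed w (par i n)) y z (conds k)) <= e]) ->
  exists2 y : U -> B, (forall i, rnorm (y i) <= 1) &
    forall k f z, TFB f -> rnorm z <= 1 -> f (evB (fun i => bcls w (par i)) y z (conds k)) <= 0.
Proof.
move=> h; have [|y y1 hy] := @reindexing_nat R w A hsigma t0 Tt0 G alpha V U conds' par.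
  move=> l e e0; apply: filterS (h e e0) => n [y y1 hy].
  exists y; split=> // j f z _ Tf z1.
  rewrite /conds'; case: unpickle => [k|]; first exact: hy.
  by rewrite /= (rpos0 (TF_rpos Tf)) ltW.
by exists y => // k f z Tf z1; have := hy (pickle k) f z Tf z1; rewrite /conds' pickleK.
Qed.

End SaturationCountable.

(** * Weak CPoU over the ultrapower *)

Section SquareRoots.
Variables (R : realType) (w : freeUltrafilter) (A : cstarAlgType R).
Hypothesis hsigma : sigma_unital A.
Variable t0 : A -> R[i].
Hypothesis Tt0 : tracial_state t0.
Local Notation B := (A_omega_b w A).
Local Notation TFB := (@TF R w A).
Variable one : B.
Hypothesis ta : tracial_alg one TFB.

(** The shift by e makes [cstar_sqrt] applicable in the coordinates: for M > |b|, (b + e)/(M + e) is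
    1 - q k1 with |k1| <= 1 and q = M/(M + e) < 1, and q k1 has self-adjoint lifts of norm below
    1. *)
Lemma pos_sqrt (b : B) (e : R) : 0 < e -> Pos TFB b ->
  exists s : B, star s = s /\ s ** s = b + e%:C%C *: one.
Proof.
move=> e0 pb; have sb := pos_sa pb.
pose M := rnorm b + 1; have M0 : 0 < M by rewrite ltr_wpDl ?rnorm_ge0.
have Me : 0 < M + e by rewrite addr_gt0.
have Mi : 0 <= M^-1 by rewrite invr_ge0 ltW.
have pM : Pos TFB (M%:C%C *: one - b) by apply: (norm_pos ta) => //; rewrite /M lerDl.
pose k1 := (M^-1)%:C%C *: (M%:C%C *: one - b).
have k1n : rnorm k1 <= 1.
  apply: (pos_norm1 ta); first by apply: (posZ ta).
  have -> : one - k1 = (M^-1)%:C%C *: b.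
    by rewrite /k1 scalerBr rZM mulVf ?gt_eqF// rZ1 opprB addrC subrK.
  exact: (posZ ta).
have sk1 : star k1 = k1 by rewrite /k1 starZr starB starZr (star_one ta) sb.
have [a ak a1] := lift_unit_ball hsigma Tt0 k1n.
pose q := M / (M + e).
have q0 : 0 <= q by rewrite divr_ge0 ?(ltW M0) ?(ltW Me).
have q1 : q < 1 by rewrite ltr_pdivrMr// mul1r ltrDl.
pose kn n := q%:C%C *: ((2^-1)%:C%C *: (a n + star (a n))).
have skn n : star (kn n) = kn n.
  by rewrite /kn !starZr starD starK addrC.
have kn1 n : rnorm (kn n) < 1.
  rewrite /kn !rnormZr (ger0_norm q0) gtr0_norm ?invr_gt0//.
  apply: le_lt_trans q1; rewrite -[leRHS]mulr1; apply: ler_wpM2l => //.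
  rewrite ler_pdivrMl// mulr1; apply: le_trans (rnormD _ _) _.
  by rewrite rnorm_star -[2]/(1 + 1)%R; apply: lerD.
have [c hc] := choice (fun n => cstar_sqrt (skn n) (kn1 n)).
have bc : bounded_seq c.
  (* From c^2 = 2c - k the norm satisfies |c|^2 <= 2|c| + 1, so it is below 3. *)
  exists 3 => n; have [cs ck _] := hc n.
  have : rnorm (c n) ^+ 2 <= 2 * rnorm (c n) + 1.
    rewrite -rnorm_sqr cs.
    have -> : c n ** c n = (c n + c n) - kn n by rewrite -ck; nc.
    apply: le_trans (rnormD _ _) _; rewrite rnormN; apply: lerD; last exact: ltW.
    by apply: le_trans (rnormD _ _) _; rewrite mulr_natl mulr2n.
  have := rnorm_ge0 (c n); nra.
pose C := bcls w (mk_linf bc).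
have kE : q%:C%C *: k1 = C + C - C ** C.
  have bk : bounded_seq kn by exists 1 => n; exact: ltW.
  have -> : q%:C%C *: k1 = bcls w (q%:C%C *: ((2^-1)%:C%C *: (a + star a))).
    rewrite !bclsZ bclsD bclsS ak sk1; congr (_ *: _).
    rewrite -mulr2n -rZn rZM mulVf ?rZ1//.
    by apply/eqP => /eqP; rewrite pnatr_eq0.
  rewrite /C -bclsM -bclsD -bclsB; congr bcls; apply: linf_ext => n.
  rewrite !linfDE linfNE linfME /=.
  by have [_ -> _] := hc n.
have sC : star C = C.
  by rewrite /C -bclsS; congr bcls; apply: linf_ext => n /=; have [] := hc n.
pose s := (Num.sqrt (M + e))%:C%C *: (one - C).
exists s; split; first by rewrite /s starZr starB (star_one ta) sC.
rewrite /s smulZl smulZr rZM -expr2 sqr_sqrtr ?(ltW Me)//.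
have -> : (one - C) ** (one - C) = one - (C + C - C ** C) by nc1.
rewrite -kE scalerBr rZM /q mulrCA mulfV ?gt_eqF// mulr1 /k1 rZM mulfV ?gt_eqF// rZ1.
by rewrite rZD; nc.
Qed.
End SquareRoots.

Section Conditions.
Variables (R : realType) (B : normedStarAlgType R) (one : B) (TF : set (B -> R)).
Hypothesis ta : tracial_alg one TF.

Lemma cond_eq0 (x : B) :
  (forall (f : B -> R) (z : B), TF f -> rnorm z <= 1 -> f (star x ** x) <= 0) -> x = 0.
Proof. by move=> h; apply: (ta_sep ta) => f Tf; apply: (h f 0) => //; rewrite rnorm0. Qed.

Lemma cond_pos (x : B) : star x = x ->
  (forall (f : B -> R) (z : B), TF f -> rnorm z <= 1 -> f (- (star z ** (x ** z))) <= 0) -> Pos TF x.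
Proof.
move=> sx h; split=> // f z Tf; have fp := ta_pos ta Tf.
pose M := rnorm z + 1; have M0 : 0 < M by rewrite ltr_wpDl ?rnorm_ge0.
have := h f ((M^-1)%:C%C *: z) Tf.
rewrite rnormZr gtr0_norm ?invr_gt0// ler_pdivrMl// mulr1 lerDl ler01 => /(_ isT).
rewrite rposN// starZr smulZl !smulZr !(rposZ fp) oppr_le0 mulrA.
by rewrite pmulr_rge0// mulr_gt0 ?invr_gt0.
Qed.
End Conditions.

Lemma ucv_dist (R : realType) (I : Type) (U : set_system I) {UU : UltraFilter U} (f : I -> R)
    (l c e : R) : ucv U f l -> (forall i, `|f i - c| <= e) -> `|l - c| <= e.
Proof.
move=> fl h; rewrite ler_distl; apply/andP; split.
  apply: ucv_le (ucv_cst _) fl _; apply: filterS filterT => i _ /=.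
  by have := h i; rewrite ler_distl => /andP[].
apply: ucv_le fl (ucv_cst _) _; apply: filterS filterT => i _ /=.
by have := h i; rewrite ler_distl => /andP[].
Qed.

Lemma countable_enum (X : Type) (x0 : X) (S : set X) : countable S ->
  exists s : nat -> X, forall x, S x -> exists n, s n = x.
Proof.
move=> /countable_injP[f fi].
have [n|s hs] := @choice nat X (fun n y => forall x, S x -> f x = n -> y = x).
  have [[x [Sx fx]]|h] := pselect (exists x, S x /\ f x = n).
    by exists x => y Sy fy; apply: fi; rewrite ?inE// fx.
  by exists x0 => x Sx fx; case: h; exists x.
by exists s => x Sx; exists (f x); exact: hs.
Qed.

Section WeakCPoU.
Variables (R : realType) (w : freeUltrafilter) (A : cstarAlgType R).
Hypothesis hsigma : sigma_unital A.
Variable t0 : A -> R[i].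
Hypothesis Tt0 : tracial_state t0.
Local Notation B := (A_omega_b w A).
Local Notation TFB := (@TF R w A).
Hypothesis hCPoU : weak_CPoU w A.
Variables (G : groupType) (alpha : action G A).
Variable one : B.
Hypothesis ta : tracial_alg one TFB.
Let w_ultra : UltraFilter (ultra_sets w) := ultra_ultra w.
Local Existing Instance w_ultra.

Lemma geval_sum (V U : Type) (C : normedStarAlgType R) (beta : G -> C -> C) (p : V -> C)
    (y : U -> C) (z : C) (J : Type) (s : seq J) (P : pred J) (F : J -> gexpr R G V U) :
  geval beta p y z (\big[@EAdd _ _ _ _/EZero]_(i <- s | P i) F i) =
  \sum_(i <- s | P i) geval beta p y z (F i).
Proof. by apply: (big_morph (geval beta p y z)). Qed.

Lemma TF_cst (a : A) f : TFB f -> exists2 tn : nat -> A -> R[i], (forall n, tracial_state (tn n)) &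
  ucv w (fun n => ret (tn n) a) (f (cst_embed w a)).
Proof. by move=> [tn [Ttn h]]; exists tn => //; exact: (h (linf_cst a)). Qed.

(** A may lack a unit; in coordinate n its role is played by the constant [par n], whose traces are
    almost 1. *)
Lemma unit_constants (par : linf A) (e : R) : bcls w par = one -> 0 < e ->
  ultra_sets w [set n | forall f, TFB f -> `|f (cst_embed w (par n)) - 1| <= e].
Proof.
move=> hp e0.
have h2 : ultra_sets w [set n | forall t (z : A), tracial_state t -> rnorm z <= 1 ->
    `|ret t (par n) - 1| < e].
  apply: (pick_bad Tt0 (Q := fun n t _ => `|ret t (par n) - 1| < e)) => tn _ Ttn _.
  have [f Tf hf] := TF_ex w hsigma Ttn.
  have := hf par; rewrite hp (ta_one ta Tf) => h.
  exact: (h _ e0).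
apply: filterS h2 => n /= h2 f Tf; have [tn Ttn hf] := TF_cst (par n) Tf.
by apply: (ucv_dist hf) => m; apply: ltW; apply: (h2 (tn m) 0) => //; rewrite rnorm0.
Qed.

Lemma cover_constants (J : Type) (s : J -> B) (par : J -> linf A) (d : R) :
  (forall j, bcls w (par j) = s j) ->
  (forall f, TFB f -> exists j, f (star (s j) ** s j) < d) ->
  ultra_sets w [set n | forall t, tracial_state t ->
    exists j, ret t (star (par j n) ** par j n) < d].
Proof.
move=> hp hs.
have h1 : ultra_sets w [set n | forall t (z : A), tracial_state t -> rnorm z <= 1 ->
    exists j, ret t (star (par j n) ** par j n) < d].
  apply: (pick_bad Tt0 (Q := fun n t _ => exists j, ret t (star (par j n) ** par j n) < d)) => tn _ Ttn _.
  have [f Tf hf] := TF_ex w hsigma Ttn; have [j fj] := hs f Tf.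
  have := hf (star (par j) ** par j); rewrite bclsM bclsS hp => h.
  have d0 : 0 < d - f (star (s j) ** s j) by rewrite subr_gt0.
  apply: filterS (h _ d0) => n /=; rewrite ltr_norml => /andP[_ hn].
  by exists j; move: hn; rewrite ltrD2r.
by apply: filterS h1 => n /= h1 t Tt; apply: (h1 t 0) => //; rewrite rnorm0.
Qed.

Definition cpou_conds k (d : R) (c : ('I_k.+1 * nat + bool)%type) :
    gexpr R G (option ('I_k.+1 + nat)) 'I_k.+1 :=
  match c with
  | inl (i, 0) => esq (esub (EStar (EUnk i)) (EUnk i))
  | inl (i, 1) => enonneg (EUnk i)
  | inl (i, 2) => esub (EMul (EMul (EStar (EPar (Some (inl i)))) (EPar (Some (inl i)))) (EUnk i))
                       (EScale d%:C%C (EUnk i))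
  | inl (i, n.+3) => esq (esub (EMul (EPar (Some (inr n))) (EUnk i)) (EMul (EUnk i) (EPar (Some (inr n)))))
  | inr true => esub (EPar None) (\big[@EAdd _ _ _ _/EZero]_(i < k.+1) EUnk i)
  | inr false => esub (\big[@EAdd _ _ _ _/EZero]_(i < k.+1) EUnk i) (EPar None)
  end.

(** The elements are given as star s ** s so that lifts of s yield positive elements of A in every
    coordinate. The gap between d' and d provides the strict bound on a supremum that weak CPoU asks
    for. *)
Lemma weak_CPoU_sqr (S : nat -> B) k (s : 'I_k.+1 -> B) (d' d : R) : d' < d ->
  (forall f, TFB f -> exists i, f (star (s i) ** s i) < d') ->
  exists e : 'I_k.+1 -> B,
    [/\ forall i, Pos TFB (e i), forall i, Pos TFB (one - e i),
        forall i n, S n ** e i = e i ** S n,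
        forall f, TFB f -> f (\sum_i e i) = 1 &
        forall i f, TFB f -> f (star (s i) ** s i ** e i) <= d * f (e i)].
Proof.
move=> dd hs.
have [par hp] := choice (fun v : option ('I_k.+1 + nat) => bclsP
  (match v with None => one | Some (inl i) => s i | Some (inr n) => S n end)).
have [e0 e0pos|e e1 he] := @reindexing R w A hsigma t0 Tt0 G alpha _ _ _ (cpou_conds d) par.
  have h1 := @cover_constants _ s (fun i => par (Some (inl i))) d' (fun i => esym (hp (Some (inl i)))) hs.
  have h2 := unit_constants (esym (hp None)) e0pos.
  apply: filterS (filterI h1 h2) => n /= [{h1}h1 {h2}h2].
  pose S' : set B := range (fun j => cst_embed w (par (Some (inr j)) n)).
  have cS : countable S' by apply: sub_countable (countableP _); exact: card_image_le.
  pose a i := star (par (Some (inl i)) n) ** par (Some (inl i)) n.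
  have pa i : positive (a i) by exists (par (Some (inl i)) n).
  have [|y [y1 y2]] := hCPoU (countable_separable hsigma Tt0 cS) pa (delta := d).
    apply: le_lt_trans dd; apply: ge_sup => [|_ [t Tt <-]].
      by exists (\big[Num.min/complex.Re (t0 (a ord0))]_(i < k.+1) complex.Re (t0 (a i))), t0.
    have [i hi] := h1 t Tt; apply: le_trans (ltW hi).
    exact: bigmin_le_cond.
  exists y => [i|c f z Tf z1'].
    by rewrite -lecR rnormE; have [_ ->] := y1 i.
  have fp := TF_rpos Tf.
  have [t lt ft] := limit_TF hsigma Tf.
  have py i : Pos TFB (y i).
    by have [[x ->] _ _] := y1 i; exact: (pos_sqr ta).
  have fu := h2 f Tf.
  have fy : f (\sum_i y i) = 1.
    by rewrite ft /ret; have [-> _] := y2 t lt.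
  case: c => [[i [|[|[|j]]]]|[]]; rewrite /cpou_conds.
  - by rewrite /= scaleN1r (pos_sa (py i)) subrr smul0 (rpos0 fp) ltW.
  - rewrite geval_nonneg (rposN fp); apply: le_trans (ltW e0pos).
    by rewrite oppr_le0; have [_] := py i; apply.
  - rewrite geval_sub /= (rposB fp) (rposZ fp); apply: le_trans (ltW e0pos).
    rewrite subr_le0; have [_ /(_ i)] := y2 t lt; rewrite ft /ret lecE => /andP[_].
    rewrite /a; case: (t (y i)) => u v; rewrite /= mul0r subr0.
    by congr (_ <= _); congr complex.Re; congr (t (_ ** _)); rewrite /cst_embed -bclsS -bclsM; congr bcls; apply: linf_ext.
  - have -> : geval (act_omega alpha) (fun i => cst_embed w (par i n)) y z
        (esq (esub (EMul (EPar (Some (inr j))) (EUnk i)) (EMul (EUnk i) (EPar (Some (inr j)))))) = 0.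
      have [_ _ /(_ (cst_embed w (par (Some (inr j)) n)))] := y1 i.
      have I : S' (cst_embed w (par (Some (inr j)) n)) by exists j.
      by move=> /(_ I) /= ->; rewrite scaleN1r subrr smul0.
    by rewrite (rpos0 fp) ltW.
  - by rewrite geval_sub /= geval_sum /= (rposB fp) fy; apply: le_trans fu; exact: ler_norm.
  - rewrite geval_sub /= geval_sum /= (rposB fp) fy.
    by apply: le_trans fu; rewrite distrC; exact: ler_norm.
have parE : (fun i => bcls w (par i)) = fun v => match v with None => one | Some (inl i) => s i | Some (inr n) => S n end.
  by apply/funext => v; rewrite -hp.
rewrite parE in he.
have sa i : star (e i) = e i.
  apply/eqP; rewrite -subr_eq0; apply/eqP; apply: (cond_eq0 ta) => f z Tf z1.
  by have := he (inl (i, 0)) f z Tf z1; rewrite /= scaleN1r.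
exists e; split=> [i|i|i n|f Tf|i f Tf].
- apply: (cond_pos ta) => // f z Tf z1.
  by have := he (inl (i, 1)) f z Tf z1; rewrite geval_nonneg.
- by apply: (norm1_pos ta).
- apply/eqP; rewrite -subr_eq0; apply/eqP; apply: (cond_eq0 ta) => f z Tf z1.
  by have := he (inl (i, n.+3)) f z Tf z1; rewrite /= scaleN1r.
- have z1 : rnorm (0 : B) <= 1 by rewrite rnorm0.
  have fp := TF_rpos Tf.
  have := he (inr true) f 0 Tf z1; have := he (inr false) f 0 Tf z1.
  rewrite /cpou_conds !geval_sub geval_sum /= !(rposB fp) (ta_one ta Tf) !subr_le0.
  by move=> h1 h2; apply/le_anti; rewrite h1 h2.
- have z1 : rnorm (0 : B) <= 1 by rewrite rnorm0.
  have := he (inl (i, 2)) f 0 Tf z1.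
  by rewrite /cpou_conds geval_sub /= (rposB (TF_rpos Tf)) (rposZ (TF_rpos Tf)) subr_le0.
Qed.
End WeakCPoU.

(** * Traces as limits of functionals *)

Lemma phase (R : realType) (z : R[i]) : exists2 u : R[i], rnorm u <= 1 & complex.Re (u * z) = rnorm z.
Proof.
have [->|z0] := eqVneq z 0; first by exists 0; rewrite ?mul0r ?rnorm0.
have nz : `|z| != 0 by rewrite normr_eq0.
exists (Num.conj_op z / `|z|).
  by rewrite -lecR rnormE normrM normfV normr_id norm_conjC mulfV.
rewrite mulrAC -normCKC expr2 mulfK//.
Qed.

Section RealFunctionals.
Variables (R : realType) (C : normedStarAlgType R).

(** The trace is the complexification x |-> phi x - i phi(i x). Multiplying x by the phase of t x
    shows that its norm is that of phi, which the last two hypotheses make 1. *)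
Lemma tracial_of_real (phi : C -> R) : rpos phi -> (forall x y, phi (x ** y) = phi (y ** x)) ->
  (forall x, rnorm x <= 1 -> `|phi x| <= 1) ->
  (forall e, 0 < e -> exists2 x : C, rnorm x <= 1 & 1 - e < phi x) ->
  exists2 t, tracial_state t & ret t = phi.
Proof.
move=> fp fC f1 f2; pose t (x : C) : R[i] := Complex (phi x) (- phi ('i%C *: x)).
have sc : scalar t.
  move=> [a b] x y.
  have zE (v : C) : Complex a b *: v = a%:C%C *: v + b%:C%C *: ('i%C *: v).
    by rewrite scalerA -scalerDl; congr (_ *: _); simpc.
  have iE (v : C) : 'i%C *: ('i%C *: v) = - (v : C).
    by rewrite scalerA -expr2 sqr_i scaleN1r.
  rewrite /t !(rposD fp, scalerDr) zE !(scalerDr, rposD fp, rposZ fp).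
  have -> : 'i%C *: (b%:C%C *: ('i%C *: x)) = - (b%:C%C *: x).
    by rewrite scalerA mulrC -scalerA iE scalerN.
  have -> : 'i%C *: (a%:C%C *: x) = a%:C%C *: ('i%C *: x) by rewrite !scalerA mulrC.
  rewrite (rposN fp) !(rposZ fp); simpc.
  apply/eqP; rewrite eq_complex /=; apply/andP; split; apply/eqP; ring.
exists t => //; split=> //.
- move=> x; rewrite /t lecE /= rpos_ge0// andbT.
  have : phi ('i%C *: (star x ** x)) = phi (- ('i%C *: (star x ** x))).
    have := rposS fp x ('i%C *: x); rewrite smulZr => ->; rewrite starZ smulZl -scaleNr.
    by congr (phi (_ *: _)); apply/eqP; rewrite eq_complex /= oppr0 !eqxx.
  rewrite (rposN fp) => h; apply/eqP; lra.
- move=> x y; have h : phi ('i%C *: (x ** y)) = phi ('i%C *: (y ** x)).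
    by rewrite -smulZl fC smulZr.
  by rewrite /t fC h.
have tn x : rnorm x <= 1 -> rnorm (t x) <= 1.
  move=> x1; have [u u1 <-] := phase (t x).
  have t0 : t 0 = 0 by rewrite /t scaler0 (rpos0 fp) oppr0.
  have -> : u * t x = t (u *: x) by have := sc u x 0; rewrite t0 !addr0 => ->.
  rewrite /t /=; apply: le_trans (ler_norm _) _; apply: f1.
  rewrite rnormZ -[1]mulr1; apply: ler_pM => //; exact: rnorm_ge0.
apply/le_anti/andP; split.
  apply: ge_sup; first by exists (rnorm (t 0)), 0 => //=; rewrite rnorm0.
  by move=> _ [x /= x1 <-]; exact: tn.
apply/ler_addgt0Pr => e e0; have [x x1 hx] := f2 e e0.
rewrite -lerBlDr; apply: le_trans (ltW hx) _; apply: le_trans (ler_norm _) _.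
apply: le_trans (Re_le_normC (t x)) _; apply: ub_le_sup; last by exists x.
by exists 1 => _ [y /= y1 <-]; exact: tn.
Qed.

Lemma tracial_normalize (phi : C -> R) x1 (K : R) : rpos phi ->
  (forall x y, phi (x ** y) = phi (y ** x)) ->
  (forall x, `|phi x| <= K * rnorm x) -> phi x1 != 0 ->
  exists t c, [/\ tracial_state t, 0 < c, c <= K & forall x, phi x = c * ret t x].
Proof.
move=> fp fC fK p1; pose E := [set `|phi x| | x in [set x : C | rnorm x <= 1]].
have Eu : has_ubound E.
  exists K => _ [x /= x1' <-]; apply: le_trans (fK x) _.
  have K0 : 0 <= K.
    have x0 : 0 < rnorm x1.
      rewrite lt_neqAle rnorm_ge0 andbT eq_sym; apply: contra_neq p1 => /rnorm0_eq0 ->.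
      exact: rpos0.
    by rewrite -(pmulr_lge0 _ x0); apply: le_trans (fK x1).
  by rewrite -[leRHS]mulr1; apply: ler_wpM2l.
pose c := sup E.
have x0 : 0 < rnorm x1.
  rewrite lt_neqAle rnorm_ge0 andbT eq_sym; apply: contra_neq p1 => /rnorm0_eq0 ->.
  exact: rpos0.
have cge x : `|phi x| <= c * rnorm x.
  have [x0'|xn] := eqVneq (rnorm x) 0.
    by rewrite x0' mulr0 (rnorm0_eq0 x0') (rpos0 fp) normr0.
  have xp : 0 < rnorm x by rewrite lt_neqAle eq_sym xn rnorm_ge0.
  rewrite -ler_pdivrMr//; apply: ub_le_sup => //.
  exists (((rnorm x)^-1)%:C%C *: x) => /=.
    by rewrite rnormZr gtr0_norm ?invr_gt0// mulVf.
  by rewrite (rposZ fp) normrM gtr0_norm ?invr_gt0// mulrC.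
have c0 : 0 < c.
  have := cge x1; rewrite -ler_pdivrMr//; apply: lt_le_trans.
  by rewrite divr_gt0// normr_gt0.
have cK : c <= K.
  apply: ge_sup; first by exists `|phi 0|, 0 => //=; rewrite rnorm0.
  move=> _ [x /= x1' <-]; apply: le_trans (fK x) _.
  have K0 : 0 <= K by rewrite -(pmulr_lge0 _ x0); apply: le_trans (fK x1).
  by rewrite -[leRHS]mulr1; apply: ler_wpM2l.
have ci : 0 <= c^-1 by rewrite invr_ge0 ltW.
have [||||t Tt tE] := @tracial_of_real (fun x => c^-1 * phi x).
- split=> [x y|d x|x y|x]; first by rewrite (rposD fp) mulrDr.
  + by rewrite (rposZ fp) mulrCA.
  + by rewrite (rposS fp).
  + by apply: mulr_ge0 => //; exact: (rpos_ge0 fp).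
- by move=> x y; rewrite fC.
- move=> x x1'; rewrite normrM (ger0_norm ci) ler_pdivrMl// mulr1.
  by apply: le_trans (cge x) _; rewrite -[leRHS]mulr1; apply: ler_wpM2l => //; exact: ltW.
- move=> e e0.
  have [||_ [x x1' <-] hx] := @sup_adherent R E (c * e); first by rewrite mulr_gt0.
    by split=> //; exists `|phi 0|, 0 => //=; rewrite rnorm0.
  have [p0|p0] := leP 0 (phi x).
    by exists x => //; rewrite ltr_pdivlMl// mulrBr mulr1; move: hx; rewrite ger0_norm.
  exists (- x); first by rewrite rnormN.
  by rewrite ltr_pdivlMl// mulrBr mulr1 (rposN fp); move: hx; rewrite ltr0_norm.
exists t, c; split=> // x; rewrite tE mulrA mulfV ?gt_eqF// mul1r//.
Qed.
End RealFunctionals.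

(** Limits along this ultrafilter serve as cluster points of nets indexed by finite sets, in every
    compactness argument below. *)
Lemma finite_set_ultrafilter (X : eqType) : exists U : set_system (seq X), UltraFilter U /\
  forall x, U [set D : seq X | x \in D].
Proof.
pose F : set_system (seq X) := [set P : set (seq X) | exists D0 : seq X, forall D : seq X, {subset D0 <= D} -> P D].
have FF : ProperFilter F.
  split; first by move=> [D0 /(_ D0)]; apply.
  split=> [|P Q [D1 h1] [D2 h2]|P Q PQ [D0 h]].
  - by exists [::].
  - exists (D1 ++ D2) => D hD; split; [apply: h1|apply: h2] => x xD; apply: hD;
      by rewrite mem_cat xD ?orbT.
  - by exists D0 => D hD; apply: PQ; exact: h.
have [U [UU FU]] := ultraFilterLemma FF; exists U; split=> // x; apply: FU.
by exists [:: x] => D; apply; rewrite inE.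
Qed.

(** * Convexity of the set of limit traces *)

Section Convexity.
Variables (R : realType) (w : freeUltrafilter) (A : cstarAlgType R).
Hypothesis hsigma : sigma_unital A.
Local Notation B := (A_omega_b w A).
Local Notation TFB := (@TF R w A).
Let w_ultra : UltraFilter (ultra_sets w) := ultra_ultra w.
Local Existing Instance w_ultra.

Lemma tracial_state_attain (t : A -> R[i]) (d : R) : tracial_state t -> 0 < d ->
  exists2 x : A, rnorm x <= 1 & 1 - d < ret t x.
Proof.
move=> Tt d0; have [sc _ _ s1] := Tt.
have [|_ [x /= x1 <-]] := @sup_adherent R [set rnorm (t x) | x in [set x | rnorm x <= 1]] d d0.
  split; first by exists (rnorm (t 0)), 0 => //=; rewrite rnorm0.
  by exists 1 => _ [x /= x1 <-]; exact: (trace_le1 Tt).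
rewrite s1 => hx; have [u u1 hu] := phase (t x); exists (u *: x).
  by rewrite rnormZ -[1]mulr1; apply: ler_pM => //; exact: rnorm_ge0.
by rewrite /ret (traceZ Tt) hu.
Qed.

(** Without a unit, norm 1 has to be witnessed by one contraction for finitely many traces at once:
    a late e_n^2 of the approximate unit. *)
Lemma tracial_state_combination (J : Type) (s : seq J) (c : J -> R) (t : J -> A -> R[i]) :
  (forall j, 0 <= c j) -> \sum_(j <- s) c j = 1 -> (forall j, tracial_state (t j)) ->
  exists2 t', tracial_state t' & forall x, ret t' x = \sum_(j <- s) c j * ret (t j) x.
Proof.
move=> c0 c1 Tt; have fp j := ret_rpos (Tt j).
suff [t' Tt' e] : exists2 t', tracial_state t' & ret t' = fun x => \sum_(j <- s) c j * ret (t j) x.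
  by exists t' => // x; rewrite e.
apply: tracial_of_real.
- split=> [x y|d x|x y|x].
  + by rewrite -big_split; apply: eq_bigr => j _; rewrite (rposD (fp j)) mulrDr.
  + by rewrite mulr_sumr; apply: eq_bigr => j _; rewrite (rposZ (fp j)) mulrCA.
  + by apply: eq_bigr => j _; rewrite (rposS (fp j)).
  + by apply: sumr_ge0 => j _; apply: mulr_ge0 => //; exact: (rpos_ge0 (fp j)).
- by move=> x y; apply: eq_bigr => j _; rewrite (retC (Tt j)).
- move=> x x1; apply: le_trans (ler_norm_sum _ _ _) _; rewrite -c1.
  apply: ler_sum => j _; rewrite normrM ger0_norm// -[leRHS]mulr1; apply: ler_wpM2l => //.
  exact: le_trans (ret_le (Tt j) x) x1.
move=> d d0; have d4 : 0 < d / 5 by rewrite divr_gt0.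
have [e [he _ hl _]] := hsigma.
have en1 n : rnorm (e n) <= 1 by rewrite -lecR rnormE; have [] := he n.
have ese n : star (e n) = e n by have [[y ->] _] := he n; rewrite starM starK.
(* If t x > 1 - d/5 for a contraction x, then t(e_n x) > 1 - 2d/5 for large n, which bounds the
   2-norm of e_n below; y^2 >= 2y - 1 gives t(e_n^2) > 1 - 4d/5. *)
have one_trace j : exists N, forall n, (N <= n)%N -> 1 - d * (4 / 5) < ret (t j) (e n ** e n).
  have [x x1 hx] := tracial_state_attain (Tt j) d4.
  have [N _ hN] : \forall n \near \oo, rnorm (x - e n ** x) < d / 5.
    have /cvgrPdist_lt/(_ (d / 5)%:C%C) := hl x; rewrite ltcR => /(_ d4).
    by apply: filterS => n; rewrite -rnormE ltcR.
  exists N => n Nn; have {}hN := hN n Nn.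
  have h1 : ret (t j) x <= ret (t j) (e n ** x) + d / 5.
    rewrite -lerBlDl -(rposB (fp j)); apply: le_trans (ler_norm _) _.
    by apply: le_trans (ret_le (Tt j) _) _; exact: ltW.
  have h2 : ret (t j) (e n ** x) <= fnorm (ret (t j)) (e n).
    rewrite -{1}(ese n); apply: le_trans (ler_norm _) _.
    apply: le_trans (cauchy_schwarz (fp j) _ _) _.
    rewrite -[leRHS]mulr1; apply: ler_wpM2l; first exact: fnorm_ge0.
    exact: le_trans (norm2_le (Tt j) x) x1.
  have h3 := fnorm_sqr (fp j) (e n); rewrite ese in h3; rewrite -h3.
  have := sqr_ge0 (fnorm (ret (t j)) (e n) - 1); move: h1 h2 hx d0; clear.
  rewrite sqrrB1 => h1 h2 h3 d0; lra.
have [n hn] : exists n, forall m, (n <= m)%N -> \sum_(j <- s) c j * (1 - d * (4 / 5)) <=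
    \sum_(j <- s) c j * ret (t j) (e m ** e m).
  elim: (s) => [|j s' [N hN]]; first by exists 0 => m _; rewrite !big_nil.
  have [M hM] := one_trace j; exists (maxn M N) => m; rewrite geq_max => /andP[Mm Nm].
  by rewrite !big_cons; apply: lerD (hN m Nm); apply: ler_wpM2l => //; exact/ltW/hM.
exists (e n ** e n).
  apply: le_trans (rnorm_smul _ _) _; rewrite -[1]mulr1.
  by apply: ler_pM; rewrite ?rnorm_ge0 ?en1.
apply: lt_le_trans (hn n (leqnn n)); rewrite -mulr_suml c1 mul1r ltrD2l ltrN2.
by rewrite -[ltRHS]mulr1 ltr_pM2l// ltr_pdivrMr// mul1r ltr_nat.
Qed.

Lemma TF_combination (J : Type) (s : seq J) (c : J -> R) (f : J -> B -> R) :
  (forall j, 0 <= c j) -> \sum_(j <- s) c j = 1 -> (forall j, TFB (f j)) ->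
  TFB (fun x => \sum_(j <- s) c j * f j x).
Proof.
move=> c0 c1 Tf; have [tn Ttn] := choice Tf.
have hn n : exists t, tracial_state t /\ forall x, ret t x = \sum_(j <- s) c j * ret (tn j n) x.
  have [|t Tt tE] := @tracial_state_combination _ s c (fun j => tn j n) c0 c1; last by exists t.
  by move=> j; have [] := Ttn j.
have [t Tt] := choice hn; exists t; split=> [n|a]; first by have [] := Tt n.
apply: (@ucv_eq _ _ _ (fun n => \sum_(j <- s) c j * ret (tn j n) (a n))).
  by move=> n; have [_ ->] := Tt n.
elim: (s) => [|j s' ih].
  apply: (@ucv_eq _ _ _ (fun=> 0)) => [n|]; rewrite big_nil//; exact: ucv_cst.
apply: (@ucv_eq _ _ _ (fun n => c j * ret (tn j n) (a n) + \sum_(j <- s') c j * ret (tn j n) (a n))).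
  by move=> n; rewrite big_cons.
rewrite big_cons; apply: ucvD ih; apply: ucvZ; have [_] := Ttn j; exact.
Qed.
End Convexity.

(** * Traces compressed by positive elements *)

Section Compactness.
Variables (R : realType) (w : freeUltrafilter) (A : cstarAlgType R).
Hypothesis hsigma : sigma_unital A.
Variable t0 : A -> R[i].
Hypothesis Tt0 : tracial_state t0.
Local Notation B := (A_omega_b w A).
Local Notation TFB := (@TF R w A).
Variable one : B.
Hypothesis ta : tracial_alg one TFB.
Let w_ultra : UltraFilter (ultra_sets w) := ultra_ultra w.
Local Existing Instance w_ultra.

Lemma cst_embedD (x y : A) : cst_embed w (x + y) = cst_embed w x + cst_embed w y.
Proof. by rewrite /cst_embed -bclsD; congr bcls; apply: linf_ext. Qed.
Lemma cst_embedZ c (x : A) : cst_embed w (c *: x) = c *: cst_embed w x.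
Proof. by rewrite /cst_embed -bclsZ; congr bcls; apply: linf_ext. Qed.
Lemma cst_embedM (x y : A) : cst_embed w (x ** y) = cst_embed w x ** cst_embed w y.
Proof. by rewrite /cst_embed -bclsM; congr bcls; apply: linf_ext. Qed.
Lemma cst_embedS (x : A) : cst_embed w (star x) = star (cst_embed w x).
Proof. by rewrite /cst_embed -bclsS; congr bcls; apply: linf_ext. Qed.

Lemma tr_pos_mul f (x y : B) : TFB f -> Pos TFB x -> Pos TFB y -> 0 <= f (x ** y).
Proof.
move=> Tf px py; have fp := TF_rpos Tf; have fx := pos_tr ta Tf px.
apply/ler_addgt0Pr => e e0; pose d := e / (f x + 1).
have f1 : 0 < f x + 1 by rewrite ltr_wpDl.
have d0 : 0 < d by rewrite divr_gt0.
have [s [ss es]] := pos_sqrt hsigma Tt0 ta d0 py.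
have := tr_pos_sqr ta s Tf px; rewrite ss es (TF_C Tf) smulDr smulZr (smul1r ta).
rewrite (rposD fp) (rposZ fp) => /le_trans; apply; rewrite lerD2l /d mulrAC ler_pdivrMr//.
by apply: ler_wpM2l; [exact: ltW|rewrite lerDl].
Qed.

Lemma reduced_rpos f (r : B) : TFB f -> Pos TFB r -> rpos (fun x => f (r ** x)).
Proof.
move=> Tf pr; have fp := TF_rpos Tf; split=> [x y|c x|x y|x].
- by rewrite smulDr (rposD fp).
- by rewrite smulZr (rposZ fp).
- by rewrite -(tr_star ta _ Tf) !starM starK (pos_sa pr) (TF_C Tf).
- by rewrite (TF_C Tf); exact: (tr_pos_sqr ta).
Qed.

Lemma reduced_le f (r x : B) : TFB f -> Pos TFB r -> `|f (r ** x)| <= f r * rnorm x.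
Proof.
move=> Tf pr; have fp := TF_rpos Tf; have rp := reduced_rpos Tf pr.
have fr := pos_tr ta Tf pr; pose M := rnorm x.
have h : f (r ** (star x ** x)) <= f r * M ^+ 2.
  have hp : Pos TFB ((M ^+ 2)%:C%C *: one - star x ** x).
    apply: (norm_pos ta); first by rewrite starM starK.
    by apply: le_trans (rnorm_smul _ _) _; rewrite rnorm_star.
  have := tr_pos_mul Tf pr hp; rewrite smulDr smulN smulZr (smul1r ta) (rposB fp) (rposZ fp).
  by rewrite subr_ge0 mulrC.
have := cauchy_schwarz rp one x; rewrite (star_one ta) (smul1l ta) => /le_trans; apply.
rewrite -(@ler_pXn2r _ 2) ?nnegrE ?mulr_ge0 ?fnorm_ge0 ?rnorm_ge0//.
rewrite exprMn !(fnorm_sqr rp) (star_one ta) (smul1l ta) (smul1r ta) exprMn expr2 -mulrA.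
by apply: ler_wpM2l.
Qed.

(* Otherwise the functionals x |-> f (r x) / f r would cluster, along the finite sets,
   at a trace on A contradicting the hypothesis. *)
Lemma cover_commuting (J : Type) (a : J -> A) (j0 : J) (d : R) : 0 < d ->
  (forall t, tracial_state t -> exists j, ret t (a j) < d) ->
  exists D0 : seq A, forall r, Pos TFB r ->
    (forall x, x \in D0 -> r ** cst_embed w x = cst_embed w x ** r) ->
    forall f, TFB f -> 0 < f r -> exists j, f (r ** cst_embed w (a j)) < d * f r.
Proof.
move=> d0 ha; apply/not_existsP => h.
have /choice[F hF] : forall D : seq A, exists F : B * (B -> R), [/\ Pos TFB F.1,
    forall x, x \in D -> F.1 ** cst_embed w x = cst_embed w x ** F.1,
    TFB F.2, 0 < F.2 F.1 & forall j, d * F.2 F.1 <= F.2 (F.1 ** cst_embed w (a j))].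
  move=> D.
  have /existsNP[r /not_implyP[pr /not_implyP[cr]]] := h D.
  move=> /existsNP[f /not_implyP[Tf /not_implyP[fr /forallNP hj]]].
  by exists (r, f); split=> // j; rewrite leNgt; apply/negP.
have [U [UU UD]] := finite_set_ultrafilter A.
pose phi D (x : A) := (F D).2 ((F D).1 ** cst_embed w x) / (F D).2 (F D).1.
have cstle x : rnorm (cst_embed w x : B) <= rnorm x.
  by apply: le_trans (rnorm_bcls _ _) _; rewrite rnorm_linf; apply: linf_sup_le.
have phile D x : `|phi D x| <= rnorm x.
  have [pr _ Tf fr _] := hF D.
  rewrite normrM normfV (gtr0_norm fr) ler_pdivrMr// mulrC.
  apply: le_trans (reduced_le _ Tf pr) _; apply: ler_wpM2l => //; exact: ltW.
have [psi hpsi] := choice (fun x => ucv_ex (U := U) (phile^~ x)).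
have rp D : rpos (phi D).
  have [pr _ Tf fr _] := hF D; have rp := reduced_rpos Tf pr.
  split=> [x y|c x|x y|x]; rewrite /phi.
  - by rewrite -mulrDl -(rposD rp) cst_embedD.
  - by rewrite mulrA -(rposZ rp) cst_embedZ.
  - by rewrite !cst_embedM !cst_embedS (rposS rp).
  - rewrite cst_embedM cst_embedS.
    by apply: mulr_ge0; [exact: (rpos_ge0 rp)|rewrite invr_ge0 ltW].
have psile x : `|psi x| <= rnorm x.
  have := ucv_dist (c := 0) (hpsi x) (e := rnorm x); rewrite subr0; apply => D.
  by rewrite subr0.
have psip : rpos psi.
  split=> [x y|c x|x y|x].
  - by apply: ucv_unique (hpsi _) _; apply: ucv_eq (ucvD (hpsi x) (hpsi y)) => D; rewrite (rposD (rp D)).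
  - by apply: ucv_unique (hpsi _) _; apply: ucv_eq (ucvZ c (hpsi x)) => D; rewrite (rposZ (rp D)).
  - by apply: ucv_unique (hpsi _) _; apply: ucv_eq (hpsi _) => D; rewrite (rposS (rp D)).
  - apply: ucv_le (ucv_cst 0) (hpsi _) _; apply: filterS filterT => D _ /=.
    exact: (rpos_ge0 (rp D)).
have psiC x y : psi (x ** y) = psi (y ** x).
  apply: ucv_unique (hpsi _) _; apply: ucv_near (hpsi (y ** x)) => e e0.
  apply: filterS (UD x) => D /= xD; have [_ /(_ x xD) cx Tf _ _] := hF D.
  suff -> : phi D (y ** x) = phi D (x ** y) by rewrite subrr normr0.
  by rewrite /phi !cst_embedM (smulA _ (cst_embed w y)) (TF_C Tf _ (cst_embed w x)) smulA -cx -smulA.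
have psia j : d <= psi (a j).
  apply: ucv_le (ucv_cst d) (hpsi _) _; apply: filterS filterT => D _ /=.
  by have [_ _ _ fr /(_ j)] := hF D; rewrite /phi ler_pdivlMr.
have [||||t [c [Tt c0 c1 tE]]] := @tracial_normalize R A psi (a j0) 1.
- exact: psip.
- exact: psiC.
- by move=> x; rewrite mul1r; exact: psile.
- by rewrite gt_eqF//; apply: lt_le_trans (psia j0).
have [j hj] := ha t Tt; have := psia j; rewrite tE leNgt => /negP; apply.
apply: le_lt_trans (hj); rewrite ler_piMl//.
have : 0 <= c * ret t (a j) by rewrite -tE; apply: le_trans (psia j); exact: ltW.
by rewrite pmulr_rge0.
Qed.
End Compactness.

(** * Partitions of unity with commuting translates *)

Lemma countable_setU (X : Type) (S S' : set X) : countable S -> countable S' -> countable (S `|` S').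
Proof.
by move=> cS cS'; rewrite -bigcup2E; apply: bigcup_countable => [|[|[|i]] _]//=; exact: countable0.
Qed.

Lemma countable_image (X Y : Type) (f : X -> Y) (S : set X) : countable S -> countable (f @` S).
Proof. by apply: sub_countable; exact: card_image_le. Qed.

Section ExhaustionArithmetic.
Variable R : realFieldType.
Implicit Types d e x y z : R.
(** The inequalities of [exhaust_step]: the first two verify the cover hypothesis when f(r) is above
    and below e, the other three read off the conclusion. *)
Lemma exhaust_arith1 d e x y : y < d * x -> d * e < d * x -> 0 < d * e ->
  y + 2 * d * (1 - x) + d * e / 8 * 1 < 2 * d - d * e * (3 / 4).
Proof. by move=> h1 h2 h3; lra. Qed.
Lemma exhaust_arith2 d e x : x <= 2 * d - d * e -> 0 < d * e ->
  x + d * e / 8 * 1 < 2 * d - d * e * (3 / 4).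
Proof. by move=> h1 h2; lra. Qed.
Lemma exhaust_arith3 d e x y z : 0 <= d * e * y ->
  z + 2 * d * (y - x) + d * e / 8 * y <= (2 * d - d * e * (1 / 2)) * y -> z <= 2 * d * x.
Proof. by move=> h1 h2; lra. Qed.
Lemma exhaust_arith4 d e x y z : 0 < d -> 0 <= z -> 0 <= d * e * y ->
  z + 2 * d * (y - x) + d * e / 8 * y <= (2 * d - d * e * (1 / 2)) * y -> e / 4 * y <= x.
Proof. by move=> d0 h1 h2 h3; rewrite -(ler_pM2l d0); lra. Qed.
Lemma exhaust_arith5 d e k x y : 0 < d -> 0 < e -> e <= 1 -> 0 <= y -> k * e = 2 * d - d * e ->
  k * x + d * e / 8 * y <= (2 * d - d * e * (1 / 2)) * y -> x <= 2 * e * y.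
Proof.
move=> d0 e0 e1 y0 ke h.
have k0 : 0 < k.
  by rewrite -(pmulr_lgt0 _ e0) ke; have := ler_wpM2l (ltW d0) e1; lra.
rewrite -(ler_pM2l k0).
have -> : k * (2 * e * y) = 2 * (k * e) * y by ring.
rewrite ke; have := mulr_ge0 (ltW (mulr_gt0 d0 e0)) y0.
have : 0 <= d * (1 - e) * y by rewrite !mulr_ge0 ?subr_ge0 ?(ltW d0).
lra.
Qed.
End ExhaustionArithmetic.

Section Exhaustion.
Variables (R : realType) (w : freeUltrafilter) (A : cstarAlgType R).
Hypothesis hsigma : sigma_unital A.
Variable t0 : A -> R[i].
Hypothesis Tt0 : tracial_state t0.
Local Notation B := (A_omega_b w A).
Local Notation TFB := (@TF R w A).
Hypothesis hCPoU : weak_CPoU w A.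
Variables (G : groupType) (alpha : action G A).
Variable one : B.
Hypothesis ta : tracial_alg one TFB.

(* The weights e_i come from weak CPoU for the elements r a_i + 2 d (1 - r) together
   with a multiple of r, which is small on the traces where r already is. *)
Lemma exhaust_step (S : nat -> B) k (a : 'I_k.+1 -> B) (r : B) (d eps : R) :
  0 < d -> 0 < eps -> eps <= 1 -> Pos TFB r -> Pos TFB (one - r) ->
  (forall i, Pos TFB (a i)) -> (forall i, r ** a i = a i ** r) ->
  (forall f, TFB f -> 0 < f r -> exists i, f (r ** a i) < d * f r) ->
  exists e : 'I_k.+1 -> B,
    [/\ forall i, Pos TFB (e i) /\ Pos TFB (one - e i),
        forall i n, S n ** e i = e i ** S n,
        forall i, r ** e i = e i ** r,
        forall i f, TFB f -> f (a i ** (r ** e i)) <= 2 * d * f (r ** e i) &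
        forall f, TFB f -> eps / 4 * (f r - 2 * eps) <= \sum_i f (r ** e i)].
Proof.
move=> d0 e0 e1 pr pr1 pa ra hr; have de : 0 < d * eps by rewrite mulr_gt0.
(* With kap * eps = 2d - d eps the two cases balance: if f(r) > eps, some f(r a_j) + 2d(1 - f(r)) is
   below 2d - d eps; otherwise kap f(r) is at most this. The slack d eps absorbs the shift d eps/8
   of the square roots. *)
pose kap := (2 * d - d * eps) / eps.
have dle : d * eps <= d by rewrite -[leRHS]mulr1 ler_pM2l.
have k0 : 0 <= kap by rewrite divr_ge0 ?(ltW e0)//; lra.
pose b (i : 'I_k.+2) : B := if unlift ord0 i is Some j then r ** a j + (2 * d)%:C%C *: (one - r)
  else kap%:C%C *: r.
have pb i : Pos TFB (b i).
  rewrite /b; case: unlift => [j|]; last exact: (posZ ta).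
  apply: (posD ta); first exact: (pos_mul ta).
  by apply: (posZ ta) => //; lra.
have e8 : 0 < d * eps / 8 by rewrite divr_gt0.
have /choice[s hs] : forall i, exists s, star s ** s = b i + (d * eps / 8)%:C%C *: one.
  by move=> i; have [s [ss sE]] := pos_sqrt hsigma Tt0 ta e8 (pb i); exists s; rewrite ss.
pose S' n := if n is m.+1 then S m else r.
have dd : 2 * d - d * eps * (3 / 4) < 2 * d - d * eps * (1 / 2) by lra.
have [|e [ep ep1 eS esum ea]] := @weak_CPoU_sqr R w A hsigma t0 Tt0 hCPoU G alpha one ta S' _ s _ _ dd.
  move=> f Tf; have fp := TF_rpos Tf; have f1 := ta_one ta Tf.
  have [fr|fr] := ltP eps (f r).
    have [||j hj] := hr f; [exact: Tf|exact: lt_trans fr|].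
    exists (lift ord0 j); rewrite hs /b liftK !(rposD fp) !(rposZ fp) (rposB fp) f1.
    have : d * eps < d * f r by rewrite ltr_pM2l.
    by move=> h; exact: (exhaust_arith1 hj h de).
  exists ord0; rewrite hs /b unlift_none (rposD fp) !(rposZ fp) f1.
  have : kap * f r <= kap * eps by apply: ler_wpM2l.
  by rewrite {2}/kap divfK ?gt_eqF// => h; exact: (exhaust_arith2 h de).
exists (fun i => e (lift ord0 i)); split.
- by move=> i; split.
- by move=> i n; exact: (eS _ n.+1).
- by move=> i; exact: (eS _ 0).
- move=> i f Tf; have fp := TF_rpos Tf.
  have := ea (lift ord0 i) f Tf; have fe := pos_tr ta Tf (ep (lift ord0 i)).
  rewrite hs /b liftK; set E := e _ in fe *.
  have -> : (r ** a i + (2 * d)%:C%C *: (one - r) + (d * eps / 8)%:C%C *: one) ** E =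
    a i ** (r ** E) + (2 * d)%:C%C *: (E - r ** E) + (d * eps / 8)%:C%C *: E.
    by rewrite !smulDl !smulZl smulDl sNmul !(smul1l ta) ra smulA.
  rewrite !(rposD fp) !(rposZ fp) (rposB fp).
  by apply: exhaust_arith3; rewrite mulr_ge0// ltW.
move=> f Tf; have fp := TF_rpos Tf.
have [f1 fe] : f one = 1 /\ forall i, 0 <= f (e i).
  by split=> [|i]; [exact: (ta_one ta)|exact: (pos_tr ta Tf)].
have hi i : eps / 4 * f (e (lift ord0 i)) <= f (r ** e (lift ord0 i)).
  have := ea (lift ord0 i) f Tf; rewrite hs /b liftK; set E := e _.
  have -> : (r ** a i + (2 * d)%:C%C *: (one - r) + (d * eps / 8)%:C%C *: one) ** E =
    a i ** (r ** E) + (2 * d)%:C%C *: (E - r ** E) + (d * eps / 8)%:C%C *: E.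
    by rewrite !smulDl !smulZl smulDl sNmul !(smul1l ta) ra smulA.
  rewrite !(rposD fp) !(rposZ fp) (rposB fp); apply: exhaust_arith4 => //.
    by apply: (tr_pos_mul hsigma Tt0 ta) => //; apply: (pos_mul ta); [exact: pr|exact: ep|exact: (eS _ 0)].
  by apply: mulr_ge0; [exact: ltW|exact: fe].
have := ea ord0 f Tf; rewrite hs /b unlift_none smulDl !smulZl (smul1l ta) (rposD fp) !(rposZ fp).
move=> /(exhaust_arith5 d0 e0 e1 (fe ord0)); rewrite /kap divfK ?gt_eqF// => /(_ erefl) hE.
have h1 : f r - 2 * eps <= \sum_i f (e (lift ord0 i)).
  have : 0 <= f ((one - r) ** (one - e ord0)) by exact: (tr_pos_mul hsigma Tt0 ta).
  have -> : (one - r) ** (one - e ord0) = one - e ord0 - (r - r ** e ord0) by nc1.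
  have := esum f Tf; rewrite big_ord_recl (rposD fp) (rpos_sum fp) !(rposB fp) f1.
  have : eps * f (e ord0) <= eps.
    rewrite -[leRHS]mulr1; apply: ler_wpM2l; first exact: ltW.
    by have := pos_tr ta Tf (ep1 ord0); rewrite (rposB fp) f1 subr_ge0.
  by move: hE; set X := f (r ** _); set Y := \sum_i _; lra.
apply: (@le_trans _ _ (eps / 4 * \sum_i f (e (lift ord0 i)))).
  by apply: ler_wpM2l => //; rewrite divr_ge0// ltW.
by rewrite mulr_sumr; apply: ler_sum => i _; exact: hi.
Qed.
(** Iterates [exhaust_step] on the remainder r. Only the traces of sum_i e_i are known to be at most
    1, so just the share c = 1/(k + 1) of each r e_i is added, which keeps the new remainder
    positive. The excess f(r) - 2 eps then shrinks by the factor th = 1 - c eps/4 at each stage. *)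
Lemma approx_povm (S : set B) k (a : 'I_k.+1 -> A) (d eps : R) : countable S ->
  0 < d -> 0 < eps -> eps <= 1 -> (forall i, positive (a i)) ->
  (forall t, tracial_state t -> exists i, ret t (a i) < d) ->
  exists u : 'I_k.+1 -> B,
    [/\ forall i, Pos TFB (u i),
        forall i s, S s -> s ** u i = u i ** s,
        Pos TFB (one - \sum_i u i),
        forall f, TFB f -> f (one - \sum_i u i) <= 3 * eps &
        forall i f, TFB f -> f (cst_embed w (a i) ** u i) <= 2 * d * f (u i)].
Proof.
move=> cS d0 e0 e1 pa ha.
have [D0 hD] := cover_commuting hsigma Tt0 ta ord0 d0 ha.
pose ca i : B := cst_embed w (a i).
have pca i : Pos TFB (ca i).
  by have [y yE] := pa i; rewrite /ca yE cst_embedM cst_embedS; exact: (pos_sqr ta).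
have [S' hS'] : exists S' : nat -> B, forall x, (S `|` [set cst_embed w x | x in [set x | x \in D0]]
    `|` range ca) x -> exists n, S' n = x.
  apply: countable_enum; first exact: 0.
  do 2?[apply: countable_setU] => //; apply: countable_image; last exact: countableP.
  by apply: finite_set_countable; exact: finite_seq.
pose c : R := k.+1%:R^-1; have c0 : 0 < c by rewrite invr_gt0 ltr0n.
have c1 : c <= 1 by rewrite invf_le1 ?ltr0n// ler1n.
pose th := 1 - c * (eps / 4).
have th0 : 0 <= th.
  rewrite subr_ge0; apply: mulr_ile1 => //; first exact: ltW.
    by rewrite divr_ge0// ltW.
  by rewrite ler_pdivrMr// mul1r; apply: le_trans e1 _; rewrite ler1n.
have th1 : th < 1 by rewrite ltrBlDr ltrDl mulr_gt0// divr_gt0.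
have hN N : exists u : 'I_k.+1 -> B,
    [/\ forall i, Pos TFB (u i),
        forall i n, S' n ** u i = u i ** S' n,
        Pos TFB (one - \sum_i u i),
        forall f, TFB f -> f (one - \sum_i u i) - 2 * eps <= th ^+ N &
        forall i f, TFB f -> f (ca i ** u i) <= 2 * d * f (u i)].
  elim: N => [|N [u [pu uS pr fr fu]]].
    exists (fun=> 0); split=> [i|i n||f Tf|i f Tf].
    - exact: (pos0 ta).
    - by rewrite smul0 s0mul.
    - by rewrite big1// subr0; exact: (pos1 ta).
    - by rewrite big1// subr0 (ta_one ta Tf) expr0 gerBl mulr_ge0// ltW.
    - by rewrite smul0 (rpos0 (TF_rpos Tf)) mulr0.
  set r := one - _ in pr fr.
  have rS n : S' n ** r = r ** S' n.
    rewrite /r smulDr smulDl smulN sNmul (smul1l ta) (smul1r ta); congr (_ - _).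
    by apply: smulC_sum => i _; exact: uS.
  have pr1 : Pos TFB (one - r) by rewrite /r opprB addrC subrK; exact: (pos_sum ta).
  have ra i : r ** ca i = ca i ** r.
    by have [|n <-] := hS' (ca i); [right; exists i|rewrite rS].
  have [|e [pe eS re ea esum]] := exhaust_step S' d0 e0 e1 pr pr1 pca ra.
    move=> f Tf fr0; apply: (hD r pr) => // x xD.
    by have [|n <-] := hS' (cst_embed w x); [left; right; exists x|rewrite rS].
  have pre i : Pos TFB (r ** e i) by apply: (pos_mul ta) => //; have [] := pe i.
  have -> : th ^+ N.+1 = th * th ^+ N by rewrite exprS.
  have rE : one - \sum_i (u i + c%:C%C *: (r ** e i)) = r ** (one - c%:C%C *: \sum_i e i).
    rewrite big_split -scaler_sumr -smul_sumr smulDr smulN smulZr (smul1r ta) opprD addrA.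
    by [].
  clearbody r.
  exists (fun i => u i + c%:C%C *: (r ** e i)); split=> [i|i n||f Tf|i f Tf].
  - by apply: (posD ta) => //; apply: (posZ ta) => //; exact: ltW.
  - have h1 := uS i n; have h2 := rS n; have h3 := eS i n.
    have h4 : S' n ** (r ** e i) = r ** e i ** S' n by nc.
    by rewrite smulDr smulDl smulZr h1 h4 -smulZl.
  - rewrite rE; apply: (pos_mul ta) => //.
      have -> : one - c%:C%C *: \sum_i e i = c%:C%C *: \sum_i (one - e i).
        rewrite sumrB scalerBr sumr_const card_ord -rZn rZM /c mulVf ?rZ1//.
        by rewrite pnatr_eq0.
      apply: (posZ ta); first exact: ltW.
      by apply: (pos_sum ta) => i _; have [] := pe i.
    rewrite smulDr smulDl smulN sNmul (smul1l ta) (smul1r ta) smulZr smulZl.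
    by congr (_ - _ *: _); apply: smulC_sum => i _; exact: re.
  - have fp := TF_rpos Tf.
    rewrite rE smulDr smulN smulZr (smul1r ta) smul_sumr (rposB fp) (rposZ fp) (rpos_sum fp).
    have h1 := ler_wpM2l (ltW c0) (esum f Tf).
    apply: le_trans (ler_wpM2l th0 (fr f Tf)); move: h1; rewrite /th; lra.
  - have fp := TF_rpos Tf.
    rewrite smulDr smulZr !(rposD fp) !(rposZ fp) mulrDr; apply: lerD; first exact: fu.
    by rewrite mulrCA; apply: ler_wpM2l; [exact: ltW|exact: ea].
have [N hNe] : exists N, th ^+ N <= eps.
  have : th ^+ n @[n --> \oo] --> (0 : R) by apply: cvg_expr; rewrite ger0_norm.
  move=> /cvgrPdist_lt/(_ _ e0)[N _ /(_ N (leqnn N)) /=].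
  by rewrite sub0r normrN ger0_norm ?exprn_ge0// => /ltW; exists N.
have [u [pu uS pr fr fu]] := hN N; exists u; split=> // [i s Ss|f Tf].
  by have [|n <-] := hS' s; [left; left|exact: uS].
by have := le_trans (fr f Tf) hNe; lra.
Qed.
End Exhaustion.

(** * Making all translates commute *)

Section CommutingPOVM.
Variables (R : realType) (w : freeUltrafilter) (A : cstarAlgType R).
Hypothesis hsigma : sigma_unital A.
Variable t0 : A -> R[i].
Hypothesis Tt0 : tracial_state t0.
Local Notation B := (A_omega_b w A).
Local Notation TFB := (@TF R w A).
Hypothesis hCPoU : weak_CPoU w A.
Variables (G : groupType) (alpha : action G A).
Hypothesis hGc : countable [set: G].
Variable one : B.
Hypothesis ta : tracial_alg one TFB.
Local Notation act := (act_omega alpha : G -> B -> B).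
Hypothesis tact : tracial_action TFB act.
Let w_ultra : UltraFilter (ultra_sets w) := ultra_ultra w.
Local Existing Instance w_ultra.

Definition comm (x y : B) : B := x ** y - y ** x.

Lemma act_comm (g h : G) (x y : B) : x ** act (g^-1 * h)%g y = act (g^-1 * h)%g y ** x ->
  act g x ** act h y = act h y ** act g x.
Proof.
move=> /(congr1 (act g)); rewrite !(tac_M tact) -(tac_comp tact).
by rewrite mulgA mulgV mul1g.
Qed.

(** N partitions are chosen in turn, each commuting with all translates of the sum of the earlier
    ones. In the commutators of the sums the cross terms vanish, so these have norm at most 2N; the
    average divides them by N^2, leaving 2/N. *)
Lemma approx_comm_povm (S : set B) k (a : 'I_k.+1 -> A) (d eps : R) : countable S ->
  0 < d -> 0 < eps -> (forall i, positive (a i)) ->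
  (forall t, tracial_state t -> exists i, ret t (a i) < d) ->
  exists u : 'I_k.+1 -> B,
    [/\ forall i, Pos TFB (u i),
        forall i s, S s -> s ** u i = u i ** s,
        Pos TFB (one - \sum_i u i),
        forall f, TFB f -> f (one - \sum_i u i) <= eps &
        (forall i f, TFB f -> f (cst_embed w (a i) ** u i) <= 2 * d * f (u i)) /\
        forall g h i j, rnorm (comm (act g (u i)) (act h (u j))) <= eps].
Proof.
move=> cS d0 e0 pa ha; pose e3 := Num.min 1 (eps / 3).
have e30 : 0 < e3 by rewrite lt_min ltr01 divr_gt0.
have e31 : e3 <= 1 by rewrite ge_min lexx.
have e33 : 3 * e3 <= eps by rewrite -ler_pdivlMl// mulrC ge_min lexx orbT.
have hN N : exists u : 'I_k.+1 -> B,
    [/\ forall i, Pos TFB (u i),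
        forall i s, S s -> s ** u i = u i ** s,
        Pos TFB (N%:R%:C%C *: one - \sum_i u i),
        forall f, TFB f -> f (N%:R%:C%C *: one - \sum_i u i) <= N%:R * eps &
        (forall i f, TFB f -> f (cst_embed w (a i) ** u i) <= 2 * d * f (u i)) /\
        forall g h i j, rnorm (comm (act g (u i)) (act h (u j))) <= 2 * N%:R].
  elim: N => [|N [M [pM MS pM1 fM [aM cM]]]].
    exists (fun=> 0); split=> [i|i s _||f Tf|].
    - exact: (pos0 ta).
    - by rewrite smul0 s0mul.
    - by rewrite big1// subr0 rZ0; exact: (pos0 ta).
    - by rewrite big1// subr0 rZ0 (rpos0 (TF_rpos Tf)) mul0r.
    - split=> [i f Tf|g h i j]; first by rewrite smul0 (rpos0 (TF_rpos Tf)) mulr0.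
      rewrite /comm; have a0 g' : act g' 0 = 0.
        by have := tac_Z tact g' 0 0; rewrite !scale0r.
      by rewrite !a0 smul0 subrr rnorm0 mulr0.
  pose S' := S `|` \bigcup_(i in [set: 'I_k.+1]) range (fun g => act g (M i)).
  have cS' : countable S'.
    apply: countable_setU => //; apply: bigcup_countable; first exact: countableP.
    by move=> i _; exact: countable_image.
  have [u [pu uS pu1 fu au]] := approx_povm hsigma Tt0 hCPoU alpha ta cS' d0 e30 e31 pa ha.
  have uM i j g : u i ** act g (M j) = act g (M j) ** u i.
    by rewrite uS//; right; exists j => //; exists g.
  have un i : rnorm (u i) <= 1.
    apply: (pos_norm1 ta) => //.
    have -> : one - u i = (one - \sum_i u i) + \sum_(j | j != i) u j.
      by rewrite (bigD1 i)//= opprD addrA subrK.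
    by apply: (posD ta) => //; exact: (pos_sum ta).
  exists (fun i => M i + u i); split=> [i|i s Ss||f Tf|].
  - exact: (posD ta).
  - by rewrite smulDr smulDl MS// uS//; left.
  - have -> : N.+1%:R%:C%C *: one - \sum_i (M i + u i) =
        (N%:R%:C%C *: one - \sum_i M i) + (one - \sum_i u i).
      by rewrite big_split opprD addrACA -natr1 rZD rZ1.
    exact: (posD ta).
  - have fp := TF_rpos Tf.
    have -> : N.+1%:R%:C%C *: one - \sum_i (M i + u i) =
        (N%:R%:C%C *: one - \sum_i M i) + (one - \sum_i u i).
      by rewrite big_split opprD addrACA -natr1 rZD rZ1.
    rewrite (rposD fp) -natr1 mulrDl mul1r; apply: lerD; first exact: fM.
    by apply: le_trans (fu f Tf) _.
  - split=> [i f Tf|g h i j].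
      have fp := TF_rpos Tf.
      by rewrite smulDr !(rposD fp) mulrDr; apply: lerD; [exact: aM|exact: au].
    have -> : comm (act g (M i + u i)) (act h (M j + u j)) =
        comm (act g (M i)) (act h (M j)) + comm (act g (u i)) (act h (u j)).
      rewrite /comm !(tac_D tact).
      have h1 : act g (u i) ** act h (M j) = act h (M j) ** act g (u i).
        by apply: act_comm; exact: uM.
      have h2 : act g (M i) ** act h (u j) = act h (u j) ** act g (M i).
        by symmetry; apply: act_comm; exact: uM.
      move: (act g (u i)) (act h (M j)) (act g (M i)) (act h (u j)) h1 h2 => x y z t h1 h2.
      nc.
    apply: le_trans (rnormD _ _) _; rewrite -[N.+1%:R]natr1 mulrDr mulr1; apply: lerD; first exact: cM.
    have h1 x y : rnorm x <= 1 -> rnorm y <= 1 -> rnorm (comm x y) <= 2.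
      move=> x1 y1; apply: le_trans (rnormD _ _) _; rewrite rnormN.
      have hxy (x' y' : B) : rnorm x' <= 1 -> rnorm y' <= 1 -> rnorm (x' ** y') <= 1.
        move=> h1 h2; apply: le_trans (rnorm_smul _ _) _.
        by apply: mulr_ile1; rewrite ?rnorm_ge0.
      by rewrite -[2]/(1 + 1); apply: lerD; exact: hxy.
    by apply: h1; apply: le_trans (tac_norm tact _ _) _.
pose N := (Num.truncn (2 / eps)).+1.
have N0 : 0 < N%:R :> R by rewrite ltr0n.
have Ne : 2 / eps < N%:R by exact: truncnS_gt.
have [M [pM MS pM1 fM [aM cM]]] := hN N.
pose c : R := N%:R^-1; have c0 : 0 < c by rewrite invr_gt0.
have sE : one - \sum_i c%:C%C *: M i = c%:C%C *: (N%:R%:C%C *: one - \sum_i M i).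
  by rewrite -scaler_sumr scalerBr rZM mulVf ?gt_eqF// rZ1.
exists (fun i => c%:C%C *: M i); split=> [i|i s Ss||f Tf|].
- by apply: (posZ ta) => //; exact: ltW.
- by rewrite smulZr smulZl MS.
- by rewrite sE; apply: (posZ ta) => //; exact: ltW.
- by rewrite sE (rposZ (TF_rpos Tf)) ler_pdivrMl//; exact: fM.
split=> [i f Tf|g h i j].
  have fp := TF_rpos Tf; rewrite smulZr !(rposZ fp) mulrCA; apply: ler_wpM2l; first exact: ltW.
  exact: aM.
have -> : comm (act g (c%:C%C *: M i)) (act h (c%:C%C *: M j)) =
    (c * c)%:C%C *: comm (act g (M i)) (act h (M j)).
  rewrite /comm !(tac_Z tact) !smulZr !smulZl !rZM scalerBr; by [].
rewrite rnormZr ger0_norm ?mulr_ge0 ?(ltW c0)//.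
apply: le_trans (ler_wpM2l _ (cM _ _ _ _)) _; first by rewrite mulr_ge0 ?(ltW c0).
rewrite (_ : c * c * (2 * N%:R) = 2 * c); last by rewrite -mulrA mulrCA mulrCA /c mulVf ?mulr1 1?mulrC ?gt_eqF.
by rewrite /c ler_pdivrMr// mulrC -ler_pdivrMr// ltW.
Qed.
(** The unknown [None] is the sum of the others. As an unknown it is bound to be a contraction, so
    one minus the sum is positive; its traces are at most 0 by the condition [inr true], hence it
    vanishes. *)
Definition povm_conds (gam : nat -> G) k (d : R)
    (c : ('I_k.+1 * nat + ('I_k.+1 * 'I_k.+1) * (nat * nat) + bool)%type) :
    gexpr R G (option ('I_k.+1 + nat)) (option 'I_k.+1) :=
  match c with
  | inl (inl (i, 0)) => esq (esub (EStar (EUnk (Some i))) (EUnk (Some i)))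
  | inl (inl (i, 1)) => enonneg (EUnk (Some i))
  | inl (inl (i, 2)) =>
      esub (EMul (EMul (EStar (EPar (Some (inl i)))) (EPar (Some (inl i)))) (EUnk (Some i)))
           (EScale (2 * d)%:C%C (EUnk (Some i)))
  | inl (inl (i, n.+3)) => esq (esub (EMul (EPar (Some (inr n))) (EUnk (Some i)))
                                (EMul (EUnk (Some i)) (EPar (Some (inr n)))))
  | inl (inr ((i, j), (n, m))) =>
      esq (esub (EMul (EAct (gam n) (EUnk (Some i))) (EAct (gam m) (EUnk (Some j))))
                (EMul (EAct (gam m) (EUnk (Some j))) (EAct (gam n) (EUnk (Some i)))))
  | inr true => esub (EPar None) (EUnk None)
  | inr false => esq (esub (EUnk None) (\big[@EAdd _ _ _ _/EZero]_(i < k.+1) EUnk (Some i)))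
  end.

Lemma comm_povm (S : set B) k (s : 'I_k.+1 -> B) (d : R) : countable S -> 0 < d ->
  (forall f, TFB f -> exists i, f (star (s i) ** s i) < d) ->
  exists u : 'I_k.+1 -> B,
    [/\ forall i, Pos TFB (u i),
        \sum_i u i = one,
        forall i x, S x -> x ** u i = u i ** x,
        forall i f, TFB f -> f (star (s i) ** s i ** u i) <= 2 * d * f (u i) &
        forall g h i j, act g (u i) ** act h (u j) = act h (u j) ** act g (u i)].
Proof.
move=> cS d0 hs; have [S' hS'] := countable_enum (0 : B) cS.
have [gam hgam] := countable_enum (1%g : G) hGc.
have [par hp] := choice (fun v : option ('I_k.+1 + nat) => bclsP
  (match v with None => one | Some (inl i) => s i | Some (inr n) => S' n end)).
have [e0 e0pos|u u1 hu] := @reindexing R w A hsigma t0 Tt0 G alpha _ _ _ (povm_conds gam d) par.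
  have h1 := cover_constants hsigma Tt0 (fun i => esym (hp (Some (inl i)))) hs.
  have h2 := unit_constants hsigma Tt0 ta (esym (hp None)) (divr_gt0 e0pos (ltr0n R 2)).
  apply: filterS (filterI h1 h2) => n /= [{h1}h1 {h2}h2].
  pose S1 : set B := range (fun j => cst_embed w (par (Some (inr j)) n)).
  have cS1 : countable S1 by apply: sub_countable (countableP _); exact: card_image_le.
  pose a i := star (par (Some (inl i)) n) ** par (Some (inl i)) n.
  have pa i : positive (a i) by exists (par (Some (inl i)) n).
  pose e1 := Num.min (e0 / 2) 1.
  have e1p : 0 < e1 by rewrite lt_min ltr01 divr_gt0.
  have e1e : e1 <= e0 / 2 by rewrite ge_min lexx.
  have e1s : e1 ^+ 2 <= e0.
    have e11 : e1 <= 1 by rewrite ge_min lexx orbT.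
    rewrite expr2; apply: le_trans (ler_wpM2l (ltW e1p) e11) _; rewrite mulr1.
    by apply: le_trans e1e _; rewrite ler_pdivrMr// ler_peMr ?ler1n ?ltW.
  have [y [yp yS yp1 yf [ya yc]]] := approx_comm_povm cS1 d0 e1p pa h1.
  have yn : rnorm (\sum_i y i) <= 1 by apply: (pos_norm1 ta) => //; exact: (pos_sum ta).
  exists (fun v => if v is Some i then y i else \sum_i y i) => [[i|]|c f z Tf z1] //.
    apply: (pos_norm1 ta) => //.
    have -> : one - y i = (one - \sum_i y i) + \sum_(j | j != i) y j.
      by rewrite (bigD1 i)//= opprD addrA subrK.
    by apply: (posD ta) => //; exact: (pos_sum ta).
  have fp := TF_rpos Tf.
  case: c => [[[i [|[|[|j]]]]|[[i j] [l m]]]|[]]; rewrite /povm_conds.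
  - by rewrite /= scaleN1r (pos_sa (yp i)) subrr smul0 (rpos0 fp) ltW.
  - rewrite geval_nonneg (rposN fp); apply: le_trans (ltW e0pos).
    by rewrite oppr_le0; have [_] := yp i; apply.
  - rewrite geval_sub /= (rposB fp) (rposZ fp); apply: le_trans (ltW e0pos).
    by rewrite subr_le0 -cst_embedS -cst_embedM; exact: ya.
  - have I : S1 (cst_embed w (par (Some (inr j)) n)) by exists j.
    by rewrite /= (yS i _ I) scaleN1r subrr smul0 (rpos0 fp) ltW.
  - rewrite /= scaleN1r -/(comm _ _); set x := comm _ _.
    rewrite -(fnorm_sqr fp); apply: le_trans e1s; rewrite ler_pXn2r ?nnegrE ?fnorm_ge0 ?(ltW e1p)//.
    by apply: le_trans (fnorm_le_norm ta _ Tf) _; exact: yc.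
  - rewrite geval_sub /= (rposB fp).
    have h3 := h2 f Tf; have h4 := yf f Tf.
    rewrite (rposB fp) (ta_one ta Tf) in h4.
    have h5 := le_trans (ler_norm _) h3.
    rewrite -(subrKA 1) [e0]splitr; apply: lerD => //.
    exact: le_trans h4 e1e.
  - by rewrite /= geval_sum /= scaleN1r subrr smul0 (rpos0 fp) ltW.
have parE : (fun i => bcls w (par i)) = fun v => match v with None => one | Some (inl i) => s i | Some (inr n) => S' n end.
  by apply/funext => v; rewrite -hp.
rewrite parE in hu.
have sa i : star (u (Some i)) = u (Some i).
  apply/eqP; rewrite -subr_eq0; apply/eqP; apply: (cond_eq0 ta) => f z Tf z1.
  by have := hu (inl (inl (i, 0))) f z Tf z1; rewrite /= scaleN1r.
have pu i : Pos TFB (u (Some i)).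
  apply: (cond_pos ta) => // f z Tf z1.
  by have := hu (inl (inl (i, 1))) f z Tf z1; rewrite geval_nonneg.
have sumE : u None = \sum_i u (Some i).
  apply/eqP; rewrite -subr_eq0; apply/eqP; apply: (cond_eq0 ta) => f z Tf z1.
  by have := hu (inr false) f z Tf z1; rewrite /= geval_sum /= scaleN1r.
have z1 : rnorm (0 : B) <= 1 by rewrite rnorm0.
exists (fun i => u (Some i)); split=> //.
- rewrite -sumE; apply/esym/eqP; rewrite -subr_eq0; apply/eqP; apply: (pos_eq0 ta).
    apply: (norm1_pos ta) => //; rewrite sumE; apply: pos_sa; exact: (pos_sum ta).
  move=> f Tf; have := hu (inr true) f 0 Tf z1.
  by rewrite /povm_conds geval_sub.
- move=> i x Sx; have [n <-] := hS' x Sx.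
  apply/eqP; rewrite -subr_eq0; apply/eqP; apply: (cond_eq0 ta) => f z Tf _.
  by have := hu (inl (inl (i, n.+3))) f 0 Tf z1; rewrite /= scaleN1r.
- move=> i f Tf; have := hu (inl (inl (i, 2))) f 0 Tf z1.
  by rewrite /povm_conds geval_sub /= (rposB (TF_rpos Tf)) (rposZ (TF_rpos Tf)) subr_le0.
- move=> g h i j; have [n <-] := hgam g I; have [m <-] := hgam h I.
  apply/eqP; rewrite -subr_eq0; apply/eqP; apply: (cond_eq0 ta) => f z Tf _.
  by have := hu (inl (inr ((i, j), (n, m)))) f 0 Tf z1; rewrite /= scaleN1r.
Qed.
End CommutingPOVM.

(** * Projections with prescribed traces *)

(** The recursion c |-> c - c^2, started at most at 1, stays below 1/(N + 1) after N steps. *)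
Lemma variance_step (R : realFieldType) (N : nat) (c y : R) : 0 <= c -> c <= N.+1%:R^-1 ->
  c ^+ 2 <= y -> c - y <= N.+2%:R^-1.
Proof.
move=> c0 cN cy; apply: (@le_trans _ _ (c * (1 - c))).
  by rewrite mulrBr mulr1 -expr2 lerD2l lerN2.
have [h|h] := leP c N.+2%:R^-1.
  by apply: le_trans h; rewrite ler_piMr// gerBl.
have c1 : c <= 1 by apply: le_trans cN _; rewrite invf_le1 ?ltr0n// ler1n.
have -> : N.+2%:R^-1 = N.+1%:R^-1 * (1 - N.+2%:R^-1) :> R.
  have n1 : N.+1%:R != 0 :> R by rewrite pnatr_eq0.
  have n2 : N.+2%:R != 0 :> R by rewrite pnatr_eq0.
  have -> : 1 - N.+2%:R^-1 = N.+1%:R / N.+2%:R :> R.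
    have e : N.+2%:R = N.+1%:R + 1 :> R by rewrite natr1.
    by apply: (mulIf n2); rewrite mulrBl mul1r mulVf// divfK// e addrK.
  by rewrite mulKf.
by apply: ler_pM => //; rewrite ?subr_ge0// lerD2l lerN2 ltW.
Qed.

Section Projections.
Variables (R : realType) (w : freeUltrafilter) (A : cstarAlgType R).
Hypothesis hsigma : sigma_unital A.
Variable t0 : A -> R[i].
Hypothesis Tt0 : tracial_state t0.
Local Notation B := (A_omega_b w A).
Local Notation TFB := (@TF R w A).
Variables (G : groupType) (alpha : action G A).
Hypothesis hGc : countable [set: G].
Hypothesis hGamma : local_equivariant_Gamma w alpha.
Variable one : B.
Hypothesis ta : tracial_alg one TFB.
Local Notation act := (act_omega alpha : G -> B -> B).
Hypothesis tact : tracial_action TFB act.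

Lemma split_mul (p a b c e : B) : p ** p = p -> p ** a = a ** p -> p ** b = b ** p ->
  p ** c = c ** p -> p ** e = e ** p ->
  (p ** a + (one - p) ** b) ** (p ** c + (one - p) ** e) = p ** (a ** c) + (one - p) ** (b ** e).
Proof. by move=> pp pa pb pc pe; nc1. Qed.

Lemma split_comm (p a b s : B) : p ** s = s ** p -> s ** a = a ** s -> s ** b = b ** s ->
  s ** (p ** a + (one - p) ** b) = (p ** a + (one - p) ** b) ** s.
Proof. by move=> ps sa sb; nc1. Qed.

Lemma split_pos (p a b : B) : projection p -> p ** a = a ** p -> p ** b = b ** p ->
  Pos TFB a -> Pos TFB b -> Pos TFB (p ** a + (one - p) ** b).
Proof.
move=> pp pa pb a0 b0; have pc := proj_compl ta pp.
apply: (posD ta); apply: (pos_mul ta) => //; try exact: (proj_pos ta).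
by nc1.
Qed.

Lemma split_tr (p a b : B) f : TFB f -> f (a ** p) = 2^-1 * f a -> f (b ** p) = 2^-1 * f b ->
  f (p ** a + (one - p) ** b) = 2^-1 * (f a + f b).
Proof.
move=> Tf fa fb; have fp := TF_rpos Tf.
rewrite smulDl sNmul (smul1l ta) (rposD fp) (rposB fp) (TF_C Tf p a) (TF_C Tf p b) fa fb.
by rewrite mulrDr; congr (_ + _); lra.
Qed.

(* A bounded martingale: e becomes e^2 or 2e - e^2 with probability 1/2 each, and
   the variance e - e^2 then loses its own square. *)
Lemma approx_projections (S D : set B) (N : nat) : countable S -> countable D -> S one ->
  (forall x, D x -> Pos TFB x /\ Pos TFB (one - x)) ->
  (forall x y, D x -> D y -> x ** y = y ** x) ->
  (forall s x, S s -> D x -> s ** x = x ** s) ->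
  exists P : B -> B,
    [/\ forall x, D x -> Pos TFB (P x) /\ Pos TFB (one - P x),
        forall x y, D x -> D y -> P x ** P y = P y ** P x,
        forall s x, S s -> D x -> s ** P x = P x ** s,
        (forall g x, act g (P x) = P (act g x)) /\
        (forall x y, D x -> D y -> Pos TFB (y - x) -> Pos TFB (P y - P x)) &
        (forall f a x, TFB f -> S a -> D x -> f (a ** P x) = f (a ** x)) /\
        forall f x, TFB f -> D x -> f (P x - P x ** P x) <= N.+1%:R^-1].
Proof.
move=> cS cD S1 hD DD SD; elim: N => [|N [P [hP PP SP [aP mP] [tP vP]]]].
  exists id; split=> //; split=> // f x Tf Dx.
  have [px px1] := hD x Dx; have fp := TF_rpos Tf.
  rewrite invr1; apply: (@le_trans _ _ (f x)).
    by rewrite (rposB fp) gerBl; apply: (pos_tr ta Tf); apply: (pos_sq ta); exact: (pos_sa px).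
  by have := pos_tr ta Tf px1; rewrite (rposB fp) (ta_one ta Tf) subr_ge0.
pose T : set B := S `|` (P @` D) `|` \bigcup_(a in S) ((fun x => a ** P x) @` D)
  `|` \bigcup_(a in S) ((fun x => a ** (P x ** P x)) @` D)
  `|` ((fun x => P x ** P x ** (P x ** P x)) @` D)
  `|` ((fun x => (P x + P x - P x ** P x) ** (P x + P x - P x ** P x)) @` D).
have cT : countable T.
  do !apply: countable_setU => //; do ?exact: countable_image;
    by apply: bigcup_countable => // a _; exact: countable_image.
have [q [pq _ iq cq tq]] := gamma_real hsigma Tt0 hGamma 2 cT.
pose p := q ord0.
have pp : projection p by exact: pq.
have p2 : p ** p = p by have [] := pp.
have pS s : S s -> p ** s = s ** p by move=> Ss; apply: cq; do 5 left.
have pP x : D x -> p ** P x = P x ** p.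
  by move=> Dx; apply: cq; do 4 left; right; exists x.
have taP a x f : TFB f -> S a -> D x -> f (a ** P x ** p) = 2^-1 * f (a ** P x).
  by move=> Tf Sa Dx; apply: tq => //; do 3 left; right; exists a => //; exists x.
have taP2 a x f : TFB f -> S a -> D x -> f (a ** (P x ** P x) ** p) = 2^-1 * f (a ** (P x ** P x)).
  by move=> Tf Sa Dx; apply: tq => //; do 2 left; right; exists a => //; exists x.
have tP4 x f : TFB f -> D x -> f (P x ** P x ** (P x ** P x) ** p) = 2^-1 * f (P x ** P x ** (P x ** P x)).
  by move=> Tf Dx; apply: tq => //; left; right; exists x.
have tPq x f : TFB f -> D x -> f ((P x + P x - P x ** P x) ** (P x + P x - P x ** P x) ** p) =
    2^-1 * f ((P x + P x - P x ** P x) ** (P x + P x - P x ** P x)).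
  by move=> Tf Dx; apply: tq => //; right; exists x.
have ip g : act g p = p by exact: iq.
have a1 g : act g one = one.
  have h x : act g one ** x = x.
    have -> : x = act g (act g^-1%g x) by rewrite -(tac_comp tact) mulgV (tac_1 tact).
    by rewrite -(tac_M tact) (smul1l ta).
  by rewrite -[LHS](smul1r ta) h.
clearbody p; clear q pq iq cq tq cT T.
pose lo (e : B) := e ** e; pose hi (e : B) := e + e - e ** e.
exists (fun x => p ** lo (P x) + (one - p) ** hi (P x)).
have plo x : D x -> p ** lo (P x) = lo (P x) ** p.
  by move=> /pP h; rewrite /lo; move: (P x) h => e h; nc.
have phi x : D x -> p ** hi (P x) = hi (P x) ** p.
  by move=> /pP h; rewrite /hi; move: (P x) h => e h; nc.
split.
- move=> x Dx; have [Px P1x] := hP x Dx; have sP := pos_sa Px; split.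
    apply: split_pos => //; [exact: plo|exact: phi|exact: (pos_sq ta)|].
    rewrite /hi -addrA; apply: (posD ta) => //; exact: (pos_xx ta).
  have -> : one - (p ** lo (P x) + (one - p) ** hi (P x)) =
      p ** (one - lo (P x)) + (one - p) ** (one - hi (P x)) by rewrite /lo /hi; nc1.
  apply: split_pos => //.
  + by have := plo x Dx; move: (lo _) => e h; nc1.
  + by have := phi x Dx; move: (hi _) => e h; nc1.
  + have -> : one - lo (P x) = (one - P x) + (P x - P x ** P x) by rewrite /lo; nc1.
    by apply: (posD ta) => //; exact: (pos_xx ta).
  + have -> : one - hi (P x) = star (one - P x) ** (one - P x).
      by rewrite /hi starB (star_one ta) sP; nc1.
    exact: (pos_sqr ta).
- move=> x y Dx Dy; have := PP x y Dx Dy; have := pP x Dx; have := pP y Dy.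
  by rewrite /lo /hi; move: (P x) (P y) => e e' h1 h2 h3; nc1.
- move=> s x Ss Dx; have h1 := SP s x Ss Dx; apply: split_comm; first exact: pS.
    by rewrite /lo; move: (P x) h1 => e h1; nc.
  by rewrite /hi; move: (P x) h1 => e h1; nc.
- have aN g x : act g (- x) = - act g x.
    by rewrite -scaleN1r (tac_Z tact) scaleN1r.
  split=> [g x|x y Dx Dy /(mP x y Dx Dy) h].
    by rewrite !(tac_D tact) !(tac_M tact) !(tac_D tact) !aN !(tac_M tact) a1 ip aP.
  have -> : p ** lo (P y) + (one - p) ** hi (P y) - (p ** lo (P x) + (one - p) ** hi (P x)) =
      p ** (lo (P y) - lo (P x)) + (one - p) ** (hi (P y) - hi (P x)) by nc1.
  have cxy := PP x y Dx Dy; have [Px P1x] := hP x Dx; have [Py P1y] := hP y Dy.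
  have [px py] := (plo x Dx, plo y Dy); have [px' py'] := (phi x Dx, phi y Dy).
  apply: split_pos => //.
  + by move: (lo _) (lo _) px py => a b h1 h2; nc.
  + by move: (hi _) (hi _) px' py' => a b h1 h2; nc.
  + have -> : lo (P y) - lo (P x) = (P y - P x) ** (P y + P x).
      by rewrite /lo; move: (P x) (P y) cxy => e e' h1; nc.
    apply: (pos_mul ta) => //; first exact: (posD ta).
    by move: (P x) (P y) cxy => e e' h1; nc.
  + have -> : hi (P y) - hi (P x) = (P y - P x) ** ((one - P y) + (one - P x)).
      by rewrite /hi; move: (P x) (P y) cxy => e e' h1; nc1.
    apply: (pos_mul ta) => //; first exact: (posD ta).
    by move: (P x) (P y) cxy => e e' h1; nc1.
split=> [f a x Tf Sa Dx|f x Tf Dx].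
  rewrite -(tP f a x Tf Sa Dx); have fp := TF_rpos Tf.
  have -> : a ** (p ** lo (P x) + (one - p) ** hi (P x)) =
      p ** (a ** lo (P x)) + (one - p) ** (a ** hi (P x)).
    by have h1 := pS a Sa; move: (lo _) (hi _) => u v; nc1.
  have e1 : a ** hi (P x) = a ** P x + a ** P x - a ** (P x ** P x) by rewrite /hi; nc.
  rewrite split_tr//; first 1 last.
  - exact: taP2.
  - rewrite e1 smulDl sNmul smulDl !(rposB fp) !(rposD fp) taP2// taP//; lra.
  by rewrite e1 !(rposB fp) !(rposD fp) /lo; lra.
have fp := TF_rpos Tf; set e := P x.
have [Px P1x] := hP x Dx; have sP := pos_sa Px.
pose v := e - e ** e; have sv : star v = v by rewrite /v starB starM sP.
have [pe1 pe2] := (plo x Dx, phi x Dx); rewrite -/e in pe1 pe2.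
have t1 : f (e ** p) = 2^-1 * f e by have := taP one x f Tf S1 Dx; rewrite !(smul1l ta).
have t2 : f (e ** e ** p) = 2^-1 * f (e ** e) by have := taP2 one x f Tf S1 Dx; rewrite !(smul1l ta).
have -> : f (p ** lo e + (one - p) ** hi e -
    (p ** lo e + (one - p) ** hi e) ** (p ** lo e + (one - p) ** hi e)) = f v - f (v ** v).
  rewrite split_mul//.
  have -> : p ** lo e + (one - p) ** hi e - (p ** (lo e ** lo e) + (one - p) ** (hi e ** hi e)) =
     p ** (lo e - lo e ** lo e) + (one - p) ** (hi e - hi e ** hi e) by nc1.
  rewrite split_tr//.
  - have -> : lo e - lo e ** lo e = e ** e - e ** e ** (e ** e) by [].
    rewrite /hi /v.
    have -> : e + e - e ** e - (e + e - e ** e) ** (e + e - e ** e) =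
       (e + e) - (e ** e *+ 5) + (e ** e ** e *+ 4) - e ** e ** e ** e by nc.
    have -> : (e - e ** e) ** (e - e ** e) = e ** e - e ** e ** e *+ 2 + e ** e ** e ** e by nc.
    rewrite !smulA -!rZn !(rposD fp, rposN fp, rposZ fp); lra.
  - by rewrite /lo smulDl sNmul !(rposB fp) t2 tP4// mulrBr.
  - by rewrite /hi smulDl sNmul [f (_ - _)](rposB fp) tPq// smulDl sNmul smulDl !(rposB fp) !(rposD fp) t1 t2; lra.
have v0 : 0 <= f v by apply: (pos_tr ta Tf); exact: (pos_xx ta).
have vv : f v ^+ 2 <= f (v ** v).
  have := tr_fnorm ta v Tf; rewrite ger0_norm// => h.
  by have := fnorm_sqr fp v; rewrite sv => <-; rewrite ler_pXn2r ?nnegrE ?fnorm_ge0.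
exact: variance_step v0 (vP f x Tf Dx) vv.
Qed.
(** Order is imposed only on pairs already ordered in D. The last case is one-sided; equality of
    traces follows by using it for s and -s, which is why [comm_projections] wants S closed under
    negation. *)
Definition proj_conds (s d : nat -> B) (gam : nat -> G) (c : (nat + nat * nat) * 'I_5) :
    gexpr R G B B :=
  match c with
  | (inl n, Ordinal 0 _) => esq (esub (EStar (EUnk (d n))) (EUnk (d n)))
  | (inl n, Ordinal _ _) => esq (esub (EMul (EUnk (d n)) (EUnk (d n))) (EUnk (d n)))
  | (inr (n, m), Ordinal 0 _) => esq (esub (EMul (EUnk (d n)) (EUnk (d m)))
                                           (EMul (EUnk (d m)) (EUnk (d n))))
  | (inr (n, m), Ordinal 1 _) => esq (esub (EMul (EPar (s m)) (EUnk (d n)))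
                                           (EMul (EUnk (d n)) (EPar (s m))))
  | (inr (n, m), Ordinal 2 _) => esq (esub (EAct (gam m) (EUnk (d n)))
                                           (EUnk (act (gam m) (d n))))
  | (inr (n, m), Ordinal 3 _) => if `[< Pos TFB (d m - d n) >]
      then enonneg (esub (EUnk (d m)) (EUnk (d n))) else EZero
  | (inr (n, m), Ordinal _ _) => esub (EMul (EPar (s m)) (EUnk (d n))) (EMul (EPar (s m)) (EPar (d n)))
  end.

Lemma proj_le_mul (p q : B) : projection p -> projection q -> p ** q = q ** p ->
  (forall f, TFB f -> 0 <= f (star (one - q) ** ((q - p) ** (one - q)))) -> p ** q = p.
Proof.
move=> [sp pp] [sq qq] pq h.
suff e0 : p ** (one - q) = 0.
  by move/eqP: e0; rewrite smulDr smulN (smul1r ta) subr_eq0 => /eqP.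
apply: (ta_sep ta) => f Tf; have := h f Tf.
have -> : star (p ** (one - q)) ** (p ** (one - q)) = p ** (one - q).
  by rewrite starM starB (star_one ta) sp sq; nc1.
have -> : star (one - q) ** ((q - p) ** (one - q)) = - (p ** (one - q)).
  by rewrite starB (star_one ta) sq; nc1.
by rewrite (rposN (TF_rpos Tf)) oppr_ge0.
Qed.

(** Saturation turns vanishing variance into idempotency. Keeping action and order allows common
    lower bounds of positive elements to be transferred to their projections. *)
Lemma comm_projections (S D : set B) : countable S -> countable D -> S one ->
  (forall s, S s -> S (- s)) ->
  (forall x, D x -> Pos TFB x /\ Pos TFB (one - x)) ->
  (forall x y, D x -> D y -> x ** y = y ** x) ->
  (forall s x, S s -> D x -> s ** x = x ** s) ->
  (forall g x, D x -> D (act g x)) -> D !=set0 ->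
  exists P : B -> B,
    [/\ forall x, D x -> projection (P x),
        forall x y, D x -> D y -> P x ** P y = P y ** P x,
        forall s x, S s -> D x -> s ** P x = P x ** s,
        (forall g x, D x -> act g (P x) = P (act g x)) /\
        (forall x y, D x -> D y -> Pos TFB (y - x) -> P x ** P y = P x) &
        forall f a x, TFB f -> S a -> D x -> f (a ** P x) = f (a ** x)].
Proof.
move=> cS cD S1 SN hD DD SD Da [x0 D0].
have [gam hgam] := countable_enum (1%g : G) hGc.
have enum_in (E : set B) x : countable E -> E x ->
    exists s : nat -> B, (forall n, E (s n)) /\ forall y, E y -> exists n, s n = y.
  move=> cE Ex; have [s hs] := countable_enum x cE.
  exists (fun n => if `[< E (s n) >] then s n else x); split=> [n|y Ey].
    by case: asboolP.
  by have [n sn] := hs y Ey; exists n; case: asboolP; rewrite sn.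
have [d [dD hd]] := enum_in D x0 cD D0; have [s [sS hs]] := enum_in S one cS S1.
have [e e0|P P1 hP] := @saturation R w A hsigma t0 Tt0 G alpha _ _ _ (proj_conds s d gam) id.
  pose N := Num.truncn e^-1.
  have Ne : (N.+1%:R : R)^-1 <= e.
    by rewrite invf_ple ?posrE ?ltr0n//; apply: ltW; exact: truncnS_gt.
  have [P [pP PP SP [aP mP] [tP vP]]] := approx_projections N cS cD S1 hD DD SD.
  exists (fun x => if `[< D x >] then P x else 0) => [x|c f z Tf z1].
    case: asboolP => [Dx|_]; last by rewrite rnorm0.
    by have [] := pP x Dx; exact: (pos_norm1 ta).
  have fp := TF_rpos Tf.
  have dE n : (if `[< D (d n) >] then P (d n) else 0) = P (d n) by rewrite asboolT.
  case: c => [[n|[n m]] [[|[|[|[|j]]]] lj]]; rewrite /proj_conds; try by [].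
  - by rewrite /= dE scaleN1r (pos_sa (pP _ (dD n)).1) subrr smul0 (rpos0 fp) ltW.
  1-4: rewrite /= dE scaleN1r; apply: le_trans (Ne).
  1-4: have [Px P1x] := pP _ (dD n); have sP := pos_sa Px.
  1-4: apply: le_trans (vP f _ Tf (dD n)).
  1-4: have -> : star (P (d n) ** P (d n) - P (d n)) ** (P (d n) ** P (d n) - P (d n)) =
      (P (d n) - P (d n) ** P (d n)) ** (P (d n) - P (d n) ** P (d n)) by rewrite starB starM sP; nc.
  1-4: have pv := pos_xx ta Px P1x; set v := _ - _ in pv *.
  1-4: have pv1 : Pos TFB (one - v) by rewrite (_ : one - v = (one - P (d n)) + P (d n) ** P (d n)); [apply: (posD ta) => //; exact: (pos_sq ta)|rewrite /v; nc1].
  1-4: by rewrite -subr_ge0 -(rposB fp); apply: (pos_tr ta Tf); exact: (pos_xx ta).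
  - by rewrite /= !dE PP// scaleN1r subrr smul0 (rpos0 fp) ltW.
  - by rewrite /= !dE SP// scaleN1r subrr smul0 (rpos0 fp) ltW.
  - rewrite /= dE aP asboolT; last exact: Da.
    by rewrite scaleN1r subrr smul0 (rpos0 fp) ltW.
  - case: asboolP => [h|_]; last by rewrite /= (rpos0 fp) ltW.
    rewrite geval_nonneg geval_sub /= !dE (rposN fp); apply: le_trans (ltW e0).
    by rewrite oppr_le0; have [_] := mP _ _ (dD n) (dD m) h; apply.
  - by rewrite geval_sub /= dE (rposB fp) tP// subrr ltW.
have z1 : rnorm (0 : B) <= 1 by rewrite rnorm0.
have pP x : D x -> projection (P x).
  move=> Dx; have [n <-] := hd x Dx; split.
    apply/eqP; rewrite -subr_eq0; apply/eqP; apply: (cond_eq0 ta) => f z Tf _.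
    by have := hP (inl n, ord0) f 0 Tf z1; rewrite /= scaleN1r.
  apply/eqP; rewrite -subr_eq0; apply/eqP; apply: (cond_eq0 ta) => f z Tf _.
  by have := hP (inl n, @Ordinal 5 1 isT) f 0 Tf z1; rewrite /= scaleN1r.
have PP x y : D x -> D y -> P x ** P y = P y ** P x.
  move=> Dx Dy; have [n <-] := hd x Dx; have [m <-] := hd y Dy.
  apply/eqP; rewrite -subr_eq0; apply/eqP; apply: (cond_eq0 ta) => f z Tf _.
  by have := hP (inr (n, m), @Ordinal 5 0 isT) f 0 Tf z1; rewrite /= scaleN1r.
exists P; split=> //.
- move=> a x Sa Dx; have [n <-] := hd x Dx; have [m <-] := hs a Sa.
  apply/eqP; rewrite -subr_eq0; apply/eqP; apply: (cond_eq0 ta) => f z Tf _.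
  by have := hP (inr (n, m), @Ordinal 5 1 isT) f 0 Tf z1; rewrite /= scaleN1r.
- split=> [g x Dx|x y Dx Dy xy].
    have [n <-] := hd x Dx; have [m <-] := hgam g I.
    apply/eqP; rewrite -subr_eq0; apply/eqP; apply: (cond_eq0 ta) => f z Tf _.
    by have := hP (inr (n, m), @Ordinal 5 2 isT) f 0 Tf z1; rewrite /= scaleN1r.
  apply: proj_le_mul; [exact: pP|exact: pP|exact: PP|] => f Tf.
  have [n dn] := hd x Dx; have [m dm] := hd y Dy.
  have n1 : rnorm (one - P y) <= 1 by apply: (proj_norm1 ta); apply: (proj_compl ta); exact: pP.
  have := hP (inr (n, m), @Ordinal 5 3 isT) f (one - P y) Tf n1.
  rewrite /proj_conds dn dm asboolT// geval_nonneg geval_sub /= (rposN (TF_rpos Tf)).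
  by rewrite oppr_le0.
have le f a x : TFB f -> S a -> D x -> f (a ** P x) <= f (a ** x).
  move=> Tf Sa Dx; have [n <-] := hd x Dx; have [m <-] := hs a Sa.
  have := hP (inr (n, m), @Ordinal 5 4 isT) f 0 Tf z1.
  by rewrite /proj_conds geval_sub /= (rposB (TF_rpos Tf)) subr_le0.
move=> f a x Tf Sa Dx; apply/le_anti; rewrite le//=.
by have := le f (- a) x Tf (SN a Sa) Dx; rewrite !sNmul !(rposN (TF_rpos Tf)) lerN2.
Qed.
End Projections.

(** * Nearly invariant orthogonal projections *)

Section Rounds.
Variables (R : realType) (w : freeUltrafilter) (A : cstarAlgType R).
Hypothesis hsigma : sigma_unital A.
Variable t0 : A -> R[i].
Hypothesis Tt0 : tracial_state t0.
Local Notation B := (A_omega_b w A).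
Local Notation TFB := (@TF R w A).
Variables (G : groupType) (alpha : action G A).
Hypothesis hGc : countable [set: G].
Hypothesis hGamma : local_equivariant_Gamma w alpha.
Variable one : B.
Hypothesis ta : tracial_alg one TFB.
Local Notation act := (act_omega alpha : G -> B -> B).
Hypothesis tact : tracial_action TFB act.
Variables (k : nat) (D : set B) (x : 'I_k.+1 -> B) (z : G -> 'I_k.+1 -> B) (m : G -> R).
Hypothesis cD : countable D.
Hypothesis hD : forall a, D a -> Pos TFB a /\ Pos TFB (one - a).
Hypothesis DD : forall a b, D a -> D b -> a ** b = b ** a.
Hypothesis Da : forall g a, D a -> D (act g a).
Hypothesis Dx : forall i, D (x i).
Hypothesis Dz : forall h i, D (z h i).
Hypothesis zx : forall h i, Pos TFB (x i - z h i).
Hypothesis zax : forall h i, Pos TFB (act h (x i) - z h i).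
Hypothesis x1 : \sum_i x i = one.
Hypothesis z1 : forall h, \sum_i z h i = (m h)%:C%C *: one.
Let c : R := k.+1%:R^-1.

(** e_i = p_i P(x_i), where the p_i are the orthogonal invariant projections of trace 1/(k + 1) from
    Gamma. They force e_i to be orthogonal to every translate of e_j for j different from i, while P
    keeps the traces of x_i and the order relations of z_i. *)
Lemma round (T : set B) : countable T -> T one -> (forall s a, T s -> D a -> s ** a = a ** s) ->
  exists e : 'I_k.+1 -> B,
    [/\ forall i, projection (e i),
        forall g i j, i != j -> e i ** act g (e j) = 0,
        (forall i s, T s -> s ** e i = e i ** s) /\
        (forall g i j, act g (e i) ** e j = e j ** act g (e i)),
        forall f i a, TFB f -> T a -> f (a ** e i) = c * f (a ** x i) &
        forall f h i a, TFB f -> T a -> Pos TFB a ->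
          c * f (a ** z h i) <= f (a ** (e i ** act h (e i)))].
Proof.
move=> cT T1 TD; pose T' := T `|` (-%R @` T).
have TT' a : T a -> T' a by left.
have cT' : countable T' by apply: countable_setU => //; exact: countable_image.
have D0 : D !=set0 by exists (x ord0).
have [|a b Ta Db|P [pP PP TP [aP mP] tP]] :=
    comm_projections hsigma Tt0 hGc hGamma ta tact cT' cD (TT' _ T1) _ hD DD _ Da D0.
- by move=> s [Ts|[r Tr <-]]; [right; exists s|left; rewrite opprK].
- by case: Ta => [Ta|[r Tr <-]]; rewrite ?sNmul ?smulN TD.
pose V := T `|` (P @` D) `|` \bigcup_(a in T) ((fun b => a ** P b) @` D)
   `|` \bigcup_(a in T) \bigcup_(b in D) ((fun b' => a ** (P b ** P b')) @` D).
have cV : countable V.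
  do !apply: countable_setU => //; do ?exact: countable_image;
    apply: bigcup_countable => // a _; first exact: countable_image.
  by apply: bigcup_countable => // b _; exact: countable_image.
have [p [pp pij ip cp tp]] := gamma_real hsigma Tt0 hGamma k.+1 cV.
have pT i a : T a -> p i ** a = a ** p i by move=> Ta; apply: cp; do 3 left.
have pP' i a : D a -> p i ** P a = P a ** p i.
  by move=> Da'; apply: cp; do 2 left; right; exists a.
have tp1 i a b f : TFB f -> T a -> D b -> f (a ** P b ** p i) = c * f (a ** P b).
  by move=> Tf Ta Db; apply: tp => //; left; right; exists a => //; exists b.
have tp2 i a b b' f : TFB f -> T a -> D b -> D b' ->
    f (a ** (P b ** P b') ** p i) = c * f (a ** (P b ** P b')).
  by move=> Tf Ta Db Db'; apply: tp => //; right; exists a => //; exists b => //; exists b'.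
have ae g i : act g (p i ** P (x i)) = p i ** P (act g (x i)).
  by rewrite (tac_M tact) aP// ip.
have Tcomm i s : T s -> s ** (p i ** P (x i)) = p i ** P (x i) ** s.
  move=> Ts; have h1 := pT i s Ts; have h2 := TP s (x i) (TT' _ Ts) (Dx i).
  by move: (P (x i)) (p i) h1 h2 => b q h1 h2; nc.
exists (fun i => p i ** P (x i)); split.
- move=> i; apply: proj_mul; [exact: pp|exact: pP|exact: pP'].
- move=> g i j ij; rewrite ae; have h1 := pij i j ij; have h2 := pP' j (x i) (Dx i).
  have -> : p i ** P (x i) ** (p j ** P (act g (x j))) = p i ** p j ** P (x i) ** P (act g (x j)).
    by move: (P (x i)) (P (act _ _)) (p i) (p j) h2 => a b q q' h; nc.
  by rewrite h1 !s0mul.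
- split=> [i s|g i j]; first exact: Tcomm.
  rewrite ae; have h1 := PP _ _ (Da g (Dx i)) (Dx j).
  have h2 := pP' j _ (Da g (Dx i)); have h3 := pP' i _ (Dx j).
  have h4 : p i ** p j = p j ** p i.
    have [->//|ij] := eqVneq i j; rewrite !pij// eq_sym//.
  by move: (P _) (P (x j)) (p i) (p j) h1 h2 h3 h4 => a b q q' h1 h2 h3 h4; nc.
- move=> f i a Tf Ta; rewrite -(tP f a (x i) Tf (TT' _ Ta) (Dx i)).
  rewrite -(tp1 i)// pP'// smulA//.
- move=> f h i a Tf Ta pa; rewrite ae.
  have -> : a ** (p i ** P (x i) ** (p i ** P (act h (x i)))) = a ** (P (x i) ** P (act h (x i))) ** p i.
    have [_ h1] := pp i; have h2 := pP' i _ (Dx i); have h3 := pP' i _ (Da h (Dx i)).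
    by move: (P _) (P _) (p i) h1 h2 h3 => b b' q h1 h2 h3; nc.
  rewrite tp2//; last exact: Da.
  apply: ler_wpM2l; first by rewrite invr_ge0 ler0n.
  rewrite -(tP f a _ Tf (TT' _ Ta) (Dz h i)) -subr_ge0 -(rposB (TF_rpos Tf)) -smulN -smulDr.
  apply: (tr_pos_mul hsigma Tt0 ta) => //.
  have hx := mP _ _ (Dz h i) (Dx i) (zx h i).
  have hax := mP _ _ (Dz h i) (Da h (Dx i)) (zax h i).
  have cxa := PP _ _ (Dx i) (Da h (Dx i)).
  have czx := PP _ _ (Dz h i) (Dx i); have cza := PP _ _ (Dz h i) (Da h (Dx i)).
  (* P(z) lies under the commuting projections P(x_i) and P(h x_i), hence under their product. *)
  have -> : P (x i) ** P (act h (x i)) - P (z h i) =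
      (P (x i) ** P (act h (x i))) ** (one - P (z h i)).
    rewrite smulDr smulN (smul1r ta); congr (_ - _).
    by rewrite -smulA -cza hax -czx hx.
  apply: (pos_mul ta).
  + by apply: (proj_pos ta); apply: proj_mul; [exact: pP|apply: pP; exact: Da|].
  + by apply: (proj_pos ta); apply: (proj_compl ta); exact: pP.
  + by move: (P _) (P (act _ _)) (P (x i)) cxa czx cza => a1 a2 a3 h1 h2 h3; nc1.
Qed.
Lemma act_sum (J : Type) (r : seq J) (Q : pred J) (F : J -> B) g :
  act g (\sum_(j <- r | Q j) F j) = \sum_(j <- r | Q j) act g (F j).
Proof.
apply: (big_morph (act g) (tac_D tact g)).
by have := tac_Z tact g 0 0; rewrite !scale0r.
Qed.

Lemma act_sub g (a b : B) : act g (a - b) = act g a - act g b.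
Proof. by rewrite (tac_D tact) -scaleN1r (tac_Z tact) scaleN1r. Qed.

Lemma act_one g : act g one = one.
Proof.
have h a : act g one ** a = a.
  have -> : a = act g (act g^-1%g a) by rewrite -(tac_comp tact) mulgV (tac_1 tact).
  by rewrite -(tac_M tact) (smul1l ta).
by rewrite -[LHS](smul1r ta) h.
Qed.

Lemma act_proj g (p : B) : projection p -> projection (act g p).
Proof. by move=> [sp pp]; split; rewrite -?(tac_S tact) ?sp// -(tac_M tact) pp. Qed.

Lemma act_comm1 g (a b : B) : a ** act g^-1%g b = act g^-1%g b ** a -> act g a ** b = b ** act g a.
Proof.
move=> h; rewrite -{1 2}(tac_1 tact b); apply: (act_comm tact).
by rewrite mulg1.
Qed.

Lemma proj_orth_sum (J : finType) (q : J -> B) : (forall i, projection (q i)) ->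
  (forall i j, i != j -> q i ** q j = 0) -> projection (\sum_i q i).
Proof.
move=> pq qq; split; first by rewrite star_sum; apply: eq_bigr => i _; have [] := pq i.
rewrite smul_suml; apply: eq_bigr => i _; rewrite smul_sumr (bigD1 i)//=.
have [_ ->] := pq i; rewrite big1 ?addr0// => j ji; apply: qq; by rewrite eq_sym.
Qed.

(** gg is the overlap of the q_i with their translates, ww the trace of the remaining part rho (h
    rho), ss the overlap gained in the round, mm that of the weights. The potential gg + th * ww
    does not decrease: it loses 2 th c' ww and gains (1 + th) ss, where ss >= c' mm ww. *)
Lemma round_arith (c' th mm ww ss gg gg' : R) : 0 <= c' -> 0 <= th -> 0 <= ww ->
  2 * th <= (1 + th) * mm -> c' * (mm * ww) <= ss -> gg + ss <= gg' ->
  gg + th * ww <= gg' + th * (ww - c' * ww - c' * ww + ss).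
Proof.
move=> c0 th0 w0 h1 h2 h3.
have h4 : (1 + th) * (c' * (mm * ww)) <= (1 + th) * ss by apply: ler_wpM2l => //; lra.
have h5 : 0 <= c' * (((1 + th) * mm - 2 * th) * ww) by rewrite !mulr_ge0// subr_ge0.
lra.
Qed.

(* Each round spends the fraction 1/(k+1) of what is left, on every trace; on the
   spent part q_i and its translate by h overlap at least as much as the z_i. *)
Lemma rounds (S : set B) (N : nat) : countable S -> S one ->
  (forall s a, S s -> D a -> s ** a = a ** s) ->
  exists q : 'I_k.+1 -> B, let rho := one - \sum_i q i in
    [/\ (forall i, projection (q i)) /\ (forall i j, i != j -> q i ** q j = 0),
        forall i s, (S `|` D) s -> s ** q i = q i ** s,
        forall g i j, act g (q i) ** q j = q j ** act g (q i),
        (forall f a, TFB f -> S a -> f (a ** rho) = (1 - c) ^+ N * f a) /\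
        (forall f i a, TFB f -> S a -> S (x i ** a) ->
           f (a ** q i) = (1 - (1 - c) ^+ N) * f (a ** x i)) &
        forall f h th, TFB f -> 0 <= th -> 2 * th <= (1 + th) * m h ->
          th <= \sum_i f (q i ** act h (q i)) + th * f (rho ** act h rho)].
Proof.
move=> cS S1 SD; elim: N => [|N [q [[pq qq] qS aq [fr fq] fg]]].
  have a0 g : act g 0 = 0 by have := tac_Z tact g 0 0; rewrite !scale0r.
  exists (fun=> 0); rewrite /= big1// subr0; split=> //.
  - by split=> [i|i j _]; [split|]; rewrite ?star0 ?smul0.
  - by move=> i s _; rewrite smul0 s0mul.
  - by move=> g i j; rewrite smul0 a0 smul0.
  - split=> [f a Tf _|f i a Tf _ _]; first by rewrite expr0 mul1r (smul1r ta).
    by rewrite smul0 (rpos0 (TF_rpos Tf)) expr0 subrr mul0r.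
  - move=> f h th Tf th0 _; rewrite act_one (smul1l ta) (ta_one ta Tf) mulr1.
    by rewrite big1 ?add0r// => i _; rewrite s0mul (rpos0 (TF_rpos Tf)).
set rho := one - _ in fr fg.
pose T := S `|` D `|` \bigcup_i range (fun g => act g (q i)) `|` ((fun a => a ** rho) @` S)
  `|` \bigcup_g range (fun h => act g rho ** act h rho).
have cT : countable T.
  do !apply: countable_setU => //; try exact: countable_image.
    by apply: bigcup_countable => [|i _]; [exact: countableP|exact: countable_image].
  by apply: bigcup_countable => // g _; exact: countable_image.
have qD g i a : D a -> act g (q i) ** a = a ** act g (q i).
  by move=> Da'; apply: act_comm1; rewrite qS//; right; exact: Da.
have rE g : act g rho = one - \sum_i act g (q i) by rewrite /rho act_sub act_one act_sum.
have comm_rho g a : (forall i, act g (q i) ** a = a ** act g (q i)) -> act g rho ** a = a ** act g rho.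
  move=> h; rewrite rE smulDl smulDr smulN sNmul (smul1l ta) (smul1r ta); congr (_ - _).
  by symmetry; apply: smulC_sum => i _; rewrite h.
have q1 i : act 1%g (q i) = q i by exact: (tac_1 tact).
have r1 : act 1%g rho = rho by exact: (tac_1 tact).
have TD s a : T s -> D a -> s ** a = a ** s.
  move=> Ts Da'; have rD g : act g rho ** a = a ** act g rho by apply: comm_rho => i; exact: qD.
  case: Ts => [[[[Ss|Ds]|[i _ [g _ <-]]]|[b Sb <-]]|[g _ [h _ <-]]].
  - exact: SD.
  - exact: DD.
  - exact: qD.
  - by have h1 := rD 1%g; rewrite r1 in h1; have h2 := SD b a Sb Da'; clearbody rho; nc.
  - have h1 := rD g; have h2 := rD h.
    by move: (act g rho) (act h rho) h1 h2 => u v h1 h2; nc.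
have T1 : T one by do 4 left.
have [e [pe ee [eT ae] fe fee]] := round cT T1 TD.
have Tq g i : T (act g (q i)) by do 2 left; right; exists i => //; exists g.
have Tr a : S a -> T (a ** rho) by move=> Sa; left; right; exists a.
have Trr g h : T (act g rho ** act h rho) by right; exists g => //; exists h.
have psum := proj_orth_sum pq qq.
have prho : projection rho by exact: (proj_compl ta).
have qe g i j : act g (q i) ** e j = e j ** act g (q i) by apply: eT.
have rqe g j : act g rho ** e j = e j ** act g rho by apply: comm_rho => i; exact: qe.
have aqq g i j : act g (q i) ** q j = q j ** act g (q i) by [].
have arq g j : act g rho ** q j = q j ** act g rho by apply: comm_rho => i; exact: aq.
have aqr g i : act g (q i) ** rho = rho ** act g (q i).
  have h := comm_rho 1%g (act g (q i)); rewrite r1 in h; rewrite h// => j.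
  by rewrite q1 aq.
have arr g : act g rho ** rho = rho ** act g rho.
  by apply: comm_rho => i; exact: aqr.
have aer g i : act g (e i) ** rho = rho ** act g (e i).
  by apply: act_comm1; rewrite rqe.
have aeq g i j : act g (e i) ** q j = q j ** act g (e i).
  by apply: act_comm1; rewrite qe.
have re j : rho ** e j = e j ** rho by rewrite -[in LHS]r1 rqe r1.
have qej i j : q i ** e j = e j ** q i by rewrite -[in LHS]q1 qe q1.
have e1 i : act 1%g (e i) = e i by exact: (tac_1 tact).
have ee1 i j : i != j -> e i ** e j = 0 by move=> ij; rewrite -(e1 j) ee.
have qr i : q i ** rho = 0.
  rewrite /rho smulDr smulN (smul1r ta) smul_sumr (bigD1 i)//= big1 ?addr0.
    by have [_ ->] := pq i; rewrite subrr.
  by move=> j ji; rewrite qq// eq_sym.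
have rq i : rho ** q i = 0 by rewrite -[in LHS]r1 arq r1 qr.
have rhoE : one - \sum_i (q i + rho ** e i) = rho ** (one - \sum_i e i).
  by rewrite big_split -smul_sumr smulDr smulN (smul1r ta) opprD addrA.
have pre i : projection (rho ** e i) by apply: proj_mul.
have Srho s : (S `|` D) s -> s ** rho = rho ** s.
  move=> Ss; have h := comm_rho 1%g s; rewrite r1 in h; rewrite h// => i; rewrite q1 qS//.
have pE : projection (\sum_i e i) by exact: proj_orth_sum.
have cc : 0 <= c by rewrite invr_ge0 ler0n.
exists (fun i => q i + rho ** e i); rewrite rhoE /=; clearbody rho.
split.
- split=> [i|i j ij].
    have [sq q2] := pq i; have [sr r2] := pre i; split; first by rewrite starD sq sr.
    rewrite smulDl !smulDr q2 r2.
    have -> : rho ** e i ** q i = 0 by rewrite re -smulA rq smul0.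
    by rewrite smulA qr s0mul addr0 add0r.
  rewrite smulDl !smulDr qq// add0r smulA qr s0mul add0r.
  have -> : rho ** e i ** q j = 0 by rewrite re -smulA rq smul0.
  have -> : rho ** e i ** (rho ** e j) = rho ** rho ** (e i ** e j).
    by have h := re i; nc.
  by rewrite ee1// smul0 addr0.
- move=> i s Ss; have h1 := qS i s Ss; have h2 := Srho s Ss.
  have h3 : s ** e i = e i ** s by apply: eT; do 3 left.
  by nc.
- move=> g i j; rewrite (tac_D tact) (tac_M tact).
  have := (aq g i j, aqr g i, qe g i j); have := (arq g j, arr g, rqe g j).
  have := (aeq g i j, aer g i, ae g i j).
  move: (act g (q i)) (act g rho) (act g (e i)) => u v w' [[h1 h2] h3] [[h4 h5] h6] [[h7 h8] h9].
  by nc.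
- have main f a : TFB f -> S a -> f (a ** (rho ** (one - \sum_i e i))) = (1 - c) ^+ N.+1 * f a.
    move=> Tf Sa; have fp := TF_rpos Tf.
    rewrite exprS -mulrA -(fr f a Tf Sa) smulA smulDr smulN (smul1r ta) (rposB fp) smul_sumr.
    rewrite (rpos_sum fp) (eq_bigr (fun i => c * f (a ** rho ** x i))) => [|i _]; last first.
      by apply: fe => //; exact: Tr.
    by rewrite -mulr_sumr -(rpos_sum fp) -smul_sumr x1 (smul1r ta) mulrBl mul1r.
  split=> // f i a Tf Sa Sxa; have fp := TF_rpos Tf.
  rewrite smulDr (rposD fp) fq// smulA fe//; last exact: Tr.
  rewrite (TF_C Tf (a ** rho)) smulA fr// (TF_C Tf (x i)) exprS.
  by move: (f (a ** x i)) ((1 - c) ^+ N) => X Y; ring.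
move=> f h th Tf th0 hm; have fp := TF_rpos Tf.
apply: le_trans (fg f h th Tf th0 hm) _.
set rh := act h rho; pose W := rho ** rh.
have crh : rho ** rh = rh ** rho by rewrite arr.
have prh : projection rh by exact: act_proj.
have pW : Pos TFB W by apply: (proj_pos ta); exact: proj_mul.
have TW : T W by rewrite /W -[rho]r1; exact: Trr.
pose E := \sum_i e i; pose Eh := \sum_i act h (e i).
have rE' : rho ** (one - E) ** act h (rho ** (one - E)) = W - W ** E - W ** Eh + W ** (E ** Eh).
  rewrite (tac_M tact) act_sub act_one /E act_sum -/E -/Eh -/rh.
  have h1 : rh ** E = E ** rh by apply: smulC_sum => i _; exact: rqe.
  by rewrite /W; move: (E) (Eh) h1 => E1 E2 h1; nc1.
have fWE : f (W ** E) = c * f W.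
  rewrite smul_sumr (rpos_sum fp) (eq_bigr (fun i => c * f (W ** x i))) => [|i _]; last exact: fe.
  by rewrite -mulr_sumr -(rpos_sum fp) -smul_sumr x1 (smul1r ta).
have fWEh : f (W ** Eh) = c * f W.
  have Tfh := tac_TF tact h Tf.
  (* W is the translate by h of an element of T, so the trace identity for e_i under the trace f o h
     evaluates W against the translate of e_i. *)
  have WE : W = act h (act h^-1%g rho ** act 1%g rho).
    by rewrite (tac_M tact) -(tac_comp tact) mulgV !(tac_1 tact).
  rewrite smul_sumr (rpos_sum fp).
  rewrite (eq_bigr (fun i => c * f (W ** act h (x i)))) => [|i _].
    by rewrite -mulr_sumr -(rpos_sum fp) -smul_sumr -act_sum x1 act_one (smul1r ta).
  have := fe _ i _ Tfh (Trr h^-1%g 1%g).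
  by rewrite (tac_M tact _ _ (e i)) (tac_M tact _ _ (x i)) -WE.
pose ss := \sum_i f (W ** (e i ** act h (e i))).
have fEE : f (W ** (E ** Eh)) = ss.
  rewrite /ss -(rpos_sum fp) -smul_sumr; congr (f (_ ** _)).
  rewrite /E smul_suml; apply: eq_bigr => i _; rewrite /Eh smul_sumr (bigD1 i)//= big1 ?addr0//.
  by move=> j ji; apply: ee; rewrite eq_sym.
have hss : c * (m h * f W) <= ss.
  have -> : m h * f W = \sum_i f (W ** z h i).
    by rewrite -(rpos_sum fp) -smul_sumr z1 smulZr (smul1r ta) (rposZ fp).
  by rewrite mulr_sumr; apply: ler_sum => i _; exact: fee.
rewrite rE' !(rposD fp) !(rposN fp) fWE fWEh fEE.
apply: (round_arith cc th0 (pos_tr ta Tf pW) hm hss).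
rewrite /ss -big_split /=; apply: ler_sum => i _.
rewrite (tac_D tact) (tac_M tact) -/rh smulDl !smulDr !(rposD fp).
set r2 := act h (q i); set ei := act h (e i).
have h1 : 0 <= f (q i ** (rh ** ei)).
  apply: (pos_tr ta Tf); apply: (pos_mul ta).
  - exact: (proj_pos ta).
  - by apply: (proj_pos ta); rewrite /rh /ei -(tac_M tact); exact: act_proj.
  - have := (arq h i, aeq h i i); rewrite -/rh -/ei => -[h2 h3].
    by clearbody rh ei; nc.
have h4 : 0 <= f (rho ** e i ** r2).
  apply: (pos_tr ta Tf); apply: (pos_mul ta).
  - exact: (proj_pos ta).
  - by apply: (proj_pos ta); exact: act_proj.
  - have := (aqr h i, qe h i i); rewrite -/r2 => -[h2 h3].
    by clearbody r2; nc.
have -> : rho ** e i ** (rh ** ei) = W ** (e i ** ei).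
  by have := rqe h i; rewrite -/rh /W => h2; clearbody rh ei; nc.
by rewrite -addrA lerD2l addrA lerDr addr_ge0.
Qed.
End Rounds.

(** * Reiter's condition *)

Section Reiter.
Variables (R : realType) (G : groupType).
Implicit Types (Om K : seq G) (wt : G -> R) (phi : G -> G -> R).

Lemma sum_shift (V : nmodType) Om (F : G -> V) h : uniq Om ->
  (forall g, g \notin Om -> F g = 0) -> (forall g, g \notin Om -> F (h * g)%g = 0) ->
  \sum_(g <- Om) F (h * g)%g = \sum_(g <- Om) F g.
Proof.
move=> uO F1 F2; rewrite -(big_map (fun g => (h * g)%g) xpredT F).
set Om' := map _ Om.
have uO' : uniq Om' by rewrite map_inj_uniq//; exact: mulgI.
have F2' g : g \notin Om' -> F g = 0.
  move=> gO; have gE : g = (h * (h^-1 * g))%g by rewrite mulgA mulgV mul1g.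
  rewrite gE; apply: F2; apply: contra gO => h1.
  by apply/mapP; exists (h^-1 * g)%g; rewrite -?gE.
have restr (s s' : seq G) : uniq s -> uniq s' -> (forall g, g \notin s' -> F g = 0) ->
    \sum_(g <- s) F g = \sum_(g <- [seq g <- s | g \in s']) F g.
  move=> us us' hF; rewrite big_filter [LHS](bigID (mem s'))/= [X in _ + X]big1 ?addr0//.
rewrite (restr Om' Om)// (restr Om Om')//; apply: perm_big; apply: uniq_perm.
- exact: filter_uniq.
- exact: filter_uniq.
by move=> g; rewrite !mem_filter andbC.
Qed.

Definition prob_on Om wt : Prop :=
  [/\ uniq Om, forall g, 0 <= wt g, forall g, g \notin Om -> wt g = 0 & \sum_(g <- Om) wt g = 1].

(** For a probability supported in Om, 1 minus this is half the l^1-distance of wt from its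
    translate by h; it is the mass of the weights z_h below. *)
Definition overlap Om wt h : R := \sum_(g <- Om) Num.min (wt g) (wt (h * g)%g).

(** An invariant mean annihilates the drift of bounded functions, so a drift bounded below by a
    positive constant contradicts amenability. *)
Definition drift K phi g : R := \sum_(h <- K) (phi h (h * g)%g - phi h g).

Definition unit_valued phi : Prop := forall h g, 0 <= phi h g <= 1.

(** After a shift the pairing is the sum of phi_h(hg) (wt g - wt(hg)). Taking for phi_h(hg) the
    indicator of positivity of the second factor gives the total positive part, which is 1 -
    overlap. *)
Lemma best_response Om wt K : prob_on Om wt -> exists2 phi, unit_valued phi &
  \sum_(g <- Om) wt g * drift K phi g = \sum_(h <- K) (1 - overlap Om wt h).
Proof.
move=> [uO w0 wO w1]; pose phi h g : R := if wt g < wt (h^-1 * g)%g then 1 else 0.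
exists phi => [h g|]; first by rewrite /phi; case: ifP; rewrite ?lexx ?ler01.
under eq_bigr do rewrite mulr_sumr.
rewrite exchange_big /=; apply: eq_bigr => h _.
under eq_bigr do rewrite mulrBr.
rewrite sumrB -(@sum_shift _ Om (fun g => wt g * phi h g) h)//; first last.
- move=> g gO; rewrite /phi mulKg (wO g gO) ltNge w0 mulr0//.
- by move=> g gO; rewrite wO ?mul0r.
rewrite -w1 /overlap -!sumrB; apply: eq_bigr => g _; rewrite /phi mulKg -mulrBl.
by case: ltP => _; rewrite ?mulr1// mulr0 subrr.
Qed.

(** The new deficiency is at most |max(0, eta - v) - t(v' - v)| in each coordinate. Expanding the
    squares, the hypothesis bounds the cross term by the squared deficiency itself. *)
Lemma deficiency_step (J : eqType) (s : seq J) (eta t : R) (v v' : J -> R) :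
  0 <= t -> eta * \sum_(j <- s) Num.max 0 (eta - v j) <= \sum_(j <- s) Num.max 0 (eta - v j) * v' j ->
  \sum_(j <- s) (Num.max 0 (eta - (v j + t * (v' j - v j)))) ^+ 2 <=
  \sum_(j <- s) (Num.max 0 (eta - v j)) ^+ 2 - 2 * t * \sum_(j <- s) (Num.max 0 (eta - v j)) ^+ 2
   + t ^+ 2 * \sum_(j <- s) (v' j - v j) ^+ 2.
Proof.
move=> t0 h; set d := \sum_(j <- s) (Num.max 0 (eta - v j)) ^+ 2.
apply: (@le_trans _ _ (\sum_(j <- s) (Num.max 0 (eta - v j) - t * (v' j - v j)) ^+ 2)).
  apply: ler_sum => j _; set a := eta - v j; set D := v' j - v j.
  have -> : eta - (v j + t * D) = a - t * D by rewrite /a opprD addrA.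
  have [h1|h1] := leP 0 (a - t * D); last by rewrite expr0n sqr_ge0.
  rewrite ler_pXn2r ?nnegrE//; last by apply: le_trans h1 _; rewrite lerD2r le_max lexx orbT.
  by rewrite lerD2r le_max lexx orbT.
have -> : \sum_(j <- s) (Num.max 0 (eta - v j) - t * (v' j - v j)) ^+ 2 =
    d - 2 * t * \sum_(j <- s) (Num.max 0 (eta - v j) * (v' j - v j))
    + t ^+ 2 * \sum_(j <- s) (v' j - v j) ^+ 2.
  rewrite /d !mulr_sumr -sumrB -big_split; apply: eq_bigr => j _ /=; ring.
rewrite lerD2r lerD2l lerN2; apply: ler_wpM2l; first by rewrite mulr_ge0.
have -> : \sum_(j <- s) Num.max 0 (eta - v j) * (v' j - v j) =
    \sum_(j <- s) Num.max 0 (eta - v j) * v' j - eta * \sum_(j <- s) Num.max 0 (eta - v j) + d.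
  rewrite /d !mulr_sumr -sumrB -big_split; apply: eq_bigr => j _ /=.
  by case: (leP 0 (eta - v j)) => _; ring.
by rewrite lerDr subr_ge0.
Qed.

(* Approachability: a strategy minimising the squared deficiency can always be
   improved in the direction of the best response to the normalised deficiency. *)
Lemma finite_drift K Om (eta : R) : 0 < eta -> uniq Om ->
  (forall wt, prob_on Om wt -> exists2 h, h \in K & overlap Om wt h <= 1 - eta) ->
  exists2 phi, unit_valued phi & forall g, g \in Om -> eta / 2 <= drift K phi g.
Proof.
move=> e0 uO hK; apply: contrapT => hno.
pose d phi := \sum_(g <- Om) (Num.max 0 (eta - drift K phi g)) ^+ 2.
have dlarge phi : unit_valued phi -> (eta / 2) ^+ 2 <= d phi.
  move=> uphi; rewrite leNgt; apply/negP => dl; apply: hno; exists phi => // g gO.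
  rewrite leNgt; apply/negP => hg; move: dl; apply/negP; rewrite -leNgt.
  rewrite /d (bigD1_seq g)//=; apply: (@le_trans _ _ ((Num.max 0 (eta - drift K phi g)) ^+ 2)).
    rewrite ler_pXn2r ?nnegrE ?divr_ge0 ?(ltW e0) ?le_max ?lexx//.
    by apply/orP; right; lra.
  by rewrite lerDl; apply: sumr_ge0 => g' _; exact: sqr_ge0.
pose E := [set d phi | phi in unit_valued].
have u0 : unit_valued (fun _ _ => 0) by move=> h g; rewrite lexx ler01.
have E0 : E !=set0 by exists (d (fun _ _ => 0)), (fun _ _ => 0).
have lE : has_lbound E by exists ((eta / 2) ^+ 2) => _ [phi uphi <-]; exact: dlarge.
pose I := inf E; have I0 : 0 < I.
  apply: (@lt_le_trans _ _ ((eta / 2) ^+ 2)); first by rewrite exprn_gt0// divr_gt0.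
  by apply: lb_le_inf => // _ [phi uphi <-]; exact: dlarge.
pose L : R := (size K)%:R; pose M := \sum_(g <- Om) (2 * L) ^+ 2.
have M0 : 0 <= M by apply: sumr_ge0 => g _; exact: sqr_ge0.
have drift_le phi g : unit_valued phi -> `|drift K phi g| <= L.
  move=> uphi; apply: le_trans (ler_norm_sum _ _ _) _.
  have -> : L = \sum_(h <- K) 1 by rewrite big_const_seq count_predT iter_addr_0.
  apply: ler_sum => h _; have /andP[h1 h2] := uphi h (h * g)%g; have /andP[h3 h4] := uphi h g.
  by rewrite ler_norml; apply/andP; split; lra.
(* This t makes the quadratic term t^2 M at most t I. A deficiency within t I/2 of the infimum I > 0
   would then drop below I. *)
pose t := I / (I + M); have IM : 0 < I + M by rewrite ltr_wpDr.
have t0 : 0 < t by rewrite divr_gt0.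
have t1 : t <= 1 by rewrite ler_pdivrMr// mul1r lerDl.
have tI : 0 < t * I / 2 by rewrite divr_gt0// mulr_gt0.
have [_ [phi uphi <-] hphi] := inf_adherent tI (conj E0 lE).
rewrite -/I in hphi.
pose a g := Num.max 0 (eta - drift K phi g); pose W := \sum_(g <- Om) a g.
have a0 g : 0 <= a g by rewrite /a le_max lexx.
have W0 : 0 < W.
  rewrite lt_neqAle sumr_ge0// andbT eq_sym; apply/negP => /eqP W0.
  have := dlarge phi uphi; apply/negP; rewrite -ltNge /d big1_seq ?exprn_gt0 ?divr_gt0//.
  move=> g /andP[_ gO]; have : a g = 0; last by rewrite /a => ->; rewrite expr0n.
  have /eqP := W0; rewrite /W psumr_eq0// => /allP/(_ g gO)/eqP //.
pose wt g := if g \in Om then a g / W else 0.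
have pw : prob_on Om wt.
  split=> // [g|g gO|]; rewrite /wt.
  - by case: ifP => // _; rewrite divr_ge0// ltW.
  - by rewrite (negbTE gO).
  - rewrite big_seq (eq_bigr (fun g => a g / W)) => [|g ->//].
    by rewrite -big_seq -mulr_suml mulfV ?gt_eqF.
have [psi upsi hpsi] := best_response K pw.
have pay : eta <= \sum_(g <- Om) wt g * drift K psi g.
  rewrite hpsi; have [h hK' ho] := hK wt pw.
  have ov h' : overlap Om wt h' <= 1.
    by have [_ _ _ <-] := pw; apply: ler_sum => g _; rewrite ge_min lexx.
  rewrite (perm_big _ (perm_to_rem hK')) big_cons /=.
  have : 0 <= \sum_(j <- rem h K) (1 - overlap Om wt j).
    by apply: sumr_ge0 => j _; rewrite subr_ge0.
  move: ho; set X := overlap _ _ _; set Y := \sum_(j <- _) _; lra.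
have pay' : eta * W <= \sum_(g <- Om) a g * drift K psi g.
  rewrite -ler_pdivlMr// mulr_suml; apply: le_trans pay _; rewrite le_eqVlt; apply/orP; left.
  apply/eqP; rewrite big_seq [RHS]big_seq; apply: eq_bigr => g gO.
  by rewrite /wt gO mulrAC.
pose phi' h g := phi h g + t * (psi h g - phi h g).
have uphi' : unit_valued phi'.
  move=> h g; have /andP[h1 h2] := uphi h g; have /andP[h3 h4] := upsi h g.
  have -> : phi' h g = (1 - t) * phi h g + t * psi h g by rewrite /phi'; ring.
  apply/andP; split; first by rewrite addr_ge0// mulr_ge0// ?subr_ge0// ltW.
  apply: (@le_trans _ _ ((1 - t) * 1 + t * 1)); last by rewrite !mulr1 subrK.
  by apply: lerD; apply: ler_wpM2l => //; rewrite ?subr_ge0// ltW.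
have dE g : drift K phi' g = drift K phi g + t * (drift K psi g - drift K phi g).
  rewrite /drift -sumrB mulr_sumr -big_split; apply: eq_bigr => h _ /=; rewrite /phi'; ring.
have := ge_inf lE (ex_intro2 _ _ phi' uphi' erefl); rewrite -/I => Ile.
have := deficiency_step (ltW t0) pay'.
have -> : \sum_(j <- Om) Num.max 0 (eta - (drift K phi j + t * (drift K psi j - drift K phi j))) ^+ 2 = d phi'.
  by apply: eq_bigr => g _; rewrite dE.
rewrite -/(d phi) => hd.
have hM : \sum_(j <- Om) (drift K psi j - drift K phi j) ^+ 2 <= M.
  apply: ler_sum => g _; rewrite -real_normK ?num_real// ler_pXn2r ?nnegrE ?mulr_ge0//.
  apply: le_trans (ler_normB _ _) _; rewrite mulr2n mulrDl mul1r; apply: lerD; exact: drift_le.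
have h1 : t ^+ 2 * \sum_(j <- Om) (drift K psi j - drift K phi j) ^+ 2 <= t * I.
  apply: le_trans (ler_wpM2l (sqr_ge0 t) hM) _; rewrite expr2 -mulrA ler_pM2l//.
  by rewrite /t mulrAC ler_pdivrMr// ler_pM2l// lerDr ltW.
have h2 : t * I <= t * d phi.
  by rewrite ler_pM2l//; apply: ge_inf => //; exists phi.
move: hd h1 h2 hphi Ile tI; set S1 := t ^+ 2 * _; rewrite -mulrA.
move: (d phi') (d phi) => d1 d2; set td2 := t * d2; set ti := t * I; lra.
Qed.
(** Otherwise every finite set Om carries functions of drift at least eta/2 on Om. Their limit along
    the finite sets has this drift on all of G, where an invariant mean gives it the value 0. *)
Lemma reiter K (eta : R) : amenable R G -> 0 < eta -> exists Om wt, prob_on Om wt /\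
  forall h, h \in K -> 1 - eta < overlap Om wt h.
Proof.
move=> [m [mL mP m1 mI]] e0; apply: contrapT => hno.
have hK Om wt : prob_on Om wt -> exists2 h, h \in K & overlap Om wt h <= 1 - eta.
  move=> pw; apply: contrapT => hn; apply: hno; exists Om, wt; split=> // h hK.
  by rewrite ltNge; apply/negP => ho; apply: hn; exists h.
have /choice[F hF] : forall Om : seq G, exists phi, unit_valued phi /\
    forall g, g \in Om -> eta / 2 <= drift K phi g.
  move=> Om; have [|phi uphi hphi] := finite_drift e0 (undup_uniq Om) (K := K); first exact: hK.
  by exists phi; split=> // g gO; apply: hphi; rewrite mem_undup.
have [U [UU UD]] := finite_set_ultrafilter G.
have bF p : forall Om, `|F Om p.1 p.2| <= 1.
  move=> Om; have [/(_ p.1 p.2)/andP[h1 h2] _] := hF Om.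
  by rewrite ger0_norm.
have [phi hphi] := choice (fun p => ucv_ex (U := U) (bF p)).
have dphi g : eta / 2 <= drift K (fun h g' => phi (h, g')) g.
  have dc : ucv U (fun Om => drift K (F Om) g) (drift K (fun h g' => phi (h, g')) g).
    rewrite /drift; elim: (K) => [|h K' ih].
      by apply: (@ucv_eq _ _ _ (fun=> 0)) => [Om|]; rewrite big_nil//; exact: ucv_cst.
    rewrite big_cons; apply: (@ucv_eq _ _ _ (fun Om => (F Om h (h * g)%g + (-1) * F Om h g) +
        \sum_(h <- K') (F Om h (h * g)%g - F Om h g))).
      by move=> Om; rewrite big_cons mulN1r.
    apply: ucvD ih; rewrite -[X in _ - X]mul1r -mulNr.
    by apply: ucvD; [exact: (hphi (h, (h * g)%g))|apply: ucvZ; exact: (hphi (h, g))].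
  apply: ucv_le (ucv_cst _) dc _; apply: filterS (UD g) => Om /= gO.
  by have [_] := hF Om; apply.
have bphi h : exists M, forall g, `|phi (h, g)| <= M.
  exists 1 => g; have := ucv_dist (c := 0) (hphi (h, g)) (e := 1); rewrite subr0; apply => Om.
  by rewrite subr0; exact: (bF (h, g)).
pose B (f : G -> R) := exists M, forall g, `|f g| <= M.
have BD c f f' : B f -> B f' -> B (fun g => c * f g + f' g).
  move=> [M hM] [M' hM']; exists (`|c| * M + M') => g; apply: le_trans (ler_normD _ _) _.
  by rewrite normrM; apply: lerD => //; apply: ler_wpM2l.
have B0 c : B (fun=> c) by exists `|c|.
have m0 : m (fun=> 0) = 0.
  have := mL (-1) (fun=> 0) (fun=> 0) (B0 0) (B0 0).
  by rewrite mulr0 addr0; move=> h; lra.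
have Bs h f : B f -> B (fun g => f (h * g)%g) by move=> [M hM]; exists M.
have [mdrift bdrift] : m (drift K (fun h g' => phi (h, g'))) = 0 /\
    B (drift K (fun h g' => phi (h, g'))).
  rewrite /drift; elim: (K) => [|h K' [ih1 ih2]].
    have -> : (fun g => \sum_(h <- [::]) (phi (h, (h * g)%g) - phi (h, g))) = fun=> 0.
      by apply/funext => g; rewrite big_nil.
    by split=> //; exact: B0.
  set f' := fun g => \sum_(h <- K') _ in ih1 ih2.
  have -> : (fun g => \sum_(h <- h :: K') (phi (h, (h * g)%g) - phi (h, g))) =
      fun g => (-1) * phi (h, g) + (1 * phi (h, (h * g)%g) + f' g).
    by apply/funext => g; rewrite big_cons mul1r mulN1r addrA [- _ + _]addrC.
  have b1 : B (fun g => 1 * phi (h, (h * g)%g) + f' g).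
    by apply: BD => //; exact: (Bs h _ (bphi h)).
  split; last exact: (BD (-1) _ _ (bphi h) b1).
  rewrite (mL _ _ _ (bphi h) b1) (mL _ _ _ (Bs h _ (bphi h)) ih2) ih1 addr0 mul1r.
  by rewrite (mI h _ (bphi h)) mulN1r addNr.
have := mP (fun g => 1 * drift K (fun h g' => phi (h, g')) g + - (eta / 2)) (BD _ _ _ bdrift (B0 _)).
rewrite (mL _ _ _ bdrift (B0 _)) mdrift mulr0 add0r => H.
have := mL (- (eta / 2)) (fun=> 1) (fun=> 0) (B0 1) (B0 0).
rewrite m1 m0 !mulr1 !addr0 => h2.
have : 0 <= m (fun=> - (eta / 2)) by apply: H => g; rewrite mul1r subr_ge0.
by rewrite h2 oppr_ge0 leNgt divr_gt0.
Qed.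
End Reiter.

(** * Patching local solutions *)

Lemma quadruple_bound (R : realFieldType) (x y z : R) : 0 <= x * y ->
  z + x * y <= 2 * (2 * x) * y -> z <= 4 * x * y.
Proof. by move=> h1 h2; lra. Qed.

Section Partition.
Variables (R : realType) (w : freeUltrafilter) (A : cstarAlgType R).
Hypothesis hsigma : sigma_unital A.
Variable t0 : A -> R[i].
Hypothesis Tt0 : tracial_state t0.
Local Notation B := (A_omega_b w A).
Local Notation TFB := (@TF R w A).
Hypothesis hCPoU : weak_CPoU w A.
Variables (G : groupType) (alpha : action G A).
Hypothesis hGc : countable [set: G].
Hypothesis hGamma : local_equivariant_Gamma w alpha.
Variable one : B.
Hypothesis ta : tracial_alg one TFB.
Local Notation act := (act_omega alpha : G -> B -> B).
Hypothesis tact : tracial_action TFB act.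

Lemma act_pos g (a : B) : Pos TFB a -> Pos TFB (act g a).
Proof.
move=> [sa pa]; split=> [|f z Tf]; first by rewrite -(tac_S tact) sa.
have -> : z = act g (act g^-1%g z) by rewrite -(tac_comp tact) mulgV (tac_1 tact).
by rewrite -(tac_S tact) -!(tac_M tact); exact: (pa _ _ (tac_TF tact g Tf)).
Qed.

(** Weak CPoU is applied to a_i, the sum of all g^-1 cc_i over Om, so that each translate g u_i is
    small against cc_i and so is any average of them. The constant 4d arises from the shift of a_i
    by d, which gives a cover bounded by 2d, and from the doubling in [comm_povm]. *)
Lemma equivariant_partition (S : set B) k (cc : 'I_k.+1 -> B) (Om : seq G) (wt : G -> R) (d eps : R) :
  countable S -> S one -> (forall g s, S s -> S (act g s)) ->
  (forall i, Pos TFB (cc i)) -> (forall i, S (cc i)) -> prob_on Om wt ->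
  0 < d -> 0 < eps ->
  (forall f, TFB f -> exists i, \sum_(g <- Om) f (act g^-1%g (cc i)) < d) ->
  exists q : 'I_k.+1 -> B, let rho := one - \sum_i q i in
    [/\ (forall i, projection (q i)) /\ (forall i j, i != j -> q i ** q j = 0),
        forall i s, S s -> s ** q i = q i ** s,
        forall g i j, act g (q i) ** q j = q j ** act g (q i),
        forall f, TFB f -> f rho <= eps /\ \sum_i f (cc i ** q i) <= 4 * d &
        forall f h th, TFB f -> 0 <= th -> 2 * th <= (1 + th) * overlap Om wt h ->
          th * (1 - eps) <= \sum_i f (q i ** act h (q i))].
Proof.
move=> cS S1 Sa pc Sc pw d0 e0 hcov; have [uO w0 wO w1] := pw.
pose a i := \sum_(g <- Om) act g^-1%g (cc i).
have pa i : Pos TFB (a i) by apply: (pos_sum ta) => g _; exact: act_pos.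
have /choice[s hs] : forall i, exists s, star s ** s = a i + d%:C%C *: one.
  by move=> i; have [s [ss sE]] := pos_sqrt hsigma Tt0 ta d0 (pa i); exists s; rewrite ss.
have d2 : 0 < 2 * d by rewrite mulr_gt0.
have [|u [pu u1 uS ua uu]] := comm_povm hsigma Tt0 hCPoU hGc ta tact (s := s) cS d2.
  move=> f Tf; have [i hi] := hcov f Tf; exists i; have fp := TF_rpos Tf.
  rewrite hs (rposD fp) (rposZ fp) (ta_one ta Tf) mulr1 /a (rpos_sum fp).
  by rewrite mulr2n mulrDl mul1r ltrD2r.
have pu1 i : Pos TFB (one - u i).
  by rewrite -u1 (bigD1 i)//= addrC addrK; exact: (pos_sum ta).
have uSg g i y : S y -> act g (u i) ** y = y ** act g (u i).
  move=> Sy; apply: (act_comm1 tact); symmetry; apply: uS; exact: Sa.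
pose lc (cf : G -> R) (tr : G -> G) i := \sum_(g <- Om) (cf g)%:C%C *: act (tr g) (u i).
(* z_h has weights min(wt g, wt(hg)) at the translates hg; it therefore lies under h x_i and, after
   a shift of the sum, under x_i, and its total mass is the overlap. *)
pose x i := lc wt id i; pose mn h g := Num.min (wt g) (wt (h * g)%g).
pose z h i := lc (mn h) (fun g => h * g)%g i.
pose D : set B := (\bigcup_i range (fun g => act g (x i))) `|`
  \bigcup_i \bigcup_h range (fun g => act g (z h i)).
have cD : countable D.
  apply: countable_setU; apply: bigcup_countable => [|i _]; try exact: countableP.
    exact: countable_image.
  by apply: bigcup_countable => // h _; exact: countable_image.
have act_lc g cf tr i : act g (lc cf tr i) = lc cf (fun g' => g * tr g')%g i.
  rewrite /lc (act_sum tact); apply: eq_bigr => g' _.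
  by rewrite (tac_Z tact) (tac_comp tact).
have mn0 h g : 0 <= mn h g by rewrite /mn le_min !w0.
have mnw h g : mn h g <= wt g by rewrite /mn ge_min lexx.
have Dlc y : D y -> exists cf tr i, [/\ y = lc cf tr i, forall g, 0 <= cf g &
    \sum_(g <- Om) cf g <= 1].
  move=> [[i _ [g _ <-]]|[i _ [h _ [g _ <-]]]]; rewrite act_lc.
    by exists wt, (fun g' => g * id g')%g, i; split=> //; rewrite w1.
  exists (mn h), (fun g' => g * (h * g'))%g, i; split=> //.
  by rewrite -w1; apply: ler_sum => g' _.
have lc_comm cf tr i y : (forall g, act g (u i) ** y = y ** act g (u i)) ->
    lc cf tr i ** y = y ** lc cf tr i.
  move=> h; symmetry; apply: smulC_sum => g _; rewrite smulZl smulZr h//.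
have plc cf tr i : (forall g, 0 <= cf g) -> Pos TFB (lc cf tr i).
  by move=> c0; apply: (pos_sum ta) => g _; apply: (posZ ta) => //; exact: act_pos.
have hD y : D y -> Pos TFB y /\ Pos TFB (one - y).
  move=> /Dlc[cf [tr [i [-> c0 c1]]]]; split; first exact: plc.
  have -> : one - lc cf tr i = (1 - \sum_(g <- Om) cf g)%:C%C *: one +
      \sum_(g <- Om) (cf g)%:C%C *: (one - act (tr g) (u i)).
    under [X in _ = _ + X]eq_bigr do rewrite scalerBr.
    by rewrite sumrB -scaler_suml -rmorph_sum /= rZB rZ1 addrA subrK.
  apply: (posD ta); first by apply: (posZ ta); [rewrite subr_ge0|exact: (pos1 ta)].
  apply: (pos_sum ta) => g _; apply: (posZ ta) => //.
  by rewrite -(act_one ta tact (tr g)) -(act_sub tact); exact: act_pos.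
have DD y y' : D y -> D y' -> y ** y' = y' ** y.
  move=> /Dlc[cf [tr [i [-> _ _]]]] /Dlc[cf' [tr' [i' [-> _ _]]]].
  by apply: (@lc_comm _ _ _ _) => g; symmetry; apply: (@lc_comm _ _ _ _) => g'; exact: uu.
have Da g y : D y -> D (act g y).
  move=> [[i _ [g' _ <-]]|[i _ [h _ [g' _ <-]]]]; rewrite -(tac_comp tact).
    by left; exists i => //; exists (g * g')%g.
  by right; exists i => //; exists h => //; exists (g * g')%g.
have Dx i : D (x i) by left; exists i => //; exists 1%g => //; exact: (tac_1 tact).
have Dz h i : D (z h i).
  by right; exists i => //; exists h => //; exists 1%g => //; exact: (tac_1 tact).
have zx h i : Pos TFB (x i - z h i).
  pose F g : B := (Num.min (wt (h^-1 * g)%g) (wt g))%:C%C *: act g (u i).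
  have -> : z h i = \sum_(g <- Om) F g.
    have F1 g : g \notin Om -> F g = 0 by move=> gO; rewrite /F (wO g gO) min_r ?w0// rZ0.
    have F2 g : g \notin Om -> F (h * g)%g = 0.
      by move=> gO; rewrite /F mulKg (wO g gO) min_l ?w0// rZ0.
    apply: etrans (sum_shift uO F1 F2); apply: eq_bigr => g _; rewrite /F mulKg//.
  rewrite /x /lc -sumrB; apply: (pos_sum ta) => g _; rewrite -rZB.
  apply: (posZ ta); last exact: act_pos.
  by rewrite subr_ge0 ge_min lexx orbT.
have zax h i : Pos TFB (act h (x i) - z h i).
  rewrite act_lc /z /lc -sumrB; apply: (pos_sum ta) => g _; rewrite -rZB.
  by apply: (posZ ta); [rewrite subr_ge0|exact: act_pos].
have sum_lc cf tr : \sum_i lc cf tr i = (\sum_(g <- Om) cf g)%:C%C *: one.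
  rewrite /lc exchange_big /= rmorph_sum scaler_suml; apply: eq_bigr => g _ /=.
  by rewrite -scaler_sumr -(act_sum tact) u1 (act_one ta tact).
have x1 : \sum_i x i = one by rewrite sum_lc w1 rZ1.
have z1 h : \sum_i z h i = (overlap Om wt h)%:C%C *: one by rewrite sum_lc.
pose S' := S `|` \bigcup_i ((fun y => x i ** y) @` S).
have cS' : countable S'.
  apply: countable_setU => //; apply: bigcup_countable => [|i _]; first exact: countableP.
  exact: countable_image.
have SD y y' : S y -> D y' -> y ** y' = y' ** y.
  move=> Sy /Dlc[cf [tr [i [-> _ _]]]]; symmetry; apply: (@lc_comm _ _ _ _) => g; exact: uSg.
have S'D y y' : S' y -> D y' -> y ** y' = y' ** y.
  move=> [Sy|[i _ [v Sv <-]]] Dy; first exact: SD.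
  have h1 := SD v y' Sv Dy; have h2 := DD _ _ (Dx i) Dy; move: (x i) h2 => xi h2; nc.
pose c : R := k.+1%:R^-1; have c0 : 0 < c by rewrite invr_gt0 ltr0n.
have c1 : c <= 1 by rewrite invf_le1 ?ltr0n// ler1n.
have [N hN] : exists N, (1 - c) ^+ N <= eps.
  have : (1 - c) ^+ n @[n --> \oo] --> (0 : R).
    by apply: cvg_expr; rewrite ger0_norm ?subr_ge0// ltrBlDr ltrDl.
  move=> /cvgrPdist_lt/(_ _ e0)[N _ /(_ N (leqnn N)) /=].
  by rewrite sub0r normrN ger0_norm ?exprn_ge0 ?subr_ge0// => /ltW; exists N.
have tN0 : 0 <= (1 - c) ^+ N by rewrite exprn_ge0 ?subr_ge0.
have S'1 : S' one by left.
have [q /= [[pq qq] qS aq [fr fq] fg]] := rounds hsigma Tt0 hGc hGamma ta tact cD hD DD Da Dx Dz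
  zx zax x1 z1 N cS' S'1 S'D.
have rle f : TFB f -> f (one - \sum_i q i) <= eps.
  move=> Tf; have := fr f one Tf S'1; rewrite (smul1l ta) (ta_one ta Tf) mulr1 => ->//.
exists q; split=> //.
- by move=> i y Sy; apply: qS; left; left.
- move=> f Tf; split; first exact: rle.
  have fp := TF_rpos Tf.
  apply: (@le_trans _ _ (\sum_i 4 * d * f (x i))); last first.
    by rewrite -mulr_sumr -(rpos_sum fp) x1 (ta_one ta Tf) mulr1.
  apply: ler_sum => i _; rewrite fq//; [|by left|by right; exists i => //; exists (cc i)].
  have cx0 : 0 <= f (cc i ** x i) by apply: (tr_pos_mul hsigma Tt0 ta) => //; exact: (hD _ (Dx i)).1.
  apply: (@le_trans _ _ (f (cc i ** x i))); first by rewrite mulrBl mul1r gerBl mulr_ge0.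
  rewrite /x /lc smul_sumr !(rpos_sum fp) mulr_sumr big_seq [leRHS]big_seq; apply: ler_sum => g gO.
  rewrite smulZr !(rposZ fp) mulrCA; apply: ler_wpM2l => //.
  have Tfg := tac_TF tact g Tf; have fgp := TF_rpos Tfg; have := ua i _ Tfg.
  rewrite -/(act g (u i)) /= hs => h1.
  have -> : cc i ** act g (u i) = act g (act g^-1%g (cc i) ** u i).
    by rewrite (tac_M tact) -(tac_comp tact) mulgV (tac_1 tact).
  apply: (@le_trans _ _ (f (act g (a i ** u i)))).
    rewrite /a smul_suml (perm_big _ (perm_to_rem gO)) big_cons /= (rposD fgp) lerDl.
    rewrite (rpos_sum fgp); apply: sumr_ge0 => g' _.
    by apply: (tr_pos_mul hsigma Tt0 ta Tfg) => //; exact: act_pos.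
  move: h1; rewrite smulDl smulZl (smul1l ta) (rposD fgp) (rposZ fgp).
  have := pos_tr ta Tfg (pu i); move: (f (act g (u i))) (f _) => U V U0 h1.
  exact: quadruple_bound (mulr_ge0 (ltW d0) U0) h1.
move=> f h th Tf th0 hm; have := fg f h th Tf th0 hm; have fp := TF_rpos Tf.
set rho := one - _; set Sm := \sum_i _ => h1.
have prho : projection rho by apply: (proj_compl ta); exact: (proj_orth_sum pq qq).
have h2 : f (rho ** act h rho) <= f rho.
  rewrite -subr_ge0 -(rposB fp).
  have -> : rho - rho ** act h rho = rho ** (one - act h rho) by rewrite smulDr smulN (smul1r ta).
  apply: (tr_pos_mul hsigma Tt0 ta) => //; first exact: (proj_pos ta).
  by apply: (proj_pos ta); apply: (proj_compl ta); exact: (act_proj tact).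
rewrite mulrBr mulr1 lerBlDr; apply: le_trans h1 _; rewrite lerD2l; apply: ler_wpM2l => //.
by apply: le_trans h2 _; exact: rle.
Qed.
End Partition.

(** * Evaluating expressions at patched unknowns *)

Section PartitionError.
Variables (R : realType) (w : freeUltrafilter) (A : cstarAlgType R).
Local Notation B := (A_omega_b w A).
Local Notation TFB := (@TF R w A).
Variables (G : groupType) (alpha : action G A).
Variable one : B.
Hypothesis ta : tracial_alg one TFB.
Local Notation act := (act_omega alpha : G -> B -> B).
Hypothesis tact : tracial_action TFB act.
Variable V : Type.
Variable par : V -> B.
Local Notation ev := (geval act par).
Local Notation expr := (gexpr R G V nat).

Fixpoint nouni (e : expr) : bool :=
  match e with
  | EUni => false
  | EAdd a b | EMul a b => nouni a && nouni b
  | EScale _ a | EStar a | EAct _ a => nouni a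
  | _ => true
  end.

Fixpoint ebound (e : expr) : R :=
  match e with
  | EPar i => rnorm (par i) + 1
  | EUnk _ | EUni | EZero => 1
  | EAdd a b => ebound a + ebound b
  | EScale c a => (rnorm (c : R[i]) + 1) * ebound a
  | EMul a b => ebound a * ebound b
  | EStar a | EAct _ a => ebound a
  end.

(** Unknowns cost nothing, being patched by definition; a parameter p costs |p| since it is
    multiplied by the remainder 1 - sum_i q_i; an action costs twice the bound of its argument for
    replacing g q_i by q_i. *)
Fixpoint eerror (e : expr) : R :=
  match e with
  | EPar i => rnorm (par i)
  | EUnk _ | EUni | EZero => 0
  | EAdd a b => eerror a + eerror b
  | EScale c a => rnorm (c : R[i]) * eerror a
  | EMul a b => eerror a * ebound b + ebound a * eerror b
  | EStar a => eerror a
  | EAct _ a => eerror a + 2 * ebound a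
  end.

Fixpoint eacts (e : expr) : seq G :=
  match e with
  | EAdd a b | EMul a b => eacts a ++ eacts b
  | EScale _ a | EStar a => eacts a
  | EAct g a => g :: eacts a
  | _ => [::]
  end.

Lemma ebound_gt0 e : 0 < ebound e.
Proof.
elim: e => //= [i|a ha b hb|c a ha|a ha b hb].
- by rewrite ltr_wpDl ?rnorm_ge0.
- exact: addr_gt0.
- by rewrite mulr_gt0// ltr_wpDl ?rnorm_ge0.
- exact: mulr_gt0.
Qed.

Lemma eerror_ge0 e : 0 <= eerror e.
Proof.
elim: e => //= [i|a ha b hb|c a ha|a ha b hb|g a ha].
- exact: rnorm_ge0.
- exact: addr_ge0.
- by rewrite mulr_ge0 ?rnorm_ge0.
- by rewrite addr_ge0 ?mulr_ge0// ltW// ebound_gt0.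
- by rewrite addr_ge0 ?mulr_ge0// ltW// ebound_gt0.
Qed.

Lemma geval_bound y z e : (forall i, rnorm (y i) <= 1) -> nouni e -> rnorm (ev y z e) <= ebound e.
Proof.
move=> y1; elim: e => //= [i _|_|a ha b hb /andP[na nb]|c a ha na|a ha b hb /andP[na nb]|a ha na|g a ha na].
- by rewrite lerDl.
- by rewrite rnorm0.
- by apply: le_trans (rnormD _ _) _; apply: lerD; [exact: ha|exact: hb].
- rewrite rnormZ; apply: ler_pM; rewrite ?rnorm_ge0 ?ha//; by rewrite lerDl.
- by apply: le_trans (rnorm_smul _ _) _; apply: ler_pM; rewrite ?rnorm_ge0 ?ha ?hb.
- by rewrite rnorm_star ha.
- by apply: le_trans (tac_norm tact _ _) _; exact: ha.
Qed.

Variables (k : nat) (q : 'I_k.+1 -> B).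
Hypothesis pq : forall i, projection (q i).
Hypothesis qq : forall i j, i != j -> q i ** q j = 0.
Hypothesis aq : forall g i j, act g (q i) ** q j = q j ** act g (q i).

Lemma partition_sqr (u : 'I_k.+1 -> B) : (forall i j, q i ** u j = u j ** q i) ->
  star (\sum_i q i ** u i) ** (\sum_i q i ** u i) = \sum_i q i ** (star (u i) ** u i).
Proof.
move=> qu.
have squ i j : q i ** star (u j) = star (u j) ** q i.
  by have [sq _] := pq i; rewrite -{1}sq -starM -qu starM sq.
rewrite star_sum smul_suml; apply: eq_bigr => i _; have [sq q2] := pq i.
rewrite smul_sumr (bigD1 i)//= big1 ?addr0.
  by rewrite starM sq -smulA (smulA (q i)) q2 smulA -squ -smulA.
move=> j ji; rewrite starM sq.
have -> : star (u i) ** q i ** (q j ** u j) = star (u i) ** (q i ** q j) ** u j by nc.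
by rewrite qq 1?eq_sym// smul0 s0mul.
Qed.

(** For contractions u_i commuting with the q_j, 1 - |sum_i q_i u_i|^2 is (1 - sum_i q_i) + sum_i
    q_i (1 - |u_i|^2), a sum of positive elements. *)
Lemma partition_norm (v : 'I_k.+1 -> B) (M : R) : 0 < M ->
  (forall i, rnorm (v i) <= M) -> (forall i j, q i ** v j = v j ** q i) ->
  rnorm (\sum_i q i ** v i) <= M.
Proof.
move=> M0 vM qv; have Mi : 0 <= M^-1 by rewrite invr_ge0 ltW.
suff h : rnorm ((M^-1)%:C%C *: \sum_i q i ** v i) <= 1.
  by move: h; rewrite rnormZr ger0_norm// ler_pdivrMl// mulr1.
pose u i := (M^-1)%:C%C *: v i.
have u1 i : rnorm (u i) <= 1 by rewrite /u rnormZr ger0_norm// ler_pdivrMl// mulr1.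
have qu i j : q i ** u j = u j ** q i by rewrite /u smulZr smulZl qv.
have -> : (M^-1)%:C%C *: \sum_i q i ** v i = \sum_i q i ** u i.
  by rewrite scaler_sumr; apply: eq_bigr => i _; rewrite /u smulZr.
clearbody u; apply: (possq_norm1 ta).
have sE := partition_sqr qu.
have -> : one - star (\sum_i q i ** u i) ** \sum_i q i ** u i =
    (one - \sum_i q i) + \sum_i q i ** (one - star (u i) ** u i).
  under [X in _ = _ + X]eq_bigr do rewrite smulDr smulN (smul1r ta).
  by rewrite sE sumrB addrA subrK.
apply: (posD ta).
  by apply: (proj_pos ta); apply: (proj_compl ta); exact: (proj_orth_sum pq qq).
apply: (pos_sum ta) => i _; apply: (pos_mul ta); first exact: (proj_pos ta).
  exact: (norm1_possq ta).
have h1 := qu i i.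
have h2 : q i ** star (u i) = star (u i) ** q i.
  by have [sq _] := pq i; rewrite -{1}sq -starM -qu starM sq.
by move: (star (u i)) h2 => su h2; nc1.
Qed.

Variable yy : 'I_k.+1 -> nat -> B.
Hypothesis yy1 : forall i j, rnorm (yy i j) <= 1.
Variable S : set B.
Hypothesis Sa : forall g s, S s -> S (act g s).
Hypothesis Spar : forall v, S (par v).
Hypothesis Syy : forall i j, S (yy i j).
Hypothesis qS : forall i s, S s -> s ** q i = q i ** s.
Let y j := \sum_i q i ** yy i j.

Lemma partition_contraction j : rnorm (y j) <= 1.
Proof. by apply: partition_norm => // i i'; rewrite qS. Qed.

Lemma geval_comm z e i g i' : nouni e -> act g (ev (yy i) z e) ** q i' = q i' ** act g (ev (yy i) z e).
Proof.
have a0 g' : act g' 0 = 0 by have := tac_Z tact g' 0 0; rewrite !scale0r.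
elim: e g => //= [v|j||a ha b hb|c a ha|a ha b hb|a ha|h a ha] g ne.
- by apply: qS; exact: Sa.
- by apply: qS; exact: Sa.
- by rewrite a0 smul0 s0mul.
- by move/andP: ne => [na nb]; rewrite (tac_D tact) smulDl smulDr ha// hb.
- by rewrite (tac_Z tact) smulZl smulZr ha.
- move/andP: ne => [na nb]; rewrite (tac_M tact) -smulA hb// smulA ha// smulA//.
- have [sq _] := pq i'; rewrite (tac_S tact) -{1}sq -starM -ha// starM sq//.
- by rewrite -(tac_comp tact) ha.
Qed.

Lemma geval_comm1 z e i i' : nouni e -> ev (yy i) z e ** q i' = q i' ** ev (yy i) z e.
Proof. by move=> ne; have := geval_comm z i 1%g i' ne; rewrite (tac_1 tact). Qed.

Variable kap : R.
Hypothesis kap0 : 0 <= kap.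
Hypothesis rho_small : forall f, TFB f -> f (one - \sum_i q i) <= kap ^+ 2.

(* For the action of g, the difference of the two sums is killed by the projection
   sum_i q_i (g . q_i), whose trace is nearly 1. *)
Lemma partition_error z e f : nouni e -> TFB f ->
  (forall f g, TFB f -> g \in eacts e -> 1 - kap ^+ 2 <= \sum_i f (q i ** act g (q i))) ->
  fnorm f (ev y z e - \sum_i q i ** ev (yy i) z e) <= eerror e * kap.
Proof.
elim: e f => //= [v|j||a ha b hb|c a ha|a ha b hb|a ha|g a ha] f ne Tf hg; have fp := TF_rpos Tf.
- pose rho := one - \sum_i q i.
  have prho : projection rho by apply: (proj_compl ta); exact: (proj_orth_sum pq qq).
  have -> : par v - \sum_i q i ** par v = rho ** par v.
    by rewrite -smul_suml /rho smulDl sNmul (smul1l ta).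
  apply: le_trans (fnorm_mulr ta _ _ Tf) _; rewrite mulrC; apply: ler_wpM2l; first exact: rnorm_ge0.
  rewrite -(@ler_pXn2r _ 2) ?nnegrE ?fnorm_ge0// (fnorm_sqr fp).
  by have [-> ->] := prho; exact: rho_small.
- by rewrite /y subrr (fnorm0 fp) mul0r.
- by rewrite big1 ?subrr ?(fnorm0 fp) ?mul0r// => i _; rewrite smul0.
- move/andP: ne => [na nb].
  have -> : ev y z a + ev y z b - \sum_i q i ** (ev (yy i) z a + ev (yy i) z b) =
     (ev y z a - \sum_i q i ** ev (yy i) z a) + (ev y z b - \sum_i q i ** ev (yy i) z b).
    under eq_bigr do rewrite smulDr.
    by rewrite big_split opprD addrACA.
  apply: le_trans (fnormD fp _ _) _; rewrite mulrDl; apply: lerD; [apply: ha|apply: hb] => //.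
    by move=> f' g' Tf' gi; apply: hg => //; rewrite mem_cat gi.
  by move=> f' g' Tf' gi; apply: hg => //; rewrite mem_cat gi orbT.
- have -> : c *: ev y z a - \sum_i q i ** (c *: ev (yy i) z a) =
     (c *: one) ** (ev y z a - \sum_i q i ** ev (yy i) z a).
    under eq_bigr do rewrite smulZr.
    by rewrite -scaler_sumr smulZl (smul1l ta) scalerBr.
  apply: le_trans (ta_mul ta Tf _ _) _; rewrite -mulrA; apply: ler_pM; rewrite ?rnorm_ge0 ?fnorm_ge0//.
    rewrite rnormZ -[leRHS]mulr1; apply: ler_wpM2l; first exact: rnorm_ge0.
    by apply: (pos_norm1 ta); [exact: (pos1 ta)|rewrite subrr; exact: (pos0 ta)].
  exact: ha.
- move/andP: ne => [na nb].
  pose X := \sum_i q i ** ev (yy i) z a; pose Y := \sum_i q i ** ev (yy i) z b.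
  have XY : \sum_i q i ** (ev (yy i) z a ** ev (yy i) z b) = X ** Y.
    rewrite /X smul_suml; apply: eq_bigr => i _; rewrite /Y smul_sumr (bigD1 i)//= big1 ?addr0.
      have h1 := geval_comm1 z i i na; have [_ q2] := pq i.
      by move: (ev (yy i) z a) (ev (yy i) z b) h1 => u v h1; nc.
    move=> j ji; have h1 := geval_comm1 z i j na.
    have -> : q i ** ev (yy i) z a ** (q j ** ev (yy j) z b) =
        q i ** q j ** ev (yy i) z a ** ev (yy j) z b.
      by move: (ev (yy i) z a) (ev (yy j) z b) h1 => u v h1; nc.
    by rewrite qq 1?eq_sym// !s0mul.
  have -> : ev y z a ** ev y z b - \sum_i q i ** (ev (yy i) z a ** ev (yy i) z b) =
     (ev y z a - X) ** ev y z b + X ** (ev y z b - Y) by rewrite XY; nc.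
  apply: le_trans (fnormD fp _ _) _; rewrite mulrDl; apply: lerD.
    apply: le_trans (fnorm_mulr ta _ _ Tf) _; rewrite mulrAC; apply: ler_pM; rewrite ?rnorm_ge0 ?fnorm_ge0//.
      by apply: ha => // f' g' Tf' gi; apply: hg => //; rewrite mem_cat gi.
    by apply: geval_bound => //; exact: partition_contraction.
  apply: le_trans (ta_mul ta Tf _ _) _; rewrite -mulrA; apply: ler_pM; rewrite ?rnorm_ge0 ?fnorm_ge0//.
    apply: partition_norm => [||i i']; first exact: ebound_gt0.
      by move=> i; apply: geval_bound.
    by rewrite geval_comm1.
  by apply: hb => // f' g' Tf' gi; apply: hg => //; rewrite mem_cat gi orbT.
- have -> : star (ev y z a) - \sum_i q i ** star (ev (yy i) z a) =
      star (ev y z a - \sum_i q i ** ev (yy i) z a).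
    rewrite starB star_sum; congr (_ - _); apply: eq_bigr => i _; have [sq _] := pq i.
    by rewrite -geval_comm1// starM sq.
  by rewrite (fnorm_starT ta)//; exact: ha.
pose v i := act g (ev (yy i) z a); pose M := ebound a.
have M0 : 0 < M by exact: ebound_gt0.
have vM i : rnorm (v i) <= M by apply: le_trans (tac_norm tact _ _) _; exact: geval_bound.
have vq i j : v i ** q j = q j ** v i by exact: geval_comm.
have avq i j : v i ** act g (q j) = act g (q j) ** v i.
  by rewrite /v -!(tac_M tact) geval_comm1.
have qsum : rnorm (\sum_i q i ** v i) <= M by apply: partition_norm => // i j; rewrite vq.
pose Del := \sum_i act g (q i) ** v i - \sum_i q i ** v i.
have aqE : \sum_i act g (q i) ** v i = act g (\sum_i q i ** ev (yy i) z a).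
  by rewrite (act_sum tact); apply: eq_bigr => i _; rewrite (tac_M tact).
have aqsum : rnorm (\sum_i act g (q i) ** v i) <= M.
  rewrite aqE; apply: le_trans (tac_norm tact _ _) _; apply: partition_norm => // i.
    exact: geval_bound.
  by move=> j; rewrite geval_comm1.
have DelM : rnorm Del <= 2 * M.
  apply: le_trans (rnormD _ _) _; rewrite rnormN mulr2n mulrDl mul1r; exact: lerD.
pose E := \sum_i q i ** act g (q i).
have pE : projection E.
  apply: proj_orth_sum => [i|i j ij].
    by apply: proj_mul; rewrite ?aq//; exact: (act_proj tact).
  have -> : q i ** act g (q i) ** (q j ** act g (q j)) =
      q i ** q j ** (act g (q i) ** act g (q j)).
    by have h := aq g i j; move: (act g (q i)) (act g (q j)) h => a1 a2 h; nc.
  by rewrite qq// s0mul.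
have aqq i j : i != j -> act g (q i) ** act g (q j) = 0.
  move=> ij; rewrite -(tac_M tact) qq//.
  by have := tac_Z tact g 0 0; rewrite !scale0r.
have EDel : E ** Del = 0.
  rewrite /Del -sumrB /E smul_suml big1// => j _; rewrite smul_sumr (bigD1 j)//= big1.
    rewrite addr0 -[_ - _ ** _]/(act g (q j) ** v j - q j ** v j).
    have [_ q2] := pq j; have [_ q3] := act_proj tact g (pq j).
    have h1 := aq g j j; have h2 := vq j j; have h3 := avq j j.
    by move: (act g (q j)) (v j) q3 h1 h2 h3 => a1 a2 q3 h1 h2 h3; nc.
  move=> i ij; rewrite smulDr smulN.
  have -> : q j ** act g (q j) ** (act g (q i) ** v i) = q j ** (act g (q j) ** act g (q i)) ** v i by nc.
  have -> : q j ** act g (q j) ** (q i ** v i) = (q j ** q i) ** act g (q j) ** v i.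
    by have h := aq g j i; move: (act g (q j)) (v i) h => a1 a2 h; nc.
  by rewrite aqq 1?eq_sym// qq 1?eq_sym// !(smul0, s0mul) subrr.
have DelE : Del = (one - E) ** Del by rewrite smulDl sNmul (smul1l ta) EDel subr0.
have -> : act g (ev y z a) - \sum_i q i ** act g (ev (yy i) z a) =
    act g (ev y z a - \sum_i q i ** ev (yy i) z a) + Del.
  by rewrite (act_sub tact) /Del aqE addrA subrK.
apply: le_trans (fnormD fp _ _) _; rewrite mulrDl; apply: lerD.
  have Tfg := tac_TF tact g Tf.
  have -> X : fnorm f (act g X) = fnorm (fun x => f (act g x)) X.
    by rewrite /fnorm (tac_M tact) (tac_S tact).
  apply: ha => //.
  by move=> f' g' Tf' gi; apply: hg => //; rewrite inE gi orbT.
rewrite DelE; apply: le_trans (fnorm_mulr ta _ _ Tf) _; rewrite [leRHS]mulrC.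
apply: ler_pM; rewrite ?rnorm_ge0 ?fnorm_ge0//.
rewrite -(@ler_pXn2r _ 2) ?nnegrE ?fnorm_ge0// (fnorm_sqr fp).
have [-> ->] := proj_compl ta pE; rewrite (rposB fp) (ta_one ta Tf) lerBlDr -lerBlDl.
rewrite /E (rpos_sum fp); apply: hg => //; by rewrite inE eqxx.
Qed.
End PartitionError.

(** * Solving the polynomial system *)

Section Cover.
Variables (R : realType) (w : freeUltrafilter) (A : cstarAlgType R).
Hypothesis hsigma : sigma_unital A.
Local Notation B := (A_omega_b w A).
Local Notation TFB := (@TF R w A).
Variable one : B.
Hypothesis ta : tracial_alg one TFB.
Let w_ultra : UltraFilter (ultra_sets w) := ultra_ultra w.
Local Existing Instance w_ultra.

Lemma Im_scalar (t : B -> R[i]) (x : B) : tracial_state t -> complex.Im (t x) = - ret t ('i%C *: x).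
Proof. by move=> Tt; rewrite /ret (traceZ Tt); case: (t x) => a b /=; rewrite mul0r mul1r sub0r opprK. Qed.

(** The unit of the ultrapower witnesses norm 1, and t is recovered from its real part by Im t(x) =
    - Re t(i x). *)
Lemma limit_trace_state (t : B -> R[i]) : limit_traces t -> tracial_state t.
Proof.
move=> lt; have Tf := TF_limit lt; have fp := TF_rpos Tf.
have [||||t' Tt' rE] := @tracial_of_real R B (ret t).
- exact: fp.
- exact: TF_C.
- by move=> x x1; apply: le_trans (TF_le Tf x) x1.
- move=> e e0; exists one; last by rewrite (ta_one ta Tf) ltrBlDr ltrDl.
  by apply: (pos_norm1 ta); [exact: (pos1 ta)|rewrite subrr; exact: (pos0 ta)].
suff -> : t = t' by [].
have [tn [Ttn h]] := lt.
have tI x : complex.Im (t x) = - ret t ('i%C *: x).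
  have [a ->] := bclsP x; have /ulimCP[_ h1] := h a.
  rewrite -bclsZ; have /ulimCP[h2 _] := h ('i%C *: a).
  have h3 := ucvZ (-1) h2; rewrite mulN1r in h3; have {}h3 := h3 w_ultra.
  apply: (ucv_unique h1); apply: (ucv_eq _ h3) => n.
  rewrite linfZE (traceZ (Ttn n)) mulN1r; case: (tn n (a n)) => u v /=.
  by rewrite mul0r mul1r sub0r opprK.
apply/funext => x; apply/eqP; rewrite eq_complex tI (Im_scalar _ Tt') rE eqxx andbT.
by rewrite -/(ret t x) -/(ret t' x) rE.
Qed.

(** Otherwise limit traces at least d on C intersected with larger and larger finite sets cluster at
    a trace in the closure that is at least d on all of C. *)
Lemma trace_cover (C : set B) (d : R) :
  (forall t, limit_traces_closure t -> exists2 b : B, C b & ret t b < d) ->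
  exists s : seq B, (forall b, b \in s -> C b) /\
    forall f, TFB f -> exists2 b, b \in s & f b < d.
Proof.
move=> hC; apply: contrapT => hno.
have /choice[t ht] : forall D : seq B, exists t : B -> R[i], limit_traces t /\
    forall b, b \in D -> C b -> d <= ret t b.
  move=> D; apply: contrapT => hD; apply: hno.
  exists [seq b <- D | `[< C b >]]; split=> [b|f /(limit_TF hsigma)[t lt ->]].
    by rewrite mem_filter => /andP[/asboolP].
  apply: contrapT => hb; apply: hD; exists t; split=> // b bD Cb.
  rewrite leNgt; apply/negP => bd; apply: hb; exists b => //.
  by rewrite mem_filter bD andbT; apply/asboolP.
have [U [UU UD]] := finite_set_ultrafilter B.
have Tf D : TFB (ret (t D)) by apply: TF_limit; have [] := ht D.
have bd x D : `|ret (t D) x| <= rnorm x by exact: TF_le.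
have [phi hphi] := choice (fun x => ucv_ex (U := U) (bd x)).
have n1 : rnorm one <= 1.
  by apply: (pos_norm1 ta); [exact: (pos1 ta)|rewrite subrr; exact: (pos0 ta)].
have phi1 : phi one = 1.
  by apply: ucv_unique (hphi one) _; apply: ucv_eq (ucv_cst 1) => D; rewrite (ta_one ta (Tf D)).
have rp D := TF_rpos (Tf D).
have [||||t' Tt' rE] := @tracial_of_real R B phi.
- split=> [x y|c x|x y|x].
  + by apply: ucv_unique (hphi _) _; apply: ucv_eq (ucvD (hphi x) (hphi y)) => D; rewrite (rposD (rp D)).
  + by apply: ucv_unique (hphi _) _; apply: ucv_eq (ucvZ c (hphi x)) => D; rewrite (rposZ (rp D)).
  + by apply: ucv_unique (hphi _) _; apply: ucv_eq (hphi _) => D; rewrite (rposS (rp D)).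
  + apply: ucv_le (ucv_cst 0) (hphi _) _; apply: filterS filterT => D _ /=.
    exact: (rpos_ge0 (rp D)).
- by move=> x y; apply: ucv_unique (hphi _) _; apply: ucv_eq (hphi (y ** x)) => D; rewrite (TF_C (Tf D)).
- move=> x x1; have := ucv_dist (c := 0) (hphi x) (e := 1); rewrite subr0; apply => D.
  by rewrite subr0; apply: le_trans x1; exact: bd.
- by move=> e e0; exists one => //; rewrite phi1 ltrBlDr ltrDl.
have cl : limit_traces_closure t'.
  split=> // N; have : {ptws, t D @[D --> U] --> t'}.
    apply/pointwise_cvgP => x; apply/cvgrPdist_lt => e e0.
    have e0' : 0 < complex.Re e by move: e0; rewrite ltcE /= => /andP[].
    have eE : e = (complex.Re e)%:C%C by apply/eqP; rewrite eq_complex /= eqxx /=; move: e0; rewrite ltcE => /andP[].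
    have e2 : 0 < complex.Re e / 2 by rewrite divr_gt0.
    suff hU : U [set D | `|t' x - t D x| < e] by exact: hU.
    apply: filterS (filterI (hphi x _ e2) (hphi ('i%C *: x) _ e2)) => D /= [h1 h2].
    rewrite eE -rnormE ltcR; apply: le_lt_trans (normC_le _) _.
    have -> : complex.Re (t' x - t D x) = phi x - ret (t D) x.
      by rewrite -rE /ret; case: (t' x) (t D x) => u v [u' v'].
    have -> : complex.Im (t' x - t D x) = - (phi ('i%C *: x) - ret (t D) ('i%C *: x)).
      have lD : tracial_state (t D) by apply: limit_trace_state; have [] := ht D.
      have -> : complex.Im (t' x - t D x) = complex.Im (t' x) - complex.Im (t D x).
        by case: (t' x) (t D x) => u v [u' v'].
      by rewrite !Im_scalar// rE opprK opprB addrC.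
    by rewrite normrN distrC [X in _ + X]distrC [ltRHS]splitr; exact: ltrD.
  move=> h /h /=; rewrite /fmap /= => hN.
  have [D hD] := filter_ex hN.
  by exists (t D); split=> //; have [] := ht D.
have [b Cb bd'] := hC t' cl; move: bd'; apply/negP; rewrite -leNgt rE.
apply: ucv_le (ucv_cst d) (hphi b) _; apply: filterS (UD b) => D /= bD.
by have [_] := ht D; apply.
Qed.
End Cover.

(** * G-*-polynomials as expressions *)

Section Translation.
Variables (R : realType) (G : groupType) (r s : nat).

Definition letter_expr (l : gstar_letter G ('I_r + 'I_s)) : gexpr R G (option nat) nat :=
  let e := EAct l.1.2 (match l.2 with inl i => EPar (Some (i : nat)) | inr j => EUnk (j : nat) end) in
  if l.1.1 then EStar e else e.

(** The parameter [None] stands for the unit, the value of the empty word. *)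
Definition word_expr (u : seq (gstar_letter G ('I_r + 'I_s))) : gexpr R G (option nat) nat :=
  if u is l :: u' then foldl (fun e l' => EMul e (letter_expr l')) (letter_expr l) u'
  else EPar None.

Definition poly_expr (p : gstar_poly R G ('I_r + 'I_s)) : gexpr R G (option nat) nat :=
  \big[@EAdd _ _ _ _/EZero]_(cu <- p) EScale cu.1 (word_expr cu.2).

Variables (B : normedStarAlgType R) (beta : G -> B -> B) (a y : nat -> B) (z : B).
Let par (v : option nat) : B := if v is Some i then a i else alg_unit B.

Lemma geval_poly p : geval beta par y z (poly_expr p) = eval_poly beta (@join_vals B r s a y) p.
Proof.
have hl l : geval beta par y z (letter_expr l) = eval_letter beta (@join_vals B r s a y) l.
  by rewrite /letter_expr /eval_letter; case: l => [[[] g] [i|j]].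
rewrite /poly_expr geval_sum; apply: eq_bigr => -[c u] _ /=; congr (_ *: _).
case: u => [//|l u] /=; rewrite -hl; elim: u (letter_expr l) => //= l' u ih e.
by rewrite -hl ih.
Qed.

Lemma nouni_poly p : nouni (poly_expr p).
Proof.
have hl l : nouni (letter_expr l) by rewrite /letter_expr; case: l => [[[] g] [i|j]].
rewrite /poly_expr; elim/big_rec: _ => //= -[c u] e _ ->; rewrite andbT /=.
case: u => [//|l u] /=; elim: u (letter_expr l) (hl l) => //= l' u ih e' he'.
by apply: ih; rewrite /= he' hl.
Qed.
End Translation.

(** With x = kap^2, Reiter's condition provides overlap above 1 - x/4, and th = 1 - x/2 is then
    admissible in [equivariant_partition] because (2 - x/2)(1 - x/4) >= 2 - x. *)
Lemma overlap_arith (R : realFieldType) (x o : R) : x <= 1 -> 1 - x / 4 < o ->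
  2 * (1 - x / 2) <= (1 + (1 - x / 2)) * o.
Proof.
move=> x1 ho; have : (1 + (1 - x / 2)) * (1 - x / 4) <= (1 + (1 - x / 2)) * o.
  by apply: ler_wpM2l; [lra|exact: ltW].
by have := sqr_ge0 x; lra.
Qed.

Lemma sqr_arith (R : realFieldType) (x : R) : 1 - x <= (1 - x / 2) * (1 - x / 2).
Proof. by have := sqr_ge0 x; lra. Qed.

Lemma quarter_arith (R : realFieldType) (x : R) : x * 2^-1 ^+ 2 = 4 * (x / 16).
Proof. by field. Qed.

(** * Approximate global solutions *)

Section Approximation.
Variables (R : realType) (w : freeUltrafilter) (A : cstarAlgType R).
Hypothesis hsigma : sigma_unital A.
Variable t0 : A -> R[i].
Hypothesis Tt0 : tracial_state t0.
Local Notation B := (A_omega_b w A).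
Local Notation TFB := (@TF R w A).
Hypothesis hCPoU : weak_CPoU w A.
Variables (G : groupType) (alpha : action G A).
Hypothesis hGc : countable [set: G].
Hypothesis hGa : amenable R G.
Hypothesis hGamma : local_equivariant_Gamma w alpha.
Variable one : B.
Hypothesis ta : tracial_alg one TFB.
Local Notation act := (act_omega alpha : G -> B -> B).
Hypothesis tact : tracial_action TFB act.
Variable par : option nat -> B.
Local Notation ev := (geval act par).
Variable E : nat -> gexpr R G (option nat) nat.
Hypothesis nE : forall m, nouni (E m).
Hypothesis happ : forall eps : R, 0 < eps -> forall (l : nat) (t : B -> R[i]),
  limit_traces_closure t -> exists y : nat -> B,
    (forall i, rnorm (y i) <= 1) /\ forall m, (m < l)%N -> norm2 t (ev y 0 (E m)) < eps.

Lemma nouni_geval y z e : nouni e -> ev y z e = ev y 0 e.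
Proof.
elim: e => //= [a ha b hb|c a ha|a ha b hb|a ha|g a ha].
- by move=> /andP[/ha -> /hb ->].
- by move=> /ha ->.
- by move=> /andP[/ha -> /hb ->].
- by move=> /ha ->.
- by move=> /ha ->.
Qed.

(** The cover consists of the elements c(y), the sums of the squared first l values at a local
    solution y. At the patched unknowns the 2-norm of a value splits into the patching error and
    sum_i q_i times the local values, each at most sqrt(e)/2. *)
Lemma approx_solution l (e : R) : 0 < e -> exists y, @solB R w A G alpha _ _ (fun m => esq (E m)) par e l y.
Proof.
move=> e0; pose se := Num.sqrt e; have se0 : 0 < se by rewrite sqrtr_gt0.
pose Cs := \sum_(m < l) eerror par (E m) + 1.
have Cs0 : 0 < Cs by rewrite ltr_wpDl// sumr_ge0// => m _; exact: eerror_ge0.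
(* Cs dominates every error constant involved, so Cs * kap <= sqrt(e)/2 controls all patching errors
   at once. *)
pose kap := Num.min (2^-1) (se / (2 * Cs)).
have kap0 : 0 < kap by rewrite lt_min invr_gt0 ltr0n divr_gt0// mulr_gt0.
have kap2 : kap <= 2^-1 by rewrite ge_min lexx.
have kapC : Cs * kap <= se / 2.
  have : kap <= se / (2 * Cs) by rewrite ge_min lexx orbT.
  by rewrite ler_pdivlMr ?mulr_gt0//; lra.
pose k2 := kap ^+ 2; have k20 : 0 < k2 by rewrite exprn_gt0.
have k21 : k2 <= 1 by rewrite exprn_ile1 ?(ltW kap0)//; lra.
(* [equivariant_partition] returns 4d, which is to equal (sqrt(e)/2)^2. *)
pose d := e / 16; have d0 : 0 < d by rewrite divr_gt0.
pose K := flatten [seq eacts (E m) | m <- iota 0 l].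
have k2h : 0 <= 1 - k2 / 2.
  by rewrite subr_ge0 ler_pdivrMr// mul1r; apply: le_trans k21 _; rewrite ler1n.
have k24 : 0 < k2 / 4 by rewrite divr_gt0.
have [Om [wt [pw ho]]] := reiter K hGa k24.
pose c (y : nat -> B) := \sum_(m < l) star (ev y 0 (E m)) ** ev y 0 (E m).
have pc y : Pos TFB (c y) by apply: (pos_sum ta) => m _; exact: (pos_sqr ta).
pose CS : set B := [set b | exists y, (forall i, rnorm (y i) <= 1) /\ b = c y].
have Om0 : (0 < size Om)%N.
  rewrite lt0n size_eq0; apply/eqP => h0; have [_ _ _] := pw; rewrite h0 big_nil => /eqP.
  by rewrite eq_sym oner_eq0.
pose n : R := (size Om)%:R; have n0 : 0 < n by rewrite ltr0n.
(* The level d/n suits the average over Om of the translated traces, again a limit trace by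
   convexity: a value below d/n there makes the sum over Om less than d. *)
have [|s [sC hs]] := @trace_cover R w A hsigma one ta CS (d / n).
  move=> t ct; pose eps := Num.sqrt (d / n / l.+1%:R).
  have eps0 : 0 < eps by rewrite sqrtr_gt0 !divr_gt0.
  have [y [y1 hy]] := happ eps0 l ct; exists (c y); first by exists y.
  have fp : rpos (ret t) by apply: ret_rpos; have [] := ct.
  rewrite /c (rpos_sum fp).
  apply: (@le_lt_trans _ _ (\sum_(m < l) d / n / l.+1%:R)).
    apply: ler_sum => m _; rewrite -(fnorm_sqr fp).
    have -> : d / n / l.+1%:R = eps ^+ 2 by rewrite sqr_sqrtr// ltW// !divr_gt0.
    by rewrite ler_pXn2r ?nnegrE ?fnorm_ge0 ?(ltW eps0)//; apply: ltW; exact: hy.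
  have dn : 0 < d / n by rewrite divr_gt0.
  rewrite sumr_const card_ord; move: (d / n) dn => X X0.
  by rewrite -[_ *+ l]mulr_natr mulrAC ltr_pdivrMr// ltr_pM2l// ltr_nat.
have [f0 Tf0 _] := TF_ex w hsigma (fun=> Tt0).
have [b0 b0s _] := hs f0 Tf0.
have [k sk] : exists k, size s = k.+1 by case: (s) b0s => // b s' _; exists (size s').
have /choice[yy hyy] : forall i : 'I_k.+1, exists y, (forall i, rnorm (y i) <= 1) /\ nth 0 s i = c y.
  by move=> i; apply: sC; apply: mem_nth; rewrite sk.
pose cc i := c (yy i).
have hcov f : TFB f -> exists i, \sum_(g <- Om) f (act g^-1%g (cc i)) < d.
  move=> Tf.
  have w1 : \sum_(g <- Om) n^-1 = 1.
    by rewrite big_const_seq count_predT iter_addr_0 -[_ *+ _]mulr_natr mulVf// gt_eqF.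
  have wn (g : G) : 0 <= n^-1 by rewrite invr_ge0 ltW.
  have := TF_combination hsigma wn w1 (fun g => tac_TF tact g^-1%g Tf).
  move=> /hs[b bs hb]; have bi : (index b s < k.+1)%N by rewrite -sk index_mem.
  exists (Ordinal bi); rewrite /cc; have [_ <-] := hyy (Ordinal bi); rewrite /= nth_index//.
  by move: hb; rewrite -mulr_sumr mulrC ltr_pdivrMr// divfK ?gt_eqF.
pose S0 : set B := [set one] `|` range par `|` \bigcup_i range (yy i) `|` range cc.
pose S : set B := \bigcup_g (act g @` S0).
have cS : countable S.
  apply: bigcup_countable => // g _; apply: countable_image.
  do !apply: countable_setU; try exact: countable_image; try exact: countable1.
  by apply: bigcup_countable => [|i _]; [exact: countableP|exact: countable_image].
have S0S b : S0 b -> S b by move=> Sb; exists 1%g => //; exists b => //; exact: (tac_1 tact).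
have S1 : S one by apply: S0S; do 3 left.
have Sa g b : S b -> S (act g b).
  move=> [g' _ [b' Sb' <-]]; exists (g * g')%g => //; exists b' => //; exact: (tac_comp tact).
have Scc i : S (cc i) by apply: S0S; right; exists i.
have Spar v : S (par v) by apply: S0S; do 2 left; right; exists v.
have Syy i j : S (yy i j) by apply: S0S; left; right; exists i => //; exists j.
have yy1 i j : rnorm (yy i j) <= 1 by have [] := hyy i.
have k22 : 0 < k2 / 2 by rewrite divr_gt0.
have [q /= [[pq qq] qS aq rq gq]] := equivariant_partition hsigma Tt0 hCPoU hGc hGamma ta tact cS S1 Sa
  (fun i => pc (yy i)) Scc pw d0 k22 hcov.
exists (fun j => \sum_i q i ** yy i j); split=> [j|m f z ml Tf z1].
  exact: (partition_contraction ta pq qq yy1 Syy qS).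
have fp := TF_rpos Tf.
set y := fun j => _; rewrite /= -(fnorm_sqr fp).
have rho_small f' : TFB f' -> f' (one - \sum_i q i) <= kap ^+ 2.
  by move=> Tf'; have [h _] := rq f' Tf'; apply: le_trans h _; rewrite ler_pdivrMr// ler_peMr ?ler1n// ltW.
have over f' g : TFB f' -> g \in eacts (E m) -> 1 - kap ^+ 2 <= \sum_i f' (q i ** act g (q i)).
  move=> Tf' gE; have gK : g \in K.
    by apply/flattenP; exists (eacts (E m)) => //; apply/map_f; rewrite mem_iota.
  have := ho g gK; rewrite -/k2; set o := overlap _ _ _ => ho'.
  have := gq f' g (1 - k2 / 2) Tf'; rewrite -/o => h.
  have h1 : (1 - k2 / 2) * (1 - k2 / 2) <= \sum_i f' (q i ** act g (q i)).
    by apply: h; [exact: k2h|exact: overlap_arith].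
  by apply: le_trans h1; exact: sqr_arith.
have err := partition_error ta tact pq qq aq yy1 Sa Spar Syy qS (ltW kap0) rho_small z (nE m) Tf over.
rewrite -/y in err.
have main : fnorm f (\sum_i q i ** ev (yy i) z (E m)) <= se / 2.
  rewrite -(@ler_pXn2r _ 2) ?nnegrE ?fnorm_ge0 ?divr_ge0 ?(ltW se0)// (fnorm_sqr fp).
  rewrite partition_sqr// => [|i j]; last first.
    by rewrite (geval_comm1 tact pq Sa Spar Syy qS).
  have -> : (se / 2) ^+ 2 = 4 * d by rewrite exprMn sqr_sqrtr ?(ltW e0)// /d; exact: quarter_arith.
  have [_ h] := rq f Tf; apply: le_trans h; rewrite (rpos_sum fp); apply: ler_sum => i _.
  (* Of the sum c(y) only the m-th summand is kept; the others contribute nonnegative traces. *)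
  rewrite (TF_C Tf (q i)) /cc /c (bigD1 (Ordinal ml))//= smulDl (rposD fp).
  rewrite (nouni_geval _ z)// lerDl; apply: (tr_pos_mul hsigma Tt0 ta) => //; last exact: (proj_pos ta).
  by apply: (pos_sum ta) => j _; exact: (pos_sqr ta).
have tot : fnorm f (ev y z (E m)) <= se.
  rewrite -(subrK (\sum_i q i ** ev (yy i) z (E m)) (ev y z (E m))).
  apply: le_trans (fnormD fp _ _) _; rewrite [se]splitr; apply: lerD main.
  apply: le_trans err _; apply: le_trans kapC; apply: ler_wpM2r; first exact: ltW.
  rewrite /Cs (bigD1 (Ordinal ml))//= -addrA lerDl addr_ge0//.
  by apply: sumr_ge0 => j _; exact: eerror_ge0.
have -> : e = se ^+ 2 by rewrite sqr_sqrtr// ltW.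
by rewrite ler_pXn2r ?nnegrE ?fnorm_ge0 ?(ltW se0).
Qed.
End Approximation.

Theorem theorem4p2 (R : realType) (w : freeUltrafilter) (A : cstarAlgType R)
    (hsigma : sigma_unital A)
    (hT0 : @tracial_state R A !=set0)
    (hTc : @compact {ptws A -> R[i]} (@tracial_state R A))
    (hCPoU : weak_CPoU w A)
    (G : groupType) (hGc : countable [set: G]) (hGa : amenable R G)
    (alpha : action G A)
    (hGamma : local_equivariant_Gamma w alpha)
    (r s : nat -> nat)
    (h : forall m : nat, gstar_poly R G ('I_(r m) + 'I_(s m)))
    (a : nat -> A_omega_b w A)
    (happrox : forall (eps : R), 0 < eps -> forall (l : nat) (t : A_omega_b w A -> R[i]),
      limit_traces_closure t ->
      exists y : nat -> A_omega_b w A,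
        (forall i, `|y i| <= 1) /\
        forall m, (m < l)%N ->
          norm2 t (eval_poly (act_omega alpha) (join_vals a y) (h m)) < eps) :
  exists y : nat -> A_omega_b w A,
    (forall i, `|y i| <= 1) /\
    forall m, eval_poly (act_omega alpha) (join_vals a y) (h m) = 0.
Proof.
have [t0 Tt0] := hT0.
have ta := tracial_algB hsigma Tt0 hCPoU hGamma.
have tact := tracial_actionB w alpha.
(* The value at [None] is the unit, required by constant monomials. *)
pose par (v : option nat) : A_omega_b w A := if v is Some i then a i else alg_unit _.
have norm1 (x : A_omega_b w A) : (`|x| <= 1) = (rnorm x <= 1) by rewrite -rnorm_leC.
have [l e e0|y y1 hy] := @saturation_nat R w A hsigma t0 Tt0 G alpha (option nat) nat
    (fun m => esq (poly_expr (h m))) par.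
  apply: (approx_solution hsigma Tt0 hCPoU hGc hGa hGamma ta tact) => // [m|eps eps0 l' t ct].
    exact: nouni_poly.
  have [y [y1 hy]] := happrox eps eps0 l' t ct; exists y; split=> [i|m ml].
    by rewrite -norm1.
  by rewrite geval_poly; exact: hy.
exists y; split=> [i|m]; first by rewrite norm1.
rewrite -(geval_poly (act_omega alpha) a y 0); apply: (ta_sep ta) => f Tf.
by have := hy m f 0 Tf; rewrite rnorm0; apply.
Qed.
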